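(* Let $\Omega\subset\mathbb{E}^n$ be a bounded convex domain in $n$-dimensional Euclidean space, let $P\in\partial\Omega$ be a fixed boundary point, and let $0<\alpha<1$. Let $a^{ij}\in C^1(\bar\Omega)$, $i,j=1,\dots,n$, be real-valued coefficients for which there is a constant $a_0>0$ with $\sum_{i,j}a^{ij}(Q)\xi_i\xi_j\ge a_0|\xi|^2$ for all $Q\in\bar\Omega$, $\xi\in\mathbb{R}^n$. Let $p:\bar\Omega\to\mathbb{R}$ satisfy $p(Q)>0$ on $\bar\Omega$ and $p\in\mathrm{Lip}\,\lambda$ with $\alpha<\lambda\le 1$. Then for every $f\in L_2(\Omega)$ there is a unique generalized solution of the boundary value problem $$-\sum_{i,j=1}^n D_j(a^{ij}D_iu)+p\,\mathfrak{D}^\alpha u=f,\qquad u\in H^2(\Omega)\cap H^1_0(\Omega),$$ that is, there exists exactly one $z\in H^1_0(\Omega)$ such that $$\int_\Omega\Big[\sum_{i,j=1}^n a^{ij}\,D_jv\,\overline{D_iz}+\big(\mathfrak{D}^\alpha_{d-}(p\,v)\big)\,\overline{z}\Big]\,dQ=\int_\Omega v\,\overline{f}\,dQ\qquad\text{for all }v\in H^1_0(\Omega).$$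
   Context: All functions are complex-valued unless stated otherwise; $L_2(\Omega),H^1_0(\Omega),H^2(\Omega)$ are the usual Lebesgue and Sobolev spaces, $D_i$ is the generalized derivative in the $i$-th coordinate, and $(v,f)_{L_2(\Omega)}=\int_\Omega v\overline{f}\,dQ$. Polar coordinates at $P$: each point $Q\in\Omega$ is written $Q=P+\vec{\mathbf e}\,r$, where $r=|P-Q|$ and $\vec{\mathbf e}$ is the unit vector directed from $P$ to $Q$; $d=d(\vec{\mathbf e})$ is the length of the segment, within $\Omega$, of the ray going from $P$ in direction $\vec{\mathbf e}$. $\mathrm{Lip}\,\lambda$ ($0<\lambda\le1$) is the set of functions $\rho$ on $\bar\Omega$ for which there is a constant $M$ with $|\rho(Q)-\rho(Q')|\le M|Q-Q'|^\lambda$ for all $Q,Q'\in\bar\Omega$. Kipriyanov fractional derivative: for $Q=P+\vec{\mathbf e}r$, $$(\mathfrak{D}^\alpha u)(Q)=\frac{\alpha}{\Gamma(1-\alpha)}\int_0^r\frac{u(Q)-u(P+\vec{\mathbf e}t)}{(r-t)^{\alpha+1}}\Big(\frac tr\Big)^{n-1}dt+C_n^{(\alpha)}u(Q)\,r^{-\alpha},\qquad C_n^{(\alpha)}=\frac{(n-1)!}{\Gamma(n-\alpha)},$$ regarded as an operator from $H^1_0(\Omega)$ to $L_2(\Omega)$. Right-side fractional derivative: for $\varepsilon>0$ put $$(\psi^-_\varepsilon g)(Q)=\begin{cases}\displaystyle\int_{r+\varepsilon}^{d}\frac{g(P+\vec{\mathbf e}r)-g(P+\vec{\mathbf e}t)}{(t-r)^{\alpha+1}}\,dt,&0\le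 r\le d-\varepsilon,\\[2mm]\displaystyle\frac{g(Q)}{\alpha}\Big(\frac1{\varepsilon^\alpha}-\frac1{(d-r)^\alpha}\Big),&d-\varepsilon<r\le d,\end{cases}$$ $$(\mathfrak{D}^\alpha_{d-,\varepsilon}g)(Q)=\frac{1}{\Gamma(1-\alpha)}g(Q)(d-r)^{-\alpha}+\frac{\alpha}{\Gamma(1-\alpha)}(\psi^-_\varepsilon g)(Q),$$ and $\mathfrak{D}^\alpha_{d-}g=\lim_{\varepsilon\to0}\mathfrak{D}^\alpha_{d-,\varepsilon}g$, the limit being taken in the norm of $L_2(\Omega)$. *)

(* Defs.v *)
From HB Require Import structures.
From mathcomp Require Import all_boot all_order all_algebra.
From mathcomp Require Import complex.
From mathcomp Require Import all_classical all_reals all_analysis.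

Set Implicit Arguments.
Unset Strict Implicit.
Unset Printing Implicit Defensive.

Import Order.TTheory GRing.Theory Num.Theory.
Import numFieldNormedType.Exports.

Local Open Scope classical_set_scope.
Local Open Scope ring_scope.
Local Open Scope complex_scope.

Section RowMeasurable.
Context {R : realType} (n : nat).

Definition row_coord (i : 'I_n) (x : 'rV[R]_n) : measurableTypeR R := x ord0 i.

Let row_set0 : g_sigma_preimage row_coord set0.
Proof. exact: sigma_algebra0. Qed.

Let row_setC A : g_sigma_preimage row_coord A ->
  g_sigma_preimage row_coord (~` A).
Proof. exact: sigma_algebraC. Qed.

Let row_bigcup (F : (set 'rV[R]_n)^nat) :
  (forall i, g_sigma_preimage row_coord (F i)) ->
  g_sigma_preimage row_coord (\bigcup_i F i).
Proof. exact: sigma_algebra_bigcup. Qed.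

(* The product (hence Borel) sigma-algebra of R^n, as the library does for
   n.-tuple R; row vectors are used because they carry the topology. *)
HB.instance Definition _ := @isMeasurable.Build default_measure_display
  'rV[R]_n (g_sigma_preimage row_coord) row_set0 row_setC row_bigcup.

End RowMeasurable.

Definition row_cons {R : realType} {n : nat}
  (tx : measurableTypeR R * 'rV[R]_n) : 'rV[R]_n.+1 :=
  \row_i oapp (tx.2 ord0) tx.1 (unlift ord0 i).

Lemma measurable_row_cons {R : realType} {n : nat} :
  measurable_fun setT (@row_cons R n).
Proof.
rewrite /measurable_fun => _ A mA.
have h : preimage_set_system setT (@row_cons R n)
    (g_sigma_preimage (@row_coord R n.+1)) `<=` measurable.
  rewrite -g_sigma_preimage_comp.
  apply: smallest_sub; first exact: sigma_algebra_measurable.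
  rewrite -bigcup_mkord_ord; apply: bigcup_sub => k _ B [C mC <-].
  rewrite setTI.
  case: (unliftP ord0 (inord k : 'I_n.+1)) => [j|] ->.
    rewrite (_ : _ @^-1` C = snd @^-1` (row_coord j @^-1` C)); last first.
      by apply/seteqP; split => x /=; rewrite /row_coord /row_cons mxE liftK.
    rewrite -[X in measurable X]setTI; apply: measurable_snd => //.
    apply: sub_sigma_algebra; rewrite -bigcup_seq/=.
    by exists j; [rewrite /= mem_index_enum|exists C => //; rewrite setTI].
  rewrite (_ : _ @^-1` C = fst @^-1` C); last first.
    by apply/seteqP; split => x /=; rewrite /row_coord /row_cons mxE unlift_none.
  by rewrite -[X in measurable X]setTI; apply: measurable_fst.
by apply: h; exists A.
Qed.

Section LebesgueStep.
Context {R : realType} (n : nat) (mu : {measure set 'rV[R]_n -> \bar R}).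
Local Open Scope ereal_scope.

Definition lebesgue_step : set 'rV[R]_n.+1 -> \bar R :=
  pushforward (@lebesgue_measure R \x^ mu) (@row_cons R n).

Let step0 : lebesgue_step set0 = 0.
Proof. by rewrite /lebesgue_step /pushforward preimage_set0 measure0. Qed.

Let step_ge0 A : 0 <= lebesgue_step A.
Proof. by rewrite /lebesgue_step /pushforward measure_ge0. Qed.

Let step_sigma_additive : semi_sigma_additive lebesgue_step.
Proof.
exact: (@measure_semi_sigma_additive _ _ _
  (measure_function_pushforward__canonical__measure_function_Measure
    (@lebesgue_measure R \x^ mu) measurable_row_cons)).
Qed.

HB.instance Definition _ := isMeasure.Build _ _ _ lebesgue_step
  step0 step_ge0 step_sigma_additive.

End LebesgueStep.

(* n-dimensional Lebesgue measure (on Borel sets). The product \x^ is used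
   because it only requires its left factor to be sigma-finite. *)
Fixpoint lebesgue_row {R : realType} (n : nat) :
    {measure set 'rV[R]_n -> \bar R} :=
  match n with
  | 0 => dirac (0 : 'rV[R]_0)
  | m.+1 => lebesgue_step (lebesgue_row m)
  end.

Definition cintegral {d} {T : measurableType d} {R : realType}
    (mu : {measure set T -> \bar R}) (D : set T) (f : T -> R[i]) : R[i] :=
  (\int[mu]_(x in D) complex.Re (f x)) +i* (\int[mu]_(x in D) complex.Im (f x)).

Definition Gamma {R : realType} (x : R) : R :=
  \int[@lebesgue_measure R]_(t in `]0, +oo[) (t `^ (x - 1) * expR (- t)).

Section Spaces.
Context {R : realType} {n : nat}.
Implicit Types (Omega : set 'rV[R]_n) (u v f g phi : 'rV[R]_n -> R[i]).

(* The norm the library puts on 'rV[R]_n is the sup norm. *)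
Definition enorm (x : 'rV[R]_n) : R := Num.sqrt (\sum_i x ord0 i ^+ 2).

Definition L2sq Omega f : \bar R :=
  (\int[lebesgue_row n]_(x in Omega) (complex.Re (f x) ^+ 2 + complex.Im (f x) ^+ 2)%:E)%E.

Definition in_L2 Omega f : Prop :=
  [/\ measurable_fun Omega (fun x => complex.Re (f x) : measurableTypeR R),
      measurable_fun Omega (fun x => complex.Im (f x) : measurableTypeR R) &
      (L2sq Omega f < +oo)%E].

Definition unit_row (i : 'I_n) : 'rV[R]_n := delta_mx ord0 i.

Definition partials (s : seq 'I_n) (h : 'rV[R]_n -> R) : 'rV[R]_n -> R :=
  foldr (fun i (k : 'rV[R]_n -> R) x => 'D_(unit_row i) k x) h s.

Definition smooth (h : 'rV[R]_n -> R) : Prop :=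
  forall s : seq 'I_n, continuous (partials s h) /\
    forall i x, derivable (partials s h) x (unit_row i).

Definition test_function Omega phi : Prop :=
  [/\ smooth (fun x => complex.Re (phi x)), smooth (fun x => complex.Im (phi x)) &
      exists K : set 'rV[R]_n,
        [/\ compact K, K `<=` Omega & forall x, ~ K x -> phi x = 0]].

Definition cpartial (i : 'I_n) phi : 'rV[R]_n -> R[i] := fun x =>
  'D_(unit_row i) (fun y => complex.Re (phi y)) x +i*
  'D_(unit_row i) (fun y => complex.Im (phi y)) x.

Definition is_gen_deriv Omega (i : 'I_n) u g : Prop :=
  in_L2 Omega g /\
  forall phi, test_function Omega phi ->
    cintegral (lebesgue_row n) Omega (fun x => u x * cpartial i phi x) =
    - cintegral (lebesgue_row n) Omega (fun x => g x * phi x).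

(* A chosen representative of the class of D_i u; zero if u has no generalized
   derivative in L_2(Omega). *)
Definition gen_deriv Omega (i : 'I_n) u : 'rV[R]_n -> R[i] :=
  xget (fun=> 0) [set g | is_gen_deriv Omega i u g].

Definition in_H1 Omega u : Prop :=
  in_L2 Omega u /\ forall i, exists g, is_gen_deriv Omega i u g.

Definition in_H10 Omega u : Prop :=
  in_H1 Omega u /\
  forall e : R, 0 < e -> exists2 phi, test_function Omega phi &
    (L2sq Omega (fun x => u x - phi x)%R +
     \sum_(i < n)
       L2sq Omega (fun x => gen_deriv Omega i u x - cpartial i phi x)%R
     < e%:E)%E.

(* C^1 up to the boundary: the first derivatives, taken in Omega, extend
   continuously to the closure. *)
Definition C1_closure Omega (h : 'rV[R]_n -> R) : Prop :=
  {within closure Omega, continuous h} /\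
  forall i, exists2 g : 'rV[R]_n -> R,
    {within closure Omega, continuous g} &
    forall x, Omega x -> is_derive x (unit_row i) h (g x).

Definition Lip Omega (lambda : R) (h : 'rV[R]_n -> R) : Prop :=
  exists M : R, forall x y, closure Omega x -> closure Omega y ->
    `|h x - h y| <= M * enorm (x - y) `^ lambda.

Section RightDerivative.
Variables (Omega : set 'rV[R]_n) (P : 'rV[R]_n) (alpha : R).

Definition direction (Q : 'rV[R]_n) : 'rV[R]_n :=
  (enorm (Q - P))^-1 *: (Q - P).

(* For Omega open and convex and P on its boundary, the set is the interval
   ]0, d[. *)
Definition ray_length (e : 'rV[R]_n) : R :=
  sup [set t : R | 0 < t /\ Omega (P + t *: e)].

(* The endpoint d is left out of the integral because the ray meets the boundary
   there, outside the domain of g. *)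
Definition psi_right (eps : R) g : 'rV[R]_n -> R[i] := fun Q =>
  let r := enorm (Q - P) in
  let e := direction Q in
  let d := ray_length e in
  if r <= d - eps then
    cintegral (@lebesgue_measure R) `[r + eps, d[
      (fun t => (g (P + r *: e) - g (P + t *: e)) /
                ((t - r) `^ (alpha + 1))%:C)
  else g Q / alpha%:C *
       ((eps `^ alpha)^-1 - ((d - r) `^ alpha)^-1)%:C.

Definition right_deriv_trunc (eps : R) g : 'rV[R]_n -> R[i] := fun Q =>
  let r := enorm (Q - P) in
  let d := ray_length (direction Q) in
  ((Gamma (1 - alpha))^-1)%:C * g Q * ((d - r) `^ (- alpha))%:C +
  (alpha / Gamma (1 - alpha))%:C * psi_right eps g Q.

(* w represents D^alpha_{d-} g, the limit being in the norm of L_2(Omega). *)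
Definition is_right_deriv g w : Prop :=
  [/\ in_L2 Omega w,
      \forall eps \near 0^'+, in_L2 Omega (right_deriv_trunc eps g) &
      L2sq Omega (fun Q => right_deriv_trunc eps g Q - w Q)
        @[eps --> 0^'+] --> 0%E].

End RightDerivative.

(* In the weak form of -sum D_j (a^ij D_i u) + p D^alpha u = f the Kipriyanov
   term (v, p D^alpha u) is written (D^alpha_{d-} (p v), u). *)
Definition generalized_solution Omega (P : 'rV[R]_n) (alpha : R)
    (a : 'I_n -> 'I_n -> 'rV[R]_n -> R) (p : 'rV[R]_n -> R) f z : Prop :=
  in_H10 Omega z /\
  forall v, in_H10 Omega v ->
    exists2 w, is_right_deriv Omega P alpha (fun Q => (p Q)%:C * v Q) w &
      cintegral (lebesgue_row n) Omega (fun Q =>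
        \sum_i \sum_j
          (a i j Q)%:C * gen_deriv Omega j v Q * (gen_deriv Omega i z Q)^* +
        w Q * (z Q)^*) =
      cintegral (lebesgue_row n) Omega (fun Q => v Q * (f Q)^*).

End Spaces.

(* Main.v *)
(* The form B(v, z) = (a grad v, grad z) + (D^alpha_(d-)(p v), z) need not be
   coercive, since p D^alpha is only bounded below: the variation of p along the
   rays costs a multiple of |v|^2. What replaces coercivity is an inf-sup bound
   |u| <= C sup_v |B(v, u) + s (v, u)| / |v|, uniform in s >= 0, obtained by
   truncation. For y = (u - m)_+ the nonlocal term also sees the level m: every
   ray leaves the bounded domain, so min(u, m) contributes at least
   m * delta * int y, where delta > 0 depends on the minimum of p and on the
   diameter. At a high level m the support of y is small, the negative term is
   absorbed by the gradient, and y is controlled by the residual. If y is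
   controlled at level m, then it is at level theta m for a fixed theta < 1,
   because the additional error K (1 - theta) m int y is dominated by
   theta m delta int y. Finitely many steps bring the level below the size of
   |u| itself, and applying this to u and - u gives the bound. Uniformity in s
   connects B to the scalar product, for which approximate solutions exist, so
   that solvability descends to s = 0 without any completeness; the solution is
   then a limit of test functions.

   On functions extended by 0 outside Omega, the right-side derivative is
   c * int_0^oo (g(Q) - g(Q + t e)) t^(- alpha - 1) dt with
   c = alpha / Gamma(1 - alpha): the part t > d - r produces the boundary term.
   Radial shifts g(Q + t e) contract L_2 in polar coordinates and differ from g
   by at most t |grad g|, which makes the integral converge in L_2. *)

(* One quantitative bound, proved on test functions only, serves both existence and uniqueness.
   Truncation has to keep test functions smooth, so the positive part is replaced by a smooth
   function within [1/k] of it; this error is carried along with the residual and disappears as [k]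
   grows, because no constant depends on [k]. Uniformity in [s] comes from a sign: the [H^1] product
   of [y] with [u] is nonnegative, so the shift only helps. At a level [m] that is a large multiple
   of the L2 norm of [u], Chebyshev's inequality makes the support of [y] small; averaging over
   translations in a small cube then bounds the L2 norm of [y] by a small multiple of its gradient,
   in place of a Sobolev inequality. Up to the factor [c], [delta] is the minimum of [p] times the
   integral of [t^(-alpha-1)] over [t >= diam], since a radial shift by the diameter moves all
   points out of the domain. Truncation needs an order, hence real functions; nothing is lost,
   because the coefficients are real and the real and imaginary parts of the solution solve separate
   problems. *)
From HB Require Import structures.
Require Import Defs.
From mathcomp Require Import all_boot all_order all_algebra.
From mathcomp Require Import complex ring lra.
From mathcomp Require Import all_classical all_reals all_analysis measurable_realfun.
Import Order.TTheory GRing.Theory Num.Theory.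
Import numFieldNormedType.Exports.

Set Implicit Arguments.
Unset Strict Implicit.
Unset Printing Implicit Defensive.

Local Open Scope classical_set_scope.
Local Open Scope ring_scope.

(** * Lebesgue measure on row vectors *)

(* A copy of [lebesgue_row] that carries the sigma-finite instance. *)
Definition lrow {R : realType} n : set 'rV[R]_n -> \bar R := lebesgue_row n.
Arguments lrow {R} n _ : simpl never.

HB.instance Definition _ (R : realType) n := Measure.on (@lrow R n).

Section RowMeasure.
Context {R : realType}.

(** By uniqueness of Lebesgue measure: [s] times the pushforward under the affine map gives every
    half-open interval its length. *)
Lemma lebesgue_measure_affine (s b : R) (A : set R) : 0 < s -> measurable A ->
  @lebesgue_measure R ((fun t => s * t + b) @^-1` A) =
  ((s^-1)%:E * @lebesgue_measure R A)%E.
Proof.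
move=> s0 mA.
have mT : measurable_fun setT (fun t : measurableTypeR R => s * t + b : measurableTypeR R).
  by apply: measurable_funD => //; exact: mulrl_measurable.
pose f : {measure set _ -> \bar R} :=
  measure_function_pushforward__canonical__measure_function_Measure
    (@lebesgue_measure R) mT.
have s0' : 0 <= s by exact: ltW.
pose m : {measure set (measurableTypeR R) -> \bar R} := mscale (NngNum s0') f.
suff -> : @lebesgue_measure R A = m A.
  by rewrite /m /= /mscale /= muleA -EFinM mulVf ?gt_eqF// mul1e.
apply: lebesgue_measure_unique => // _ [[x y] _ <-] /=.
rewrite /m /mscale /f /= /pushforward.
have -> : (fun t : R => s * t + b) @^-1` `]x, y] = `](x - b) / s, (y - b) / s]%classic.
  by apply/seteqP; split => t /=;
    rewrite !in_itv/= ltr_pdivrMr// ler_pdivlMr// ltrBlDr lerBrDr (mulrC t).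
rewrite !lebesgue_measure_itv /= !lte_fin ltr_pM2r ?invr_gt0// ltrD2r.
case: ifPn => _; last by rewrite mule0.
rewrite -!EFinB -EFinM; congr EFin; by field; rewrite gt_eqF.
Qed.

Lemma measurable_rowP {d} {T : measurableType d} n (f : T -> 'rV[R]_n) :
  measurable_fun setT f <->
  forall i, measurable_fun setT (fun x => f x ord0 i).
Proof.
apply: (@iff_trans _ (g_sigma_preimage
    (fun i x => @row_coord R n i (f x)) `<=` measurable)).
  rewrite (g_sigma_preimage_comp (@row_coord R n) f).
  split=> [mf A [/= C preC <-]|prefS]; first exact: mf.
  by move=> _ A mA; apply: prefS; exists A.
split=> [tnthfS i|mf].
- move=> _ A mA.
  apply: tnthfS; apply: sub_sigma_algebra.
  rewrite -bigcup_seq/=; exists i; first by rewrite /= mem_index_enum.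
  by exists A => //.
- apply: smallest_sub; first exact: sigma_algebra_measurable.
  rewrite -bigcup_seq/=; apply: bigcup_sub => i Ii.
  by move=> A [B mB <-]; exact: mf.
Qed.

Lemma measurable_coord n (i : 'I_n) :
  measurable_fun setT (fun x : 'rV[R]_n => x ord0 i).
Proof. by have /measurable_rowP := @measurable_id _ 'rV[R]_n setT; apply. Qed.

Lemma lrowS n (A : set 'rV[R]_n.+1) :
  lrow n.+1 A =
  (\int[lrow n]_y @lebesgue_measure R [set t | A (row_cons (t, y))])%E.
Proof.
rewrite /lrow /= /lebesgue_step /pushforward /product_measure2.
by apply: eq_integral => y _ /=; congr lebesgue_measure; apply/seteqP; split => t;
  rewrite /ysection /= ?inE.
Qed.

Lemma measurable_affine_row n (s : R) (h : 'rV[R]_n) :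
  measurable_fun setT (fun x : 'rV[R]_n => s *: x + h).
Proof.
apply/measurable_rowP => i; under eq_fun do rewrite !mxE.
by apply: measurable_funD => //; apply: measurable_funM => //; exact: measurable_coord.
Qed.

Lemma row_cons_affine n (s : R) (h : 'rV[R]_n.+1) t (y : 'rV[R]_n) :
  s *: row_cons (t, y) + h =
  row_cons (s * t + h ord0 ord0, s *: y + \row_j h ord0 (lift ord0 j)).
Proof.
apply/rowP => i; rewrite !mxE /=.
by case: (unliftP ord0 i) => [j ->|->] /=; rewrite ?mxE.
Qed.

Let affine_integral n (s : R) (h : 'rV[R]_n) : 0 < s ->
  (forall A, measurable A -> lrow n ((fun x => s *: x + h) @^-1` A) =
   (((s^-1) ^+ n)%:E * lrow n A)%E) ->
  forall f : 'rV[R]_n -> \bar R, measurable_fun setT f -> (forall x, 0 <= f x)%E ->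
  (\int[lrow n]_x f (s *: x + h)%R =
   ((s^-1) ^+ n)%:E * \int[lrow n]_x f x)%E.
Proof.
move=> s0 H f mf f0.
have mT := @measurable_affine_row n s h.
have := @ge0_integral_pushforward _ _ _ _ _ _ mT (lrow n) setT f measurableT mf
  (fun y _ => f0 y).
rewrite preimage_setT => <-.
have c0 : 0 <= (s^-1) ^+ n by rewrite exprn_ge0// invr_ge0 ltW.
rewrite -(@ge0_integral_mscale _ _ _ (lrow n) setT measurableT (NngNum c0) f)//.
by apply: eq_measure_integral => A mA _ /=; rewrite /mscale /= -H.
Qed.

(** Slicing along the first coordinate: each slice scales by [1/s], and the integral over the
    remaining coordinates scales by the induction hypothesis, passed from sets to functions by
    [affine_integral]. *)
Lemma lrow_affine n (s : R) (h : 'rV[R]_n) (A : set 'rV[R]_n) :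
  0 < s -> measurable A ->
  lrow n ((fun x => s *: x + h) @^-1` A) =
  (((s^-1) ^+ n)%:E * lrow n A)%E.
Proof.
move=> s0; elim: n h A => [|n IH] h A mA.
  have e0 (x y : 'rV[R]_0) : x = y by apply/rowP => -[].
  rewrite expr0 mul1e (_ : _ @^-1` A = A)//.
  by apply/seteqP; split => x /=; rewrite [_ + h](e0 _ x).
rewrite !lrowS.
pose G (y : 'rV[R]_n) := @lebesgue_measure R [set t | A (row_cons (t, y))].
have mrc := @measurable_row_cons R n.
have mG : measurable_fun setT G.
  have := @measurable_fun_ysection _ _ (measurableTypeR R) 'rV[R]_n R
    (@lebesgue_measure R) (row_cons @^-1` A).
  rewrite -[X in measurable X]setTI => /(_ (mrc measurableT _ mA)).
  apply: eq_measurable_fun => y _ /=; congr lebesgue_measure.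
  by apply/seteqP; split => t; rewrite /ysection /= ?inE.
have mS y : measurable [set t : R | A (row_cons (t, y))].
  have := @measurable_ysection _ _ (measurableTypeR R) 'rV[R]_n (row_cons @^-1` A) y.
  rewrite -[X in measurable X -> _]setTI => /(_ (mrc measurableT _ mA)).
  congr measurable.
  by apply/seteqP; split => t; rewrite /ysection /= ?inE.
transitivity (\int[lrow n]_y ((s^-1)%:E * G (s *: y + \row_j h ord0 (lift ord0 j))%R))%E.
  apply: eq_integral => y _; rewrite /G -(lebesgue_measure_affine (h ord0 ord0))//.
  by congr lebesgue_measure; apply/seteqP; split => t /=; rewrite row_cons_affine; exact.
have G0 y : (0 <= G y)%E by exact: measure_ge0.
rewrite ge0_integralZl//; last 2 first.
- by apply: (measurableT_comp mG); exact: measurable_affine_row.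
- by rewrite lee_fin invr_ge0 ltW.
rewrite affine_integral//; last by move=> B mB; exact: IH.
by rewrite exprS EFinM muleA.
Qed.

Lemma ge0_integral_row_affine n (s : R) (h : 'rV[R]_n) (f : 'rV[R]_n -> \bar R) :
  0 < s -> measurable_fun setT f -> (forall x, 0 <= f x)%E ->
  (\int[lrow n]_x f (s *: x + h)%R =
   ((s^-1) ^+ n)%:E * \int[lrow n]_x f x)%E.
Proof. by move=> s0; apply: affine_integral => // A mA; exact: lrow_affine. Qed.

Lemma measurable_row_cube n (a b : R) :
  measurable [set x : 'rV[R]_n | forall i, x ord0 i \in `[a, b]].
Proof.
rewrite (_ : mkset _ = \big[setI/setT]_(i < n) ((fun x : 'rV[R]_n => x ord0 i) @^-1` `[a, b])).
  apply: bigsetI_measurable => i _; rewrite -[X in measurable X]setTI.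
  exact: measurable_coord.
apply/seteqP; split => x /=.
  by move=> H; rewrite -bigcap_seq => i _ /=; exact: H.
by rewrite -bigcap_seq => + i => /(_ i); apply; rewrite /= mem_index_enum.
Qed.

Lemma lrow_cube n (a b : R) : a <= b ->
  lrow n [set x | forall i, x ord0 i \in `[a, b]] = ((b - a) ^+ n)%:E.
Proof.
move=> ab; elim: n => [|n IH].
  by rewrite expr0 /lrow /= /dirac indicE mem_set//= => -[].
rewrite lrowS exprS EFinM -IH.
transitivity (\int[lrow n]_y
   ((b - a)%:E * (\1_[set x : 'rV[R]_n | forall i, x ord0 i \in `[a, b]] y)%:E))%E.
  apply: eq_integral => y _.
  case: (asboolP (forall i, y ord0 i \in `[a, b])) => [Hy|Hy].
    rewrite indicE mem_set// mule1 (_ : mkset _ = `[a, b]%classic).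
      rewrite lebesgue_measure_itv /= lte_fin; case: ltP => // ba.
      by rewrite (_ : b = a) ?subrr//; apply/eqP; rewrite eq_le ab ba.
    apply/seteqP; split => t /=.
      by move=> /(_ ord0); rewrite mxE unlift_none.
    by move=> tab i; rewrite mxE; case: unliftP => [j _|_] /=.
  rewrite indicE memNset// mule0 (_ : mkset _ = set0) ?measure0//.
  apply/seteqP; split => t //= H; apply: Hy => i.
  by have := H (lift ord0 i); rewrite mxE liftK.
rewrite ge0_integralZl//; last 2 first.
- by apply/measurable_EFinP; apply: measurable_indic; exact: measurable_row_cube.
- by rewrite lee_fin subr_ge0.
by rewrite integral_indic// ?setIT//; exact: measurable_row_cube.
Qed.

Lemma lrow_sigma_finite n : sigma_finite setT (@lrow R n).
Proof.
exists (fun k : nat => [set x : 'rV[R]_n | forall i, x ord0 i \in `[- k%:R, k%:R]]).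
  apply/seteqP; split => // x _.
  pose M := \sum_i `|x ord0 i|.
  exists (Num.truncn M).+1 => // i; rewrite in_itv /= -ler_norml.
  apply: ltW; apply: (le_lt_trans _ (truncnS_gt _)).
  by rewrite /M (bigD1 i)//= lerDl sumr_ge0.
move=> k; split; first exact: measurable_row_cube.
by rewrite lrow_cube ?ltry//; rewrite -subr_ge0 opprK -natrD ler0n.
Qed.

HB.instance Definition _ n := Measure_isSigmaFinite.Build _ _ _
  (@lrow R n) (@lrow_sigma_finite n).

(** Balls of the sup norm are cubes, so an open set is the union of the countably many open cubes
    with rational centre and half-width [1/(k+1)] that it contains. *)
Lemma open_row_measurable n (A : set 'rV[R]_n) : open A -> measurable A.
Proof.
move=> oA.
pose ctr (q : 'rV[rat]_n) : 'rV[R]_n := map_mx ratr q.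
pose I := [set z : 'rV[rat]_n * nat | ball (ctr z.1) (z.2.+1%:R^-1) `<=` A].
have -> : A = \bigcup_(z in I) [set x | forall i, `|ctr z.1 ord0 i - x ord0 i| < z.2.+1%:R^-1].
  apply/seteqP; split => x; last first.
    by move=> [z Iz /= Hx]; apply: Iz; split => [|i j]; rewrite ?invr_gt0 ?ltr0n// ord1; exact: Hx.
  move=> Ax; have : nbhs x A by move: oA; rewrite openE => /(_ _ Ax).
  move=> /nbhs_ballP[e /= e0 eA].
  pose k := Num.truncn (2 / e).
  have k0 : (k.+1%:R^-1 : R) < e / 2.
    rewrite invf_plt ?posrE ?divr_gt0//; last first.
    by rewrite invf_div; exact: truncnS_gt.
  have qex i : {q : rat | `|ratr q - x ord0 i| < (k.+1%:R^-1 : R)}.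
    apply: cid; have : x ord0 i - k.+1%:R^-1 < x ord0 i + k.+1%:R^-1.
      by rewrite ltrD2l gtrN// invr_gt0.
    move=> /rat_in_itvoo[q]; rewrite in_itv /= => /andP[q1 q2]; exists q.
    by rewrite ltr_norml ltrBrDr ltrBlDr addrC q1 addrC.
  exists (\row_i sval (qex i), k) => /=; last first.
    by move=> i; rewrite !mxE; exact: svalP (qex i).
  move=> y [_ /= yk]; apply: eA; split => // i0 j /=; rewrite (ord1 i0).
  have := yk ord0 j; rewrite /ball /= !mxE => H.
  have := svalP (qex j) => /= H2.
  rewrite /ball/= (splitr e).
  apply: le_lt_trans (ler_distD (ratr (sval (qex j))) _ _) _.
  by apply: ltrD; [rewrite distrC; apply: lt_trans H2 k0|apply: lt_trans H k0].
have mB (z : 'rV[rat]_n * nat) : measurable [set x : 'rV[R]_n | forall i,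
    `|ctr z.1 ord0 i - x ord0 i| < z.2.+1%:R^-1].
  rewrite (_ : mkset _ = \big[setI/setT]_(i < n) ((fun x : 'rV[R]_n =>
      `|ctr z.1 ord0 i - x ord0 i|) @^-1` `]-oo, z.2.+1%:R^-1[)).
    apply: bigsetI_measurable => i _; rewrite -[X in measurable X]setTI.
    have /= : measurable_fun setT (fun x : 'rV[R]_n => `|ctr z.1 ord0 i - x ord0 i|).
      apply: measurableT_comp => //; apply: measurable_funB => //.
      exact: measurable_coord.
    by apply.
  apply/seteqP; split => x /=.
    by move=> H; rewrite -bigcap_seq => i _ /=; rewrite in_itv /=; exact: H.
  rewrite -bigcap_seq => + i => /(_ i) /=; rewrite in_itv /=; apply.
  by rewrite mem_index_enum.
rewrite bigcup_mkcond; apply: countable_bigcupT_measurable; first exact: countableP.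
by move=> z; case: (z \in I); [exact: mB|exact: measurable0].
Qed.

Lemma continuous_row_measurable n (f : 'rV[R]_n -> R) :
  continuous f -> measurable_fun setT f.
Proof.
move=> cf mD; apply: (measurability _ (RGenOpens.measurableE R)) => //.
move=> _ [_ [a [b ->] <-]]; rewrite setTI.
apply: open_row_measurable; apply: open_comp; last exact: interval_open.
by move=> x _; exact: cf.
Qed.

End RowMeasure.

(** * Solvability from an inf-sup bound in pre-Hilbert spaces *)

Lemma discriminant_le {R : realType} (a b c : R) : 0 <= a ->
  (forall t, 0 <= a * t ^+ 2 + 2 * b * t + c) -> b ^+ 2 <= a * c.
Proof.
move=> a0 H; have [a_gt0|] := ltP 0 a.
  have := H (- b / a); rewrite -(ler_pM2l a_gt0) mulr0 => /le_trans h.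
  rewrite -subr_ge0; have -> : a * c - b ^+ 2 =
    a * (a * (- b / a) ^+ 2 + 2 * b * (- b / a) + c) by field; rewrite gt_eqF.
  by rewrite mulr_ge0// ltW.
move=> a0'; have a_eq0 : a = 0 by apply/eqP; rewrite eq_le a0 a0'.
have c0 : 0 <= c by have := H 0; rewrite expr0n !mulr0 !add0r.
have [->|b0] := eqVneq b 0; first by rewrite expr0n mulr_ge0.
(* For [a = 0] the polynomial is affine in [t], and at this point it takes the value [-1]. *)
have := H (- (c + 1) / (2 * b)).
have -> : a * (- (c + 1) / (2 * b)) ^+ 2 + 2 * b * (- (c + 1) / (2 * b)) + c = -1.
  by rewrite a_eq0; field.
by rewrite lerNr oppr0 ler10.
Qed.

Section PreHilbert.
Context {R : realType} {V : lmodType R}.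

(** Subspaces are predicates on one ambient space, since the same forms are used on all square
    integrable pairs, on limits of test pairs and on test pairs. Products are only semidefinite:
    functions equal almost everywhere are not identified. *)
Record submodule (D : V -> Prop) : Prop := Submodule {
  sub0 : D 0;
  subD : forall u v, D u -> D v -> D (u + v);
  subZ : forall k u, D u -> D (k *: u) }.

Record functional_on (D : V -> Prop) (F : V -> R) : Prop := FunctionalOn {
  funD : forall u v, D u -> D v -> F (u + v) = F u + F v;
  funZ : forall k u, D u -> F (k *: u) = k * F u }.

Record bilinear_on (D : V -> Prop) (B : V -> V -> R) : Prop := BilinearOn {
  bilDl : forall u v w, D u -> D v -> D w -> B (u + v) w = B u w + B v w;
  bilZl : forall k u w, D u -> D w -> B (k *: u) w = k * B u w;
  bilDr : forall u v w, D u -> D v -> D w -> B w (u + v) = B w u + B w v;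
  bilZr : forall k u w, D u -> D w -> B w (k *: u) = k * B w u }.

Record semi_inner_product (D : V -> Prop) (dot : V -> V -> R) : Prop :=
  SemiInnerProduct {
  sip_bil : bilinear_on D dot;
  sipC : forall u v, D u -> D v -> dot u v = dot v u;
  sip_ge0 : forall u, D u -> 0 <= dot u u }.

Variables (D : V -> Prop) (dot : V -> V -> R).
Hypotheses (sD : submodule D) (sdot : semi_inner_product D dot).

Let nrm u := Num.sqrt (dot u u).

Lemma subN u : D u -> D (- u).
Proof. by move=> Du; rewrite -scaleN1r; exact: subZ. Qed.

Lemma subB u v : D u -> D v -> D (u - v).
Proof. by move=> Du Dv; apply: subD => //; exact: subN. Qed.

Lemma sip_sqr u : D u -> Num.sqrt (dot u u) ^+ 2 = dot u u.
Proof. by move=> Du; rewrite sqr_sqrtr// (sip_ge0 sdot). Qed.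

Lemma cauchy_schwarz u v : D u -> D v -> `|dot u v| <= nrm u * nrm v.
Proof.
move=> Du Dv; have [B C P] := sdot.
rewrite -(@ler_pXn2r _ 2)// ?nnegrE// ?mulr_ge0 ?sqrtr_ge0//.
rewrite real_normK ?num_real// exprMn !sip_sqr//.
apply: discriminant_le => [|t]; first exact: P.
have := P (t *: u + v) (subD sD (subZ sD t Du) Dv).
have Dtu := subZ sD t Du; have Dtv := subD sD Dtu Dv.
rewrite (bilDl B)// !(bilZl B)// !(bilDr B)// !(bilZr B)// (C v u)//.
suff -> : dot u u * t ^+ 2 + 2 * dot u v * t + dot v v =
  t * (t * dot u u + dot u v) + (t * dot u v + dot v v) by [].
by ring.
Qed.

Lemma sip_triangle u v : D u -> D v -> nrm (u + v) <= nrm u + nrm v.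
Proof.
move=> Du Dv; have [B C P] := sdot; have Duv := subD sD Du Dv.
rewrite -(@ler_pXn2r _ 2)// ?nnegrE ?addr_ge0 ?sqrtr_ge0//.
rewrite sqrrD !sip_sqr// (bilDl B)// !(bilDr B)// (C v u)//.
have := le_trans (ler_norm _) (cauchy_schwarz Du Dv).
by rewrite /nrm => H; lra.
Qed.

Lemma sip_nrmZ k u : D u -> nrm (k *: u) = `|k| * nrm u.
Proof.
move=> Du; have [B C P] := sdot; rewrite /nrm (bilZl B)//; last exact: subZ.
by rewrite (bilZr B)// mulrA -expr2 sqrtrM ?sqr_ge0// sqrtr_sqr.
Qed.

Lemma bilNr (B : V -> V -> R) u v : bilinear_on D B -> D u -> D v ->
  B u (- v) = - B u v.
Proof. by move=> bB Du Dv; rewrite -scaleN1r (bilZr bB)// mulN1r. Qed.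

Lemma bilBr (B : V -> V -> R) u v w : bilinear_on D B -> D u -> D v -> D w ->
  B u (v - w) = B u v - B u w.
Proof.
by move=> bB Du Dv Dw; rewrite (bilDr bB)//; [rewrite bilNr|exact: subN].
Qed.

Lemma bilNl (B : V -> V -> R) u v : bilinear_on D B -> D u -> D v ->
  B (- u) v = - B u v.
Proof. by move=> bB Du Dv; rewrite -scaleN1r (bilZl bB)// mulN1r. Qed.

Lemma bilBl (B : V -> V -> R) u v w : bilinear_on D B -> D u -> D v -> D w ->
  B (u - v) w = B u w - B v w.
Proof.
by move=> bB Du Dv Dw; rewrite (bilDl bB)//; [rewrite bilNl|exact: subN].
Qed.

(** Solvability up to an arbitrarily small error in the dual norm, because [D] will be the
    incomplete space of test functions. *)
Definition solvable (B : V -> V -> R) := forall (F : V -> R) (N : R),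
  functional_on D F -> (forall v, D v -> `|F v| <= N * nrm v) ->
  forall e, 0 < e -> exists2 z, D z &
    forall v, D v -> `|B v z - F v| <= e * nrm v.

(* Minimising [dot v v / 2 - F v] up to [e ^+ 2 / 2] replaces Riesz' theorem
   when the space is not complete. *)
Lemma riesz_approx : solvable dot.
Proof.
move=> F N [FD FZ] FN e e0; have [B C P] := sdot.
pose J v := dot v v / 2 - F v.
have JN v : D v -> - (N ^+ 2 / 2) <= J v.
  move=> Dv; have := le_trans (ler_norm _) (FN v Dv).
  have := sqr_ge0 (nrm v - N); rewrite sqrrB sip_sqr// /J => h1 h2; lra.
pose S := [set J v | v in [set v | D v]].
have hS : has_inf S.
  split; first by exists (J 0), 0 => //; exact: sub0.
  by exists (- (N ^+ 2 / 2)) => _ [v Dv <-]; exact: JN.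
have [_ [z Dz <-] Jz] := inf_adherent (divr_gt0 (exprn_gt0 2 e0) (ltr0n R 2)) hS.
exists z => // v Dv; set m := inf S in Jz.
have Jm w : D w -> m <= J w by move=> Dw; apply: ge_inf; [case: hS|exists w].
rewrite -(@ler_pXn2r _ 2)// ?nnegrE// ?mulr_ge0 ?sqrtr_ge0 ?(ltW e0)//.
rewrite real_normK ?num_real// exprMn sip_sqr// mulrC.
apply: discriminant_le => [|t]; first exact: P.
have Dtv := subZ sD t Dv.
have := Jm (z + t *: v) (subD sD Dz Dtv).
have Dztv := subD sD Dz Dtv.
rewrite /J (bilDl B)// !(bilDr B)// !(bilZl B)// !(bilZr B)// FD// FZ// (C z v)//.
by move: Jz; rewrite /J => h1 h2; lra.
Qed.

Lemma solvableZ (B : V -> V -> R) s : 0 < s -> solvable B ->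
  solvable (fun v u => s * B v u).
Proof.
move=> s0 sB F N [FD FZ] FN e e0.
have [|||z Dz Hz] := sB (fun v => s^-1 * F v) (s^-1 * N) _ _ (e / s).
- by split=> [u v Du Dv|k u Du]; rewrite ?FD ?FZ// ?mulrDr// mulrCA.
- move=> v Dv; rewrite normrM gtr0_norm ?invr_gt0// -mulrA ler_pM2l ?invr_gt0//.
  exact: FN.
- by rewrite divr_gt0.
exists z => // v Dv; have := Hz v Dv.
rewrite -(ler_pM2l s0) -{1}(gtr0_norm s0) -normrM mulrBr mulVKf ?gt_eqF//.
by rewrite mulrA mulrCA divff ?gt_eqF// mulr1.
Qed.

(** A Neumann iteration. Each correction solves the problem for [A] with the current residual as
    right side; the inf-sup bound controls its norm, hence what [E] puts back, and the residual
    shrinks by the factor 3/4. *)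
Lemma solvable_perturb (A E : V -> V -> R) (C rho : R) :
  bilinear_on D A -> bilinear_on D E -> 0 <= C -> 0 <= rho ->
  (forall u, D u -> forall G, 0 <= G ->
    (forall v, D v -> `|A v u| <= G * nrm v) -> nrm u <= C * G) ->
  (forall v u, D v -> D u -> `|E v u| <= rho * nrm v * nrm u) ->
  rho * C <= 2^-1 ->
  solvable A -> solvable (fun v u => A v u + E v u).
Proof.
move=> bA bE C0 rho0 infsup Erho rhoC sA F N fF FN.
wlog N0 : N FN / 0 < N.
  move=> H; apply: (H (`|N| + 1)); last by rewrite ltr_wpDl.
  move=> v Dv; apply: le_trans (FN v Dv) _; rewrite ler_wpM2r ?sqrtr_ge0//.
  by rewrite (le_trans (ler_norm N))// lerDl.
have step k : exists2 z, D z & forall v, D v ->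
    `|F v - (A v z + E v z)| <= N * (3 / 4) ^+ k * nrm v.
  elim: k => [|k [z Dz Hz]].
    exists 0; first exact: sub0.
    move=> v Dv; rewrite expr0 mulr1.
    have D0 : D 0 by exact: sub0.
    rewrite -(scale0r (0 : V)) (bilZr bA)// (bilZr bE)// !mul0r addr0 subr0.
    exact: FN.
  have [FD FZ] := fF.
  set Nk := N * (3 / 4) ^+ k in Hz.
  have Nk0 : 0 < Nk by rewrite mulr_gt0// exprn_gt0//; lra.
  (* The tolerance [Nk / 8] gives [|y| <= C * 9/8 * Nk], so the new residual is at most
     [(1/8 + 1/2 * 9/8) Nk = 11/16 Nk], below [3/4 Nk]. *)
  have [||y Dy Hy] := sA (fun v => F v - (A v z + E v z)) Nk _ Hz (Nk / 8).
  - split=> [u v Du Dv|c u Du].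
      by rewrite FD// (bilDl bA)// (bilDl bE)//; lra.
    by rewrite FZ// (bilZl bA)// (bilZl bE)//; lra.
  - by rewrite divr_gt0.
  have ny : nrm y <= C * (Nk + Nk / 8).
    apply: infsup => //; first by rewrite addr_ge0 ?divr_ge0 ?ltW.
    move=> v Dv.
    rewrite -[A v y](subrK (F v - (A v z + E v z))) (le_trans (ler_normD _ _))//.
    by rewrite mulrDl addrC lerD// ?Hz ?Hy.
  exists (z + y) => [|v Dv]; first exact: subD.
  rewrite (bilDr bA)// (bilDr bE)//.
  have -> : F v - (A v z + A v y + (E v z + E v y)) =
    - (A v y - (F v - (A v z + E v z))) - E v y by ring.
  apply: le_trans (ler_normD _ _) _; rewrite !normrN.
  apply: le_trans (lerD (Hy v Dv) (Erho v y Dv Dy)) _.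
  rewrite exprSr (mulrA N) -/Nk.
  have nv0 : 0 <= nrm v by exact: sqrtr_ge0.
  have h1 : rho * nrm v * nrm y <= rho * nrm v * (C * (Nk + Nk / 8)).
    by rewrite ler_wpM2l// mulr_ge0.
  have h2 : rho * nrm v * (C * (Nk + Nk / 8)) = (rho * C) * (nrm v * Nk * (9 / 8)).
    by field.
  have h3 : (rho * C) * (nrm v * Nk * (9 / 8)) <= 2^-1 * (nrm v * Nk * (9 / 8)).
    by rewrite ler_wpM2r// !mulr_ge0// ?(ltW Nk0)//; lra.
  have h4 : 0 <= nrm v * Nk by rewrite mulr_ge0// ltW.
  lra.
move=> e e0.
have : (3 / 4 : R) ^+ k @[k --> \oo] --> 0.
  by apply: cvg_expr; rewrite ger0_norm; lra.
move=> /cvgrPdist_lt/(_ (e / N) (divr_gt0 e0 N0))[k _ /(_ k (leqnn k))] /=.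
rewrite sub0r normrN ger0_norm; last by rewrite exprn_ge0//; lra.
rewrite ltr_pdivlMr// mulrC => ke.
have [z Dz Hz] := step k.
exists z => // v Dv; rewrite distrC; apply: le_trans (Hz v Dv) _.
by rewrite ler_wpM2r ?sqrtr_ge0// ltW.
Qed.

(** The method of continuity in [s]. For large [s] the form is a perturbation of [s * dot], solvable
    by [riesz_approx]; the inf-sup constant being the same for all [s >= 0], one can descend to 0 in
    steps of fixed length. *)
Lemma solvable_of_infsup (B : V -> V -> R) (C CB : R) :
  bilinear_on D B -> 0 < C ->
  (forall v u, D v -> D u -> `|B v u| <= CB * nrm v * nrm u) ->
  (forall s u, 0 <= s -> D u -> forall G, 0 <= G ->
     (forall v, D v -> `|B v u + s * dot v u| <= G * nrm v) ->
     nrm u <= C * G) ->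
  solvable B.
Proof.
move=> bB C0 BCB infsup; have [bd dC dP] := sdot.
(* The longest step allowed by [solvable_perturb]: [delta * C = 1/2]. *)
pose delta := (2 * C)^-1; have delta0 : 0 < delta by rewrite invr_gt0 mulr_gt0.
have bs s : bilinear_on D (fun v u => s * dot v u).
  by split=> *; rewrite ?(bilDl bd, bilDr bd, bilZl bd, bilZr bd)//; ring.
have bBs s : bilinear_on D (fun v u => B v u + s * dot v u).
  by split=> *; rewrite ?(bilDl bd, bilDr bd, bilZl bd, bilZr bd,
    bilDl bB, bilDr bB, bilZl bB, bilZr bB)//; ring.
have BC v u : D v -> D u -> `|B v u| <= `|CB| * nrm v * nrm u.
  move=> Dv Du; apply: le_trans (BCB v u Dv Du) _.
  by rewrite !ler_wpM2r ?sqrtr_ge0 ?ler_norm.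
(* Here [s * dot] has inf-sup constant [1/s], and [B] is the perturbation. Positivity of [s] is
   asked separately because [CB] may be 0. *)
have large s : 2 * `|CB| <= s -> 0 < s -> solvable (fun v u => B v u + s * dot v u).
  move=> sB s0.
  rewrite (_ : (fun v u => _) = fun v u => s * dot v u + B v u); last first.
    by apply/funext => v; apply/funext => u; rewrite addrC.
  apply: (@solvable_perturb _ _ s^-1 `|CB|) => //.
  - by rewrite invr_ge0 ltW.
  - move=> u Du G G0 /(_ u Du).
    rewrite normrM gtr0_norm// ger0_norm ?dP// -sip_sqr// expr2 mulrA.
    have := sqrtr_ge0 (dot u u); rewrite -/(nrm u) le_eqVlt => /predU1P[<-|u0].
      by move=> _; rewrite mulr_ge0// invr_ge0 ltW.
    by rewrite ler_pM2r// ler_pdivlMl.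
  - by rewrite ler_pdivrMr// mulrC ler_pdivlMr// mulrC.
  - by apply: solvableZ => //; exact: riesz_approx.
have down s : 0 <= s -> solvable (fun v u => B v u + (s + delta) * dot v u) ->
    solvable (fun v u => B v u + s * dot v u).
  move=> s0 H.
  rewrite (_ : (fun v u => _) = fun v u => (B v u + (s + delta) * dot v u) +
     (- delta) * dot v u); last first.
    by apply/funext => v; apply/funext => u; ring.
  apply: (@solvable_perturb _ _ C delta) => //.
  - exact: ltW.
  - exact: ltW.
  - by move=> u Du G; apply: infsup => //; rewrite addr_ge0// ltW.
  - move=> v u Dv Du; have := cauchy_schwarz Dv Du.
    rewrite normrM normrN (gtr0_norm delta0) => h.
    have -> : delta * nrm v * nrm u = delta * (nrm v * nrm u) by ring.
    by rewrite ler_pM2l.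
  - by rewrite /delta invfM -mulrA mulVf ?gt_eqF// mulr1.
have iter k : solvable (fun v u => B v u + (k%:R * delta) * dot v u) ->
    solvable (fun v u => B v u + 0 * dot v u).
  elim: k => [|k IH]; first by rewrite mul0r.
  rewrite -natr1 mulrDl mul1r => /down H; apply: IH; apply: H.
  by rewrite mulr_ge0// ltW.
rewrite (_ : B = fun v u => B v u + 0 * dot v u); last first.
  by apply/funext => v; apply/funext => u; rewrite mul0r addr0.
(* Enough steps to start from a parameter [k * delta] above [2 * |CB|]. *)
pose k := (Num.truncn (2 * `|CB| / delta)).+1.
apply: (iter k); apply: large.
  by rewrite -ler_pdivrMr// ltW// truncnS_gt.
by rewrite mulr_gt0.
Qed.

End PreHilbert.

(** * Square integrable functions *)

Section SquareIntegrable.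
Context {d} {T : measurableType d} {R : realType} (mu : {measure set T -> \bar R}).
Implicit Types f g h : T -> R.

Definition L2 f := measurable_fun setT f /\
  mu.-integrable setT (EFin \o (fun x => f x ^+ 2)).

(** A real number obtained from the extended integral by a default value at infinity. Outside [L2]
    it carries no information, which is why membership is proved along with every norm bound. *)
Definition ip f g : R := \int[mu]_x (f x * g x).

Definition nrm f : R := Num.sqrt (ip f f).

Lemma L2_meas f : L2 f -> measurable_fun setT f. Proof. by case. Qed.

Lemma nrm_ge0 f : 0 <= nrm f. Proof. exact: sqrtr_ge0. Qed.

Lemma L2_dom f g : measurable_fun setT g -> L2 f ->
  (forall x, `|g x| <= `|f x|) -> L2 g.
Proof.
move=> mg [mf intf] gf; split => //; apply: le_integrable intf => //.
  by apply/measurable_EFinP; exact: measurable_funX.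
by move=> x _ /=; rewrite lee_fin !normrX ler_pXn2r// nnegrE.
Qed.

Lemma L2_integrableM f g : L2 f -> L2 g ->
  mu.-integrable setT (EFin \o (fun x => f x * g x)).
Proof.
move=> [mf If] [mg Ig].
have mfg := @integrableD _ _ _ _ _ measurableT _ _ If Ig.
apply: le_integrable mfg => //.
  by apply/measurable_EFinP; exact: measurable_funM.
move=> x _ /=; rewrite lee_fin [leRHS]ger0_norm ?addr_ge0 ?sqr_ge0//.
rewrite normrM -(real_normK (num_real (f x))) -(real_normK (num_real (g x))).
have := sqr_ge0 (`|f x| - `|g x|); rewrite sqrrB.
have := sqr_ge0 `|f x|; have := sqr_ge0 `|g x|.
by move=> *; lra.
Qed.

Lemma L2D f g : L2 f -> L2 g -> L2 (f + g).
Proof.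
move=> lf lg; have [mf If] := lf; have [mg Ig] := lg.
have Ifg := L2_integrableM lf lg.
split; first exact: measurable_funD.
have := @integrableD _ _ _ _ _ measurableT _ _ (@integrableD _ _ _ _ _ measurableT _ _ If Ig)
  (@integrableZl _ _ _ _ _ measurableT 2 _ Ifg).
apply: eq_integrable => // x _ /=; rewrite -!EFinM -!EFinD; congr EFin.
by rewrite addrfctE/=; ring.
Qed.

Lemma L2Z k f : L2 f -> L2 (k *: f).
Proof.
move=> [mf If]; split.
  by rewrite (_ : k *: f = fun x => k * f x)//; exact: measurable_funM.
apply: eq_integrable (@integrableZl _ _ _ _ _ measurableT (k ^+ 2) _ If) => //.
by move=> x _ /=; rewrite -EFinM -exprMn.
Qed.

Lemma L2_0 : L2 0.
Proof.
split; first exact: measurable_cst.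
apply: eq_integrable (integrable0 mu setT) => // x _ /=.
by rewrite expr0n.
Qed.

Lemma L2_submodule : submodule L2.
Proof. by split; [exact: L2_0|exact: L2D|exact: L2Z]. Qed.

Lemma L2N f : L2 f -> L2 (- f). Proof. exact: (subN L2_submodule). Qed.

Lemma L2B f g : L2 f -> L2 g -> L2 (f - g). Proof. exact: (subB L2_submodule). Qed.

Lemma L2_sum I (s : seq I) (P : pred I) (F : I -> T -> R) :
  (forall i, P i -> L2 (F i)) -> L2 (\sum_(i <- s | P i) F i).
Proof. by move=> H; elim/big_rec: _ => [|i f Pi]; [exact: L2_0|apply: L2D; exact: H]. Qed.

Lemma L2M_bounded c f g : measurable_fun setT g -> (forall x, `|g x| <= c) ->
  L2 f -> L2 (fun x => g x * f x).
Proof.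
move=> mg gc lf; apply: (@L2_dom (c *: f)).
- by apply: measurable_funM => //; exact: L2_meas.
- exact: L2Z.
- move=> x; rewrite normrM /= [X in _ <= X](_ : _ = `|c * f x|)// normrM.
  by rewrite ler_wpM2r// (le_trans (gc x))// ler_norm.
Qed.

Lemma ip_bilinear : bilinear_on L2 ip.
Proof.
have ipDl f g h : L2 f -> L2 g -> L2 h -> ip (f + g) h = ip f h + ip g h.
  move=> lf lg lh; rewrite /ip -RintegralD//; try exact: L2_integrableM.
  by apply: eq_Rintegral => x _; rewrite -mulrDl.
have ipZl k f h : L2 f -> L2 h -> ip (k *: f) h = k * ip f h.
  move=> lf lh; rewrite /ip -RintegralZl//; last exact: L2_integrableM.
  by apply: eq_Rintegral => x _; rewrite mulrA.
have ipC f g : ip f g = ip g f by apply: eq_Rintegral => x _; exact: mulrC.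
split => // [f g h ? ? ?|k f h ? ?].
  by rewrite !(ipC h) ipDl.
by rewrite !(ipC h) ipZl.
Qed.

Lemma ipC f g : ip f g = ip g f.
Proof. by apply: eq_Rintegral => x _; exact: mulrC. Qed.

Lemma ip_ge0 f : 0 <= ip f f.
Proof. by apply: Rintegral_ge0 => x _; rewrite -expr2 sqr_ge0. Qed.

Lemma ip_sip : semi_inner_product L2 ip.
Proof. by split; [exact: ip_bilinear|move=> *; exact: ipC|move=> *; exact: ip_ge0]. Qed.

Lemma nrm_sqr f : nrm f ^+ 2 = ip f f.
Proof. by rewrite sqr_sqrtr// ip_ge0. Qed.

Lemma ip_CS f g : L2 f -> L2 g -> `|ip f g| <= nrm f * nrm g.
Proof. exact: (cauchy_schwarz L2_submodule ip_sip). Qed.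

Lemma nrmD f g : L2 f -> L2 g -> nrm (f + g) <= nrm f + nrm g.
Proof. exact: (sip_triangle L2_submodule ip_sip). Qed.

Lemma nrmZ k f : L2 f -> nrm (k *: f) = `|k| * nrm f.
Proof. exact: (sip_nrmZ L2_submodule ip_sip). Qed.

Lemma nrmN f : nrm (- f) = nrm f.
Proof. by congr Num.sqrt; apply: eq_Rintegral => x _; rewrite mulrNN. Qed.

Lemma nrmB f g : L2 f -> L2 g -> nrm (f - g) <= nrm f + nrm g.
Proof. by move=> lf lg; rewrite -(nrmN g); apply: nrmD => //; exact: L2N. Qed.

Lemma nrm_distC f g : nrm (f - g) = nrm (g - f).
Proof. by rewrite -nrmN opprB. Qed.

Lemma nrm_le_dist f g : L2 f -> L2 g -> nrm f <= nrm g + nrm (f - g).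
Proof. by move=> lf lg; rewrite -{1}(subrK g f) addrC; apply: nrmD => //; exact: L2B. Qed.

Lemma nrm_sum I (s : seq I) (P : pred I) (F : I -> T -> R) :
  (forall i, P i -> L2 (F i)) ->
  nrm (\sum_(i <- s | P i) F i) <= \sum_(i <- s | P i) nrm (F i).
Proof.
move=> H; elim: s => [|i s IH].
  rewrite !big_nil (_ : nrm 0 = 0)//.
  by rewrite -(scale0r (0 : T -> R)) nrmZ ?normr0 ?mul0r//; exact: L2_0.
rewrite !big_cons; case: ifPn => // Pi.
apply: le_trans (nrmD (H _ Pi) (L2_sum _ H)) _.
by rewrite lerD2l.
Qed.

Lemma nrm_sqrE f : L2 f -> ((nrm f ^+ 2)%:E = \int[mu]_x (f x ^+ 2)%:E)%E.
Proof.
move=> [mf If]; rewrite nrm_sqr /ip /Rintegral.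
under eq_integral do rewrite -expr2.
by rewrite fineK//; exact: integrable_fin_num.
Qed.

Lemma L2P f : measurable_fun setT f ->
  (\int[mu]_x (f x ^+ 2)%:E < +oo)%E -> L2 f.
Proof.
move=> mf fy; split=> //; apply/integrableP; split.
  by apply/measurable_EFinP; exact: measurable_funX.
by under eq_integral do rewrite /= ger0_norm ?sqr_ge0//.
Qed.

Lemma L2_lty f : L2 f -> (\int[mu]_x (f x ^+ 2)%:E < +oo)%E.
Proof. by move=> lf; rewrite -nrm_sqrE// ltry. Qed.

Lemma L2_nrm_le f c : 0 <= c -> measurable_fun setT f ->
  (\int[mu]_x (f x ^+ 2)%:E <= (c ^+ 2)%:E)%E -> L2 f /\ nrm f <= c.
Proof.
move=> c0 mf fc; have lf : L2 f by apply: L2P => //; rewrite (le_lt_trans fc)// ltry.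
split => //; rewrite -(@ler_pXn2r _ 2)// ?nnegrE ?nrm_ge0//.
by rewrite -lee_fin nrm_sqrE.
Qed.

Lemma le_nrm f g : measurable_fun setT f -> L2 g ->
  (forall x, `|f x| <= `|g x|) -> nrm f <= nrm g.
Proof.
move=> mf lg fg; have lf := L2_dom mf lg fg.
rewrite ler_wsqrtr//; apply: le_Rintegral => //; try exact: L2_integrableM.
move=> x _; rewrite -!expr2 -(real_normK (num_real (f x))).
by rewrite -(real_normK (num_real (g x))) ler_pXn2r ?nnegrE.
Qed.

Lemma nrmM_bounded c f g : 0 <= c -> measurable_fun setT g ->
  (forall x, `|g x| <= c) -> L2 f -> nrm (fun x => g x * f x) <= c * nrm f.
Proof.
move=> c0 mg gc lf; rewrite -[c]ger0_norm// -nrmZ//.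
apply: le_nrm; [|exact: L2Z|].
  by apply: measurable_funM => //; exact: L2_meas.
move=> x; rewrite normrM [X in _ <= X](_ : _ = `|c * f x|)// normrM.
by rewrite ler_wpM2r// (le_trans (gc x))// ler_norm.
Qed.

Lemma nrm_ae_eq f g : measurable_fun setT f -> measurable_fun setT g ->
  {ae mu, forall x, f x = g x} -> nrm f = nrm g.
Proof.
move=> mf mg fg; congr Num.sqrt; rewrite /ip /Rintegral; congr fine.
apply: ae_eq_integral => //; try by apply/measurable_EFinP; exact: measurable_funM.
by apply: filterS fg => x /= -> _.
Qed.

Lemma ip_ae_eq f g h : measurable_fun setT f -> measurable_fun setT g ->
  measurable_fun setT h -> {ae mu, forall x, f x = g x} -> ip f h = ip g h.
Proof.
move=> mf mg mh fg; rewrite /ip /Rintegral; congr fine.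
apply: ae_eq_integral => //; try by apply/measurable_EFinP; exact: measurable_funM.
by apply: filterS fg => x /= -> _.
Qed.

Lemma L2_ae_eq f g : measurable_fun setT g -> L2 f ->
  {ae mu, forall x, f x = g x} -> L2 g.
Proof.
move=> mg lf fg; have mf := L2_meas lf; apply: L2P => //.
rewrite (_ : (\int[mu]_x _)%E = (\int[mu]_x (f x ^+ 2)%:E)%E); last first.
  apply: ae_eq_integral => //; try by apply/measurable_EFinP; exact: measurable_funX.
  by apply: filterS fg => x /= -> _.
exact: L2_lty.
Qed.

Lemma nrm_eq0_ae f : L2 f -> nrm f = 0 -> {ae mu, forall x, f x = 0}.
Proof.
move=> lf f0; have := nrm_sqrE lf; rewrite f0 expr0n/= => /esym H.
have mf2 : measurable_fun setT (fun x => (f x ^+ 2)%:E).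
  by apply/measurable_EFinP; apply: measurable_funX; exact: L2_meas.
have : (\int[mu]_x `|(f x ^+ 2)%:E| = 0)%E.
  by under eq_integral do rewrite gee0_abs ?lee_fin ?sqr_ge0//.
move=> /(ae_eq_integral_abs mu measurableT mf2).1.
apply: filterS => x /(_ I) /eqP; rewrite eqe sqrf_eq0 => /eqP //.
Qed.

(** The dominating function has extended values because in the proof of completeness it is a limit
    of partial sums that may be infinite on a null set. *)
Lemma nrm_cvg0_dominated (u : nat -> T -> R) (G : T -> \bar R) :
  (forall k, measurable_fun setT (u k)) -> mu.-integrable setT G ->
  {ae mu, forall x, forall k, ((u k x ^+ 2)%:E <= G x)%E} ->
  {ae mu, forall x, u k x @[k --> \oo] --> 0} ->
  nrm (u k) @[k --> \oo] --> 0.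
Proof.
move=> mu_ IG uG u0.
have [||||_ _] := @dominated_convergence _ _ _ mu setT measurableT
  (fun k x => (u k x ^+ 2)%:E) (cst 0%E) G _ _ _ IG.
- by move=> k; apply/measurable_EFinP; exact: measurable_funX.
- exact: measurable_cst.
- apply: filterS u0 => x ux _; apply: cvg_EFin; first exact: nearW.
  rewrite (_ : fine \o _ = (fun k => u k x) \* (fun k => u k x)); last first.
    by apply/funext => k /=; rewrite expr2.
  by rewrite -(mulr0 0); exact: (cvgM ux ux).
- by apply: filterS uG => x ux k _; rewrite gee0_abs ?lee_fin ?sqr_ge0.
rewrite integral0 => H.
have {}H : \int[mu]_x (u k x * u k x) @[k --> \oo] --> (0 : R).
  rewrite (_ : (fun k => _) = fun k => fine (\int[mu]_x (u k x ^+ 2)%:E)); last first.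
    by apply/funext => k; congr fine; apply: eq_integral => x _; rewrite expr2.
  exact: (@fine_cvg _ _ _ _ _ 0).
rewrite -(sqrtr0 R).
exact: (continuous_cvg _ (@sqrt_continuous R 0) H).
Qed.

Lemma cvg_nrm_dominated (u : nat -> T -> R) (v g : T -> R) :
  (forall k, measurable_fun setT (u k)) -> measurable_fun setT v -> L2 g ->
  (forall k x, `|u k x - v x| <= g x) ->
  (forall x, u k x @[k --> \oo] --> v x) ->
  nrm (u k - v) @[k --> \oo] --> 0.
Proof.
move=> mu_ mv [mg Ig] ug uv.
apply: (nrm_cvg0_dominated _ Ig).
- by move=> k; exact: measurable_funB.
- apply: aeW => x k /=; rewrite lee_fin -(real_normK (num_real _)).
  have := ug k x; have -> : (u k - v) x = u k x - v x by [].
  move=> h; rewrite ler_pXn2r// nnegrE//.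
  exact: le_trans (normr_ge0 _) h.
- apply: aeW => x; rewrite -(subrr (v x)).
  by apply: cvgB; [exact: uv|exact: cvg_cst].
Qed.

Lemma nrm_partial_sum (u : nat -> T -> R) k : (forall j, L2 (u j)) ->
  (forall j, nrm (u j) <= (2^-1) ^+ j) ->
  nrm (fun x => \sum_(j < k) `|u j x|) <= 2.
Proof.
move=> lu un; rewrite (_ : (fun x => _) = \sum_(j < k) (fun x => `|u j x|)); last first.
  by apply/funext => x; elim/big_ind2 : _ => // [? ? ? ? -> ->].
have lau j : L2 (fun x => `|u j x|).
  apply: (@L2_dom (u j)) => //; last by move=> x; rewrite normr_id.
  by apply: measurableT_comp => //; exact: L2_meas.
apply: le_trans (nrm_sum _ _) _ => //.
apply: (@le_trans _ _ (\sum_(j < k) 2^-1 ^+ j)).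
  apply: ler_sum => j _; apply: le_trans (un j).
  by apply: le_nrm => // [|x]; [exact: L2_meas|rewrite normr_id].
suff -> : \sum_(j < k) (2^-1 : R) ^+ j = 2 - 2 * 2^-1 ^+ k.
  by rewrite lerBlDr lerDl mulr_ge0// exprn_ge0.
elim: k => [|k IH]; first by rewrite big_ord0 expr0 mulr1 subrr.
by rewrite big_ord_recr/= IH exprS; field.
Qed.

(** The Riesz-Fischer argument: the absolute series of increments has partial sums of norm at most
    2, so it converges almost everywhere and its square dominates all the errors. *)
Lemma L2_complete (f : nat -> T -> R) : (forall k, L2 (f k)) ->
  (forall k, nrm (f k.+1 - f k) <= (2^-1) ^+ k) ->
  exists2 h, L2 h & nrm (f k - h) @[k --> \oo] --> 0.
Proof.
move=> lf fn.
pose u k := f k.+1 - f k.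
have lu k : L2 (u k) by exact: L2B.
pose s k x := \sum_(j < k) `|u j x|.
have s0 k x : 0 <= s k x by exact: sumr_ge0.
have ms k : measurable_fun setT (s k).
  apply: measurable_sum => j; apply: measurableT_comp => //.
  exact: L2_meas.
have sndc x : nondecreasing_seq (fun k => s k x).
  by apply/nondecreasing_seqP => k; rewrite /s big_ord_recr/= lerDl.
(* An extended limit, so that it exists at every point; the squares are taken inside in order to
   apply monotone convergence to it. *)
pose L x := limn (fun k => (s k x ^+ 2)%:E).
have ms2 k : measurable_fun setT (fun x => (s k x ^+ 2)%:E).
  by apply/measurable_EFinP; exact: measurable_funX.
have nd2 x : {homo (fun k => (s k x ^+ 2)%:E) : i j / (i <= j)%N >-> (i <= j)%E}.
  by move=> i j ij; rewrite lee_fin ler_pXn2r ?nnegrE//; exact: sndc.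
have sL k x : ((s k x ^+ 2)%:E <= L x)%E.
  rewrite /L (cvg_lim _ (ereal_nondecreasing_cvgn (nd2 x)))//.
  by apply: ereal_sup_ubound; exists k.
have mL : measurable_fun setT L.
  apply: (emeasurable_fun_cvg (fun k x => (s k x ^+ 2)%:E)) => // x _.
  exact: (ereal_nondecreasing_is_cvgn (nd2 x)).
have IL : mu.-integrable setT L.
  apply/integrableP; split => //.
  rewrite (_ : (\int[mu]_x _)%E = (\int[mu]_x L x)%E); last first.
    apply: eq_integral => x _; rewrite gee0_abs//.
    by apply: le_trans (sL 0%N x); rewrite lee_fin sqr_ge0.
  rewrite (monotone_convergence mu measurableT ms2)//; last first.
    by move=> k x _; rewrite lee_fin sqr_ge0.
  apply: (@le_lt_trans _ _ 4%:E); last by rewrite ltry.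
  apply: lime_le.
    apply: ereal_nondecreasing_is_cvgn => i j ij; apply: ge0_le_integral => //.
    - by move=> x _; rewrite lee_fin sqr_ge0.
    - by move=> x _; exact: nd2.
  apply: nearW => k.
  have ls : L2 (s k).
    rewrite (_ : s k = \sum_(j < k) (fun x => `|u j x|)); last first.
      by apply/funext => x; rewrite /s; elim/big_ind2 : _ => // [? ? ? ? -> ->].
    apply: L2_sum => j _; apply: (@L2_dom (u j)) => //.
      by apply: measurableT_comp => //; exact: L2_meas.
    by move=> x; rewrite normr_id.
  rewrite -nrm_sqrE// lee_fin (_ : 4 = 2 ^+ 2 :> R); last by rewrite -natrX.
  by rewrite ler_pXn2r ?nnegrE ?nrm_ge0//; exact: nrm_partial_sum.
have aeL : {ae mu, forall x, L x \is a fin_num}.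
  have := integrable_ae measurableT IL; apply: filterS => x; exact.
pose A := [set x | L x \is a fin_num].
have mA : measurable A.
  have := emeasurable_fin_num measurableT mL; by rewrite setTI.
have fdist x i j : (i <= j)%N -> `|f j x - f i x| <= s j x.
  move=> /subnK <-; elim: (j - i)%N => [|m IH].
    by rewrite add0n subrr normr0.
  rewrite addSn; have -> : f (m + i).+1 x - f i x = (f (m + i)%N x - f i x) + u (m + i)%N x.
    by rewrite /u [(_ - _ : T -> R) x](_ : _ = f (m + i).+1 x - f (m + i)%N x)//; ring.
  by apply: le_trans (ler_normD _ _) _; rewrite /s big_ord_recr /= lerD2r.
have fcvg x : A x -> cvgn (fun k => f k x).
  move=> Ax.
  have sb k : s k x <= fine (L x) + 1.
    have := sL k x; rewrite -(fineK Ax) lee_fin => h.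
    have := sqr_ge0 (s k x - 1); have := s0 k x; rewrite sqrrB1; nra.
  have : cvgn (fun k => s k x).
    apply: nondecreasing_is_cvgn; first exact: sndc.
    by exists (fine (L x) + 1) => _ [k _ <-].
  rewrite (_ : (fun k => s k x) = [normed series (u^~ x)]); last first.
    by apply/funext => k; apply/esym; exact: big_mkord.
  move=> /normed_cvg /= cu.
  rewrite (_ : (fun k => f k x) = (fun k => f 0%N x + series (fun k => u k x) k)).
    by apply: is_cvgD => //; exact: is_cvg_cst.
  apply/funext => k.
  have -> : series (u^~ x) k = f k x - f 0%N x.
    by rewrite -(telescope_sumr (f ^~ x) (leq0n k)); apply: eq_bigr.
  by rewrite addrC subrK.
(* Multiplication by [\1_A] removes the null set where the series may diverge, so the limit exists
   everywhere and is measurable. *)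
pose h x := limn (fun k => f k x * \1_A x).
have hcvg x : f k x * \1_A x @[k --> \oo] --> h x.
  have [Ax|Ax] := pselect (A x).
    rewrite /h indicE mem_set//; under eq_fun do rewrite mulr1.
    exact: fcvg.
  rewrite /h indicE memNset//; under eq_fun do rewrite mulr0.
  rewrite lim_cst//; exact: cvg_cst.
have mh : measurable_fun setT h.
  apply: (measurable_fun_cvg (f := h) (h := fun k x => f k x * \1_A x)).
    move=> k; apply: measurable_funM; first exact: L2_meas.
    exact: measurable_indic.
  by move=> x _; exact: hcvg.
have fh x k : A x -> (((f k x - h x) ^+ 2)%:E <= L x)%E.
  move=> Ax; rewrite -(fineK Ax) lee_fin.
  have sk j : s j x <= Num.sqrt (fine (L x)).
    rewrite -(ger0_norm (s0 j x)) -sqrtr_sqr ler_wsqrtr//.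
    by rewrite -lee_fin fineK.
  have L0 : 0 <= fine (L x).
    by rewrite fine_ge0// (le_trans _ (sL 0%N x))// lee_fin sqr_ge0.
  rewrite -(sqr_sqrtr L0) -(real_normK (num_real (_ - _))).
  rewrite ler_pXn2r ?nnegrE ?sqrtr_ge0//.
  have c : `|f k x - f j x| @[j --> \oo] --> `|f k x - h x|.
    apply: cvg_norm; apply: cvgB; first exact: cvg_cst.
    have := hcvg x; rewrite indicE mem_set//.
    by under eq_fun do rewrite mulr1.
  rewrite -(cvg_lim _ c)//; apply: limr_le; first exact: cvgP c.
  exists k => // j /= kj; rewrite distrC; apply: le_trans (sk j).
  exact: fdist.
have cv : nrm (f k - h) @[k --> \oo] --> 0.
  apply: (nrm_cvg0_dominated _ IL).
  - by move=> k; apply: measurable_funB => //; exact: L2_meas.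
  - by apply: filterS aeL => x Ax k; exact: fh.
  - apply: filterS aeL => x Ax; rewrite -(subrr (h x)).
    apply: cvgB; last exact: cvg_cst.
    have := hcvg x; rewrite indicE mem_set//.
    by under eq_fun do rewrite mulr1.
exists h => //.
(* Only the differences [f k - h] are dominated by [L], so [h] is reached as [f 0 - (f 0 - h)]. *)
rewrite -(subKr (f 0%N) h); apply: L2B => //.
apply: L2P; first by apply: measurable_funB => //; exact: L2_meas.
apply: (@le_lt_trans _ _ (\int[mu]_x L x)%E).
  apply: ae_ge0_le_integral => //.
  - by move=> x _; rewrite lee_fin sqr_ge0.
  - apply/measurable_EFinP; apply: measurable_funX; apply: measurable_funB => //.
    exact: L2_meas.
  - by move=> x _; apply: le_trans (sL 0%N x); rewrite lee_fin sqr_ge0.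
  - by apply: filterS aeL => x Ax _; exact: fh.
have := integrable_lty measurableT IL; exact.
Qed.

End SquareIntegrable.

(** * Power integrals and the Euclidean norm *)

Section HalfLine.
Context {R : realType}.
Notation leb := (@lebesgue_measure R).

Lemma ge0_integral_affine (s b : R) (f : R -> \bar R) : 0 < s ->
  measurable_fun setT f -> (forall x, 0 <= f x)%E ->
  (\int[leb]_x f (s * x + b)%R = (s^-1)%:E * \int[leb]_x f x)%E.
Proof.
move=> s0 mf f0.
have mT : measurable_fun setT (fun t : measurableTypeR R => s * t + b : measurableTypeR R).
  by apply: measurable_funD => //; exact: mulrl_measurable.
have := @ge0_integral_pushforward _ _ _ _ _ _ mT leb setT f measurableT mf
  (fun y _ => f0 y).
rewrite preimage_setT => <-.
have c0 : 0 <= s^-1 by rewrite invr_ge0 ltW.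
rewrite -(@ge0_integral_mscale _ _ _ leb setT measurableT (NngNum c0) f)//.
apply: eq_measure_integral => A mA _ /=.
by rewrite /mscale /= -(lebesgue_measure_affine b s0 mA).
Qed.

Lemma continuous_powR_gt0 (a : R) : {in `]0, +oo[, continuous (fun x : R => x `^ a)}.
Proof.
move=> x x0; apply/differentiable_continuous/derivable1_diffP.
exact: derivable_powR.
Qed.

Lemma integral_powR_tail (a r : R) : 0 < a -> 0 < r ->
  (\int[leb]_(s in `[r, +oo[) (s `^ (- a - 1))%:E = (r `^ (- a) / a)%:E)%E.
Proof.
move=> a0 r0.
have a_neq0 : a != 0 by rewrite gt_eqF.
rewrite (@ge0_continuous_FTC2y _ _ (fun s => - (s `^ (- a) / a)) r 0).
- by rewrite -EFinB sub0r opprK.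
- by move=> x _; exact: powR_ge0.
- apply: continuous_in_subspaceT => x; rewrite inE /= in_itv /= andbT => rx.
  by apply: continuous_powR_gt0; rewrite in_itv /= andbT (lt_le_trans r0).
- rewrite -oppr0; apply: cvgN; rewrite -(mul0r a^-1).
  apply: cvgM; last exact: cvg_cst.
  apply/cvgrPdist_lt => e e0.
  have e20 : 0 < e / 2 by rewrite divr_gt0.
  near=> x; rewrite sub0r normrN ger0_norm ?powR_ge0//.
  apply: (@le_lt_trans _ _ (e / 2)); last by rewrite ltr_pdivrMr// ltr_pMr// ltr1n.
  have X0 : 0 < (e / 2) `^ (- a^-1) by exact: powR_gt0.
  have Xx : (e / 2) `^ (- a^-1) <= x by near: x; apply: nbhs_pinfty_ge; rewrite num_real.
  have x0 : 0 < x by exact: lt_le_trans Xx.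
  rewrite powRN; have -> : e / 2 = (((e / 2) `^ (- a^-1)) `^ a)^-1.
    by rewrite -powRrM mulNr mulVf// powRN powRr1 ?(ltW e20)// invrK.
  rewrite lef_pV2 ?posrE ?powR_gt0//.
  by apply: ge0_ler_powR => //; rewrite ?nnegrE ltW.
- move=> x rx; apply: derivableN; apply: derivableM => //.
  by apply: derivable_powR; rewrite in_itv /= andbT (lt_trans r0).
- apply: cvg_at_right_filter; apply: cvgN; apply: cvgM; last exact: cvg_cst.
  by apply: continuous_powR_gt0; rewrite in_itv /= andbT.
- move=> x; rewrite in_itv /= andbT => rx; have x0 := lt_trans r0 rx.
  rewrite derive1E; have := is_derive1_powR (- a) x0 => dp.
  rewrite (_ : (fun s => - (s `^ (- a) / a)) = (- a^-1) *: (fun s : R => s `^ (- a))).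
    by rewrite derive_val /GRing.scale /= ; field.
  by apply/funext => s; rewrite [RHS](_ : _ = - a^-1 * s `^ (- a))//; ring.
Unshelve. all: by end_near. Qed.

Lemma integral_powR_head_le (a r : R) : 0 < a -> 0 < r ->
  (\int[leb]_(s in `]0%R, r]) (s `^ (a - 1))%:E <= (r `^ a / a)%:E)%E.
Proof.
move=> a0 r0.
have a_neq0 : a != 0 by rewrite gt_eqF.
(* Starting the denominators at 2 keeps the left end strictly below [r] for every [k]. *)
have rk0 (k : nat) : 0 < r / k.+2%:R by rewrite divr_gt0.
have rkr (k : nat) : r / k.+2%:R < r.
  by rewrite ltr_pdivrMr// ltr_pMr// ltr1n.
have mp : measurable_fun setT (fun s : R => (s `^ (a - 1))%:E).
  by apply/measurable_EFinP; exact: measurable_powR.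
have cup : `]0, r]%classic = \bigcup_k `[r / k.+2%:R, r]%classic.
  apply/seteqP; split => s /=; last first.
    move=> [k _ /=]; rewrite !in_itv /= => /andP[ks ->].
    by rewrite (lt_le_trans _ ks).
  rewrite in_itv /= => /andP[s0 sr].
  exists (Num.truncn (r / s)) => //=; rewrite in_itv /= sr andbT.
  rewrite ler_pdivrMr// mulrC -ler_pdivrMr// ltW//.
  by rewrite (lt_trans (truncnS_gt _))// ltr_nat.
have H : (\int[leb]_(s in `[(r / k.+2%:R)%R, r]) (s `^ (a - 1))%:E)%E @[k --> \oo] -->
    (\int[leb]_(s in `]0%R, r]) (s `^ (a - 1))%:E)%E.
  rewrite cup; apply: ge0_nondecreasing_set_cvg_integral.
  - apply/nondecreasing_seqP => k; rewrite subsetEset => s /=.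
    rewrite !in_itv /= => /andP[ks ->]; rewrite andbT (le_trans _ ks)//.
    by rewrite ler_pM2l// lef_pV2 ?posrE// ler_nat.
  - by move=> k; exact: measurable_itv.
  - by move=> k; exact: measurable_funS mp.
  - by move=> k x _; rewrite lee_fin powR_ge0.
rewrite -(cvg_lim _ H)//; apply: lime_le; first exact: cvgP H.
apply: nearW => k.
have in0 x : r / k.+2%:R <= x -> x \in `]0, +oo[.
  by move=> kx; rewrite in_itv /= andbT (lt_le_trans _ kx).
have cF x : r / k.+2%:R <= x -> {for x, continuous (fun s : R => s `^ a / a)}.
  move=> /in0 x0; apply: cvgM; last exact: cvg_cst.
  exact: continuous_powR_gt0.
rewrite (@continuous_FTC2 _ _ (fun s => s `^ a / a) (r / k.+2%:R) r)//.
- by rewrite -EFinB lee_fin lerBlDr lerDl divr_ge0 ?powR_ge0 ?ltW.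
- apply: continuous_in_subspaceT => x; rewrite inE /= in_itv /= => /andP[kx _].
  exact/continuous_powR_gt0/in0.
- split.
  + move=> x; rewrite in_itv /= => /andP[kx _]; apply: derivableM => //.
    by apply: derivable_powR; apply: in0; exact: ltW.
  + by apply: cvg_at_right_filter; exact: cF.
  + by apply: cvg_at_left_filter; apply: cF; exact: ltW.
- move=> x; rewrite in_itv /= => /andP[kx _].
  have /in0 := ltW kx; rewrite in_itv /= andbT => x0.
  rewrite derive1E; have := is_derive1_powR a x0 => dp.
  rewrite (_ : (fun s => s `^ a / a) = a^-1 *: (fun s : R => s `^ a)).
    by rewrite derive_val /GRing.scale /= ; field.
  by apply/funext => s; rewrite [RHS](_ : _ = a^-1 * s `^ a)// mulrC.
Qed.

End HalfLine.

Section EuclideanNorm.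
Context {R : realType} {n : nat}.
Implicit Types x y : 'rV[R]_n.

Lemma enorm_ge0 x : 0 <= enorm x. Proof. exact: sqrtr_ge0. Qed.

Lemma enorm_sqr x : enorm x ^+ 2 = \sum_i x ord0 i ^+ 2.
Proof. by rewrite sqr_sqrtr// sumr_ge0// => i _; exact: sqr_ge0. Qed.

Lemma enormZ k x : enorm (k *: x) = `|k| * enorm x.
Proof.
rewrite /enorm -sqrtr_sqr -sqrtrM ?sqr_ge0// mulr_sumr; congr Num.sqrt.
by apply: eq_bigr => i _; rewrite mxE exprMn.
Qed.

Lemma enorm0 : enorm (0 : 'rV[R]_n) = 0.
Proof. by rewrite -(scale0r 0) enormZ normr0 mul0r. Qed.

Lemma enorm_eq0 x : enorm x = 0 -> x = 0.
Proof.
move=> x0; apply/rowP => i; rewrite mxE; apply/eqP; rewrite -sqrf_eq0.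
have := enorm_sqr x; rewrite x0 expr0n /= => /esym/eqP.
rewrite psumr_eq0; last by move=> j _; exact: sqr_ge0.
by move=> /allP/(_ i); rewrite mem_index_enum; exact.
Qed.

Lemma enorm_gt0 x : (0 < enorm x) = (x != 0).
Proof.
rewrite lt_def enorm_ge0 andbT; congr (~~ _).
apply/eqP/eqP => [/enorm_eq0//|->]; exact: enorm0.
Qed.

Lemma enormN x : enorm (- x) = enorm x.
Proof. by rewrite -scaleN1r enormZ normrN1 mul1r. Qed.

Lemma enorm_le_sum x : enorm x <= \sum_i `|x ord0 i|.
Proof.
have s0 : 0 <= \sum_i `|x ord0 i| by exact: sumr_ge0.
rewrite -(@ler_pXn2r _ 2)// ?nnegrE ?enorm_ge0// enorm_sqr.
rewrite expr2 mulr_suml; apply: ler_sum => i _.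
rewrite -(real_normK (num_real (x _ _))) expr2 ler_wpM2l//.
by rewrite (bigD1 i)//= lerDl sumr_ge0.
Qed.

Lemma measurable_enorm : measurable_fun setT (@enorm R n).
Proof.
rewrite (_ : enorm = fun x => (\sum_i x ord0 i ^+ 2) `^ 2^-1); last first.
  apply/funext => x; rewrite powR12_sqrt// sumr_ge0// => i _; exact: sqr_ge0.
apply: (measurableT_comp (measurable_powR _)).
by apply: measurable_sum => i; apply: measurable_funX; exact: measurable_coord.
Qed.

Lemma enorm_direction P x : x != P -> enorm (direction P x) = 1.
Proof.
move=> xP; rewrite /direction enormZ ger0_norm ?invr_ge0 ?enorm_ge0//.
by rewrite mulVf// gt_eqF// enorm_gt0 subr_eq0.
Qed.

Lemma measurable_direction P : measurable_fun setT (@direction R n P).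
Proof.
apply/measurable_rowP => i; rewrite /direction.
under eq_fun do rewrite !mxE -powR_inv1 ?enorm_ge0//.
have mB j : measurable_fun setT (fun x : 'rV[R]_n => x ord0 j - P ord0 j).
  by apply: measurable_funB => //; exact: measurable_coord.
apply: measurable_funM => //.
apply: (measurableT_comp (measurable_powR _)).
apply: (measurableT_comp measurable_enorm); apply/measurable_rowP => j.
apply: eq_measurable_fun (mB j) => x _; by rewrite !mxE.
Qed.

End EuclideanNorm.

(** * Polar coordinates and radial shifts *)

Lemma measurable_integral_snd d1 d2 (T1 : measurableType d1)
    (T2 : measurableType d2) (R : realType)
    (m2 : {sigma_finite_measure set T2 -> \bar R}) (f : T1 * T2 -> \bar R) :
  measurable_fun setT f -> (forall z, 0 <= f z)%E ->
  measurable_fun setT (fun x => \int[m2]_y f (x, y))%E.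
Proof. by move=> mf f0; exact: (@measurable_fun_fubini_tonelli_F _ _ _ _ _ _ f mf f0). Qed.

Section Polar.
Context {R : realType} {n : nat}.
Hypothesis n0 : (0 < n)%N.
Notation leb := (@lebesgue_measure R).
Notation E := 'rV[R]_n.
Notation TR := (measurableTypeR R).

Lemma lrow_set1_0 : @lrow R n [set 0] = 0%E.
Proof.
have -> : [set 0] = [set x : E | forall i, x ord0 i \in `[0, 0]].
  apply/seteqP; split => x /=; first by move=> -> i; rewrite mxE in_itv /= lexx.
  move=> H; apply/rowP => i; have := H i; rewrite in_itv /= mxE => /andP[h1 h2].
  by apply/eqP; rewrite eq_le h1 h2.
by rewrite lrow_cube// subrr expr0n; case: (n) n0.
Qed.

Lemma ae_neq0 : {ae @lrow R n, forall x, x != 0}.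
Proof.
exists [set 0]; split; last 1 first.
- by move=> x /= /negP; rewrite negbK => /eqP.
- rewrite (_ : [set 0] = [set x : E | forall i, x ord0 i \in `[0, 0]]).
    exact: measurable_row_cube.
  apply/seteqP; split => x /=; first by move=> -> i; rewrite mxE in_itv /= lexx.
  move=> H; apply/rowP => i; have := H i; rewrite in_itv /= mxE => /andP[h1 h2].
  by apply/eqP; rewrite eq_le h1 h2.
- exact: lrow_set1_0.
Qed.

Lemma measurable_row_fst d (T : measurableType d) (f : T -> E) (i : 'I_n) :
  measurable_fun setT f -> measurable_fun setT (fun x => f x ord0 i).
Proof. by move=> mf; exact: (measurableT_comp (measurable_coord i) mf). Qed.

Lemma measurable_rowD d (T : measurableType d) (f g : T -> E) :
  measurable_fun setT f -> measurable_fun setT g ->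
  measurable_fun setT (fun x => f x + g x).
Proof.
move=> mf mg; apply/measurable_rowP => i.
apply: (eq_measurable_fun (fun x => f x ord0 i + g x ord0 i)).
  by move=> x _; rewrite mxE.
by apply: measurable_funD; exact: measurable_row_fst.
Qed.

Lemma measurable_rowZ d (T : measurableType d) (k : T -> R) (f : T -> E) :
  measurable_fun setT k -> measurable_fun setT f ->
  measurable_fun setT (fun x => k x *: f x).
Proof.
move=> mk mf; apply/measurable_rowP => i.
apply: (eq_measurable_fun (fun x => k x * f x ord0 i)).
  by move=> x _; rewrite mxE.
by apply: measurable_funM => //; exact: measurable_row_fst.
Qed.

Let W (y : E) : R := if enorm y <= 1 then enorm y else 0.

Let mW : measurable_fun setT W.
Proof.
apply: measurable_fun_ifT => //; last exact: measurable_enorm.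
by apply: measurable_fun_ler => //; exact: measurable_enorm.
Qed.

Let W0 y : 0 <= W y.
Proof. by rewrite /W; case: ifP => // _; exact: enorm_ge0. Qed.

(** The polar density: under [x = s y] the factor [|x| s^-2] becomes [|y| s^-1], and the Jacobian
    [s^n] turns it into [|y| s^(n-1)], with [|x| <= s] becoming [|y| <= 1]. *)
Let c (z : E * TR) : R := if 0 < (z.2 : R) then W z.1 * (z.2 : R) ^+ n.-1 else 0.

Let c0 z : 0 <= c z.
Proof. by rewrite /c; case: ifPn => // h; rewrite mulr_ge0// exprn_ge0// ltW. Qed.

Let mfst : measurable_fun setT (fun z : E * TR => z.1).
Proof. exact: measurable_fst. Qed.

Let msnd : measurable_fun setT (fun z : E * TR => (z.2 : R)).
Proof. exact: measurable_snd. Qed.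

Let mc : measurable_fun setT c.
Proof.
apply: measurable_fun_ifT => //.
  by apply: measurable_fun_ltr.
by apply: measurable_funM; [exact: (measurableT_comp mW)|exact: measurable_funX].
Qed.

Let ray (G : E -> \bar R) (z : E * TR) : \bar R :=
  ((c z)%:E * G ((z.2 : R) *: z.1))%E.

Let mray G : measurable_fun setT G -> measurable_fun setT (ray G).
Proof.
move=> mG; apply: emeasurable_funM; first exact/measurable_EFinP.
by apply: (measurableT_comp mG); exact: measurable_rowZ.
Qed.

Let mEFinR d (T : measurableType d) (f : T -> R) :
  measurable_fun setT f -> measurable_fun setT (fun x => (f x)%:E).
Proof. by move=> mf; exact/measurable_EFinP. Qed.

(* Polar coordinates without a surface measure: the factor
   [|x| * s ^ (-2)] on [s >= |x|] has integral 1 in [s], and for fixed [s] the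
   variable [x = s y] replaces the sphere by the unit ball. *)
Lemma polar_integral (G : E -> \bar R) : measurable_fun setT G ->
  (forall x, 0 <= G x)%E ->
  (\int[lrow n]_x G x = \int[lrow n]_y \int[leb]_s ray G (y, s))%E.
Proof.
move=> mG G0.
pose k (z : E * TR) : R := if (0 < (z.2 : R)) && (enorm z.1 <= (z.2 : R)) then
  enorm z.1 * (z.2 : R) `^ (- 1 - 1) else 0.
have k0 z : 0 <= k z.
  by rewrite /k; case: ifP => // _; rewrite mulr_ge0 ?enorm_ge0 ?powR_ge0.
have men : measurable_fun setT (fun z : E * TR => enorm z.1).
  exact: (measurableT_comp measurable_enorm).
have mk : measurable_fun setT k.
  apply: measurable_fun_ifT => //.
    by apply: measurable_and; [exact: measurable_fun_ltr|exact: measurable_fun_ler].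
  by apply: measurable_funM => //; exact: (measurableT_comp (measurable_powR _)).
have k1 x : x != 0 -> (\int[leb]_s (k (x, s))%:E = 1)%E.
  rewrite -enorm_gt0 => x0.
  have := @integral_powR_tail _ 1 _ ltr01 x0; rewrite divr1 => H.
  transitivity (\int[leb]_(s in `[enorm x, +oo[)
      ((enorm x)%:E * (s `^ (- 1 - 1))%:E))%E.
    rewrite [RHS]integral_mkcond; apply: eq_integral => s _.
    rewrite patchE; case: ifPn; rewrite ?inE ?notin_setE /= in_itv /= andbT => xs.
      by rewrite /k /= xs (lt_le_trans x0 xs) EFinM.
    by rewrite /k /=; case: ifPn => // /andP[_ h].
  rewrite ge0_integralZl//.
  - rewrite H -EFinM powR_inv1 ?enorm_ge0// divff// gt_eqF//.
  - by apply/measurable_EFinP; apply: measurable_funS (measurable_powR _).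
  - by move=> s _; rewrite lee_fin powR_ge0.
  - by rewrite lee_fin enorm_ge0.
have mGk : measurable_fun setT (fun z : E * TR => ((k z)%:E * G z.1)%E).
  apply: emeasurable_funM; first exact: mEFinR.
  exact: (measurableT_comp mG).
have Gk0 z : (0 <= (k z)%:E * G z.1)%E by rewrite mule_ge0 ?lee_fin.
transitivity (\int[lrow n]_x \int[leb]_s ((k (x, s))%:E * G x))%E.
  apply: ae_eq_integral => //.
    exact: (measurable_integral_snd leb mGk Gk0).
  apply: filterS ae_neq0 => x x0 _.
  have mkx : measurable_fun setT (fun s : TR => (k (x, s))%:E).
    by apply: mEFinR; exact: (measurableT_comp mk).
  by rewrite ge0_integralZr ?k1 ?mul1e// => s _; rewrite lee_fin.
rewrite (fubini_tonelli _ mGk Gk0) (fubini_tonelli _ (mray mG)); last first.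
  by move=> z; rewrite mule_ge0 ?lee_fin.
apply: eq_integral => s _.
have [s0|s0] := ltP 0 s; last first.
  rewrite !integral0_eq// => x _; rewrite /ray/c/k/= ltNge s0/= ?mul0e//.
have mf : measurable_fun setT (fun x => (k (x, s))%:E * G x)%E.
  by apply: emeasurable_funM => //; apply: mEFinR; exact: (measurableT_comp mk).
have := ge0_integral_row_affine 0 s0 mf (fun x => Gk0 (x, s)).
move=> /(congr1 (fun z => (s ^+ n)%:E * z)%E).
rewrite muleA -EFinM -exprMn divff ?gt_eqF// expr1n mul1e => <-.
rewrite -ge0_integralZl//.
- apply: eq_integral => y _; rewrite muleA -EFinM addr0 /ray; congr (_%:E * _)%E.
  rewrite /k /c /= s0 /= enormZ gtr0_norm// ger_pMr// /W.
  case: ifPn => _; last by rewrite mul0r mulr0.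
  rewrite (_ : (-1 - 1 : R) = - (2%:R)); last by ring.
  rewrite powR_invn ?ltW// -{1}(prednK n0) exprS; field.
  by rewrite gt_eqF.
- apply: (measurableT_comp mf); exact: measurable_affine_row.
- by rewrite lee_fin exprn_ge0// ltW.
Qed.

(** The shift sends [s y] to [(s + b) y]; after translating [s], the density [(s - b)^(n-1)] on
    [s > b] is at most [s^(n-1)]. The indicator records that a shift by [t] reaches only points
    farther than [t] from the centre; this is what empties a bounded domain after a long shift. *)
Lemma shift0_le (F : E -> \bar R) (t : R) : 0 <= t ->
  measurable_fun setT F -> (forall x, 0 <= F x)%E ->
  (\int[lrow n]_x F (x + t *: direction 0 x)%R <=
   \int[lrow n]_x ((t < enorm x)%R%:R%:E * F x))%E.
Proof.
move=> t0 mF F0.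
have mS : measurable_fun setT (fun x : E => x + t *: direction 0 x).
  by apply: measurable_rowD => //; apply: measurable_rowZ => //; exact: measurable_direction.
have mFS := measurableT_comp mF mS.
have mI : measurable_fun setT (fun x : E => ((t < enorm x)%R%:R%:E : \bar R)).
  apply: mEFinR; rewrite (_ : (fun x : E => _) = fun x => if t < enorm x then 1 else 0).
    by apply: measurable_fun_ifT => //; apply: measurable_fun_ltr => //; exact: measurable_enorm.
  by apply/funext => x; case: ifP.
have mIF : measurable_fun setT (fun x : E => ((t < enorm x)%R%:R%:E * F x))%E.
  exact: emeasurable_funM.
have IF0 x : (0 <= (t < enorm x)%R%:R%:E * F x)%E by rewrite mule_ge0// lee_fin ler0n.
rewrite [leLHS](polar_integral mFS (fun x => F0 _)) [leRHS](polar_integral mIF IF0).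
have r0 G : (forall x, 0 <= G x)%E -> forall z, (0 <= ray G z)%E.
  by move=> G0 z; rewrite mule_ge0// lee_fin.
have mrl := mray mFS; have mrr := mray mIF.
apply: ge0_le_integral => //.
- by move=> y _; apply: integral_ge0 => s _; apply: r0 => x; exact: F0.
- exact: (measurable_integral_snd leb mrl (r0 _ (fun x => F0 _))).
- exact: (measurable_integral_snd leb mrr (r0 _ IF0)).
move=> y _; have [->|y0] := eqVneq y 0.
  rewrite integral0_eq; last first.
    by move=> s _; rewrite /ray /c /= /W enorm0 ler01 mul0r if_same mul0e.
  by apply: integral_ge0 => s _; exact: r0.
have ny : 0 < enorm y by rewrite enorm_gt0.
(* [t] is a Euclidean length, whereas [s] multiplies [y], which need not be a unit vector. *)
pose b := t / enorm y; have b0 : 0 <= b by rewrite divr_ge0// ltW.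
pose f (s : R) : \bar R := ((if (0 < s - b)%R then W y * (s - b) ^+ n.-1 else 0)%:E * F (s *: y))%E.
have mf : measurable_fun setT f.
  apply: emeasurable_funM.
    apply: mEFinR; apply: measurable_fun_ifT => //.
      by apply: measurable_fun_ltr => //; exact: measurable_funB.
    by apply: measurable_funM => //; apply: measurable_funX; exact: measurable_funB.
  by apply: (measurableT_comp mF); exact: measurable_rowZ.
have f0 s : (0 <= f s)%E.
  rewrite mule_ge0// lee_fin; case: ifPn => // h.
  by rewrite mulr_ge0// exprn_ge0// ltW.
have -> : (\int[leb]_s ray (fun x => F (x + t *: direction 0 x)%R) (y, s) =
    \int[leb]_s f (1 * s + b)%R)%E.
  apply: eq_integral => s _; rewrite /ray /f /c /= mul1r addrK.
  case: ifPn => s0; last by rewrite !mul0e.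
  congr (_ * F _)%E; rewrite /direction subr0 enormZ gtr0_norm// invfM !scalerA.
  rewrite -scalerDl; congr (_ *: _); rewrite /b; field.
  by rewrite !gt_eqF.
rewrite ge0_integral_affine// invr1 mul1e.
apply: ge0_le_integral => //.
  exact: (measurable_fun_pair2 y mrr).
move=> s _; rewrite /f /ray /c /=.
case: ifPn => sb; last by rewrite mul0e mule_ge0// ?lee_fin ?(c0 (y, s)).
have s0 : 0 < s by move: sb; rewrite subr_gt0; exact: le_lt_trans.
rewrite s0 enormZ gtr0_norm// -ltr_pdivrMr// -/b -subr_gt0 sb mul1e.
rewrite lee_wpmul2r// lee_fin ler_wpM2l//.
by apply: lerXn2r; rewrite ?nnegrE ?(ltW sb) ?(ltW s0)// lerBlDr lerDl.
Qed.

Lemma shift_le P (F : E -> \bar R) (t : R) : 0 <= t ->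
  measurable_fun setT F -> (forall x, 0 <= F x)%E ->
  (\int[lrow n]_x F (x + t *: direction P x)%R <=
   \int[lrow n]_x ((t < enorm (x - P))%R%:R%:E * F x))%E.
Proof.
move=> t0 mF F0.
have mS : measurable_fun setT (fun x : E => x + t *: direction P x).
  by apply: measurable_rowD => //; apply: measurable_rowZ => //; exact: measurable_direction.
have mI : measurable_fun setT (fun x : E => ((t < enorm (x - P))%R%:R%:E * F x))%E.
  apply: emeasurable_funM => //.
  apply: mEFinR; rewrite (_ : (fun x : E => _) = fun x => if t < enorm (x - P) then 1 else 0).
    apply: measurable_fun_ifT => //; apply: measurable_fun_ltr => //.
    by apply: (measurableT_comp measurable_enorm); exact: measurable_rowD.
  by apply/funext => x; case: ifP.
have IF0 x : (0 <= (t < enorm (x - P))%R%:R%:E * F x)%E by rewrite mule_ge0// lee_fin ler0n.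
have := ge0_integral_row_affine P ltr01 (measurableT_comp mF mS) (fun x => F0 _).
have := ge0_integral_row_affine P ltr01 mI IF0.
rewrite invr1 expr1n !mul1e => <- <-.
have mFP : measurable_fun setT (fun x : E => F (x + P)).
  by apply: (measurableT_comp mF); exact: measurable_rowD.
have := shift0_le t0 mFP (fun x => F0 _).
congr (_ <= _)%E; apply: eq_integral => x _ /=; rewrite scale1r ?addrK//.
by rewrite /direction addrK subr0 addrAC.
Qed.

End Polar.

(** * Integrals with values in L2 *)

Lemma measurable_Rintegral_snd d1 d2 (T1 : measurableType d1)
    (T2 : measurableType d2) (R : realType)
    (m2 : {sigma_finite_measure set T2 -> \bar R}) (f : T1 * T2 -> R) :
  measurable_fun setT f -> measurable_fun setT (fun x => \int[m2]_y f (x, y)).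
Proof.
move=> mf; apply: (measurableT_comp (fine_measurable measurableT)).
have mfE : measurable_fun setT (EFin \o f) by exact/measurable_EFinP.
under eq_fun do rewrite integralE.
apply: emeasurable_funB.
  have h := measurable_integral_snd m2 (measurable_funepos mfE) (fun z => funepos_ge0 _ z).
  by apply: eq_measurable_fun h => x _; apply: eq_integral => y _; rewrite !funeposE.
have h := measurable_integral_snd m2 (measurable_funeneg mfE) (fun z => funeneg_ge0 _ z).
by apply: eq_measurable_fun h => x _; apply: eq_integral => y _; rewrite !funenegE.
Qed.

Section Minkowski.
Context {d} {X : measurableType d} {R : realType}.
Variable mu : {sigma_finite_measure set X -> \bar R}.
Notation leb := (@lebesgue_measure R).
Notation TR := (measurableTypeR R).
Variables (h : X * TR -> R) (k b : TR -> R) (C I : R).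
Hypotheses (mh : measurable_fun setT h) (mk : measurable_fun setT k)
  (mb : measurable_fun setT b) (k0 : forall t, 0 <= k t)
  (b0 : forall t, k t != 0 -> 0 < b t) (C0 : 0 <= C) (I0 : 0 < I)
  (hb : forall t, k t != 0 ->
    (\int[mu]_x (h (x, t) ^+ 2)%:E <= ((C * b t) ^+ 2)%:E)%E)
  (bk : (\int[leb]_t (b t * k t)%:E <= I%:E)%E).

(** The inverse of [b] where [k] does not vanish. It is set to 0 elsewhere, where the sign of [b] is
    unknown, and written as a power so that it is measurable. *)
Let bi t := if k t == 0 then 0 else `|b t| `^ (- 1).

Let biE t : k t != 0 -> bi t = (b t)^-1.
Proof.
by move=> kt; rewrite /bi (negbTE kt) ger0_norm ?ltW ?b0// powR_inv1// ltW ?b0.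
Qed.

Let bi0 t : 0 <= bi t.
Proof. by rewrite /bi; case: ifP => // _; exact: powR_ge0. Qed.

Let mbi : measurable_fun setT bi.
Proof.
apply: measurable_fun_ifT => //; first exact: measurable_fun_eqr.
by apply: (measurableT_comp (measurable_powR _)); exact: measurableT_comp.
Qed.

Let msnd (f : TR -> R) : measurable_fun setT f ->
  measurable_fun setT (fun z : X * TR => f z.2).
Proof. by move=> mf; exact: (measurableT_comp mf). Qed.

Let mfst (f : X -> R) : measurable_fun setT f ->
  measurable_fun setT (fun z : X * TR => f z.1).
Proof. by move=> mf; exact: (measurableT_comp mf). Qed.

(** The weight of the Cauchy-Schwarz inequality: the square of the integral of [|h| k] is at most
    the integral of [b k] times that of [h^2 k / b]. By Tonelli the latter, as a function of [x],
    has integral at most [C^2 I]. *)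
Let j (z : X * TR) : \bar R := (h z ^+ 2 * (k z.2 * bi z.2))%:E.
Let J x := (\int[leb]_t j (x, t))%E.

Let mj : measurable_fun setT j.
Proof.
apply/measurable_EFinP; apply: measurable_funM; first exact: measurable_funX.
exact: (msnd (f := fun t => k t * bi t) (measurable_funM mk mbi)).
Qed.

Let j0 z : (0 <= j z)%E.
Proof. by rewrite lee_fin mulr_ge0 ?sqr_ge0 ?mulr_ge0. Qed.

Let mJ : measurable_fun setT J.
Proof. exact: (measurable_integral_snd leb mj j0). Qed.

Let J0 x : (0 <= J x)%E. Proof. by apply: integral_ge0 => t _; exact: j0. Qed.

Let intJ : (\int[mu]_x J x <= (C ^+ 2 * I)%:E)%E.
Proof.
rewrite /J (fubini_tonelli _ mj j0).
apply: (@le_trans _ _ (\int[leb]_t ((C ^+ 2)%:E * (b t * k t)%:E))%E); last first.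
  rewrite ge0_integralZl//.
  - by rewrite (EFinM (C ^+ 2)); apply: lee_wpmul2l => //; rewrite lee_fin sqr_ge0.
  - by apply/measurable_EFinP; exact: measurable_funM.
  - move=> t _; rewrite lee_fin; have [->|kt] := eqVneq (k t) 0.
      by rewrite mulr0.
    by rewrite mulr_ge0 ?k0 ?ltW ?b0.
  - by rewrite lee_fin sqr_ge0.
have mbk : measurable_fun setT (fun t => ((C ^+ 2)%:E * (b t * k t)%:E)%E).
  by under eq_fun do rewrite -EFinM; apply/measurable_EFinP;
    apply: measurable_funM => //; exact: measurable_funM.
apply: ge0_le_integral => //.
- by move=> t _; apply: integral_ge0 => x _; exact: j0.
- exact: (measurable_fun_fubini_tonelli_G _ mj j0).
- move=> t _; have [kt|kt] := eqVneq (k t) 0.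
    rewrite integral0_eq; first by rewrite kt mulr0 mule0.
    by move=> x _; rewrite /j /= kt mul0r mulr0.
  rewrite /j /=; under eq_integral do rewrite mulrC EFinM.
  rewrite ge0_integralZl//.
  - apply: (@le_trans _ _ ((k t * bi t)%:E * ((C * b t) ^+ 2)%:E)%E).
      by apply: lee_wpmul2l; rewrite ?hb// lee_fin mulr_ge0.
    rewrite -!EFinM lee_fin biE// le_eqVlt; apply/orP; left; apply/eqP.
    by field; rewrite gt_eqF// b0.
  - apply/measurable_EFinP; apply: measurable_funX.
    exact: (measurable_fun_pair1 t mh).
  - by move=> x _; rewrite lee_fin sqr_ge0.
  - by rewrite lee_fin mulr_ge0.
Qed.

Let H x := (\int[leb]_t (`|h (x, t)| * k t)%:E)%E.

Let mhk : measurable_fun setT (fun z => (`|h z| * k z.2)%:E : \bar R).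
Proof.
apply/measurable_EFinP; apply: measurable_funM; last exact: msnd.
exact: measurableT_comp.
Qed.

Let hk0 z : (0 <= (`|h z| * k z.2)%:E :> \bar R)%E.
Proof. by rewrite lee_fin mulr_ge0. Qed.

Let mH : measurable_fun setT H.
Proof. exact: (measurable_integral_snd leb mhk hk0). Qed.

Let H0 x : (0 <= H x)%E. Proof. by apply: integral_ge0 => t _; exact: (hk0 (_, _)). Qed.

(* AM-GM: [|h| k <= (s b k + h ^ 2 k / (b s)) / 2] for every [s > 0]. *)
Let H_le x s : 0 < s -> (H x <= (s / 2)%:E * I%:E + (2 * s)^-1%:E * J x)%E.
Proof.
move=> s0.
have mbk : measurable_fun setT (fun t => (b t * k t)%:E).
  by apply/measurable_EFinP; exact: measurable_funM.
have bk0 t : (0 <= (b t * k t)%:E)%E.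
  rewrite lee_fin; have [->|kt] := eqVneq (k t) 0; first by rewrite mulr0.
  by rewrite mulr_ge0 ?k0 ?ltW ?b0.
have mjx : measurable_fun setT (fun t => j (x, t)) by exact: (measurable_fun_pair2 x mj).
apply: (@le_trans _ _ ((s / 2)%:E * (\int[leb]_t (b t * k t)%:E) +
    (2 * s)^-1%:E * J x)%E); last first.
  by apply: leeD2r; apply: lee_wpmul2l => //; rewrite lee_fin divr_ge0 ?ltW.
rewrite -ge0_integralZl//; last by rewrite lee_fin divr_ge0 ?ltW.
rewrite -ge0_integralZl//; last by rewrite lee_fin invr_ge0 mulr_ge0 ?ltW.
rewrite -ge0_integralD//; last 4 first.
- by move=> t _; rewrite mule_ge0// lee_fin divr_ge0 ?ltW.
- exact: measurable_funeM.
- by move=> t _; rewrite mule_ge0// lee_fin invr_ge0 mulr_ge0 ?ltW.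
- exact: measurable_funeM.
apply: ge0_le_integral => //.
- exact: (measurable_fun_pair2 x mhk).
- by apply: emeasurable_funD; exact: measurable_funeM.
move=> t _; rewrite /j /= -!EFinM -EFinD lee_fin.
have [kt|kt] := eqVneq (k t) 0; first by rewrite kt !(mulr0, mul0r) addr0.
rewrite biE//; have bt := b0 kt; have kt0 : 0 < k t by rewrite lt_def kt k0.
rewrite -(real_normK (num_real (h (x, t)))); set y := `|_|.
rewrite -subr_ge0; have -> : s / 2 * (b t * k t) + (2 * s)^-1 * (y ^+ 2 * (k t / b t)) - y * k t =
  (s * b t - y) ^+ 2 * (k t / (2 * s * b t)).
  by field; rewrite !gt_eqF.
by rewrite mulr_ge0 ?sqr_ge0// divr_ge0 ?mulr_ge0 ?ltW.
Qed.

Let J_fin : {ae mu, forall x, J x \is a fin_num}.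
Proof.
have IJ : mu.-integrable setT J.
  apply/integrableP; split => //; under eq_integral do rewrite gee0_abs//.
  by rewrite (le_lt_trans intJ)// ltry.
by apply: filterS (integrable_ae measurableT IJ) => x; exact.
Qed.

Let H_fin x : J x \is a fin_num -> H x \is a fin_num.
Proof.
move=> Jx; rewrite ge0_fin_numE//; apply: le_lt_trans (H_le x ltr01) _.
by rewrite -(fineK Jx) -!EFinM -EFinD ltry.
Qed.

Let H_sqr x : J x \is a fin_num -> fine (H x) ^+ 2 <= I * fine (J x).
Proof.
move=> Jx; have Hx := H_fin Jx; have := fine_ge0 (H0 x).
rewrite le_eqVlt => /predU1P[<-|Hp].
  by rewrite expr0n/= mulr_ge0 ?(ltW I0)// fine_ge0.
(* The parameter [s = H / I] balances the two terms; the bound then becomes [H^2 <= I J]. *)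
have := H_le x (divr_gt0 Hp I0); rewrite -{1}(fineK Hx) -(fineK Jx).
rewrite -!EFinM -EFinD lee_fin; set y := fine (H x) in Hp *; set u := fine (J x).
have -> : y / I / 2 * I + (2 * (y / I))^-1 * u = y / 2 + I * u / (2 * y).
  by field; rewrite !gt_eqF.
rewrite -lerBlDl; have -> : y - y / 2 = y ^+ 2 / (2 * y).
  by field; rewrite gt_eqF.
by rewrite ler_pM2r// invr_gt0 mulr_gt0.
Qed.

Let L2_H : L2 mu (fun x => fine (H x)) /\ nrm mu (fun x => fine (H x)) <= C * I.
Proof.
have mfH : measurable_fun setT (fun x => fine (H x)).
  exact: (measurableT_comp (fine_measurable measurableT)).
apply: L2_nrm_le => //; first by rewrite mulr_ge0// ltW.
apply: (@le_trans _ _ (\int[mu]_x (I%:E * J x))%E); last first.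
  rewrite ge0_integralZl ?lee_fin ?(ltW I0)//.
  apply: (@le_trans _ _ (I%:E * (C ^+ 2 * I)%:E)%E).
    by apply: lee_wpmul2l; rewrite ?lee_fin ?(ltW I0).
  by rewrite -EFinM lee_fin le_eqVlt; apply/orP; left; apply/eqP; ring.
apply: ae_ge0_le_integral => //.
- by move=> x _; rewrite lee_fin sqr_ge0.
- by apply/measurable_EFinP; exact: measurable_funX.
- by move=> x _; rewrite mule_ge0// lee_fin ltW.
- exact: measurable_funeM.
apply: filterS J_fin => x Jx _.
by rewrite -(fineK Jx) -EFinM lee_fin H_sqr.
Qed.

Definition param_int x := \int[leb]_t (h (x, t) * k t).

Lemma measurable_param_int : measurable_fun setT param_int.
Proof.
apply: (measurable_Rintegral_snd leb (f := fun z => h z * k z.2)).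
by apply: measurable_funM => //; exact: msnd.
Qed.

Let mhk' : measurable_fun setT (fun z => h z * k z.2).
Proof. by apply: measurable_funM => //; exact: msnd. Qed.

Let H_int x : H x \is a fin_num ->
  leb.-integrable setT (fun t => (h (x, t) * k t)%:E).
Proof.
move=> Hx; apply/integrableP; split.
  by apply/measurable_EFinP; exact: (measurable_fun_pair2 x mhk').
rewrite (_ : (\int[leb]_t _)%E = H x); first by rewrite -ge0_fin_numE.
by apply: eq_integral => t _; rewrite /= normrM (ger0_norm (k0 t)).
Qed.

Lemma param_int_integrable : {ae mu, forall x,
  leb.-integrable setT (fun t => (h (x, t) * k t)%:E)}.
Proof. by apply: filterS J_fin => x Jx; exact/H_int/H_fin. Qed.

Let param_int_le x : `|param_int x| <= fine (H x) \/ ~~ (J x \is a fin_num).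
Proof.
case: (boolP (J x \is a fin_num)) => [Jx|]; [left|by right].
have Hx := H_fin Jx; have := H_int Hx => hI.
apply: le_trans (le_normr_Rintegral measurableT hI) _.
rewrite /Rintegral (_ : (\int[leb]_t _)%E = H x)//.
by apply: eq_integral => t _; rewrite /= normrM (ger0_norm (k0 t)).
Qed.

(** Minkowski's integral inequality, with [C * b t] as bound for the norm of [h (., t)]. *)
Lemma L2_param_int : L2 mu param_int /\ nrm mu param_int <= C * I.
Proof.
have [lH nH] := L2_H.
apply: L2_nrm_le; first by rewrite mulr_ge0// ltW.
  exact: measurable_param_int.
apply: (@le_trans _ _ (\int[mu]_x (fine (H x) ^+ 2)%:E)%E); last first.
  by rewrite -nrm_sqrE// lee_fin ler_pXn2r ?nnegrE ?nrm_ge0// mulr_ge0// ltW.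
apply: ae_ge0_le_integral => //.
- by move=> x _; rewrite lee_fin sqr_ge0.
- by apply/measurable_EFinP; apply: measurable_funX; exact: measurable_param_int.
- by move=> x _; rewrite lee_fin sqr_ge0.
- by apply/measurable_EFinP; apply: measurable_funX; case: lH.
apply: filterS J_fin => x Jx _; rewrite lee_fin.
have [h1|] := param_int_le x; last by rewrite Jx.
rewrite -(real_normK (num_real (param_int x))) ler_pXn2r ?nnegrE//.
by rewrite fine_ge0.
Qed.

(** Fubini's theorem applies because [|h| k |u|] integrates in [t] to [H |u|], a product of two
    square integrable functions. Estimates of the form thereby reduce to a single shift [t]. *)
Lemma ip_param_int u : L2 mu u ->
  leb.-integrable setT (fun t => (k t * \int[mu]_x (h (x, t) * u x))%:E) /\
  ip mu param_int u = \int[leb]_t (k t * \int[mu]_x (h (x, t) * u x)).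
Proof.
move=> lu; have [lH nH] := L2_H; have mu_ := L2_meas lu.
pose F (z : X * TR) : \bar R := (h z * k z.2 * u z.1)%:E.
have mF : measurable_fun setT F.
  by apply/measurable_EFinP; apply: measurable_funM => //; exact: mfst.
have IF : (mu \x leb)%E.-integrable setT F.
  apply/integrable12ltyP => //.
  apply: (@le_lt_trans _ _ (\int[mu]_x (`|fine (H x)| * `|u x|)%:E)%E); last first.
    have lau : L2 mu (fun x => `|u x|).
      apply: (@L2_dom _ _ _ _ u) => //; last by move=> x; rewrite normr_id.
      exact: measurableT_comp.
    have laH : L2 mu (fun x => `|fine (H x)|).
      apply: (@L2_dom _ _ _ _ (fun x => fine (H x))) => //; last first.
        by move=> x; rewrite normr_id.
      by apply: measurableT_comp => //; case: lH.
    have := integrable_lty measurableT (L2_integrableM laH lau); exact.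
  apply: ae_ge0_le_integral => //.
  - by move=> x _; exact: integral_ge0.
  - apply: (measurable_integral_snd leb (f := fun z => `|F z|)%E) => //.
    exact: measurableT_comp.
  - apply/measurable_EFinP; apply: measurable_funM; apply: measurableT_comp => //.
    by case: lH.
  apply: filterS J_fin => x Jx _.
  rewrite (ger0_norm (fine_ge0 (H0 x))) EFinM fineK ?H_fin//.
  rewrite muleC -ge0_integralZl//.
  - by apply: ge0_le_integral => //;[
      by apply: measurableT_comp => //; exact: (measurable_fun_pair2 x mF)|
      by apply: measurable_funeM; exact: (measurable_fun_pair2 x mhk)|
      by move=> t _; rewrite /F /= !normrM (ger0_norm (k0 t)) -EFinM lee_fin mulrC].
  - exact: (measurable_fun_pair2 x mhk).
have IF' : (leb \x mu)%E.-integrable setT (fun z : TR * X => F (z.2, z.1)).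
  have mF' : measurable_fun setT (fun z : TR * X => F (z.2, z.1)).
    by apply: (measurableT_comp mF); exact: measurable_fun_pair.
  apply/integrable12ltyP => //.
  have := (integrable12ltyP _ _ mF).1 IF.
  rewrite (fubini_tonelli (fun z => `|F z|)%E)//.
  exact: measurableT_comp.
have intG : leb.-integrable setT (fubini_G mu F) := integrable_fubini_F IF'.
have aeG : ae_eq leb setT (fubini_G mu F)
    (fun t => (k t * \int[mu]_x (h (x, t) * u x))%:E).
  have := ae_integrable2 IF; apply: filterS => t It _; rewrite /fubini_G /F /=.
  (* Nothing is assumed on [h (., t)] where [k t = 0], but both sides vanish there; elsewhere
     integrability of [h u] follows by dividing by [k t]. *)
  have [kt|kt] := eqVneq (k t) 0.
    by rewrite kt mul0r; apply: integral0_eq => x _; rewrite mulr0 mul0r.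
  have It' : mu.-integrable setT (fun x => (h (x, t) * u x)%:E).
    have := integrableZl measurableT (k t)^-1 It.
    by apply: eq_integrable => // x _; rewrite /F/= -EFinM; congr EFin; field.
  rewrite EFinM /Rintegral fineK ?integrable_fin_num//.
  rewrite -integralZl//; apply: eq_integral => x _; rewrite -EFinM; congr EFin; ring.
have mG : measurable_fun setT (fun t => (k t * \int[mu]_x (h (x, t) * u x))%:E).
  apply/measurable_EFinP; apply: measurable_funM => //.
  have msw : measurable_fun setT (fun z : TR * X => h (z.2, z.1) * u z.2).
    apply: measurable_funM; last exact: measurableT_comp.
    by apply: (measurableT_comp mh); exact: measurable_fun_pair.
  exact: (measurable_Rintegral_snd mu msw).
split.
  apply/integrableP; split => //; have /integrableP[mGG] := intG.
  rewrite (ae_eq_integral (fun t => `|(k t * \int[mu]_x (h (x, t) * u x))%:E|)%E)//.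
  - exact: measurableT_comp.
  - exact: measurableT_comp.
  - by apply: filterS aeG => t /= e _; rewrite e.
have mGG : measurable_fun setT (fubini_G mu F) by case/integrableP: intG.
rewrite /ip /Rintegral -(ae_eq_integral _ _ measurableT mGG mG aeG).
rewrite -(Fubini IF); congr fine; apply: ae_eq_integral => //.
- apply/measurable_EFinP; apply: measurable_funM => //; exact: measurable_param_int.
- exact: (measurable_fubini_F IF).
apply: filterS param_int_integrable => x hI _; rewrite /fubini_F /F /=.
rewrite EFinM /param_int /Rintegral fineK ?integrable_fin_num//.
rewrite -integralZr//.
Qed.

Lemma ip_param_int_ge u beta : L2 mu u ->
  leb.-integrable setT (fun t => (k t * beta t)%:E) ->
  (forall t, k t != 0 -> beta t <= \int[mu]_x (h (x, t) * u x)) ->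
  \int[leb]_t (k t * beta t) <= ip mu param_int u.
Proof.
move=> lu Ib hbeta; have [Iu ->] := ip_param_int lu.
apply: le_Rintegral => // t _; have [->|kt] := eqVneq (k t) 0; first by rewrite !mul0r.
by rewrite ler_wpM2l// hbeta.
Qed.

End Minkowski.

(** * Smooth functions *)

Section Derivatives.
Context {R : realType} {V : normedModType R}.
Implicit Types (f g : V -> R) (x v : V).

Lemma is_derive_cvg f x v (d : R) :
  (h^-1 * (f (h *: v + x) - f x)) @[h --> 0^'] --> d -> is_derive x v f d.
Proof.
move=> H; have {}H : h^-1 *: ((f \o shift x) (h *: v) - f x) @[h --> 0^'] --> d by [].
by apply: DeriveDef; [exact: cvgP H|exact: cvg_lim H].
Qed.

Lemma cvg_is_derive f x v (d : R) : is_derive x v f d ->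
  (h^-1 * (f (h *: v + x) - f x)) @[h --> 0^'] --> d.
Proof. by move=> [H <-]; exact: H. Qed.

(** Reduces directional derivatives to functions of one variable, where the mean value theorem and
    the chain rule apply. *)
Lemma is_derive_line f x v (t d : R) :
  is_derive (t *: v + x) v f d <-> is_derive t 1 (fun s : R => f (s *: v + x)) d.
Proof.
have e (h : R) : h^-1 *: (((fun s : R => f (s *: v + x)) \o shift t) (h *: 1) -
     (fun s : R => f (s *: v + x)) t) =
   h^-1 *: ((f \o shift (t *: v + x)) (h *: v) - f (t *: v + x)).
  by rewrite /= [h *: 1](_ : _ = h) ?scalerDl ?addrA//; rewrite /GRing.scale/= mulr1.
split=> -[H1 H2]; apply: DeriveDef.
- by rewrite /derivable; under eq_fun do rewrite e.
- by rewrite -H2 /derive; under eq_fun do rewrite e.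
- by move: H1; rewrite /derivable; under eq_fun do rewrite e.
- by rewrite -H2 /derive; under [in RHS]eq_fun do rewrite e.
Qed.

Lemma is_derive_line0 f x v (d : R) :
  is_derive x v f d <-> is_derive (0 : R) 1 (fun s : R => f (s *: v + x)) d.
Proof. by rewrite -is_derive_line scale0r add0r. Qed.

Lemma is_derive_comp1 (F : R -> R) f x v (a d : R) :
  is_derive (f x) 1 F a -> is_derive x v f d -> is_derive x v (F \o f) (a * d).
Proof.
move=> dF /is_derive_line0 df; apply/is_derive_line0.
have := @is_derive1_comp _ F (fun s : R => f (s *: v + x)) 0 a d.
by rewrite scale0r add0r; exact.
Qed.

Lemma is_derive_mean f v x (g : V -> R) (t : R) :
  (forall y, is_derive y v f (g y)) ->
  exists2 s : R, `|s| <= `|t| & f (t *: v + x) - f x = t * g (s *: v + x).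
Proof.
move=> fg.
have dline (s : R) : is_derive s 1 (fun s : R => f (s *: v + x)) (g (s *: v + x)).
  exact/is_derive_line.
have cline : continuous (fun s : R => f (s *: v + x)).
  move=> s; apply/differentiable_continuous/derivable1_diffP.
  by have [] := dline s.
have [t0|t0|->] := ltgtP t 0; last first.
- by exists 0; rewrite ?normr0// scale0r add0r subrr mul0r.
- have [|s] := MVT t0 (fun s _ => dline s); first exact: continuous_subspaceT.
  rewrite in_itv /= => /andP[s0 st]; rewrite scale0r add0r subr0 mulrC => e.
  by exists s => //; rewrite !gtr0_norm// ltW.
- have [|s] := MVT t0 (fun s _ => dline s); first exact: continuous_subspaceT.
  rewrite in_itv /= => /andP[s0 st]; rewrite scale0r add0r sub0r => e.
  exists s; first by rewrite !ltr0_norm// lerN2 ltW.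
  by rewrite -opprB e mulrN opprK mulrC.
Qed.

(** Derivatives along [v] and [w] do not add up in general. The increment along [v] starts from the
    moving point [h w + x]; the mean value theorem expresses it by [g] at a nearby point, and
    continuity of [g] at [x] gives the limit. *)
Lemma is_derive_addv f v w x (g : V -> R) (d : R) :
  (forall y, is_derive y v f (g y)) -> {for x, continuous g} ->
  is_derive x w f d -> is_derive x (v + w) f (g x + d).
Proof.
move=> fg cg /cvg_is_derive dw; apply: is_derive_cvg.
have -> : (fun h => h^-1 * (f (h *: (v + w) + x) - f x)) =
    (fun h => h^-1 * (f (h *: v + (h *: w + x)) - f (h *: w + x))) \+
    (fun h => h^-1 * (f (h *: w + x) - f x)).
  by apply/funext => h; rewrite /= -mulrDr scalerDr addrA; congr (_ * _); rewrite addrA subrK.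
apply: cvgD => //; apply/cvgrPdist_lt => e e0.
have /cvgrPdist_lt/(_ e e0) := cg; move=> /nbhs_ballP[r /= r0 rP].
pose N := `|v| + `|w| + 1; have N0 : 0 < N by rewrite ltr_wpDl ?addr_ge0.
have : \forall h \near (0 : R)^', `|h| < r / N.
  apply: nbhs_dnbhs; apply/nbhs_ballP; exists (r / N); first by rewrite /= divr_gt0.
  by move=> h; rewrite /ball/= sub0r normrN.
have : \forall h \near (0 : R)^', h != 0 by exact: nbhs_dnbhs_neq.
apply: filterS2 => h h0 hr.
have [s sh ->] := is_derive_mean (h *: w + x) h fg.
rewrite mulKf//; apply: rP; rewrite -ball_normE /= addrA opprD addrCA subrr addr0.
rewrite normrN; apply: (le_lt_trans (ler_normD _ _)); rewrite !normrZ.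
apply: (@le_lt_trans _ _ (`|h| * (`|v| + `|w|))).
  by rewrite mulrDr lerD2r ler_wpM2r.
apply: (@le_lt_trans _ _ (`|h| * N)); first by rewrite ler_wpM2l// /N lerDl.
by rewrite -ltr_pdivlMr.
Qed.

Lemma is_derive_scalev f x v (a d : R) :
  is_derive x v f d -> is_derive x (a *: v) f (a * d).
Proof.
move=> /is_derive_line0 df; apply/is_derive_line0.
rewrite (_ : (fun s : R => _) = (fun s : R => f (s *: v + x)) \o (fun s => s * a)); last first.
  by apply/funext => s /=; rewrite scalerA.
rewrite mulrC; apply: is_derive1_comp; first by rewrite mul0r.
have := is_deriveZ a (is_derive_id (0 : R) (1 : R)).
rewrite [a *: 1](_ : _ = a); last by rewrite /GRing.scale/= mulr1.
by rewrite (_ : _ \*: id = (fun s : R => s * a))//; apply/funext => s; exact: mulrC.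
Qed.

End Derivatives.

Section Smooth.
Context {R : realType} {n : nat}.
Notation E := 'rV[R]_n.
Implicit Types f g : E -> R.

(** A coinduction principle: any class of continuous functions stable under partial differentiation
    consists of smooth functions. *)
Lemma smooth_coind (C : (E -> R) -> Prop) :
  (forall f, C f -> continuous f /\ forall i, exists2 g, C g &
     forall x, is_derive x (unit_row i) f (g x)) ->
  forall f, C f -> smooth f.
Proof.
move=> HC f Cf; suff H s : C (partials s f).
  move=> s; have [cs ds] := HC _ (H s); split => // i x.
  by have [g _ /(_ x)[]] := ds i.
elim: s => //= i s IH; have [_ /(_ i)[g Cg fg]] := HC _ IH.
rewrite (_ : (fun x => _) = g)//; apply/funext => x.
by have [] := fg x.
Qed.

Lemma smooth_continuous f : smooth f -> continuous f.
Proof. by move=> /(_ [::])[]. Qed.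

Definition pd (i : 'I_n) f : E -> R := fun x => 'D_(unit_row i) f x.

Lemma smooth_pd i f : smooth f -> smooth (pd i f).
Proof.
move=> sf s; have := sf (rcons s i); rewrite /partials foldr_rcons.
exact.
Qed.

Lemma smooth_is_derive i f x : smooth f -> is_derive x (unit_row i) f (pd i f x).
Proof. by move=> /(_ [::])[_ /(_ i x)] H; apply: DeriveDef. Qed.

(** Products and compositions alone are not stable under differentiation. With sums, and with the
    whole tower [F] of derivatives of the outer function, the class becomes stable and
    [smooth_coind] applies. *)
Inductive smooth_alg : (E -> R) -> Prop :=
| smooth_alg_base f of smooth f : smooth_alg f
| smooth_algD f g of smooth_alg f & smooth_alg g : smooth_alg (f + g)
| smooth_algM f g of smooth_alg f & smooth_alg g : smooth_alg (f * g)
| smooth_alg_comp (F : nat -> R -> R) k f of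
    (forall k (x : R), is_derive x 1 (F k) (F k.+1 x)) & smooth f : smooth_alg (F k \o f).

Lemma smooth_algP f : smooth_alg f -> smooth f.
Proof.
apply: smooth_coind => {}f; elim => {f} [f sf|f g Cf [cf df] Cg [cg dg]|
    f g Cf [cf df] Cg [cg dg]|F k f dF sf].
- split; first exact: smooth_continuous.
  move=> i; exists (pd i f); first exact/smooth_alg_base/smooth_pd.
  by move=> x; exact: smooth_is_derive.
- split; first by move=> x; exact: (continuousD (cf x) (cg x)).
  move=> i; have [f' Cf' ff'] := df i; have [g' Cg' gg'] := dg i.
  by exists (f' + g'); [exact: smooth_algD|move=> x; exact: is_deriveD].
- split; first by move=> x; exact: (continuousM (cf x) (cg x)).
  move=> i; have [f' Cf' ff'] := df i; have [g' Cg' gg'] := dg i.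
  exists (f * g' + g * f'); first by apply: smooth_algD; exact: smooth_algM.
  by move=> x; exact: is_deriveM.
- split.
    move=> x; apply: continuous_comp; first exact: smooth_continuous.
    apply/differentiable_continuous/derivable1_diffP.
    by have [] := dF k (f x).
  move=> i; exists ((F k.+1 \o f) * pd i f).
    apply: smooth_algM; first exact: (@smooth_alg_comp F k.+1).
    exact/smooth_alg_base/smooth_pd.
  by move=> x; exact: (is_derive_comp1 (dF k (f x)) (smooth_is_derive i x sf)).
Qed.

Lemma smoothD f g : smooth f -> smooth g -> smooth (f + g).
Proof. by move=> sf sg; apply: smooth_algP; apply: smooth_algD; exact: smooth_alg_base. Qed.

Lemma smoothM f g : smooth f -> smooth g -> smooth (f * g).
Proof. by move=> sf sg; apply: smooth_algP; apply: smooth_algM; exact: smooth_alg_base. Qed.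

Lemma smooth_comp (F : nat -> R -> R) k f :
  (forall k (x : R), is_derive x 1 (F k) (F k.+1 x)) -> smooth f -> smooth (F k \o f).
Proof. by move=> dF sf; apply: smooth_algP; exact: smooth_alg_comp. Qed.

Lemma smooth_cst (a : R) : smooth (cst a : E -> R).
Proof.
apply: (@smooth_coind (fun f => exists b, f = cst b)); last by exists a.
move=> _ [b ->]; split; first exact: cst_continuous.
move=> i; exists (cst 0); first by exists 0.
by move=> x; exact: is_derive_cst.
Qed.

Lemma smoothZ (a : R) f : smooth f -> smooth (a *: f).
Proof.
move=> sf; rewrite (_ : a *: f = cst a * f)//.
by apply: smoothM => //; exact: smooth_cst.
Qed.

Lemma smoothN f : smooth f -> smooth (- f).
Proof. by move=> sf; rewrite -scaleN1r; exact: smoothZ. Qed.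

Lemma smooth_coord (j : 'I_n) : smooth (fun x : E => x ord0 j).
Proof.
apply: (@smooth_coind (fun f => f = (fun x : E => x ord0 j) \/ smooth f)); last by left.
move=> f [->|sf]; last first.
  split; first exact: smooth_continuous.
  move=> i; exists (pd i f); first by right; exact: smooth_pd.
  by move=> x; exact: smooth_is_derive.
split; first by move=> x; exact: coord_continuous.
move=> i; exists (cst ((i == j)%:R : R)); first by right; exact: smooth_cst.
move=> x; apply: is_derive_cvg.
apply: (@cvg_trans _ (cst ((i == j)%:R : R) @ (0 : R)^')); last exact: cvg_cst.
apply: near_eq_cvg.
have : \forall h \near (0 : R)^', h != 0 by exact: nbhs_dnbhs_neq.
apply: filterS => h h0 /=.
by rewrite !mxE eqxx /= addrK eq_sym mulKf.
Qed.

Lemma is_derive_smooth f x v : smooth f ->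
  is_derive x v f (\sum_i v ord0 i * pd i f x).
Proof.
move=> sf; rewrite {1}(row_sum_delta v).
have H (s : seq 'I_n) y : is_derive y (\sum_(i <- s) v ord0 i *: delta_mx ord0 i) f
    (\sum_(i <- s) v ord0 i * pd i f y).
  elim: s y => [|i s IH] y.
    rewrite !big_nil; apply: is_derive_cvg.
    under eq_fun do rewrite scaler0 add0r subrr mulr0.
    exact: cvg_cst.
  rewrite !big_cons.
  apply: (is_derive_addv (g := fun y => v ord0 i * pd i f y)) => //; last first.
    have c : pd i f z @[z --> y] --> pd i f y by exact/smooth_continuous/smooth_pd.
    exact: (cvgM (cvg_cst (v ord0 i)) c).
  by move=> z; apply: is_derive_scalev; exact: smooth_is_derive.
exact: H.
Qed.

End Smooth.

(** * The flat function exp (- 1 / x) and its derivatives *)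

Section FlatFunction.
Context {R : realType}.

Definition flat_pow (j : nat) (x : R) : R := if 0 < x then x ^- j * expR (- x^-1) else 0.

Definition flat (x : R) : R := flat_pow 0 x.

Lemma flat_pow_gt0 j x : 0 < x -> flat_pow j x = x ^- j * expR (- x^-1).
Proof. by move=> x0; rewrite /flat_pow x0. Qed.

Lemma flat_pow_le0 j x : x <= 0 -> flat_pow j x = 0.
Proof. by move=> x0; rewrite /flat_pow ltNge x0. Qed.

(** With [m = j + 2], [exp (1/x)] is the [m]-th power of [exp (1/(m x))], which is at least
    [1/(m x)]; hence [exp (-1/x) <= (m x)^m]. The order 2 in [x] is what makes the derivative at 0
    vanish. *)
Lemma flat_pow_le j (x : R) : `|flat_pow j x| <= (j.+2%:R ^+ j.+2) * x ^+ 2.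
Proof.
have [x0|x0] := ltP 0 x; last first.
  by rewrite flat_pow_le0// normr0 mulr_ge0 ?sqr_ge0// exprn_ge0.
rewrite flat_pow_gt0// ger0_norm ?mulr_ge0 ?expR_ge0 ?invr_ge0 ?exprn_ge0 ?(ltW x0)//.
set m := j.+2.
have m0 : (0 : R) < m%:R by rewrite ltr0n.
have h : expR (- x^-1) <= (m%:R * x) ^+ m.
  have e : x^-1 = m%:R * (m%:R * x)^-1 by field; rewrite gt_eqF// gt_eqF.
  rewrite expRN e expRM_natl -exprVn; apply: lerXn2r; rewrite ?nnegrE ?invr_ge0 ?expR_ge0//.
    by rewrite mulr_ge0 ?ltW.
  rewrite -[leRHS]invrK lef_pV2 ?posrE ?expR_gt0 ?invr_gt0 ?mulr_gt0//.
  by apply: le_trans (expR_ge1Dx _); rewrite lerDr.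
apply: (@le_trans _ _ (x ^- j * (m%:R * x) ^+ m)).
  by rewrite ler_wpM2l// invr_ge0 exprn_ge0// ltW.
rewrite exprMn mulrCA; apply: ler_wpM2l; first by rewrite exprn_ge0// ltW.
by rewrite /m -addn2 exprD mulKf// expf_neq0// gt_eqF.
Qed.

Lemma is_derive_flat_pow j (x : R) :
  is_derive x 1 (flat_pow j) (- j%:R * flat_pow j.+1 x + flat_pow j.+2 x).
Proof.
have [x0|x0|->] := ltgtP x 0.
- rewrite !flat_pow_le0 ?(ltW x0)// mulr0 addr0.
  apply: (near_eq_is_derive (f := fun=> 0)).
    have : \forall y \near x, y < 0 by exact: lt_nbhsl.
    by apply: filterS => y y0; rewrite flat_pow_le0// ltW.
- rewrite !flat_pow_gt0//.
  apply: (@near_eq_is_derive _ _ _ (fun y : R => (y ^+ j)^-1 * expR (- y^-1))).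
    have : \forall y \near x, 0 < y by exact: lt_nbhsr.
    by apply: filterS => y y0; rewrite flat_pow_gt0.
  have xn0 : x != 0 by rewrite gt_eqF.
  have dV : is_derive x 1 (fun y : R => y^-1) (- x ^- 2).
    have := is_deriveV xn0 (is_derive_id x 1).
    by rewrite [_ *: 1](_ : _ = - x ^- 2)//; rewrite /GRing.scale /= mulr1.
  have dE : is_derive x 1 (fun y : R => expR (- y^-1)) (expR (- x^-1) * (x ^- 2)).
    apply: (@is_derive1_comp _ expR (fun y => - y^-1)).
    have := is_deriveN dV; by rewrite opprK.
  have dX : is_derive x 1 (fun y : R => (y ^+ j)^-1) (- j%:R * x ^- j.+1).
    have dj := is_deriveX j (is_derive_id x 1).
    have xj0 : x ^+ j != 0 by rewrite expf_neq0.
    have := @is_deriveV _ (fun y : R => y ^+ j) x _ 1 xj0 _.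
    move=> /(_ (j%:R * x ^+ j.-1)) H.
    have {}H := H _.
    apply: is_derive_eq; first apply: H.
      move: dj; rewrite [_ *: 1](_ : _ = j%:R * x ^+ j.-1); last exact: mulr1.
      by rewrite exprfctE.
    rewrite /GRing.scale /=; case: (j) => [|i]; first by rewrite !(mul0r, mulr0, oppr0).
    rewrite /= !exprS; field.
    by rewrite xn0 expf_neq0.
  have := is_deriveM dX dE; rewrite /GRing.scale /=.
  by move=> H; apply: is_derive_eq H _; rewrite !exprS; field; rewrite xn0 expf_neq0.
- rewrite !flat_pow_le0 ?lexx// mulr0 addr0; apply: is_derive_cvg.
  rewrite flat_pow_le0 ?lexx//.
  apply/cvgr0Pnorm_lt => e e0.
  pose M : R := j.+2%:R ^+ j.+2 + 1.
  have M0 : 0 < M by rewrite ltr_wpDl// exprn_ge0.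
  have : \forall h \near (0 : R)^', `|h| < e / M.
    apply: nbhs_dnbhs; apply/nbhs_ballP; exists (e / M); first by rewrite /= divr_gt0.
    by move=> h; rewrite /ball/= sub0r normrN.
  have : \forall h \near (0 : R)^', h != 0 by exact: nbhs_dnbhs_neq.
  apply: filterS2 => h h0 he; rewrite addr0 subr0 [h *: 1](_ : _ = h); last first.
    by rewrite /GRing.scale /= mulr1.
  rewrite normrM normfV ltr_pdivrMl ?normr_gt0//.
  apply: le_lt_trans (flat_pow_le _ _) _.
  apply: (@le_lt_trans _ _ (M * h ^+ 2)); first by rewrite ler_wpM2r ?sqr_ge0// lerDl.
  rewrite -real_normK ?num_real// expr2 mulrCA ltr_pM2l ?normr_gt0// mulrC.
  by rewrite -ltr_pdivlMr.
Qed.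

(** For [x > 0] the derivative of [x^-j exp (-1/x)] combines the same expressions with exponents
    [j + 1] and [j + 2], so the linear span is stable under differentiation. *)
Inductive flat_span : (R -> R) -> Prop :=
| flat_span_pow j : flat_span (flat_pow j)
| flat_spanD f g of flat_span f & flat_span g : flat_span (f + g)
| flat_spanZ k f of flat_span f : flat_span (k *: f).

Lemma flat_span_derive f : flat_span f ->
  exists2 g, flat_span g & forall x : R, is_derive x 1 f (g x).
Proof.
elim=> {f} [j|f g _ [f' Cf' ff'] _ [g' Cg' gg']|k f _ [f' Cf' ff']].
- exists ((- j%:R) *: flat_pow j.+1 + flat_pow j.+2).
    by apply: flat_spanD; [apply: flat_spanZ|]; exact: flat_span_pow.
  by move=> x; exact: is_derive_flat_pow.
- by exists (f' + g'); [exact: flat_spanD|move=> x; exact: is_deriveD].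
- by exists (k *: f'); [exact: flat_spanZ|move=> x; exact: is_deriveZ].
Qed.

Lemma flat_tower : exists2 F : nat -> R -> R, F 0%N = flat &
  forall k (x : R), is_derive x 1 (F k) (F k.+1 x).
Proof.
pose F k := iter k (fun f : R -> R => f^`()%classic) flat.
have HF k : flat_span (F k).
  elim: k => [|k IH]; first exact: flat_span_pow.
  have [g Cg fg] := flat_span_derive IH.
  rewrite /F iterS -/(F k) (_ : (F k)^`()%classic = g)//.
  by apply/funext => x; rewrite derive1E; have [] := fg x.
exists F => // k x; have [g Cg fg] := flat_span_derive (HF k).
rewrite /F iterS -/(F k) derive1E; have dg := fg x.
by rewrite (@derive_val _ _ _ _ _ _ _ dg).
Qed.

Lemma flat_ge0 x : 0 <= flat x.
Proof.
rewrite /flat /flat_pow; case: ifP => // _.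
by rewrite expr0 invr1 mul1r expR_ge0.
Qed.

Lemma flat_gt0 x : 0 < x -> 0 < flat x.
Proof. by move=> x0; rewrite /flat flat_pow_gt0// expr0 invr1 mul1r expR_gt0. Qed.

Lemma flat_eq0 x : x <= 0 -> flat x = 0.
Proof. exact: flat_pow_le0. Qed.

End FlatFunction.

(** * Test functions *)

Section TestFunctions.
Context {R : realType} {n : nat}.
Notation E := 'rV[R]_n.
Notation leb := (@lebesgue_measure R).
Notation TR := (measurableTypeR R).
Implicit Types (f g phi psi : E -> R) (x v : E) (Omega K : set E).

Definition rtest Omega phi := smooth phi /\
  exists K : set E, [/\ compact K, K `<=` Omega & forall x, ~ K x -> phi x = 0].

Lemma rtest0 Omega : rtest Omega 0.
Proof.
split; first exact: (smooth_cst 0).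
by exists set0; split => //; exact: compact0.
Qed.

Lemma rtestD Omega phi psi : rtest Omega phi -> rtest Omega psi -> rtest Omega (phi + psi).
Proof.
move=> [sp [K [cK KO Kp]]] [sq [L [cL LO Lp]]]; split; first exact: smoothD.
exists (K `|` L); split; first exact: compactU.
  by move=> x [/KO|/LO].
by move=> x /not_orP[/Kp px /Lp qx]; rewrite addrfctE px qx addr0.
Qed.

Lemma rtest_smoothM Omega phi g : rtest Omega phi -> smooth g -> rtest Omega (g * phi).
Proof.
move=> [sp [K [cK KO Kp]]] sg; split; first exact: smoothM.
by exists K; split => // x /Kp px; rewrite mulrfctE px mulr0.
Qed.

Lemma rtestZ Omega k phi : rtest Omega phi -> rtest Omega (k *: phi).
Proof.
move=> tp; rewrite (_ : k *: phi = cst k * phi)//.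
by apply: rtest_smoothM => //; exact: smooth_cst.
Qed.

Lemma rtest_pd Omega i phi : rtest Omega phi -> rtest Omega (pd i phi).
Proof.
move=> [sp [K [cK KO Kp]]]; split; first exact: smooth_pd.
exists K; split => // x Kx; rewrite /pd.
rewrite (@near_eq_derive _ _ _ _ (cst 0)).
  by have [] := @is_derive_cst R _ _ (0 : R) x (unit_row i).
have oK : open (~` K).
  by apply: closed_openC; apply: compact_closed => //; exact: norm_hausdorff.
move: oK; rewrite openE => /(_ _ Kx); apply: filterS => y /= Ky.
exact: Kp.
Qed.

Lemma continuous_compact_bound f K : continuous f -> compact K ->
  (forall x, ~ K x -> f x = 0) -> exists2 M, 0 <= M & forall x, `|f x| <= M.
Proof.
move=> cf cK fK.
have /compact_bounded[M [Mr HM]] : compact (f @` K).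
  by apply: continuous_compact => //; exact: continuous_subspaceT.
exists (`|M| + 1); first by rewrite addr_ge0.
move=> x; have [Kx|Kx] := pselect (K x); last by rewrite fK// normr0 addr_ge0.
apply: HM => //=; last by exists x.
by rewrite (le_lt_trans (ler_norm M))// ltrDl.
Qed.

Lemma coord_le_norm x (i : 'I_n) : `|x ord0 i| <= `|x|.
Proof.
rewrite [leRHS]/Num.norm /= mx_normrE.
exact: (le_bigmax _ (fun ij : 'I_1 * 'I_n => `|x ij.1 ij.2|) (ord0, i)).
Qed.

Definition cube (r : R) : set E := [set x | forall i, x ord0 i \in `[- r, r]].

Lemma compact_cube K : compact K -> exists2 r, 0 < r & K `<=` cube r.
Proof.
move=> /compact_bounded[M [Mr HM]]; exists (`|M| + 1); first by rewrite ltr_wpDl.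
move=> x Kx i; rewrite in_itv /= -ler_norml.
have := HM (`|M| + 1); rewrite (le_lt_trans (ler_norm M)) ?ltrDl// => /(_ isT x Kx).
move=> /= h; apply: le_trans h; exact: coord_le_norm.
Qed.

Lemma measurable_cube r : measurable (cube r).
Proof. exact: measurable_row_cube. Qed.

Lemma lrow_cube_lty r : (lrow n (cube r) < +oo)%E.
Proof.
have [r0|r0] := leP 0 r.
  by rewrite lrow_cube ?ltry// (le_trans _ r0)// oppr_le0.
apply: (@le_lt_trans _ _ (lrow n (cube (- r)))).
  apply: le_measure; rewrite ?inE; [exact: measurable_cube|exact: measurable_cube|].
  move=> x /= + i => /(_ i); rewrite !in_itv /= opprK => /andP[h1 h2].
  by rewrite (le_trans _ h1) ?(le_trans h2)// ?(ltW (lt_trans r0 _)) ?oppr_gt0 ?(ltW r0)//;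
    rewrite (le_trans (ltW r0))// oppr_ge0 ltW.
by rewrite lrow_cube ?ltry// opprK (le_trans (ltW r0))// oppr_ge0 ltW.
Qed.

Lemma L2_indic (A : set E) : measurable A -> (lrow n A < +oo)%E -> L2 (lrow n) (\1_A).
Proof.
move=> mA Ay; apply: L2P; first exact: measurable_indic.
rewrite (_ : (\int[_]_x _)%E = (\int[lrow n]_x (\1_A x)%:E)%E).
  by rewrite integral_indic// setIT.
by apply: eq_integral => x _; rewrite indicE; case: (_ \in _); rewrite ?expr1n ?expr0n.
Qed.

Lemma L2_cube_bounded f r M : measurable_fun setT f -> (forall x, `|f x| <= M) ->
  (forall x, ~ cube r x -> f x = 0) -> L2 (lrow n) f.
Proof.
move=> mf fM f0; apply: (@L2_dom _ _ _ _ (M *: \1_(cube r))) => //.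
  by apply: L2Z; apply: L2_indic; [exact: measurable_cube|exact: lrow_cube_lty].
move=> x; rewrite [X in _ <= `|X|](_ : _ = M * \1_(cube r) x)//.
have [cx|cx] := pselect (cube r x).
  by rewrite indicE mem_set// mulr1 (le_trans (fM x))// ler_norm.
by rewrite f0// normr0.
Qed.

Lemma rtest_continuous Omega phi : rtest Omega phi -> continuous phi.
Proof. by move=> [/smooth_continuous]. Qed.

Lemma rtest_measurable Omega phi : rtest Omega phi -> measurable_fun setT phi.
Proof. by move=> /rtest_continuous; exact: continuous_row_measurable. Qed.

Lemma rtest_bounded Omega phi : rtest Omega phi -> exists2 M, 0 <= M & forall x, `|phi x| <= M.
Proof.
move=> tp; have cp := rtest_continuous tp; have [_ [K [cK _ Kp]]] := tp.
exact: (continuous_compact_bound cp cK).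
Qed.

Lemma rtest_cube Omega phi : rtest Omega phi ->
  exists2 r, 0 < r & forall x, ~ cube r x -> phi x = 0.
Proof.
move=> [_ [K [cK _ Kp]]]; have [r r0 Kr] := compact_cube cK.
by exists r => // x cx; apply: Kp => /Kr.
Qed.

Lemma rtest_L2 Omega phi : rtest Omega phi -> L2 (lrow n) phi.
Proof.
move=> tp; have [M M0 HM] := rtest_bounded tp; have [r r0 Hr] := rtest_cube tp.
by apply: (L2_cube_bounded _ HM Hr); exact: rtest_measurable tp.
Qed.

Lemma integral_row_shift (g : E -> \bar R) v : measurable_fun setT g ->
  (\int[lrow n]_x g (x + v)%R = \int[lrow n]_x g x)%E.
Proof.
move=> mg; rewrite integralE [RHS]integralE.
have H (f : E -> \bar R) : measurable_fun setT f -> (forall x, 0 <= f x)%E ->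
    (\int[lrow n]_x f (x + v)%R = \int[lrow n]_x f x)%E.
  move=> mf f0; have := ge0_integral_row_affine v ltr01 mf f0.
  by rewrite invr1 expr1n mul1e => <-; apply: eq_integral => x _; rewrite scale1r.
have hp := H _ (measurable_funepos mg) (fun x => funepos_ge0 g x).
have hn := H _ (measurable_funeneg mg) (fun x => funeneg_ge0 g x).
by congr (_ - _)%E; [rewrite -hp|rewrite -hn]; apply: eq_integral => x _;
  rewrite ?funeposE ?funenegE.
Qed.

Lemma rtest_integrable Omega phi : rtest Omega phi ->
  (lrow n).-integrable setT (EFin \o phi).
Proof.
move=> tp; have lp := rtest_L2 tp; have [r r0 Hr] := rtest_cube tp.
have li := L2_indic (measurable_cube r) (lrow_cube_lty r).
apply: eq_integrable (L2_integrableM lp li) => // x _ /=; congr EFin.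
have [cx|cx] := pselect (cube r x); first by rewrite indicE mem_set// mulr1.
by rewrite Hr// mul0r.
Qed.

(** Difference quotients have integral 0 by translation invariance. They are bounded by the maximum
    of the derivative and supported in a fixed cube, so dominated convergence gives the claim. *)
Lemma Rintegral_pd Omega phi i : rtest Omega phi -> \int[lrow n]_x pd i phi x = 0.
Proof.
move=> tp; have tpd := rtest_pd i tp; have sp := tp.1.
have mp := rtest_measurable tp; have mpd := rtest_measurable tpd.
have [M M0 HM] := rtest_bounded tpd; have [r r0 Hr] := rtest_cube tp.
pose u (k : nat) x := k.+1%:R * (phi (k.+1%:R^-1 *: unit_row i + x) - phi x).
have mu_ k : measurable_fun setT (u k).
  apply: measurable_funM => //; apply: measurable_funB => //.
  by apply: (measurableT_comp mp); exact: measurable_rowD.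
have kn (k : nat) : (k.+1%:R^-1 : R) \in `[0, 1].
  by rewrite in_itv /= invr_ge0 ler0n invf_le1 ?ler1n.
have uM k x : `|u k x| <= M.
  rewrite /u; have [s _ ->] := is_derive_mean x (k.+1%:R^-1 : R)
    (fun y => smooth_is_derive i y sp).
  by rewrite mulrA divff ?mul1r.
(* The steps [1/(k+1)] are at most 1, so enlarging the cube by 1 contains all the supports. *)
have u0 k x : ~ cube (r + 1) x -> u k x = 0.
  move=> cx; rewrite /u !Hr ?subrr ?mulr0//.
    move=> h; apply: cx => j; have := h j; rewrite !in_itv /=.
    move=> /andP[h1 h2]; apply/andP; split; first by rewrite opprD (le_trans _ h1)// lerBlDr lerDl.
    by rewrite (le_trans h2)// lerDl.
  move=> h; apply: cx => j; have := h j; rewrite !in_itv /= !mxE eqxx /=.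
  have := kn k; rewrite in_itv /= => /andP[k0 k1].
  set b := (j == i)%:R; have b0 : 0 <= b :> R by rewrite ler0n.
  have b1 : b <= 1 :> R by rewrite /b lern1 leq_b1.
  have kb0 := mulr_ge0 k0 b0; have kb1 := mulr_ile1 k0 b0 k1 b1.
  move=> /andP[h1 h2]; apply/andP; split.
    by rewrite opprD lerBlDr (le_trans h1)// addrC lerD2l.
  apply: (@le_trans _ _ (k.+1%:R^-1 * b + x ord0 j)); first by rewrite lerDr.
  by apply: (le_trans h2); rewrite lerDl.
have lim x : u k x @[k --> \oo] --> pd i phi x.
  have := cvg_is_derive (smooth_is_derive i x sp).
  move=> H; rewrite (_ : u^~ x = (fun h => h^-1 * (phi (h *: unit_row i + x) - phi x)) \o
      (fun k => k.+1%:R^-1)); last by apply/funext => k; rewrite /= invrK.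
  apply: cvg_comp H => A /=; rewrite /dnbhs /within /= => hA.
  have : \forall k \near \oo, (k.+1%:R^-1 : R) != 0 -> A k.+1%:R^-1 := cvg_harmonic hA.
  apply: filterS => k h.
  have kk : (k.+1%:R^-1 : R) != 0 by rewrite invr_eq0 pnatr_eq0.
  exact: (h kk).
have li := L2_indic (measurable_cube (r + 1)) (lrow_cube_lty (r + 1)).
have IG : (lrow n).-integrable setT (fun x : E => (M * \1_(cube (r + 1)) x)%:E).
  apply: eq_integrable (integrableZl measurableT M (L2_integrableM li li)) => // x _ /=.
  by rewrite -EFinM; congr (_ * _)%:E; rewrite indicE; case: (_ \in _); rewrite ?mulr1 ?mulr0.
have [||||_ _ H] := @dominated_convergence _ _ _ (lrow n) setT measurableT
  (fun k x => (u k x)%:E) (fun x => (pd i phi x)%:E) _ _ _ _ IG _.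
- by move=> k; exact/measurable_EFinP.
- exact/measurable_EFinP.
- by apply: aeW => x _; apply: cvg_EFin; [exact: nearW|exact: lim].
- apply: aeW => x k _; rewrite /= lee_fin.
  have [cx|cx] := pselect (cube (r + 1) x); first by rewrite indicE mem_set// mulr1.
  by rewrite u0// normr0 mulr_ge0.
have {}H : (0%E : \bar R) @[k --> \oo] --> (\int[lrow n]_x (pd i phi x)%:E)%E.
  apply: cvg_trans H; apply: near_eq_cvg; apply: nearW => k /=.
  have Ip := rtest_integrable tp.
  have IpS : (lrow n).-integrable setT (fun x => (phi (k.+1%:R^-1 *: unit_row i + x))%:E).
    apply/integrableP; split.
      by apply/measurable_EFinP; apply: (measurableT_comp mp); exact: measurable_rowD.
    have /integrableP[_] := Ip.
    rewrite -(integral_row_shift (k.+1%:R^-1 *: unit_row i)); last first.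
      by apply: measurableT_comp => //; exact/measurable_EFinP.
    by under eq_integral do rewrite addrC.
  rewrite /u; under eq_integral do rewrite EFinM EFinB.
  rewrite integralZl//; last exact: (integrableB measurableT IpS Ip).
  rewrite integralB//.
  have -> : (\int[lrow n]_x (phi (k.+1%:R^-1 *: unit_row i + x))%:E =
      \int[lrow n]_x (phi x)%:E)%E.
    rewrite -[RHS](integral_row_shift (k.+1%:R^-1 *: unit_row i)); last exact/measurable_EFinP.
    by apply: eq_integral => x _; rewrite addrC.
  by rewrite subee ?mule0//; exact: (integrable_fin_num measurableT Ip).
have := cvg_lim _ H; rewrite lim_cst// => h.
by rewrite /Rintegral -h.
Qed.

Lemma pdM i phi psi : smooth phi -> smooth psi ->
  pd i (phi * psi) = phi * pd i psi + psi * pd i phi.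
Proof.
move=> sp sq; apply/funext => x.
have := is_deriveM (smooth_is_derive i x sp) (smooth_is_derive i x sq).
by case.
Qed.

Lemma pdD i phi psi : smooth phi -> smooth psi -> pd i (phi + psi) = pd i phi + pd i psi.
Proof.
move=> sp sq; apply/funext => x.
have := is_deriveD (smooth_is_derive i x sp) (smooth_is_derive i x sq).
by case.
Qed.

Lemma pdZ i k phi : smooth phi -> pd i (k *: phi) = k *: pd i phi.
Proof.
move=> sp; apply/funext => x.
have := is_deriveZ k (smooth_is_derive i x sp).
by case.
Qed.

Lemma ip_pd Omega Omega' i phi psi : rtest Omega phi -> rtest Omega' psi ->
  ip (lrow n) (pd i phi) psi = - ip (lrow n) phi (pd i psi).
Proof.
move=> tp tq; apply/eqP; rewrite -subr_eq0 opprK; apply/eqP.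
have := Rintegral_pd i (rtest_smoothM tp tq.1); rewrite pdM; [|exact: tq.1|exact: tp.1].
have lp := rtest_L2 tp; have lq := rtest_L2 tq.
have lpd := rtest_L2 (rtest_pd i tp); have lqd := rtest_L2 (rtest_pd i tq).
move=> H; rewrite -[RHS]H /ip -RintegralD//; try exact: L2_integrableM.
by apply: eq_Rintegral => x _; rewrite addrfctE !mulrfctE; ring.
Qed.

Definition gnrm2 phi : R := \sum_i ip (lrow n) (pd i phi) (pd i phi).

Lemma gnrm2_ge0 phi : 0 <= gnrm2 phi.
Proof. by apply: sumr_ge0 => i _; exact: ip_ge0. Qed.

Let D phi x := \sum_i pd i phi x ^+ 2.

Let measurable_D Omega phi : rtest Omega phi -> measurable_fun setT (D phi).
Proof.
move=> tp; apply: measurable_sum => i; apply: measurable_funX.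
exact: rtest_measurable (rtest_pd i tp).
Qed.

Let integral_D Omega phi : rtest Omega phi ->
  (\int[lrow n]_x (D phi x)%:E = (gnrm2 phi)%:E)%E.
Proof.
move=> tp; rewrite /D; under eq_integral do rewrite -sumEFin.
rewrite ge0_integral_sum//.
- rewrite /gnrm2 -sumEFin; apply: eq_bigr => i _.
  by rewrite -nrm_sqrE ?nrm_sqr//; exact: rtest_L2 (rtest_pd i tp).
- move=> i; apply/measurable_EFinP; apply: measurable_funX.
  exact: rtest_measurable (rtest_pd i tp).
- by move=> i x _; rewrite lee_fin sqr_ge0.
Qed.

Lemma sum_CS (a b : 'I_n -> R) :
  (\sum_i a i * b i) ^+ 2 <= (\sum_i a i ^+ 2) * (\sum_i b i ^+ 2).
Proof.
apply: discriminant_le => [|t]; first by apply: sumr_ge0 => i _; exact: sqr_ge0.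
rewrite [2 * _ * t]mulrAC [2 * t * _]mulr_sumr mulr_suml -!big_split /=.
apply: sumr_ge0 => i _; have := sqr_ge0 (t * a i + b i).
by rewrite sqrrD exprMn => h; lra.
Qed.

Lemma continuous_sum (I : eqType) (r : seq I) (f : I -> R -> R) :
  (forall i, continuous (f i)) -> continuous (fun s => \sum_(i <- r) f i s).
Proof.
move=> cf; elim: r => [|i r IH].
  rewrite (_ : (fun s => _) = cst 0); first exact: cst_continuous.
  by apply/funext => s; rewrite big_nil.
rewrite (_ : (fun s => _) = f i \+ (fun s => \sum_(i <- r) f i s)).
  by move=> s; exact: (continuousD (cf i s) (IH s)).
by apply/funext => s; rewrite big_cons.
Qed.

(** The increment is the integral of the derivative along the segment; the Cauchy-Schwarz inequality
    is used once in the parameter [s] and once between [v] and the gradient. *)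
Let line_estimate phi x v t c : smooth phi -> 0 < t -> 0 <= c -> enorm v <= c ->
  (((phi (x + t *: v) - phi x) ^+ 2)%:E <= (t * c ^+ 2)%:E *
    \int[leb]_(s in `[0%R, t]) (D phi (x + s *: v)%R)%:E)%E.
Proof.
move=> sp t0 c0 vc.
pose f (s : R) := \sum_i v ord0 i * pd i phi (s *: v + x).
have cline : continuous (fun s : R => s *: v + x).
  move=> s; apply: (@continuousD _ _ _ (fun s : R => s *: v) (cst x)); last exact: cst_continuous.
  exact: scalel_continuous.
have cpd i : continuous (fun s : R => pd i phi (s *: v + x)).
  move=> s; apply: continuous_comp; first exact: cline.
  exact/smooth_continuous/smooth_pd.
have cf : continuous f.
  apply: continuous_sum => i s; apply: cvgM; [exact: cvg_cst|exact: cpd].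
have dF (s : R) : is_derive s 1 (fun s : R => phi (s *: v + x)) (f s).
  exact: ((is_derive_line phi x v s (f s)).1 (is_derive_smooth (s *: v + x) v sp)).
have FTC : \int[leb]_(s in `[0, t]) f s = phi (x + t *: v) - phi x.
  rewrite /Rintegral (@continuous_FTC2 _ _ (fun s : R => phi (s *: v + x)) 0 t)//.
  - by rewrite scale0r add0r [x + _]addrC.
  - exact: continuous_subspaceT.
  - have cF : continuous (fun s : R => phi (s *: v + x)).
      move=> s; apply: continuous_comp; first exact: cline.
      exact: smooth_continuous.
    split; first by move=> s _; have [] := dF s.
      by apply: cvg_at_right_filter; exact: cF.
    by apply: cvg_at_left_filter; exact: cF.
  - by move=> s _; rewrite derive1E; have [] := dF s.
have mI : measurable `[0, t]%classic by exact: measurable_itv.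
have Ic (g : R -> R) : continuous g -> leb.-integrable `[0, t] (EFin \o g).
  move=> cg; apply: continuous_compact_integrable; first exact: segment_compact.
  exact: continuous_subspaceT.
have cf2 : continuous (fun s => f s ^+ 2).
  by move=> s; under eq_fun do rewrite expr2; apply: cvgM; exact: cf.
have cD : continuous (fun s : R => D phi (x + s *: v)).
  apply: (@continuous_sum _ (index_enum 'I_n) (fun i (s : R) => pd i phi (x + s *: v) ^+ 2)) => i s.
  rewrite (_ : (fun s => _) = (fun s : R => pd i phi (s *: v + x)) \* (fun s => pd i phi (s *: v + x))).
    exact: (continuousM (cpd i s) (cpd i s)).
  by apply/funext => s'; rewrite addrC expr2.
set A := \int[leb]_(s in `[0, t]) f s in FTC.
have lt : fine (leb `[0, t]%classic) = t.
  by rewrite lebesgue_measure_itv /= lte_fin t0 sube0.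
(* The difference of the two sides is [t] times the integral of [(f - A/t)^2]. *)
have CS : A ^+ 2 <= t * \int[leb]_(s in `[0, t]) (f s ^+ 2).
  have cq : continuous (fun s => (2 * (A / t)) * f s).
    by move=> s; apply: cvgM; [exact: cvg_cst|exact: cf].
  have ccst (k : R) : continuous (fun _ : R => k) by move=> s; exact: cvg_cst.
  have -> : t * \int[leb]_(s in `[0, t]) (f s ^+ 2) = A ^+ 2 +
      t * \int[leb]_(s in `[0, t]) ((f s - A / t) ^+ 2).
    have -> : \int[leb]_(s in `[0, t]) ((f s - A / t) ^+ 2) =
        \int[leb]_(s in `[0, t]) (f s ^+ 2 - (2 * (A / t)) * f s + (A / t) ^+ 2).
      by apply: eq_Rintegral => s _; ring.
    rewrite RintegralD//; last 2 first.
    - apply: Ic => s; exact: (continuousB (cf2 s) (cq s)).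
    - exact: (Ic _ (ccst _)).
    rewrite RintegralB//; [|exact: Ic|exact: Ic].
    rewrite RintegralZl//; last exact: Ic.
    by rewrite -/A Rintegral_cst// lt; field; rewrite gt_eqF.
  by rewrite lerDl mulr_ge0 ?(ltW t0)//; apply: Rintegral_ge0 => s _; exact: sqr_ge0.
have Df s : f s ^+ 2 <= c ^+ 2 * D phi (x + s *: v).
  rewrite /f; apply: le_trans (sum_CS _ _) _; rewrite -enorm_sqr /D addrC.
  apply: ler_wpM2r; first by apply: sumr_ge0 => i _; exact: sqr_ge0.
  by rewrite ler_pXn2r ?nnegrE ?enorm_ge0.
have ID := Ic _ cD.
rewrite -FTC; apply: (@le_trans _ _ ((t * c ^+ 2) * \int[leb]_(s in `[0, t]) D phi (x + s *: v))%:E).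
  rewrite lee_fin; apply: (le_trans CS); rewrite -mulrA; apply: ler_wpM2l; first exact: ltW.
  have mI' : @measurable _ TR `[0, t]%classic := mI.
  rewrite -(RintegralZl (c ^+ 2) mI' ID); apply: (le_Rintegral mI' (Ic _ cf2)).
    by apply: Ic => s; exact: (continuousM (@cst_continuous _ _ (c ^+ 2) s) (cD s)).
  by move=> s _; exact: Df.
by rewrite EFinM /Rintegral fineK//; exact: integrable_fin_num.
Qed.

(** Stated for a field [e] whose shifts do not increase integrals, to cover constant fields
    (translations) and the radial field. The bound along each segment is integrated over [x], the
    orders are exchanged, and every shifted gradient integral is at most the unshifted one. *)
Lemma flow_estimate Omega phi (e : E -> E) (c t : R) : rtest Omega phi ->
  measurable_fun setT e -> 0 <= c -> (forall x, enorm (e x) <= c) -> 0 <= t ->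
  (forall s (F : E -> \bar R), 0 <= s -> measurable_fun setT F ->
    (forall x, 0 <= F x)%E ->
    (\int[lrow n]_x F (x + s *: e x)%R <= \int[lrow n]_x F x)%E) ->
  (\int[lrow n]_x ((phi (x + t *: e x) - phi x) ^+ 2)%:E <=
   (t ^+ 2 * c ^+ 2 * gnrm2 phi)%:E)%E.
Proof.
move=> tp me c0 ec; rewrite le_eqVlt => /predU1P[<-|t0] He.
  rewrite integral0_eq; first by rewrite expr0n/= !mul0r.
  by move=> x _; rewrite scale0r addr0 subrr expr0n.
have mD := measurable_D tp; have mp := rtest_measurable tp.
pose F (z : E * TR) : \bar R := (\1_`[0, t]%classic (z.2 : R) * D phi (z.1 + (z.2 : R) *: e z.1))%:E.
have D0 x : 0 <= D phi x by apply: sumr_ge0 => i _; exact: sqr_ge0.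
have mS : measurable_fun setT (fun z : E * TR => z.1 + (z.2 : R) *: e z.1).
  apply: measurable_rowD; first exact: measurable_fst.
  apply: measurable_rowZ; first exact: measurable_snd.
  exact: (measurableT_comp me).
have mF : measurable_fun setT F.
  apply/measurable_EFinP; apply: measurable_funM; last exact: (measurableT_comp mD).
  have m1 : measurable_fun setT (\1_`[0, t]%classic : TR -> R) by exact: measurable_indic.
  exact: (measurableT_comp m1 measurable_snd).
have F0 z : (0 <= F z)%E by rewrite lee_fin mulr_ge0.
have tc0 : (0 <= (t * c ^+ 2)%:E :> \bar R)%E by rewrite lee_fin mulr_ge0 ?sqr_ge0 ?(ltW t0).
apply: (@le_trans _ _ (\int[lrow n]_x ((t * c ^+ 2)%:E * \int[leb]_s F (x, s)))%E).
  apply: ge0_le_integral => //.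
  - by move=> x _; rewrite lee_fin sqr_ge0.
  - apply/measurable_EFinP; apply: measurable_funX; apply: measurable_funB => //.
    apply: (measurableT_comp mp); apply: measurable_rowD => //.
    exact: measurable_rowZ.
  - by apply: measurable_funeM; exact: (measurable_integral_snd leb mF F0).
  move=> x _; apply: le_trans (line_estimate x tp.1 t0 c0 (ec x)) _.
  apply: lee_wpmul2l => //; rewrite le_eqVlt; apply/orP; left; apply/eqP.
  rewrite integral_mkcond; apply: eq_integral => s _; rewrite /F /= patchE indicE.
  by case: ifPn => _; rewrite ?mul1r ?mul0r.
rewrite ge0_integralZl//; last 2 first.
- exact: (measurable_integral_snd leb mF F0).
- by move=> x _; exact: integral_ge0.
rewrite (fubini_tonelli _ mF F0).
rewrite (_ : t ^+ 2 * c ^+ 2 * gnrm2 phi = (t * c ^+ 2) * (t * gnrm2 phi)); last by ring.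
rewrite [leRHS]EFinM; apply: lee_wpmul2l => //.
apply: (@le_trans _ _ (\int[leb]_s ((gnrm2 phi)%:E * (\1_`[0, t]%classic (s : R))%:E))%E).
  apply: ge0_le_integral => //.
  - by move=> s _; exact: integral_ge0.
  - exact: (measurable_fun_fubini_tonelli_G F mF F0).
  - by apply: measurable_funeM; apply/measurable_EFinP; exact: measurable_indic.
  move=> s _; rewrite /F /= indicE; have [|] := boolP (s \in _); last first.
    by rewrite mule0 integral0_eq// => x _; rewrite mul0r.
  rewrite inE /= in_itv /= => /andP[s0 _]; rewrite mule1.
  under eq_integral do rewrite mul1r.
  apply: le_trans (He s (EFin \o D phi) s0 _ _) _ => //.
    exact/measurable_EFinP.
  by rewrite (integral_D tp).
rewrite ge0_integralZl//; last 2 first.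
- by apply/measurable_EFinP; exact: measurable_indic.
- by rewrite lee_fin gnrm2_ge0.
rewrite integral_indic//= ?setIT.
by rewrite lebesgue_measure_itv /= lte_fin t0 sube0 -EFinM mulrC.
Qed.

End TestFunctions.

(** * The fundamental lemma of the calculus of variations *)

Section FundamentalLemma.
Context {R : realType} {n : nat}.
Notation E := 'rV[R]_n.
Notation mu := (@lrow R n).
Implicit Types (a b : 'I_n -> R) (Omega : set E).

Definition obox a b : set E := [set x | forall i, a i < x ord0 i < b i].
Definition cbox a b : set E := [set x | forall i, x ord0 i \in `[a i, b i]].

Lemma compact_cbox a b : compact (cbox a b).
Proof.
have -> : cbox a b = [set v : E | forall i, `[a i, b i]%classic (v ord0 i)] by [].
by apply: (@rV_compact R n (fun i => `[a i, b i]%classic)) => i; exact: segment_compact.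
Qed.

Lemma obox_cbox a b : obox a b `<=` cbox a b.
Proof. by move=> x h i; rewrite in_itv /=; have /andP[/ltW -> /ltW ->] := h i. Qed.

Lemma oboxI a b a' b' : obox a b `&` obox a' b' =
  obox (fun i => Num.max (a i) (a' i)) (fun i => Num.min (b i) (b' i)).
Proof.
apply/seteqP; split => x /=.
  move=> [h h'] i; have /andP[h1 h2] := h i; have /andP[h3 h4] := h' i.
  by rewrite gt_max lt_min h1 h2 h3 h4.
by move=> h; split => i; have := h i;
  rewrite gt_max lt_min => /andP[/andP[h1 h2] /andP[h3 h4]];
  rewrite ?h1 ?h2 ?h3 ?h4.
Qed.

Lemma measurable_obox a b : measurable (obox a b).
Proof.
rewrite (_ : obox a b =
    \big[setI/setT]_(i < n) ((fun x : E => x ord0 i) @^-1` `]a i, b i[)).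
  apply: bigsetI_measurable => i _; rewrite -[X in measurable X]setTI.
  exact: measurable_coord.
apply/seteqP; split => x /=.
  by move=> H; rewrite -bigcap_seq => i _ /=; rewrite in_itv; exact: H.
rewrite -bigcap_seq => + i => /(_ i) /=; rewrite in_itv; apply.
by rewrite mem_index_enum.
Qed.

Lemma smooth_prod (I : eqType) (s : seq I) (f : I -> E -> R) :
  (forall i, smooth (f i)) -> smooth (fun x => \prod_(i <- s) f i x).
Proof.
move=> sf; elim: s => [|i s IH].
  rewrite (_ : (fun x => _) = cst 1); first exact: smooth_cst.
  by apply/funext => x; rewrite big_nil.
rewrite (_ : (fun x => _) = f i * (fun x => \prod_(i <- s) f i x)).
  exact: smoothM.
by apply/funext => x; rewrite big_cons.
Qed.

Lemma smooth_flat (f : E -> R) : smooth f -> smooth (flat \o f).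
Proof.
move=> sf; have [F F0 dF] := @flat_tower R; rewrite -F0.
exact: (smooth_comp 0 dF).
Qed.

(** A product of flat functions is a smooth [psi] positive exactly on the open box;
    [1 - exp (- k psi)] then tends to the indicator and stays between 0 and it. *)
Lemma box_test Omega a b : cbox a b `<=` Omega ->
  exists2 phi : nat -> E -> R, forall k, rtest Omega (phi k) &
    (forall k x, 0 <= phi k x <= \1_(obox a b) x) /\
    forall x, phi k x @[k --> \oo] --> (\1_(obox a b) x : R).
Proof.
move=> abO.
pose psi (x : E) : R := \prod_(i <- index_enum 'I_n)
  (flat (x ord0 i - a i) * flat (b i - x ord0 i)).
have psi0 x : 0 <= psi x.
  by apply: prodr_ge0 => i _; rewrite mulr_ge0// flat_ge0.
have psi_out x : ~ obox a b x -> psi x = 0.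
  move=> /existsNP[i /negP]; rewrite negb_and -!leNgt => h.
  rewrite /psi (bigD1_seq i) ?mem_index_enum ?index_enum_uniq//=.
  by case/orP: h => h; [rewrite flat_eq0 ?mul0r ?subr_le0|
    rewrite [X in _ * X * _]flat_eq0 ?mulr0 ?mul0r ?subr_le0].
have psi_in x : obox a b x -> 0 < psi x.
  move=> h; apply: prodr_gt0 => i _; have /andP[h1 h2] := h i.
  by rewrite mulr_gt0// flat_gt0 ?subr_gt0.
have spsi : smooth psi.
  apply: (smooth_prod _ (f := fun i x => flat (x ord0 i - a i) * flat (b i - x ord0 i))) => i.
  apply: (@smoothM _ _ (fun x : E => flat (x ord0 i - a i)) (fun x => flat (b i - x ord0 i))).
    apply: (smooth_flat (f := fun x : E => x ord0 i - a i)).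
    by apply: (@smoothD _ _ (fun x : E => x ord0 i) (cst (- a i)));
      [exact: smooth_coord|exact: smooth_cst].
  apply: (smooth_flat (f := fun x : E => b i - x ord0 i)).
  apply: (@smoothD _ _ (cst (b i)) (- (fun x : E => x ord0 i))); first exact: smooth_cst.
  by apply: smoothN; exact: smooth_coord.
exists (fun k x => 1 - expR (- (k%:R * psi x))).
  move=> k; split.
    apply: (@smoothD _ _ (cst 1) (- (fun x => expR (- (k%:R * psi x))))); first exact: smooth_cst.
    apply: smoothN; apply: (@smooth_comp _ _ (fun _ => expR) 0 (fun x => - (k%:R * psi x))).
      apply: (@smoothN _ _ (fun x => k%:R * psi x)).
      exact: (@smoothZ _ _ (k%:R) psi).
  exists (cbox a b); split => //; first exact: (@compact_cbox a b).
  move=> x hx; rewrite psi_out ?mulr0 ?oppr0 ?expR0 ?subrr//.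
  by move=> /obox_cbox.
split=> [k x|x].
  have [hx|hx] := pselect (obox a b x).
    rewrite indicE mem_set// subr_ge0 lerBlDr lerDl expR_ge0 andbT.
    by rewrite -(expR0 R) ler_expR oppr_le0 mulr_ge0.
  by rewrite psi_out// mulr0 oppr0 expR0 subrr lexx /= indicE ler0n.
have [hx|hx] := pselect (obox a b x); last first.
  rewrite indicE memNset//; under eq_fun do rewrite psi_out// mulr0 oppr0 expR0 subrr.
  exact: cvg_cst.
rewrite indicE mem_set// -[X in _ --> X]subr0; apply: cvgB; first exact: cvg_cst.
have p0 := psi_in _ hx.
apply/cvgrPdist_lt => e e0.
(* Beyond this index [k psi > 1/e], and [exp (- k psi)] is at most [1 / (1 + k psi)]. *)
exists (Num.truncn (e^-1 / psi x)).+1 => // k /= hk.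
rewrite sub0r normrN ger0_norm ?expR_ge0// expRN.
rewrite -[ltRHS]invrK ltf_pV2 ?posrE ?expR_gt0 ?invr_gt0//.
apply: (@lt_le_trans _ _ (1 + k%:R * psi x)); last exact: expR_ge1Dx.
rewrite ltr_wpDl// -ltr_pdivrMr// (lt_le_trans (truncnS_gt _))// ler_nat.
exact: hk.
Qed.

Let G : set (set E) := [set A | exists a b, A = obox a b].

Let GI : setI_closed G.
Proof. by move=> _ _ [a [b ->]] [a' [b' ->]]; rewrite oboxI; do 2 eexists. Qed.

(** Half-spaces generate the sigma-algebra, and each is a union of boxes whose other sides grow to
    the whole line. *)
Let measurable_G : measurable `<=` <<s G >>.
Proof.
pose T' := g_sigma_algebraType G.
have mid : measurable_fun setT (id : T' -> E).
  apply/measurable_rowP => i mD.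
  apply: (measurability _ (RGenOInfty.measurableE R)) => //.
  move=> /= _ [_ [r ->] <-]; rewrite setTI.
  rewrite (_ : _ @^-1` _ = \bigcup_k (obox (fun j => if j == i then r else - k%:R)
      (fun j => k%:R + (if j == i then r else 0)) : set E)); last first.
    apply/seteqP; split => x /=.
      rewrite in_itv /= andbT => rx.
      pose M : R := `|x ord0 i - r| + \sum_j `|x ord0 j|.
      exists (Num.truncn M).+1 => // j; have kM := truncnS_gt M.
      have xM : `|x ord0 j| <= M.
        by rewrite /M (bigD1 j)//= addrCA lerDl addr_ge0// sumr_ge0.
      case: eqP => [->|_].
        rewrite rx /= addrC -ltrBlDl (le_lt_trans _ kM)//.
        by rewrite (le_trans (ler_norm _))// lerDl sumr_ge0.
      by rewrite addr0 -ltr_norml (le_lt_trans _ kM).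
    move=> [k _ /(_ i)]; rewrite eqxx => /andP[h _].
    by rewrite in_itv /= h.
  apply: (@bigcupT_measurable _ T') => k; apply: sub_sigma_algebra.
  by do 2 eexists.
by move=> A mA; have := mid measurableT A mA; rewrite setTI.
Qed.

(** Dynkin's theorem: the sets [A] with vanishing integral of [g] over [A] cut by [B] form a Dynkin
    system containing the boxes, which are closed under intersection. Finiteness of the measure of
    [B] gives the complements and the dominated limit over disjoint unions. *)
Lemma ip_indic_eq0 (g : E -> R) (B A : set E) : L2 mu g -> measurable B ->
  (mu B < +oo)%E -> (forall a b, ip mu g (\1_(obox a b `&` B)) = 0) ->
  ip mu g (\1_B) = 0 -> measurable A -> ip mu g (\1_(A `&` B)) = 0.
Proof.
move=> lg mB By Hbox HB mA.
have muS (C : set E) : measurable C -> (mu (C `&` B) < +oo)%E.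
  move=> mC; apply: le_lt_trans By; apply: le_measure; rewrite ?inE//.
  exact: measurableI.
have lI C : measurable C -> L2 mu (\1_(C `&` B)).
  by move=> mC; apply: L2_indic; [exact: measurableI|exact: muS].
pose H : set (set E) := [set C | measurable C /\ ip mu g (\1_(C `&` B)) = 0].
suff : <<s G >> `<=` H by move=> /(_ A (measurable_G mA))[].
rewrite -(setI_closed_g_dynkin_g_sigma_algebra GI).
apply: smallest_sub; last first.
  by move=> _ [a [b ->]]; split; [exact: measurable_obox|exact: Hbox].
split.
- by split => //; rewrite setTI.
- move=> C [mC HC]; split; first exact: measurableC.
  have -> : \1_(~` C `&` B) = (\1_B - \1_(C `&` B) : E -> R).
    apply/funext => x; rewrite [RHS](_ : _ = \1_B x - \1_(C `&` B) x)// !indicE !in_setI in_setC.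
    by case: (x \in C); case: (x \in B) => /=; rewrite ?subrr ?subr0.
  rewrite (bilBr (L2_submodule mu) (ip_bilinear mu))//.
  + by rewrite HB HC subrr.
  + by have := lI _ measurableT; rewrite setTI.
  + exact: lI.
- move=> F tF HF; split; first by apply: bigcupT_measurable => k; case: (HF k).
  have mF k : measurable (F k) by case: (HF k).
  have mU : measurable (\bigcup_k F k) by exact: bigcupT_measurable.
  pose S k : E -> R := \1_((\big[setU/set0]_(i < k) F i) `&` B).
  have mS k : measurable (\big[setU/set0]_(i < k) F i) by exact: bigsetU_measurable.
  have S0 k : ip mu g (S k) = 0.
    elim: k => [|k IH].
      rewrite (_ : S 0%N = 0 *: (0 : E -> R)); last first.
        by rewrite scale0r /S big_ord0 set0I indic0.
      by rewrite (bilZr (ip_bilinear mu)) ?mul0r//; exact: L2_0.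
    rewrite (_ : S k.+1 = S k + \1_(F k `&` B)).
      rewrite (bilDr (ip_bilinear mu))//; [|exact: lI|exact: lI].
      by rewrite IH; case: (HF k) => _ ->; rewrite addr0.
    apply/funext => x; rewrite [RHS](_ : _ = S k x + \1_(F k `&` B) x)//.
    rewrite /S big_ord_recr /= setIUl !indicE in_setU.
    case: (boolP (x \in F k `&` B)) => [|_]; last by rewrite orbF addr0.
    rewrite inE => -[Fx Bx]; rewrite orbT memNset ?add0r//.
    rewrite -bigcup_mkord => -[[j /= jk Fj] _].
    have : (F j `&` F k) !=set0 by exists x.
    by move=> /tF => /(_ I I) jk'; move: jk; rewrite jk' ltnn.
  have cS : nrm mu (S k - \1_(\bigcup_k F k `&` B)) @[k --> \oo] --> 0.
    apply: (cvg_nrm_dominated (g := \1_B)).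
    + by move=> k; exact: L2_meas (lI _ (mS k)).
    + exact: L2_meas (lI _ mU).
    + by have := lI _ measurableT; rewrite setTI.
    + move=> k x; rewrite /S !indicE !in_setI; case: (x \in B); rewrite ?andbT ?andbF ?subrr ?normr0//.
      by case: (_ \in _); case: (_ \in _); rewrite ?subrr ?subr0 ?sub0r ?normrN ?normr0 ?normr1.
    + move=> x; apply: (@cvg_trans _ (cst (\1_(\bigcup_k F k `&` B) x : R) @ \oo)); last exact: cvg_cst.
      apply: near_eq_cvg; have [[j _ Fj]|nF] := pselect ((\bigcup_k F k) x).
        apply: (filterS _ (nbhs_infty_gt j)) => k /= jk.
        have h1 : x \in \bigcup_k F k by rewrite inE; exists j.
        have h2 : x \in \big[setU/set0]_(i < k) F i.
          by rewrite inE -bigcup_mkord; exists j.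
        by rewrite /S !indicE !in_setI h1 h2.
      apply: nearW => k; have h1 : x \in \bigcup_k F k = false by exact: memNset.
      have h2 : x \in \big[setU/set0]_(i < k) F i = false.
        by apply: memNset; rewrite -bigcup_mkord => -[j _ Fj]; apply: nF; exists j.
      by rewrite /S !indicE !in_setI h1 h2.
  have le k : `|ip mu g (\1_(\bigcup_k F k `&` B))| <= nrm mu g * nrm mu (S k - \1_(\bigcup_k F k `&` B)).
    apply: le_trans (ip_CS lg _); last by apply: L2B; exact: lI.
    rewrite (bilBr (L2_submodule mu) (ip_bilinear mu))//; [|exact: lI|exact: lI].
    by rewrite S0 sub0r normrN.
  apply/eqP; rewrite -normr_le0.
  have c : nrm mu g * nrm mu (S k - \1_(\bigcup_k F k `&` B)) @[k --> \oo] --> nrm mu g * 0.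
    by apply: cvgM; [exact: cvg_cst|exact: cS].
  rewrite -(mulr0 (nrm mu g)) -(cvg_lim _ c)//.
  by apply: limr_ge; [exact: cvgP c|exact: nearW].
Qed.

Lemma flcv_box Omega (g : E -> R) a b : L2 mu g ->
  (forall phi, rtest Omega phi -> ip mu g phi = 0) -> cbox a b `<=` Omega ->
  ip mu g (\1_(obox a b)) = 0.
Proof.
move=> lg Hg abO; have [phi tphi [phi01 cphi]] := box_test abO.
have lI : L2 mu (\1_(obox a b)).
  apply: L2_indic; first exact: measurable_obox.
  have [r r0 Hr] := compact_cube (@compact_cbox a b).
  apply: le_lt_trans (lrow_cube_lty r); apply: le_measure; rewrite ?inE.
  - exact: measurable_obox.
  - exact: measurable_cube.
  - by apply: subset_trans Hr; exact: obox_cbox.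
have c0 : nrm mu (phi k - \1_(obox a b)) @[k --> \oo] --> 0.
  apply: (cvg_nrm_dominated (g := \1_(obox a b))) => //.
  - by move=> k; exact: rtest_measurable (tphi k).
  - exact: L2_meas lI.
  - move=> k x; have /andP[h1 h2] := phi01 k x.
    by rewrite distrC ger0_norm ?subr_ge0// lerBlDr lerDl.
have le k : `|ip mu g (\1_(obox a b))| <= nrm mu g * nrm mu (phi k - \1_(obox a b)).
  have lp := rtest_L2 (tphi k).
  apply: le_trans (ip_CS lg _); last exact: L2B.
  rewrite (bilBr (L2_submodule mu) (ip_bilinear mu))//.
  by rewrite (Hg _ (tphi k)) sub0r normrN.
apply/eqP; rewrite -normr_le0.
have c : nrm mu g * nrm mu (phi k - \1_(obox a b)) @[k --> \oo] --> nrm mu g * 0.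
  by apply: cvgM; [exact: cvg_cst|exact: c0].
rewrite -(mulr0 (nrm mu g)) -(cvg_lim _ c)//.
by apply: limr_ge; [exact: cvgP c|exact: nearW].
Qed.

Lemma flcv_box_ae Omega (g : E -> R) a b : L2 mu g ->
  (forall phi, rtest Omega phi -> ip mu g phi = 0) -> cbox a b `<=` Omega ->
  {ae mu, forall x, obox a b x -> g x = 0}.
Proof.
move=> lg Hg abO; have mg := L2_meas lg; set B := obox a b.
have mB : measurable B by exact: measurable_obox.
have By : (mu B < +oo)%E.
  have [r r0 Hr] := compact_cube (@compact_cbox a b).
  apply: le_lt_trans (lrow_cube_lty r); apply: le_measure; rewrite ?inE//.
  - exact: measurable_cube.
  - by apply: subset_trans Hr; exact: obox_cbox.
have HA A : measurable A -> ip mu g (\1_(A `&` B)) = 0.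
  apply: ip_indic_eq0 => //; last exact: flcv_box abO.
  move=> a' b'; rewrite oboxI; apply: (flcv_box lg Hg).
  apply: subset_trans abO => x h i; have := h i; rewrite !in_itv /=.
  by rewrite ge_max le_min => /andP[/andP[_ ->] /andP[_ ->]].
pose A0 := [set x | 0 <= g x].
have mA0 : measurable A0.
  have := @measurable_fun_ler _ _ _ setT (cst 0) g (measurable_cst _) mg measurableT [set true].
  by rewrite setTI; exact.
have lI C : measurable C -> L2 mu (\1_(C `&` B)).
  move=> mC; apply: L2_indic; first exact: measurableI.
  by apply: le_lt_trans By; apply: le_measure; rewrite ?inE//; exact: measurableI.
(* The sign of [g] on the box: pairing [g] with it gives the integral of [|g|] over the box. *)
pose h : E -> R := \1_(A0 `&` B) - \1_(~` A0 `&` B).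
have lh : L2 mu h by apply: L2B; apply: lI => //; exact: measurableC.
have gh x : g x * h x = `|g x| * \1_B x.
  rewrite /h [(_ - _ : E -> R) x](_ : _ = \1_(A0 `&` B) x - \1_(~` A0 `&` B) x)//.
  rewrite !indicE !in_setI in_setC; have [|] := boolP (x \in A0); rewrite ?inE ?notin_setE /A0 /=.
    by move=> h0; rewrite subr0 ger0_norm.
  by move=> /negP; rewrite -ltNge => h0; rewrite sub0r ltr0_norm// mulrN mulNr.
have : ip mu g h = 0.
  rewrite (bilBr (L2_submodule mu) (ip_bilinear mu))//; try by apply: lI => //; exact: measurableC.
  by rewrite !HA ?subrr//; exact: measurableC.
rewrite /ip; under eq_Rintegral do rewrite gh.
move=> H0.
have Igh : mu.-integrable setT (EFin \o (fun x => `|g x| * \1_B x)).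
  by apply: eq_integrable (L2_integrableM lg lh) => // x _ /=; rewrite gh.
have : (\int[mu]_x `|(`|g x| * \1_B x)%:E| = 0)%E.
  under eq_integral do rewrite gee0_abs ?lee_fin ?mulr_ge0//.
  have /fineK <- := integrable_fin_num measurableT Igh.
  by move: H0; rewrite /Rintegral => ->.
move=> /(ae_eq_integral_abs mu measurableT (measurable_int mu Igh)).1.
apply: filterS => x /(_ I) /= + Bx; rewrite indicE mem_set// mulr1 => -[] /eqP.
by rewrite normr_eq0 => /eqP.
Qed.

(** The box version yields a null set for each box; countably many rational boxes cover the open
    set, and the union of their null sets is null. *)
Lemma flcv Omega (g : E -> R) : open Omega -> L2 mu g ->
  (forall phi, rtest Omega phi -> ip mu g phi = 0) ->
  {ae mu, forall x, Omega x -> g x = 0}.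
Proof.
move=> oO lg Hg.
pose lo (z : 'rV[rat]_n * nat) (i : 'I_n) : R := ratr (z.1 ord0 i) - z.2.+1%:R^-1.
pose hi (z : 'rV[rat]_n * nat) (i : 'I_n) : R := ratr (z.1 ord0 i) + z.2.+1%:R^-1.
have H (z : 'rV[rat]_n * nat) : {ae mu, forall x, cbox (lo z) (hi z) `<=` Omega ->
    obox (lo z) (hi z) x -> g x = 0}.
  have [cz|cz] := pselect (cbox (lo z) (hi z) `<=` Omega).
    by apply: filterS (flcv_box_ae lg Hg cz) => x + _.
  by apply: aeW => x /cz.
(* Boxes are enumerated through [unpickle], so that one null set serves all of them. *)
have Hall : {ae mu, forall x, forall k, forall z, unpickle k = Some z ->
    cbox (lo z) (hi z) `<=` Omega -> obox (lo z) (hi z) x -> g x = 0}.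
  apply/ae_foralln => k; case: (unpickle k) => [z|]; last by apply: aeW => x z.
  by apply: filterS (H z) => x h _ [<-].
apply: filterS Hall => x Hx Ox.
have : nbhs x Omega by move: oO; rewrite openE => /(_ _ Ox).
move=> /nbhs_ballP[e /= e0 eO].
pose k := Num.truncn (2 / e).
have k0 : (k.+1%:R^-1 : R) < e / 2.
  rewrite invf_plt ?posrE ?divr_gt0//; last first.
  by rewrite invf_div; exact: truncnS_gt.
have qex i : {q : rat | `|ratr q - x ord0 i| < (k.+1%:R^-1 : R)}.
  apply: cid; have : x ord0 i - k.+1%:R^-1 < x ord0 i + k.+1%:R^-1.
    by rewrite ltrD2l gtrN// invr_gt0.
  move=> /rat_in_itvoo[q]; rewrite in_itv /= => /andP[q1 q2]; exists q.
  by rewrite ltr_norml ltrBrDr ltrBlDr addrC q1 addrC.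
pose z := (\row_i sval (qex i), k).
have key (q X Y l r : R) : - l < q - X -> q - X < l -> q - l <= Y -> Y <= q + l ->
    l < r / 2 -> `|X - Y| < r.
  by move=> h1 h2 h3 h4 h5; rewrite ltr_norml; apply/andP; split; lra.
apply: (Hx (pickle z) z); first exact: pickleK.
  move=> y yz; apply: eO; split => // i0 j; rewrite (ord1 i0) /ball /=.
  have := yz j; rewrite in_itv /= /lo /hi !mxE => /andP[y1 y2].
  have := svalP (qex j) => /= h; move: h y1 y2 k0.
  rewrite /z /= ltr_norml => /andP[h1 h2] y1 y2 k0.
  apply: (key _ _ _ _ _ h1 h2 y1 y2 k0).
move=> i; rewrite /lo /hi !mxE; have := svalP (qex i) => /=.
have key2 (q X l : R) : `|q - X| < l -> q - l < X < q + l.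
  by rewrite ltr_norml => /andP[h1 h2]; apply/andP; split; lra.
exact: key2.
Qed.

End FundamentalLemma.

(** * The fractional operator along rays *)

Section Nonlocal.
Context {R : realType} {n : nat}.
Notation E := 'rV[R]_n.
Notation leb := (@lebesgue_measure R).
Notation TR := (measurableTypeR R).
Notation mu := (@lrow R n).
Implicit Types (g u v y : E -> R) (t : R) (A : set TR) (Omega : set E).

Definition ray_dif (P : E) g (z : E * TR) : R :=
  g z.1 - g (z.1 + (z.2 : R) *: direction P z.1).
Definition ray_ker (alpha : R) (t : TR) : R :=
  if 0 < (t : R) then (t : R) `^ (- alpha - 1) else 0.
(** The growth in [t] of the norm of a shift difference of [q u]: order [t^lambda] near 0, as [q] is
    only Hölder continuous, and bounded for large [t], where the two terms are estimated
    separately. *)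
Definition lip_bnd (lambda : R) (t : TR) : R := Num.min ((t : R) `^ lambda) 1.
Definition cut_ker alpha A (t : TR) : R := \1_A t * ray_ker alpha t.
(* With [A = `[eps, +oo[] this is the truncated right-side derivative of [g], up
   to the factor [alpha / Gamma (1 - alpha)], when [g] vanishes off [Omega]. *)
Definition frac_op P alpha A g := param_int (ray_dif P g) (cut_ker alpha A).

(* What is kept of [u] in H^1_0 with norm at most [N]: this is stable under
   limits in L2. *)
Definition slope_on Omega P u N := [/\ L2 mu u, nrm mu u <= N,
  (forall x, ~ Omega x -> u x = 0) &
  forall t, 0 < t -> nrm mu (fun x => ray_dif P u (x, t)) <= t * N].

(** What the rays need from convexity and from [p]: a ray that has left the domain does not return
    ([nl_ray]), and [q], standing for [p] extended by 0, is controlled only between points of the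
    domain ([nl_lip]), since it jumps across the boundary. *)
Record nonlocal_setting (Omega : set E) (P : E) (alpha lambda : R) (q : E -> R)
    (Q0 M pmin diam : R) : Prop := NonlocalSetting {
  nl_n0 : (0 < n)%N;
  nl_mO : measurable Omega;
  nl_fin : (mu Omega < +oo)%E;
  nl_alpha0 : 0 < alpha;
  nl_alpha1 : alpha < lambda;
  nl_lambda1 : lambda <= 1;
  nl_mq : measurable_fun setT q;
  nl_q_out : forall x, ~ Omega x -> q x = 0;
  nl_q_ge0 : forall x, 0 <= q x;
  nl_q_le : forall x, q x <= Q0;
  nl_pmin : 0 < pmin;
  nl_q_min : forall x, Omega x -> pmin <= q x;
  nl_M0 : 0 <= M;
  nl_ray : forall x t, 0 <= t -> Omega (x + t *: direction P x) -> Omega x;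
  nl_lip : forall x t, 0 < t -> Omega (x + t *: direction P x) ->
    `|q x - q (x + t *: direction P x)| <= M * lip_bnd lambda t;
  nl_diam0 : 0 < diam;
  nl_diam : forall x, Omega x -> enorm (x - P) <= diam }.

Variables (Omega : set E) (P : E) (alpha lambda : R) (q : E -> R) (Q0 M pmin diam : R).
Hypothesis Hnl : nonlocal_setting Omega P alpha lambda q Q0 M pmin diam.
Let n0 := nl_n0 Hnl.
Let mO := nl_mO Hnl.
Let fO := nl_fin Hnl.
Let alpha0 := nl_alpha0 Hnl.
Let alpha1 := nl_alpha1 Hnl.
Let lambda1 := nl_lambda1 Hnl.
Let mq := nl_mq Hnl.
Let q_out := nl_q_out Hnl.
Let q_ge0 := nl_q_ge0 Hnl.
Let q_le := nl_q_le Hnl.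
Let p0 := ltW (nl_pmin Hnl).
Let pq := nl_q_min Hnl.
Let M0 := nl_M0 Hnl.
Let ray_in := nl_ray Hnl.
Let q_lip := nl_lip Hnl.
Let d0 := nl_diam0 Hnl.
Let dO := nl_diam Hnl.
Local Notation dif := (ray_dif P).
Local Notation ker := (ray_ker alpha).
Local Notation bnd := (lip_bnd lambda).
Local Notation kerA := (cut_ker alpha).
Local Notation Wop := (frac_op P alpha).
Local Notation slope := (slope_on Omega P).

Let Q00 : 0 <= Q0. Proof. exact: le_trans (q_ge0 0) (q_le 0). Qed.

Lemma measurable_ray d (T : measurableType d) (f : T -> E) (k : T -> R) :
  measurable_fun setT f -> measurable_fun setT k ->
  measurable_fun setT (fun z => f z + k z *: direction P (f z)).
Proof.
move=> mf mk; apply: measurable_rowD => //; apply: measurable_rowZ => //.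
exact: (measurableT_comp (measurable_direction P)).
Qed.

Lemma measurable_shift g t : measurable_fun setT g ->
  measurable_fun setT (fun x : E => g (x + t *: direction P x)).
Proof. by move=> mg; apply: (measurableT_comp mg); exact: measurable_ray. Qed.

Lemma measurable_dif g : measurable_fun setT g -> measurable_fun setT (dif g).
Proof.
move=> mg; apply: measurable_funB; first exact: (measurableT_comp mg).
apply: (measurableT_comp mg); apply: measurable_ray; first exact: measurable_fst.
exact: measurable_snd.
Qed.

Lemma measurable_ker : measurable_fun setT ker.
Proof.
apply: measurable_fun_ifT => //; first by apply: measurable_fun_ltr.
Qed.

Lemma measurable_bnd : measurable_fun setT bnd.
Proof. by apply: measurable_minr => //; exact: measurable_powR. Qed.

Lemma measurable_kerA A : measurable A -> measurable_fun setT (kerA A).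
Proof.
by move=> mA; apply: measurable_funM; [exact: measurable_indic|exact: measurable_ker].
Qed.

Lemma ker_ge0 t : 0 <= ker t.
Proof. by rewrite /ker; case: ifP => // _; exact: powR_ge0. Qed.

Lemma kerA_ge0 A t : 0 <= kerA A t.
Proof. by rewrite mulr_ge0// ker_ge0. Qed.

Lemma kerA_neq0 A t : kerA A t != 0 -> 0 < t.
Proof.
by rewrite /kerA /ker; case: ifP => // _; rewrite mulr0 eqxx.
Qed.

Lemma bnd_gt0 t : 0 < t -> 0 < bnd t.
Proof. by move=> t0; rewrite lt_min powR_gt0// ltr01. Qed.

Lemma bnd_ge0 t : 0 <= bnd t.
Proof. by rewrite le_min powR_ge0 ler01. Qed.

(** The integral of [t^(lambda - alpha - 1)] over []0, 1]] plus that of [t^(- alpha - 1)] over [[1,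
    +oo[]; the first is finite because [alpha < lambda]. *)
Definition bndI := (lambda - alpha)^-1 + alpha^-1.

Lemma bndI_gt0 : 0 < bndI.
Proof. by rewrite addr_gt0 ?invr_gt0 ?subr_gt0. Qed.

Lemma bnd_ker_small t : 0 < t -> bnd t * ker t <= t `^ (lambda - alpha - 1).
Proof.
move=> t0; rewrite /ker t0; apply: (@le_trans _ _ (t `^ lambda * t `^ (- alpha - 1))).
  by apply: ler_wpM2r; [exact: powR_ge0|rewrite ge_min lexx].
by rewrite -powRD; [rewrite addrA|rewrite (gt_eqF t0) implybT].
Qed.

Lemma bnd_ker_large t : 0 < t -> bnd t * ker t <= t `^ (- alpha - 1).
Proof.
move=> t0; rewrite /ker t0 -[leRHS]mul1r.
by apply: ler_wpM2r; [exact: powR_ge0|rewrite ge_min lexx orbT].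
Qed.

(** For [r = 1] half of the bound [bndI]; for [r = eps] the rate at which the truncated derivatives
    converge. *)
Lemma integral_bnd_near r : 0 < r ->
  (\int[leb]_t (bnd t * kerA `]-oo, r] t)%:E <=
   (r `^ (lambda - alpha) / (lambda - alpha))%:E)%E.
Proof.
move=> r0; apply: le_trans (integral_powR_head_le _ r0); last by rewrite subr_gt0.
rewrite [leRHS]integral_mkcond; apply: ge0_le_integral => //.
- by move=> t _; rewrite lee_fin mulr_ge0 ?bnd_ge0 ?kerA_ge0.
- apply/measurable_EFinP; apply: measurable_funM; first exact: measurable_bnd.
  by apply: measurable_kerA; exact: measurable_itv.
- apply/(measurable_restrictT _ _).1 => //; apply/measurable_EFinP.
  by apply: measurable_funTS; exact: measurable_powR.
move=> t _; rewrite patchE /kerA indicE.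
have [t0|t0] := ltP 0 (t : R); last by rewrite /ker ltNge t0/= !mulr0; case: ifP => // _; rewrite lee_fin powR_ge0.
have [tr|tr] := leP (t : R) r.
  rewrite !mem_set/= ?in_itv/= ?t0// mul1r lee_fin; exact: bnd_ker_small.
rewrite (@memNset _ `]-oo, r]%classic) ?mul0r ?mulr0; last by rewrite /= in_itv /= leNgt tr.
by case: ifP => // _; rewrite lee_fin powR_ge0.
Qed.

Lemma integral_bnd A : measurable A ->
  (\int[leb]_t (bnd t * kerA A t)%:E <= bndI%:E)%E.
Proof.
move=> mA; rewrite EFinD.
have mb C : measurable C -> measurable_fun setT (fun t => (bnd t * kerA C t)%:E).
  move=> mC; apply/measurable_EFinP; apply: measurable_funM; first exact: measurable_bnd.
  exact: measurable_kerA.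
have b0 C t : (0 <= (bnd t * kerA C t)%:E)%E by rewrite lee_fin mulr_ge0 ?bnd_ge0 ?kerA_ge0.
apply: (@le_trans _ _ (\int[leb]_t ((bnd t * kerA `]-oo, 1] t)%:E +
                        (bnd t * kerA `[1, +oo[ t)%:E))%E).
  apply: ge0_le_integral => //; [exact: mb| |].
  - by apply: emeasurable_funD; apply: mb; exact: measurable_itv.
  move=> t _; rewrite -EFinD lee_fin -mulrDr; apply: ler_wpM2l; first exact: bnd_ge0.
  rewrite -mulrDl; apply: ler_wpM2r; first exact: ker_ge0.
  rewrite !indicE; have [t1|t1] := leP (t : R) 1.
    by rewrite [t \in `]-oo, _]%classic]mem_set ?ler_wpDr// ?lern1 ?leq_b1// /= in_itv.
  by rewrite [t \in `[_, +oo[%classic]mem_set ?ler_wpDl// ?lern1 ?leq_b1// /= in_itv /= (ltW t1).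
rewrite ge0_integralD//; [|by apply: mb; exact: measurable_itv..].
apply: leeD.
  by apply: le_trans (integral_bnd_near ltr01) _; rewrite powR1 mul1r.
have := integral_powR_tail alpha0 (@ltr01 R); rewrite powR1 mul1r => <-.
rewrite [leRHS]integral_mkcond; apply: ge0_le_integral => //.
- by apply: mb; exact: measurable_itv.
- apply/(measurable_restrictT _ _).1 => //; apply/measurable_EFinP.
  by apply: measurable_funTS; exact: measurable_powR.
move=> t _; rewrite patchE /kerA indicE; case: ifPn => [|_]; last by rewrite mul0r mulr0.
rewrite inE /= in_itv /= andbT => t1; rewrite mul1r lee_fin.
by apply: bnd_ker_large; exact: lt_le_trans t1.
Qed.

Lemma shift_le_integral (F : E -> \bar R) t : 0 <= t -> measurable_fun setT F ->
  (forall x, 0 <= F x)%E ->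
  (\int[mu]_x F (x + t *: direction P x)%R <= \int[mu]_x F x)%E.
Proof.
move=> t0 mF F0; apply: le_trans (shift_le n0 P t0 mF F0) _.
apply: ge0_le_integral => //.
- by move=> x _; rewrite mule_ge0// lee_fin ler0n.
- apply: emeasurable_funM => //; apply/measurable_EFinP.
  rewrite (_ : (fun x : E => _) = fun x => if t < enorm (x - P) then 1 else 0).
    apply: measurable_fun_ifT => //; apply: measurable_fun_ltr => //.
    apply: (measurableT_comp measurable_enorm).
    exact: (measurable_rowD (g := cst (- P))).
  by apply/funext => x; case: ifP.
by move=> x _; rewrite -[leRHS]mul1e; apply: lee_wpmul2r => //; rewrite lee_fin lern1 leq_b1.
Qed.

Lemma L2_shift g t : 0 <= t -> L2 mu g ->
  L2 mu (fun x : E => g (x + t *: direction P x)) /\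
  nrm mu (fun x : E => g (x + t *: direction P x)) <= nrm mu g.
Proof.
move=> t0 lg; have mg := L2_meas lg.
apply: L2_nrm_le; [exact: nrm_ge0|exact: measurable_shift|].
rewrite nrm_sqrE//; apply: (shift_le_integral (F := fun x => (g x ^+ 2)%:E)) => //.
  by apply/measurable_EFinP; exact: measurable_funX.
by move=> x; rewrite lee_fin sqr_ge0.
Qed.

(** [flow_estimate] for the radial field, whose shifts contract integrals by [shift_le] and whose
    length is at most 1, being 0 at [P]. *)
Lemma slope_rtest phi : rtest Omega phi ->
  slope phi (Num.sqrt (ip mu phi phi + gnrm2 phi)).
Proof.
move=> tp; have lp := rtest_L2 tp; split => //.
- by rewrite ler_wsqrtr// lerDl gnrm2_ge0.
- move=> x Ox; case: tp => _ [K [_ KO Kx]]; by apply: Kx => /KO.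
- move=> t t0; have t0' := ltW t0.
  have := flow_estimate tp (measurable_direction P) ler01 _ t0' _.
  have dir1 x : enorm (direction P x) <= 1.
    have [->|xP] := eqVneq x P; last by rewrite enorm_direction.
    by rewrite /direction subrr scaler0 enorm0.
  move=> /(_ dir1 (fun s F s0 mF F0 => shift_le_integral s0 mF F0)).
  rewrite expr1n mulr1 => H.
  apply: (@L2_nrm_le _ _ _ mu _ _ _ _ _).2.
  + by rewrite mulr_ge0// sqrtr_ge0.
  + apply: measurable_funB; first exact: L2_meas lp.
    by apply: measurable_shift; exact: L2_meas lp.
  rewrite exprMn sqr_sqrtr ?addr_ge0 ?ip_ge0 ?gnrm2_ge0//.
  under eq_integral do rewrite /dif -sqrrN opprB.
  apply: le_trans H _; rewrite lee_fin ler_wpM2l ?sqr_ge0// lerDr; exact: ip_ge0.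
Qed.

Lemma slope_limit (u : E -> R) (phi : nat -> E -> R) (N : nat -> R) N0 : L2 mu u ->
  (forall x, ~ Omega x -> u x = 0) -> (forall k, slope (phi k) (N k)) ->
  nrm mu (phi k - u) @[k --> \oo] --> 0 -> N k @[k --> \oo] --> N0 -> slope u N0.
Proof.
move=> lu uO sphi c0 cN; split => //.
  have le k : nrm mu u <= N k + nrm mu (phi k - u).
    case: (sphi k) => lp pN _ _; rewrite nrm_distC.
    by apply: le_trans (nrm_le_dist lu lp) _; rewrite lerD2r.
  have c : N k + nrm mu (phi k - u) @[k --> \oo] --> N0 + 0 by exact: cvgD.
  rewrite -[N0]addr0 -(cvg_lim _ c)//.
  by apply: limr_ge; [exact: cvgP c|exact: nearW].
move=> t t0; have t0' := ltW t0.
have le k : nrm mu (fun x => dif u (x, t)) <= t * N k + (nrm mu (phi k - u) + nrm mu (phi k - u)).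
  case: (sphi k) => lp _ _ pt.
  have ld v : L2 mu v -> L2 mu (fun x => dif v (x, t)).
    by move=> lv; apply: (L2B lv); exact: (L2_shift t0' lv).1.
  have lup : L2 mu (phi k - u) by exact: L2B.
  apply: le_trans (nrm_le_dist (ld _ lu) (ld _ lp)) _; apply: lerD; first exact: pt.
  rewrite nrm_distC.
  rewrite (_ : (fun x => dif (phi k) (x, t)) - (fun x => dif u (x, t)) =
    (phi k - u) - (fun x : E => (phi k - u) (x + t *: direction P x))).
    apply: le_trans (nrmB lup (L2_shift t0' lup).1) _.
    by rewrite lerD2l; exact: (L2_shift t0' lup).2.
  apply/funext => x; rewrite /dif /= !fctE /=; ring.
have c : t * N k + (nrm mu (phi k - u) + nrm mu (phi k - u)) @[k --> \oo] --> t * N0 + (0 + 0).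
  by apply: cvgD; [apply: cvgM => //; exact: cvg_cst|exact: cvgD].
rewrite -[t * N0]addr0 -[X in _ + X](addr0 0) -(cvg_lim _ c)//.
by apply: limr_ge; [exact: cvgP c|exact: nearW].
Qed.

(** For [t <= 1] the constant [Q0 + M] is enough, for [t > 1] the constant [2 Q0]; this one serves
    both ranges. *)
Definition nlC := 2 * Q0 + M.
Lemma nlC_ge0 : 0 <= nlC. Proof. by rewrite addr_ge0 ?mulr_ge0. Qed.

Let qn x : `|q x| <= Q0. Proof. by rewrite ger0_norm. Qed.

Lemma le_bnd t : 0 < t -> t <= 1 -> t <= bnd t.
Proof.
move=> t0 t1; rewrite le_min t1 andbT -[leLHS]powRr1 ?(ltW t0)//.
by apply: ger_powR => //; rewrite t0.
Qed.

Lemma bnd1 t : 1 <= t -> bnd t = 1.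
Proof.
move=> t1; apply/min_idPr; rewrite -[X in X <= _](_ : 1 `^ lambda = 1); last by rewrite powR1.
apply: ge0_ler_powR => //; rewrite ?nnegrE//.
- by apply: ltW; exact: lt_trans alpha1.
- exact: le_trans t1.
Qed.

(** The difference splits as [q (u - u(s)) + (q - q(s)) u(s)]. In the second term [u(s)] vanishes
    unless the shifted point lies in the domain, exactly where [nl_lip] applies. The first is of
    order [t], which is below [t^lambda] for [t <= 1]; for larger [t] the triangle inequality
    suffices. *)
Lemma dif_q_le u N t : slope u N -> 0 < t ->
  L2 mu (fun x => dif (q * u) (x, t)) /\
  nrm mu (fun x => dif (q * u) (x, t)) <= nlC * N * bnd t.
Proof.
move=> [lu uN uO ut] t0; have t0' := ltW t0; have [ls sN] := L2_shift t0' lu.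
have N0 : 0 <= N by apply: le_trans uN; exact: nrm_ge0.
have ld : L2 mu (fun x => dif u (x, t)) by exact: L2B.
have l1 : L2 mu (fun x => q x * dif u (x, t)) by exact: (L2M_bounded mq qn).
pose s (x : E) := x + t *: direction P x.
have qs x : `|(q x - q (s x)) * u (s x)| <= `|M * bnd t * u (s x)|.
  have [Os|Os] := pselect (Omega (s x)); last by rewrite uO// !mulr0.
  rewrite !normrM; apply: ler_wpM2r => //; apply: le_trans (q_lip t0 Os) _.
  by rewrite -normrM ler_norm.
have lMs : L2 mu (fun x => M * bnd t * u (s x)) by exact: (L2Z (M * bnd t) ls).
have ms : measurable_fun setT (fun x : E => (q x - q (s x)) * u (s x)).
  apply: measurable_funM; last exact: L2_meas ls.
  by apply: measurable_funB => //; exact: measurable_shift.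
have l2 : L2 mu (fun x : E => (q x - q (s x)) * u (s x)) by exact: L2_dom lMs qs.
have E1 : (fun x => dif (q * u) (x, t)) =
    (fun x => q x * dif u (x, t)) + (fun x : E => (q x - q (s x)) * u (s x)).
  apply/funext => x; rewrite /dif /= !fctE /= -/(s x); ring.
have lqu : L2 mu (q * u) by exact: (L2M_bounded mq qn).
split; first by rewrite E1; exact: L2D.
have [t1|t1] := leP t 1.
  rewrite E1; apply: le_trans (nrmD l1 l2) _.
  apply: (@le_trans _ _ (Q0 * (t * N) + M * bnd t * N)).
    apply: lerD.
      apply: le_trans (nrmM_bounded Q00 mq qn ld) _.
      by apply: ler_wpM2l => //; exact: ut.
    apply: le_trans (le_nrm ms lMs qs) _.
    have -> : nrm mu (fun x => M * bnd t * u (s x)) = `|M * bnd t| * nrm mu (fun x => u (s x)).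
      exact: (nrmZ (M * bnd t) ls).
    rewrite ger0_norm ?mulr_ge0 ?bnd_ge0//; apply: ler_wpM2l; first by rewrite mulr_ge0 ?bnd_ge0.
    exact: le_trans sN uN.
  have := ler_wpM2r N0 (ler_wpM2l Q00 (le_bnd t0 t1)).
  have : 0 <= Q0 * bnd t * N by rewrite !mulr_ge0 ?bnd_ge0.
  by rewrite /nlC; nra.
have [lq2 nq2] := L2_shift t0' lqu.
apply: le_trans (nrmB lqu lq2) _; rewrite bnd1 ?(ltW t1)// mulr1.
have h : nrm mu (q * u) <= Q0 * N.
  apply: le_trans (nrmM_bounded Q00 mq qn lu) _; exact: ler_wpM2l.
have : 0 <= M * N by rewrite mulr_ge0.
have := le_trans nq2 h.
by rewrite /nlC; move: h; lra.
Qed.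

Let sq u N t : slope u N -> 0 < t ->
  (\int[mu]_x (dif (q * u) (x, t) ^+ 2)%:E <= ((nlC * N * bnd t) ^+ 2)%:E)%E.
Proof.
move=> su t0; have [ld dle] := dif_q_le su t0.
rewrite -(nrm_sqrE ld) lee_fin; apply: lerXn2r; rewrite ?nnegrE ?nrm_ge0//.
exact: le_trans (nrm_ge0 _ _) dle.
Qed.

Let Cp u N : slope u N -> 0 <= nlC * N.
Proof.
by move=> [_ uN _ _]; rewrite mulr_ge0 ?nlC_ge0// (le_trans (nrm_ge0 _ _) uN).
Qed.

(** The bound [I] is kept free, to be used for the whole kernel and, with a small value, for the
    part of the kernel near 0. *)
Lemma L2_WopI A u N I : measurable A -> 0 < I ->
  (\int[leb]_t (bnd t * kerA A t)%:E <= I%:E)%E -> slope u N ->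
  L2 mu (Wop A (q * u)) /\ nrm mu (Wop A (q * u)) <= nlC * N * I.
Proof.
move=> mA I0 hI su; have [[lu _ _ _] C0] := (su, Cp su).
apply: (@L2_param_int _ _ _ mu _ _ bnd) => //.
- by apply: measurable_dif; apply: measurable_funM => //; exact: L2_meas lu.
- exact: measurable_kerA.
- exact: measurable_bnd.
- exact: kerA_ge0.
- by move=> t /kerA_neq0; exact: bnd_gt0.
- by move=> t /kerA_neq0; exact: sq.
Qed.

Lemma L2_Wop A u N : measurable A -> slope u N ->
  L2 mu (Wop A (q * u)) /\ nrm mu (Wop A (q * u)) <= nlC * N * bndI.
Proof. by move=> mA; apply: L2_WopI => //; [exact: bndI_gt0|exact: integral_bnd]. Qed.

(** Where the integral in [t] diverges the operator has only a default value, so its linearity holds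
    almost everywhere and needs this condition. *)
Definition Wfin A g := {ae mu, forall x,
  leb.-integrable setT (fun t => (dif g (x, t) * kerA A t)%:E)}.

Lemma Wop_fin A u N : measurable A -> slope u N -> Wfin A (q * u).
Proof.
move=> mA su; have [[lu _ _ _] C0] := (su, Cp su).
apply: (@param_int_integrable _ _ _ mu _ _ bnd (nlC * N) bndI) => //.
- by apply: measurable_dif; apply: measurable_funM => //; exact: L2_meas lu.
- exact: measurable_kerA.
- exact: measurable_bnd.
- exact: kerA_ge0.
- by move=> t /kerA_neq0; exact: bnd_gt0.
- by move=> t /kerA_neq0; exact: sq.
- exact: integral_bnd.
Qed.

Lemma WopD A f g : Wfin A f -> Wfin A g ->
  {ae mu, forall x, Wop A (f + g) x = (Wop A f + Wop A g) x}.
Proof.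
move=> hf hg; apply: filterS2 hf hg => x hf hg.
rewrite [RHS](_ : _ = Wop A f x + Wop A g x)// /Wop /param_int -RintegralD//.
by apply: eq_Rintegral => t _; rewrite /dif /= !fctE; ring.
Qed.

Lemma WopZ A k f : Wfin A f -> {ae mu, forall x, Wop A (k *: f) x = (k *: Wop A f) x}.
Proof.
move=> hf; apply: filterS hf => x hf.
rewrite [RHS](_ : _ = k * Wop A f x)// /Wop /param_int -RintegralZl//.
by apply: eq_Rintegral => t _; rewrite /dif /= !fctE /= /GRing.scale /=; ring.
Qed.

Lemma integrable_bnd A : measurable A ->
  leb.-integrable setT (fun t => (bnd t * kerA A t)%:E).
Proof.
move=> mA; apply/integrableP; split.
  apply/measurable_EFinP; apply: measurable_funM; first exact: measurable_bnd.
  exact: measurable_kerA.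
apply: le_lt_trans (ltry bndI); apply: le_trans (integral_bnd mA).
rewrite le_eqVlt; apply/orP; left; apply/eqP; apply: eq_integral => t _.
by rewrite gee0_abs// lee_fin mulr_ge0 ?bnd_ge0 ?kerA_ge0.
Qed.

Lemma Rintegral_bnd A : measurable A -> \int[leb]_t (bnd t * kerA A t) <= bndI.
Proof.
move=> mA; rewrite -lee_fin /Rintegral fineK; first exact: integral_bnd.
exact: integrable_fin_num (integrable_bnd mA).
Qed.

(** For one shift [s], [u u(s) <= (u^2 + u(s)^2) / 2] gives the lower bound [(q u^2 - q(s) u(s)^2) /
    2 - (q(s) - q) u^2 / 2]. The first part has nonnegative integral because shifts contract
    integrals; the second is controlled by the modulus of continuity of [q]. When the shifted point
    is outside the domain, [q(s) = 0] and the bound on [q(s) - q] is trivial. *)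
Lemma Wop_ge A u N : measurable A -> slope u N ->
  - (M * bndI / 2) * ip mu u u <= ip mu (Wop A (q * u)) u.
Proof.
move=> mA su; have [[lu _ uO _] C0] := (su, Cp su); have mu_ := L2_meas lu.
have lqu : L2 mu (q * u) by exact: (L2M_bounded mq qn).
pose beta t := - (M / 2 * ip mu u u) * bnd t.
have ibk : leb.-integrable setT (fun t => (- (M / 2 * ip mu u u) * (bnd t * kerA A t))%:E).
  by apply: (integrableZl measurableT _ (integrable_bnd mA)).
have ib : leb.-integrable setT (fun t => (kerA A t * beta t)%:E).
  by apply: eq_integrable ibk => // t _; rewrite /beta; congr (_%:E); ring.
have Hb : - (M * bndI / 2) * ip mu u u <= \int[leb]_t (kerA A t * beta t).
  have -> : \int[leb]_t (kerA A t * beta t) =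
      \int[leb]_t (- (M / 2 * ip mu u u) * (bnd t * kerA A t)).
    by apply: eq_Rintegral => t _; rewrite /beta; ring.
  rewrite RintegralZl//; last exact: integrable_bnd.
  have h : 0 <= M / 2 * ip mu u u by rewrite mulr_ge0 ?ip_ge0 ?divr_ge0.
  have := ler_wpM2l h (Rintegral_bnd mA).
  by set X := ip mu u u; set Y := Rintegral _ _ _; lra.
apply: le_trans Hb _; apply: (@ip_param_int_ge _ _ _ mu _ _ bnd (nlC * N) bndI) => //.
- by apply: measurable_dif; apply: measurable_funM.
- exact: measurable_kerA.
- exact: measurable_bnd.
- exact: kerA_ge0.
- by move=> t /kerA_neq0; exact: bnd_gt0.
- exact: bndI_gt0.
- by move=> t /kerA_neq0; exact: sq.
- exact: integral_bnd.
move=> t /kerA_neq0 t0; have t0' := ltW t0.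
pose s (x : E) := x + t *: direction P x.
have [ls _] := L2_shift t0' lu; have [lqs _] := L2_shift t0' lqu.
have i1 := L2_integrableM lqu lu; have i2 := L2_integrableM lqs ls.
have i3 := L2_integrableM lu lu.
pose a := \int[mu]_x (q x * u x * u x); pose a' := \int[mu]_x (q (s x) * u (s x) * u (s x)).
have aa : a' <= a.
  rewrite -lee_fin /a /a' /Rintegral !fineK ?(integrable_fin_num _ i1) ?(integrable_fin_num _ i2)//.
  apply: (shift_le_integral (F := fun x => (q x * u x * u x)%:E)) => //.
    by apply/measurable_EFinP; apply: measurable_funM => //; exact: measurable_funM.
  by move=> x; rewrite lee_fin -mulrA mulr_ge0// -expr2 sqr_ge0.
pose L x := 2^-1 * (q x * u x * u x - q (s x) * u (s x) * u (s x)) - M / 2 * bnd t * (u x * u x).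
have i12 : mu.-integrable setT (EFin \o (fun x => q x * u x * u x - q (s x) * u (s x) * u (s x))).
  exact: (integrableB measurableT i1 i2).
have iH : mu.-integrable setT (EFin \o (fun x => 2^-1 * (q x * u x * u x - q (s x) * u (s x) * u (s x)))).
  exact: (integrableZl measurableT _ i12).
have iM : mu.-integrable setT (EFin \o (fun x => M / 2 * bnd t * (u x * u x))).
  exact: (integrableZl measurableT _ i3).
have EL : \int[mu]_x L x = 2^-1 * (a - a') - M / 2 * bnd t * ip mu u u.
  have e1 := RintegralB measurableT iH iM.
  have e2 := RintegralZl 2^-1 measurableT i12.
  have e3 := RintegralB measurableT i1 i2.
  have e4 := RintegralZl (M / 2 * bnd t) measurableT i3.
  by move: e1; rewrite e2 e3 e4.
have ld : L2 mu (fun x => dif (q * u) (x, t)) by exact: (dif_q_le su t0).1.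
apply: (@le_trans _ _ (\int[mu]_x L x)).
  by rewrite EL /beta; lra.
apply: le_Rintegral => //; first exact: (integrableB measurableT iH iM).
  exact: L2_integrableM ld lu.
move=> x _; rewrite /L /dif /= !fctE -/(s x).
have qs : q (s x) <= q x + M * bnd t.
  have [Os|Os] := pselect (Omega (s x)).
    have := q_lip t0 Os; rewrite -/(s x) ler_norml => /andP[h _].
    by move: h; lra.
  by rewrite q_out// addr_ge0// mulr_ge0// bnd_ge0.
have h1 := ler_wpM2r (sqr_ge0 (u x)) qs.
have h2 : 0 <= q (s x) * (u x - u (s x)) ^+ 2 by rewrite mulr_ge0// sqr_ge0.
move: h1 h2; rewrite !expr2; lra.
Qed.

Lemma tail_ker r : 0 < r ->
  leb.-integrable setT (fun t => (kerA `[r, +oo[ t)%:E) /\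
  \int[leb]_t kerA `[r, +oo[ t = r `^ (- alpha) / alpha.
Proof.
move=> r0; have H : (\int[leb]_t (kerA `[r, +oo[ t)%:E = (r `^ (- alpha) / alpha)%:E)%E.
  rewrite -(integral_powR_tail alpha0 r0) [RHS]integral_mkcond.
  apply: eq_integral => t _; rewrite patchE /kerA indicE; case: ifPn => [|_]; last by rewrite mul0r.
  by rewrite inE /= in_itv /= andbT => rt; rewrite mul1r /ker (lt_le_trans r0 rt).
split; last by rewrite /Rintegral H.
apply/integrableP; split.
  by apply/measurable_EFinP; apply: measurable_kerA; exact: measurable_itv.
apply: le_lt_trans (ltry (r `^ (- alpha) / alpha)); rewrite -H le_eqVlt; apply/orP; left.
by apply/eqP; apply: eq_integral => t _; rewrite gee0_abs// lee_fin kerA_ge0.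
Qed.

(* For [y = (v - m)_+] the function [u] is [min v m]. *)
Lemma Wop_trunc_ge (y u : E -> R) N m : slope y N -> (forall x, 0 <= y x) ->
  L2 mu u -> 0 <= m -> (forall x, y x = 0 -> u x <= m) -> (forall x, y x != 0 -> u x = m) ->
  m * (pmin * (diam `^ (- alpha) / alpha)) * \int[mu]_x y x <=
    ip mu (Wop setT (q * y)) u.
Proof.
move=> sy y0 lu m0 u1 u2.
have [[ly _ yO _] C0] := (sy, Cp sy); have my := L2_meas ly.
have lqy : L2 mu (q * y) by exact: (L2M_bounded mq qn).
have l1 : L2 mu (\1_Omega : E -> R) by exact: L2_indic.
have onO f : (forall x, ~ Omega x -> f x = 0) -> forall x, f x * \1_Omega x = f x.
  move=> f0 x; rewrite indicE; have [Ox|Ox] := pselect (Omega x).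
    by rewrite mem_set ?mulr1.
  by rewrite f0// mul0r.
have iO f : L2 mu f -> (forall x, ~ Omega x -> f x = 0) -> mu.-integrable setT (EFin \o f).
  move=> lf f0; apply: eq_integrable (L2_integrableM lf l1) => // x _.
  by rewrite /= onO.
have iy := iO _ ly yO.
have qyO x : ~ Omega x -> (q * y) x = 0 by move=> Ox; rewrite fctE /= yO// mulr0.
have iqy := iO _ lqy qyO.
have Y0 : 0 <= \int[mu]_x y x by apply: Rintegral_ge0 => x _.
have pY : pmin * \int[mu]_x y x <= \int[mu]_x (q * y) x.
  rewrite -RintegralZl//; apply: le_Rintegral => //.
    exact: (integrableZl measurableT _ iy).
  move=> x _; rewrite fctE /=; have [Ox|Ox] := pselect (Omega x).
    by apply: ler_wpM2r => //; exact: pq.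
  by rewrite yO// !mulr0.
have [iT ET] := tail_ker d0.
pose K := m * (pmin * \int[mu]_x y x).
pose beta t := K * \1_(`[diam, +oo[%classic : set TR) t.
have Eb t : kerA setT t * beta t = K * kerA `[diam, +oo[ t.
  by rewrite /beta /kerA indicT /= mul1r mulrCA; congr (K * _); exact: mulrC.
have ib : leb.-integrable setT (fun t => (kerA setT t * beta t)%:E).
  have iK : leb.-integrable setT (fun t => (K * kerA `[diam, +oo[ t)%:E).
    exact: (integrableZl measurableT _ iT).
  by apply: eq_integrable iK => // t _; rewrite Eb.
have Hb : \int[leb]_t (kerA setT t * beta t) = m * (pmin * (diam `^ (- alpha) / alpha)) * \int[mu]_x y x.
  under eq_Rintegral do rewrite Eb.
  by rewrite RintegralZl// ET /K; ring.
rewrite -Hb; apply: (@ip_param_int_ge _ _ _ mu _ _ bnd (nlC * N) bndI) => //.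
- by apply: measurable_dif; apply: measurable_funM.
- exact: measurable_kerA.
- exact: measurable_bnd.
- exact: kerA_ge0.
- by move=> t /kerA_neq0; exact: bnd_gt0.
- exact: bndI_gt0.
- by move=> t /kerA_neq0; exact: sq.
- exact: integral_bnd.
move=> t /kerA_neq0 t0; have t0' := ltW t0.
pose s (x : E) := x + t *: direction P x.
have [lqs _] := L2_shift t0' lqy.
have ld : L2 mu (fun x => dif (q * y) (x, t)) by exact: (dif_q_le sy t0).1.
have iqs : mu.-integrable setT (EFin \o (fun x => (q * y) (s x))).
  by apply: iO => // x Ox; apply: qyO => Os; apply: Ox; exact: (ray_in t0').
have idf : mu.-integrable setT (EFin \o (fun x => dif (q * y) (x, t))).
  exact: (integrableB measurableT iqy iqs).
(* Replacing [u] by the constant [m] decreases the integrand: where [y] is nonzero [u] equals [m],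
   and where [y = 0] the difference of [q y] is nonpositive while [u <= m]. *)
apply: (@le_trans _ _ (m * \int[mu]_x dif (q * y) (x, t))); last first.
  rewrite -RintegralZl//; apply: le_Rintegral => //.
  - exact: (integrableZl measurableT _ idf).
  - exact: L2_integrableM ld lu.
  move=> x _; rewrite [leLHS]mulrC; have [yx|yx] := eqVneq (y x) 0; last by rewrite u2.
  apply: ler_wnM2l; last exact: u1.
  by rewrite /dif /= !fctE /= yx mulr0 sub0r oppr_le0 mulr_ge0.
rewrite /beta -mulrA; apply: ler_wpM2l => //.
have -> : \int[mu]_x dif (q * y) (x, t) = \int[mu]_x (q * y) x - \int[mu]_x (q * y) (s x).
  by rewrite -RintegralB.
have qy0 x : 0 <= (q * y) x by rewrite fctE /= mulr_ge0.
have mqy : measurable_fun setT (fun x => ((q * y) x)%:E).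
  by apply/measurable_EFinP; exact: L2_meas lqy.
have fqy := integrable_fin_num measurableT iqy.
have fqs := integrable_fin_num measurableT iqs.
rewrite indicE; case: (boolP (t \in _)) => [|_]; last first.
  rewrite mulr0 subr_ge0 /Rintegral fine_le//.
  by apply: (shift_le_integral (F := fun x => ((q * y) x)%:E)) => // x; rewrite lee_fin.
rewrite inE /= in_itv /= andbT => dt; rewrite mulr1.
(* For [t >= diam] the indicator in [shift_le] vanishes on the whole domain, so the full integral of
   [q y] remains. *)
suff -> : \int[mu]_x (q * y) (s x) = 0 by rewrite subr0.
apply/eqP; rewrite eq_le; apply/andP; split; last by apply: Rintegral_ge0 => x _.
rewrite -lee_fin /Rintegral fineK//.
apply: le_trans (shift_le n0 P t0' mqy _) _; first by move=> x; rewrite lee_fin.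
rewrite integral0_eq// => x _; have [Ox|Ox] := pselect (Omega x).
  by rewrite ltNge (le_trans (dO Ox) dt)/= mul0e.
by rewrite qyO// mule0.
Qed.

End Nonlocal.

(** * Truncations of test functions *)

Section Truncation.
Context {R : realType}.
Implicit Types (s m k : R).

(** A smooth positive part, [s exp (-1/(k s))] for [s > 0]. By [exp (-x) >= 1 - x] it is within
    [1/k] of the positive part, and its slope [exp (-x) (1 + x)], with [x = 1/(k s)], lies between 0
    and 1. *)
Definition tcut k s := s * flat (k * s).
Definition dcut k s := flat (k * s) + k * s * flat_pow 2 (k * s).

Lemma flat_le1 s : flat s <= 1.
Proof.
have [s0|s0] := leP s 0; first by rewrite flat_eq0.
rewrite /flat flat_pow_gt0// expr0 invr1 mul1r -expR0 ler_expR oppr_le0.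
by rewrite invr_ge0 ltW.
Qed.

Lemma tcut_eq0 k s : 0 < k -> s <= 0 -> tcut k s = 0.
Proof. by move=> k0 s0; rewrite /tcut flat_eq0 ?mulr0// pmulr_rle0. Qed.

Lemma tcut_ge0 k s : 0 < k -> 0 <= tcut k s.
Proof.
move=> k0; have [s0|s0] := leP s 0; first by rewrite tcut_eq0.
by rewrite mulr_ge0 ?flat_ge0// ltW.
Qed.

Lemma tcut_gt0 k s : 0 < k -> tcut k s != 0 -> 0 < s.
Proof. by move=> k0; rewrite ltNge; apply: contra => s0; rewrite tcut_eq0. Qed.

Lemma tcut_neq0 k s : 0 < k -> 0 < s -> tcut k s != 0.
Proof. by move=> k0 s0; rewrite gt_eqF// mulr_gt0// flat_gt0// mulr_gt0. Qed.

Lemma tcut_le k s : 0 < k -> 0 <= s -> tcut k s <= s.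
Proof. by move=> k0 s0; rewrite -[leRHS]mulr1; apply: ler_wpM2l => //; exact: flat_le1. Qed.

Lemma tcut_near k s : 0 < k -> 0 <= s -> s - tcut k s <= k^-1.
Proof.
move=> k0; rewrite le_eqVlt => /predU1P[<-|s0].
  by rewrite tcut_eq0// subrr invr_ge0 ltW.
have ks : 0 < k * s by rewrite mulr_gt0.
rewrite /tcut /flat flat_pow_gt0// expr0 invr1 mul1r.
have su : s * (k * s)^-1 = k^-1 by field; rewrite !gt_eqF.
have := ler_wpM2l (ltW s0) (expR_ge1Dx (- (k * s)^-1)).
by rewrite mulrDr mulr1 mulrN su; lra.
Qed.

Lemma is_derive_tcut k s : is_derive s 1 (tcut k) (dcut k s).
Proof.
have dk : is_derive s 1 (fun x : R => k * x) k.
  have := @is_deriveZ _ _ _ (@id R) k s 1 1 (is_derive_id _ _).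
  by rewrite /GRing.scale /= mulr1.
have df : is_derive s 1 (fun x : R => flat (k * x)) (flat_pow 2 (k * s) * k).
  have := is_derive_flat_pow 0 (k * s); rewrite mulr0n oppr0 mul0r add0r => d.
  exact: (is_derive_comp1 d dk).
have := @is_deriveM _ _ (@id R) (fun x : R => flat (k * x)) s 1 1 _ (is_derive_id _ _) df.
rewrite (_ : id * _ = tcut k)//; congr is_derive.
by rewrite /dcut /GRing.scale /= mulr1; ring.
Qed.

Lemma dcut01 k s : 0 < k -> 0 <= dcut k s <= 1.
Proof.
move=> k0; rewrite /dcut; have [ks|ks] := leP (k * s) 0.
  by rewrite flat_eq0// flat_pow_le0// mulr0 addr0 lexx ler01.
rewrite /flat !flat_pow_gt0// expr0 invr1 mul1r; set x := k * s in ks *.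
have -> : expR (- x^-1) + x * (x ^- 2 * expR (- x^-1)) = expR (- x^-1) * (1 + x^-1).
  by field; rewrite gt_eqF.
have xi : 0 < x^-1 by rewrite invr_gt0.
rewrite mulr_ge0 ?expR_ge0 ?addr_ge0 ?(ltW xi)//=.
rewrite expRN -ler_pdivlMl ?invr_gt0 ?expR_gt0// invrK mulr1.
exact: expR_ge1Dx.
Qed.

End Truncation.

(** * Truncated test functions; estimates of Poincaré type by translation *)

Section TruncatedTests.
Context {R : realType} {n : nat}.
Notation E := 'rV[R]_n.
Notation mu := (@lrow R n).
Notation leb := (@lebesgue_measure R).
Implicit Types (phi y : E -> R) (Omega : set E) (m k : R).

Definition cut k m phi : E -> R := fun x => tcut k (phi x - m).

Lemma rtest_cut Omega k m phi : 0 < k -> 0 <= m -> rtest Omega phi ->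
  rtest Omega (cut k m phi).
Proof.
move=> k0 m0 [sp [K [cK KO K0]]]; split.
  have sm : smooth (fun x : E => phi x - m).
    by apply: (@smoothD _ _ phi (cst (- m))) => //; exact: smooth_cst.
  apply: (@smoothM _ _ _ (fun x : E => flat (k * (phi x - m)))) => //.
  apply: (smooth_flat (f := fun x : E => k * (phi x - m))).
  exact: (smoothZ k sm).
exists K; split => // x Kx; rewrite /cut K0// sub0r tcut_eq0//.
by rewrite oppr_le0.
Qed.

Lemma pd_cut k m phi i x : smooth phi ->
  pd i (cut k m phi) x = dcut k (phi x - m) * pd i phi x.
Proof.
move=> sp; apply: derive_val.
have dm : is_derive x (unit_row i) (fun y : E => phi y - m) (pd i phi x).
  have := @is_deriveD _ _ _ phi (cst (- m)) x (unit_row i) _ _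
    (smooth_is_derive i x sp) (is_derive_cst _ _ _).
  by rewrite addr0.
exact: (@is_derive_comp1 _ _ (tcut k) (fun y : E => phi y - m) _ _ _ _ (is_derive_tcut k (phi x - m)) dm).
Qed.

Lemma integral_row_const_shift (F : E -> \bar R) v (s : R) : measurable_fun setT F ->
  (\int[mu]_x F (x + s *: v)%R <= \int[mu]_x F x)%E.
Proof. by move=> mF; rewrite integral_row_shift. Qed.

Lemma translation_estimate Omega phi v c : rtest Omega phi -> enorm v <= c ->
  (\int[mu]_x ((phi (x + v) - phi x) ^+ 2)%:E <= (c ^+ 2 * gnrm2 phi)%:E)%E.
Proof.
move=> tp vc; have c0 : 0 <= c by apply: le_trans vc; exact: enorm_ge0.
have := @flow_estimate _ _ _ _ (cst v) c 1 tp (measurable_cst _) c0 (fun=> vc) ler01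
  (fun s F s0 mF F0 => integral_row_const_shift v s mF).
rewrite expr1n mul1r; under eq_integral do rewrite scale1r.
exact.
Qed.

(** A translation by [2 r + 1] along one axis moves the cube off itself, so on the cube [phi]
    coincides up to sign with its increment. *)
Lemma poincare Omega r : (0 < n)%N -> 0 < r -> Omega `<=` cube r -> forall phi,
  rtest Omega phi -> ip mu phi phi <= (2 * r + 1) ^+ 2 * gnrm2 phi.
Proof.
move=> n0 r0 Or phi tp; have lp := rtest_L2 tp; have mp := L2_meas lp.
pose i0 := Ordinal n0; pose v : E := (2 * r + 1) *: unit_row i0.
have r10 : 0 < 2 * r + 1 by rewrite addr_gt0// mulr_gt0.
have phi0 x : ~ cube r x -> phi x = 0.
  by move=> cx; case: tp => _ [K [_ KO K0]]; apply: K0 => /KO/Or.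
have ev : enorm v <= 2 * r + 1.
  rewrite enormZ gtr0_norm// -[leRHS]mulr1 ler_wpM2l ?(ltW r10)//.
  apply: le_trans (enorm_le_sum _) _; rewrite (bigD1 i0)//= big1.
    by rewrite addr0 /unit_row mxE !eqxx normr1.
  by move=> j ji; rewrite /unit_row mxE eqxx (negPf ji) normr0.
rewrite -lee_fin -nrm_sqr nrm_sqrE//.
apply: le_trans (translation_estimate tp ev).
apply: ge0_le_integral => //.
- by move=> x _; rewrite lee_fin sqr_ge0.
- by apply/measurable_EFinP; exact: measurable_funX.
- apply/measurable_EFinP; apply: measurable_funX; apply: measurable_funB => //.
  by apply: (measurableT_comp mp); exact: (measurable_rowD (g := cst v)).
move=> x _; rewrite lee_fin; have [xr|/phi0 ->] := pselect (cube r x); last first.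
  by rewrite expr0n /= sqr_ge0.
rewrite [phi (x + v)]phi0 ?sub0r ?sqrrN// => xv.
have := xv i0; have := xr i0; rewrite !in_itv /= /v !mxE !eqxx mulr1.
by move=> /andP[h1 h2] /andP[h3 h4]; lra.
Qed.

(** For [x] in [S] one has [y(x)^2 <= 2 (y(x+v) - y(x))^2 + 2 y(x+v)^2]. Integrating over [x], then
    over [v] in the cube, bounds the last term by twice the measure of [S] times the integral of
    [y^2], which is at most half of the left side and is absorbed. The constant is of order [r^2],
    hence small for a small support. *)
Lemma small_support_estimate Omega y (S : set E) (r s0 : R) : rtest Omega y -> measurable S ->
  (forall x, ~ S x -> y x = 0) -> 0 < r ->
  (mu S <= s0%:E)%E -> 2 * s0 <= (2 * r) ^+ n / 2 ->
  ip mu y y <= 4 * (n%:R * r) ^+ 2 * gnrm2 y.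
Proof.
move=> ty mS yS r0 Es Sb; have ly := rtest_L2 ty; have my := L2_meas ly.
pose c : R := n%:R * r; have cE (v : E) : cube r v -> enorm v <= c.
  move=> vr; apply: le_trans (enorm_le_sum _) _.
  apply: (@le_trans _ _ (\sum_(i < n) r)); last first.
    by rewrite sumr_const card_ord /c mulr_natl.
  by apply: ler_sum => i _; have := vr i; rewrite in_itv /= ler_norml.
have mQ := @measurable_cube R n r.
have rr : - r <= r by rewrite -subr_ge0 opprK addr_ge0 ?(ltW r0).
pose b : R := (2 * r) ^+ n.
have Eb : mu (cube r) = b%:E.
  by have := lrow_cube n rr; rewrite (_ : r - - r = 2 * r)//; ring.
have b0 : 0 < b by rewrite exprn_gt0// mulr_gt0.
set V := ip mu y y; have V0 : 0 <= V by exact: ip_ge0.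
have EV : (V%:E = \int[mu]_x (y x ^+ 2)%:E)%E by rewrite /V -nrm_sqr nrm_sqrE.
set g := gnrm2 y; have g0 : 0 <= g by exact: gnrm2_ge0.
pose F (z : E * E) : \bar R := (2 * (\1_(cube r) z.2 * (\1_S z.1 * y (z.1 + z.2) ^+ 2)))%:E.
have myz : measurable_fun setT (fun z : E * E => y (z.1 + z.2)).
  apply: (measurableT_comp my); apply: measurable_rowD; first exact: measurable_fst.
  exact: measurable_snd.
have mF : measurable_fun setT F.
  apply/measurable_EFinP; apply: measurable_funM => //; apply: measurable_funM.
    by apply: (measurableT_comp (measurable_indic mQ)); exact: measurable_snd.
  apply: measurable_funM; last exact: measurable_funX.
  by apply: (measurableT_comp (measurable_indic mS)); exact: measurable_fst.
have Sy0 (x v : E) : 0 <= \1_S x * y (x + v) ^+ 2 by apply: mulr_ge0 => //; exact: sqr_ge0.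
have F0 z : (0 <= F z)%E by rewrite lee_fin; do 2 (apply: mulr_ge0 => //).
have cg0 : 0 <= 2 * c ^+ 2 * g by apply: mulr_ge0 => //; apply: mulr_ge0 => //; exact: sqr_ge0.
have mI1 : measurable_fun setT (fun v : E => (\1_(cube r) v * (2 * c ^+ 2 * g))%:E).
  by apply/measurable_EFinP; apply: measurable_funM => //; exact: measurable_indic.
have step1 (v : E) : ((\1_(cube r) v * V)%:E <=
    (\1_(cube r) v * (2 * c ^+ 2 * g))%:E + \int[mu]_x F (x, v))%E.
  rewrite indicE; case: (boolP (v \in cube r)) => [|_]; last first.
    by rewrite !mul0r add0e integral_ge0.
  rewrite inE => vQ; rewrite !mul1r EV.
  have mF1 : measurable_fun setT (fun x : E => (2 * (y (x + v) - y x) ^+ 2)%:E).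
    apply/measurable_EFinP; apply: measurable_funM => //; apply: measurable_funX.
    apply: measurable_funB => //; apply: (measurableT_comp my).
    exact: (measurable_rowD (g := cst v)).
  have mF2 : measurable_fun setT (fun x => F (x, v)) by exact: measurable_fun_pair1.
  apply: (@le_trans _ _ (\int[mu]_x ((2 * (y (x + v) - y x) ^+ 2)%:E + F (x, v)))%E).
    apply: ge0_le_integral => //.
    - by move=> x _; rewrite lee_fin sqr_ge0.
    - by apply/measurable_EFinP; exact: measurable_funX.
    - by apply: emeasurable_funD.
    move=> x _; rewrite /F /= -EFinD lee_fin !indicE mem_set// mul1r.
    have [xS|/yS ->] := pselect (S x); last first.
      rewrite expr0n /= addr_ge0//; first by apply: mulr_ge0 => //; exact: sqr_ge0.
      by apply: mulr_ge0 => //; rewrite -indicE.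
    rewrite (mem_set xS) mul1r; have := sqr_ge0 (y x - 2 * y (x + v)); nra.
  rewrite ge0_integralD//; last by move=> x _; rewrite lee_fin mulr_ge0// sqr_ge0.
  apply: leeD => //; under eq_integral do rewrite EFinM.
  rewrite ge0_integralZl//; last 2 first.
  - have := mF1; under eq_fun do rewrite EFinM; move=> _.
    apply/measurable_EFinP; apply: measurable_funX.
    apply: measurable_funB => //; apply: (measurableT_comp my).
    exact: (measurable_rowD (g := cst v)).
  - by move=> x _; rewrite lee_fin sqr_ge0.
  rewrite -mulrA [leRHS]EFinM; apply: lee_wpmul2l => //.
  exact: (translation_estimate ty (cE _ vQ)).
have mIF : measurable_fun setT (fun v : E => \int[mu]_x F (x, v))%E.
  exact: (measurable_fun_fubini_tonelli_G F mF F0).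
have IQ (k : R) : 0 <= k -> (\int[mu]_(v in [set: E]) (\1_(cube r) v * k)%:E = (b * k)%:E)%E.
  move=> k0; under eq_integral do rewrite mulrC EFinM.
  rewrite ge0_integralZl//; last by apply/measurable_EFinP; exact: measurable_indic.
  rewrite integral_indic// setIT [RHS]EFinM muleC; congr (_ * _)%E; exact: Eb.
have step3 : (\int[mu]_v \int[mu]_x F (x, v) <= (b / 2 * V)%:E)%E.
  rewrite -(fubini_tonelli _ mF F0).
  apply: (@le_trans _ _ (\int[mu]_x ((2 * V)%:E * (\1_S x)%:E))%E).
    apply: ge0_le_integral => //.
    - by move=> x _; exact: integral_ge0.
    - exact: (measurable_integral_snd mu mF F0).
    - by apply: measurable_funeM; apply/measurable_EFinP; exact: measurable_indic.
    move=> x _; rewrite /F /= indicE; case: (x \in S); last first.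
      by rewrite mule0 integral0_eq// => v _; rewrite mul0r !mulr0.
    rewrite mule1; apply: (@le_trans _ _ (\int[mu]_v (2%:E * (y (v + x) ^+ 2)%:E))%E).
      apply: ge0_le_integral => //.
      + by move=> v _; rewrite lee_fin mul1r mulr_ge0// mulr_ge0// sqr_ge0.
      + apply/measurable_EFinP; apply: measurable_funM => //; apply: measurable_funM; first exact: measurable_indic.
        apply: measurable_funM => //; apply: measurable_funX; apply: (measurableT_comp my).
        exact: (measurable_rowD (f := cst x)).
      + apply: measurable_funeM; apply/measurable_EFinP; apply: measurable_funX.
        by apply: (measurableT_comp my); exact: (measurable_rowD (g := cst x)).
      move=> v _; rewrite -EFinM lee_fin ler_wpM2l// mul1r addrC indicE.
      by case: (_ \in _); rewrite ?mul1r// mul0r sqr_ge0.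
    rewrite ge0_integralZl//; last 2 first.
    - apply/measurable_EFinP; apply: measurable_funX.
      by apply: (measurableT_comp my); exact: (measurable_rowD (g := cst x)).
    - by move=> v _; rewrite lee_fin sqr_ge0.
    rewrite (integral_row_shift (g := fun v => (y v ^+ 2)%:E)); last first.
      by apply/measurable_EFinP; exact: measurable_funX.
    by rewrite -EV -EFinM.
  rewrite ge0_integralZl//; last 2 first.
  - by apply/measurable_EFinP; exact: measurable_indic.
  - by rewrite lee_fin mulr_ge0.
  rewrite integral_indic// setIT; apply: (@le_trans _ _ ((2 * V)%:E * s0%:E)%E).
    by apply: lee_wpmul2l => //; rewrite lee_fin mulr_ge0.
  by rewrite -EFinM lee_fin mulrAC; apply: ler_wpM2r.
have [G [mG G0 G1 G2]] : exists G : E -> \bar R, [/\ measurable_fun setT G,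
    (forall v, 0 <= G v)%E, (forall v, ((\1_(cube r) v * V)%:E <=
    (\1_(cube r) v * (2 * c ^+ 2 * g))%:E + G v)%E) &
    (\int[mu]_v G v <= (b / 2 * V)%:E)%E].
  exists (fun v => \int[mu]_x F (x, v))%E; split => // v.
  exact: integral_ge0.
have b1 (v : E) : (0 <= (\1_(cube r) v * (2 * c ^+ 2 * g))%:E)%E.
  by rewrite lee_fin mulr_ge0.
have b3 (v : E) : (0 <= (\1_(cube r) v * V)%:E)%E by rewrite lee_fin mulr_ge0.
have mV : measurable_fun setT (fun v : E => (\1_(cube r) v * V)%:E).
  by apply/measurable_EFinP; apply: measurable_funM => //; exact: measurable_indic.
have step2 : ((b * V)%:E <= (b * (2 * c ^+ 2 * g))%:E + \int[mu]_v G v)%E.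
  have mD : measurable_fun setT
      (fun v : E => ((\1_(cube r) v * (2 * c ^+ 2 * g))%:E + G v)%E).
    by apply: emeasurable_funD.
  rewrite -IQ// -IQ// -ge0_integralD//; apply: ge0_le_integral => //.
have : b * V <= b * (2 * c ^+ 2 * g) + b / 2 * V.
  by rewrite -lee_fin [leRHS]EFinD; apply: le_trans step2 _; exact: leeD.
have -> : b * (2 * c ^+ 2 * g) + b / 2 * V = b * (2 * c ^+ 2 * g + V / 2) by ring.
by rewrite ler_pM2l// => h; rewrite -/c; lra.
Qed.

End TruncatedTests.

(** * Energy space *)

Lemma Rintegral_sum d (T : measurableType d) (R : realType)
    (mu : {measure set T -> \bar R}) (I : Type) (s : seq I) (f : I -> T -> R) :
  (forall i, mu.-integrable setT (EFin \o f i)) ->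
  mu.-integrable setT (EFin \o (fun x => \sum_(i <- s) f i x)) /\
  \int[mu]_x (\sum_(i <- s) f i x) = \sum_(i <- s) \int[mu]_x f i x.
Proof.
move=> fi; elim: s => [|i s [I1 E1]].
  rewrite big_nil (_ : (fun x => _) = cst 0); last first.
    by apply/funext => x; rewrite big_nil.
  split; first exact: integrable0.
  by rewrite /Rintegral integral0.
rewrite (_ : (fun x => _) = fun x => f i x + \sum_(i <- s) f i x); last first.
  by apply/funext => x; rewrite big_cons.
split; first exact: (integrableD measurableT (fi i) I1).
by rewrite (RintegralD measurableT (fi i) I1) big_cons E1.
Qed.

Section EnergySpace.
Context {R : realType} {n : nat}.
Notation E := 'rV[R]_n.
Notation mu := (@lrow R n).
Notation PV := ((E -> R) * ('I_n -> E -> R))%type.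
Implicit Types (U V Z W : PV) (Omega : set E).

Definition pL2 U := L2 mu U.1 /\ forall i, L2 mu (U.2 i).
(** The [H^1] product on pairs, where the second component is not tied to the first until [H0] is
    imposed. *)
Definition pdot U V := ip mu U.1 V.1 + \sum_i ip mu (U.2 i) (V.2 i).
Definition pnrm U := Num.sqrt (pdot U U).
Definition ptest Omega U := rtest Omega U.1 /\ U.2 = (fun i => pd i U.1).
(* An element of H^1_0 is represented by the pair of the function and its
   gradient. *)
Definition H0 Omega U := [/\ pL2 U, (forall x, ~ Omega x -> U.1 x = 0) &
  exists2 Phi : nat -> PV, forall k, ptest Omega (Phi k) &
    pnrm (Phi k - U) @[k --> \oo] --> 0].

Lemma fstZ k U : (k *: U).1 = k *: U.1. Proof. by []. Qed.
Lemma sndZ k U i : (k *: U).2 i = k *: U.2 i. Proof. by []. Qed.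
Lemma fstD U V : (U + V).1 = U.1 + V.1. Proof. by []. Qed.
Lemma sndD U V i : (U + V).2 i = U.2 i + V.2 i. Proof. by []. Qed.

Lemma famD (f g : 'I_n -> E -> R) i : (f + g) i = f i + g i. Proof. by []. Qed.

Lemma pL2_submodule : submodule pL2.
Proof.
split; first by split => [|i]; exact: L2_0.
- move=> U V [u1 u2] [v1 v2]; split => [|i]; first by rewrite fstD; exact: L2D.
  by rewrite sndD; exact: L2D.
- move=> k U [u1 u2]; split => [|i]; first by rewrite fstZ; exact: L2Z.
  by rewrite sndZ; exact: L2Z.
Qed.

Lemma pdotC U V : pdot U V = pdot V U.
Proof. by rewrite /pdot ipC; congr (_ + _); apply: eq_bigr => i _; exact: ipC. Qed.

Lemma pdotDl U V W : pL2 U -> pL2 V -> pL2 W -> pdot (U + V) W = pdot U W + pdot V W.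
Proof.
have bi := ip_bilinear mu; move=> [u1 u2] [v1 v2] [w1 w2].
rewrite /pdot fstD (bilDl bi)// addrACA -big_split /=; congr (_ + _).
by apply: eq_bigr => i _; rewrite famD (bilDl bi).
Qed.

Lemma pdotZl k U W : pL2 U -> pL2 W -> pdot (k *: U) W = k * pdot U W.
Proof.
have bi := ip_bilinear mu; move=> [u1 u2] [w1 w2].
rewrite /pdot fstZ (bilZl bi)// mulrDr mulr_sumr; congr (_ + _).
by apply: eq_bigr => i _; rewrite sndZ (bilZl bi).
Qed.

Lemma pdot_sip : semi_inner_product pL2 pdot.
Proof.
split; first split.
- by move=> U V W; exact: pdotDl.
- by move=> k U W; exact: pdotZl.
- by move=> U V W lU lV lW; rewrite !(pdotC W); exact: pdotDl.
- by move=> k U W lU lW; rewrite !(pdotC W); exact: pdotZl.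
- by move=> U V _ _; exact: pdotC.
- by move=> U _; rewrite addr_ge0 ?ip_ge0// sumr_ge0// => i _; exact: ip_ge0.
Qed.

Lemma pdot_ge0 U : 0 <= pdot U U.
Proof. by rewrite addr_ge0 ?ip_ge0// sumr_ge0// => i _; exact: ip_ge0. Qed.

Lemma pnrm_sqr U : pnrm U ^+ 2 = pdot U U.
Proof. by rewrite sqr_sqrtr// pdot_ge0. Qed.

Lemma pnrm_ge0 U : 0 <= pnrm U. Proof. exact: sqrtr_ge0. Qed.

Lemma nrm_le_pnrm U : nrm mu U.1 <= pnrm U.
Proof. by rewrite ler_wsqrtr// lerDl sumr_ge0// => i _; exact: ip_ge0. Qed.

Lemma nrm_grad_le_pnrm U i : nrm mu (U.2 i) <= pnrm U.
Proof.
rewrite ler_wsqrtr// /pdot (bigD1 i)//= addrCA lerDl.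
by rewrite addr_ge0 ?ip_ge0// sumr_ge0// => j _; exact: ip_ge0.
Qed.

Lemma pnrmD U V : pL2 U -> pL2 V -> pnrm (U + V) <= pnrm U + pnrm V.
Proof. exact: (sip_triangle pL2_submodule pdot_sip). Qed.

Lemma pnrmZ k U : pL2 U -> pnrm (k *: U) = `|k| * pnrm U.
Proof. exact: (sip_nrmZ pL2_submodule pdot_sip). Qed.

Lemma pnrmN U : pL2 U -> pnrm (- U) = pnrm U.
Proof. by move=> lU; rewrite -scaleN1r pnrmZ// normrN1 mul1r. Qed.

Lemma pnrm_distC U V : pL2 U -> pL2 V -> pnrm (U - V) = pnrm (V - U).
Proof. by move=> lU lV; rewrite -pnrmN ?opprB//; exact: (subB pL2_submodule). Qed.

Lemma ptest_submodule Omega : submodule (ptest Omega).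
Proof.
split.
- split; first exact: rtest0.
  apply/funext => i; have := pdZ i 0 (rtest0 (n := n) Omega).1.
  by rewrite !scale0r => ->.
- move=> U V [tU eU] [tV eV]; split; first exact: rtestD.
  by apply/funext => i; rewrite sndD eU eV pdD//; [case: tU|case: tV].
- move=> k U [tU eU]; split; first exact: rtestZ.
  by apply/funext => i; rewrite sndZ eU pdZ//; case: tU.
Qed.

Lemma ptest_L2 Omega U : ptest Omega U -> pL2 U.
Proof.
move=> [tU eU]; split; first exact: rtest_L2 tU.
by move=> i; rewrite eU; exact: rtest_L2 (rtest_pd i tU).
Qed.

Lemma ptest_pdot Omega U : ptest Omega U -> pdot U U = ip mu U.1 U.1 + gnrm2 U.1.
Proof. by move=> [_ eU]; rewrite /pdot eU. Qed.

Lemma ptest_out Omega U x : ptest Omega U -> ~ Omega x -> U.1 x = 0.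
Proof. by move=> [[_ [K [_ KO K0]]] _] Ox; apply: K0 => /KO. Qed.

Lemma ptest_H0 Omega U : ptest Omega U -> H0 Omega U.
Proof.
move=> tU; split; [exact: ptest_L2 tU|by move=> x; exact: ptest_out|].
exists (fun=> U) => // ; rewrite subrr.
have -> : pnrm 0 = 0.
  have := pnrmZ 0 (sub0 pL2_submodule); by rewrite scale0r normr0 mul0r.
exact: cvg_cst.
Qed.

Lemma H0_submodule Omega : submodule (H0 Omega).
Proof.
split; first exact/ptest_H0/(sub0 (ptest_submodule Omega)).
- move=> U V [lU uO [Phi tP cP]] [lV vO [Psi tQ cQ]]; split.
  + exact: (subD pL2_submodule).
  + by move=> x Ox; rewrite fstD fctE uO// vO// addr0.
  exists (fun k => Phi k + Psi k); first by move=> k; exact: (subD (ptest_submodule Omega)).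
  apply: (@squeeze_cvgr _ _ _ _ (cst 0) (fun k => pnrm (Phi k - U) + pnrm (Psi k - V))).
  + apply: nearW => k; rewrite pnrm_ge0 /= opprD addrACA.
    by apply: pnrmD; apply: (subB pL2_submodule) => //; exact: ptest_L2.
  + exact: cvg_cst.
  + by rewrite -[X in _ --> X](addr0 0); exact: cvgD.
- move=> a U [lU uO [Phi tP cP]]; split.
  + exact: (subZ pL2_submodule).
  + by move=> x Ox; rewrite fstZ scalrfctE uO// scaler0.
  exists (fun k => a *: Phi k); first by move=> k; exact: (subZ (ptest_submodule Omega)).
  under eq_fun => k.
    rewrite -scalerBr pnrmZ; last by apply: (subB pL2_submodule) => //; exact: ptest_L2.
    over.
  have -> : 0 = `|a| * 0 :> R by rewrite mulr0.
  by apply: cvgM => //; exact: cvg_cst.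
Qed.

(** * The second-order part of the form *)

Section LocalForm.
Variables (Omega : set E) (A : 'I_n -> 'I_n -> E -> R) (Amax a0 : R).
Record elliptic_setting : Prop := EllipticSetting {
  el_meas : forall i j, measurable_fun setT (A i j);
  el_bound : forall i j x, `|A i j x| <= Amax;
  el_a0 : 0 < a0;
  el_ellip : forall x, Omega x -> forall xi : 'I_n -> R,
    a0 * \sum_i xi i ^+ 2 <= \sum_i \sum_j A i j x * xi i * xi j }.
Hypothesis Hel : elliptic_setting.

Definition lform U Z : R :=
  \sum_i \sum_j ip mu (fun x => A i j x * U.2 j x) (Z.2 i).

Lemma L2_coef i j f : L2 mu f -> L2 mu (fun x => A i j x * f x).
Proof. exact: (L2M_bounded (el_meas Hel i j) (el_bound Hel i j)). Qed.

Lemma lformDl U V W : pL2 U -> pL2 V -> pL2 W -> lform (U + V) W = lform U W + lform V W.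
Proof.
have bi := ip_bilinear mu; move=> [u1 u2] [v1 v2] [w1 w2].
rewrite /lform -big_split /=; apply: eq_bigr => i _.
rewrite -big_split /=; apply: eq_bigr => j _.
rewrite -(bilDl bi (L2_coef i j (u2 j)) (L2_coef i j (v2 j)) (w2 i)) famD.
by congr (ip mu _ _); apply/funext => x; exact: mulrDr.
Qed.

Lemma lformZl k U W : pL2 U -> pL2 W -> lform (k *: U) W = k * lform U W.
Proof.
have bi := ip_bilinear mu; move=> [u1 u2] [w1 w2].
rewrite /lform mulr_sumr; apply: eq_bigr => i _.
rewrite mulr_sumr; apply: eq_bigr => j _.
rewrite -(bilZl bi k (L2_coef i j (u2 j)) (w2 i)) sndZ.
by congr (ip mu _ _); apply/funext => x; exact: mulrCA.
Qed.

Lemma lformDr U V W : pL2 U -> pL2 V -> pL2 W -> lform W (U + V) = lform W U + lform W V.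
Proof.
have bi := ip_bilinear mu; move=> [u1 u2] [v1 v2] [w1 w2].
rewrite /lform -big_split /=; apply: eq_bigr => i _.
rewrite -big_split /=; apply: eq_bigr => j _.
by rewrite famD (bilDr bi (u2 i) (v2 i) (L2_coef i j (w2 j))).
Qed.

Lemma lformZr k U W : pL2 U -> pL2 W -> lform W (k *: U) = k * lform W U.
Proof.
have bi := ip_bilinear mu; move=> [u1 u2] [w1 w2].
rewrite /lform mulr_sumr; apply: eq_bigr => i _.
rewrite mulr_sumr; apply: eq_bigr => j _.
by rewrite sndZ (bilZr bi k (u2 i) (L2_coef i j (w2 j))).
Qed.

Lemma lform_bilinear : bilinear_on pL2 lform.
Proof.
by split; [move=> U V W; exact: lformDl|move=> k U W; exact: lformZl|
  move=> U V W; exact: lformDr|move=> k U W; exact: lformZr].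
Qed.

Lemma lform_le U Z : 0 <= Amax -> pL2 U -> pL2 Z ->
  `|lform U Z| <= Amax * n%:R ^+ 2 * pnrm U * pnrm Z.
Proof.
move=> A0 [u1 u2] [z1 z2].
have h i j : `|ip mu (fun x => A i j x * U.2 j x) (Z.2 i)| <= Amax * pnrm U * pnrm Z.
  apply: le_trans (ip_CS (L2_coef i j (u2 j)) (z2 i)) _.
  apply: ler_pM; rewrite ?nrm_ge0//; last exact: nrm_grad_le_pnrm.
  apply: le_trans (nrmM_bounded A0 (el_meas Hel i j) (el_bound Hel i j) (u2 j)) _.
  by apply: ler_wpM2l => //; exact: nrm_grad_le_pnrm.
apply: le_trans (ler_norm_sum _ _ _) _.
apply: (@le_trans _ _ (\sum_(i < n) \sum_(j < n) Amax * pnrm U * pnrm Z)).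
  by apply: ler_sum => i _; apply: le_trans (ler_norm_sum _ _ _) _; apply: ler_sum => j _.
rewrite !sumr_const !card_ord -[leLHS]mulr_natl -[X in _ * X <= _]mulr_natl le_eqVlt; apply/orP; left; apply/eqP.
by move: (pnrm U) (pnrm Z) (n%:R : R) => x y z; ring.
Qed.

(** The gradient of the truncation is [dcut] times that of [phi]. The form thus has the factor
    [dcut] where the square of the truncated gradient has [dcut^2], and [dcut] lies between 0 and
    1. *)
Lemma lform_cut k m phi : 0 < k -> 0 <= m -> rtest Omega phi ->
  a0 * gnrm2 (cut k m phi) <=
  lform (cut k m phi, fun i => pd i (cut k m phi)) (phi, fun i => pd i phi).
Proof.
move=> k0 m0 tp; have tc := rtest_cut k0 m0 tp.
have lc i : L2 mu (pd i (cut k m phi)) by exact: rtest_L2 (rtest_pd i tc).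
have lp i : L2 mu (pd i phi) by exact: rtest_L2 (rtest_pd i tp).
have I1 i : mu.-integrable setT (EFin \o (fun x => pd i (cut k m phi) x * pd i (cut k m phi) x)).
  exact: L2_integrableM.
have I2 i j : mu.-integrable setT (EFin \o (fun x => A i j x * pd j (cut k m phi) x * pd i phi x)).
  by apply: L2_integrableM => //; exact: L2_coef.
pose L x := \sum_i pd i (cut k m phi) x * pd i (cut k m phi) x.
pose B i x := \sum_j A i j x * pd j (cut k m phi) x * pd i phi x.
have [iL EL] := Rintegral_sum (index_enum 'I_n) I1.
have HB i := Rintegral_sum (index_enum 'I_n) (I2 i).
have [iB EB] := Rintegral_sum (index_enum 'I_n) (fun i => (HB i).1).
have -> : gnrm2 (cut k m phi) = \int[mu]_x L x by rewrite EL.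
have -> : lform (cut k m phi, fun i => pd i (cut k m phi)) (phi, fun i => pd i phi) =
    \int[mu]_x \sum_i B i x.
  by rewrite /lform EB; apply: eq_bigr => i _; exact: esym (HB i).2.
rewrite -RintegralZl//; apply: le_Rintegral => //.
  exact: (integrableZl measurableT _ iL).
move=> x _; have [Ox|Ox] := pselect (Omega x); last first.
  have pO psi i : rtest Omega psi -> pd i psi x = 0.
    by move=> tpsi; have [_ [K [_ KO K0]]] := rtest_pd i tpsi; apply: K0 => /KO.
  rewrite /L /B big1 ?mulr0; last by move=> i _; rewrite pO// mul0r.
  by rewrite big1// => i _; rewrite big1// => j _; rewrite [pd i phi x]pO// mulr0.
set dd := dcut k (phi x - m); have /andP[dd0 dd1] := dcut01 (phi x - m) k0.
have EL' : L x = dd ^+ 2 * \sum_i pd i phi x ^+ 2.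
  rewrite mulr_sumr; apply: eq_bigr => i _; rewrite pd_cut; last by case: tp.
  by rewrite -/dd; ring.
have EB' : \sum_i B i x = dd * \sum_i \sum_j A i j x * pd i phi x * pd j phi x.
  rewrite mulr_sumr; apply: eq_bigr => i _; rewrite mulr_sumr; apply: eq_bigr => j _.
  by rewrite pd_cut; [rewrite -/dd; ring|case: tp].
rewrite EL' EB'; apply: (@le_trans _ _ (dd * (a0 * \sum_i pd i phi x ^+ 2))).
  rewrite [leLHS](_ : _ = dd * (dd * (a0 * \sum_i pd i phi x ^+ 2))); last by ring.
  apply: ler_wpM2l => //; rewrite -[leRHS]mul1r; apply: ler_wpM2r => //.
  by rewrite mulr_ge0 ?(ltW (el_a0 Hel))// sumr_ge0// => i _; exact: sqr_ge0.
by apply: ler_wpM2l => //; exact: (el_ellip Hel Ox (fun i => pd i phi x)).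
Qed.

Lemma lform_ge phi : rtest Omega phi ->
  a0 * gnrm2 phi <= lform (phi, fun i => pd i phi) (phi, fun i => pd i phi).
Proof.
move=> tp; have lp i : L2 mu (pd i phi) by exact: rtest_L2 (rtest_pd i tp).
have I1 i : mu.-integrable setT (EFin \o (fun x => pd i phi x * pd i phi x)).
  exact: L2_integrableM.
have I2 i j : mu.-integrable setT (EFin \o (fun x => A i j x * pd j phi x * pd i phi x)).
  by apply: L2_integrableM => //; exact: L2_coef.
have [iL EL] := Rintegral_sum (index_enum 'I_n) I1.
have HB i := Rintegral_sum (index_enum 'I_n) (I2 i).
have [iB EB] := Rintegral_sum (index_enum 'I_n) (fun i => (HB i).1).
have -> : gnrm2 phi = \int[mu]_x \sum_i pd i phi x * pd i phi x by rewrite EL.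
have -> : lform (phi, fun i => pd i phi) (phi, fun i => pd i phi) =
    \int[mu]_x \sum_i \sum_j A i j x * pd j phi x * pd i phi x.
  by rewrite /lform EB; apply: eq_bigr => i _; exact: esym (HB i).2.
rewrite -RintegralZl//; apply: le_Rintegral => //.
  exact: (integrableZl measurableT _ iL).
move=> x _; have [Ox|Ox] := pselect (Omega x); last first.
  have pO i : pd i phi x = 0.
    by have [_ [K [_ KO K0]]] := rtest_pd i tp; apply: K0 => /KO.
  rewrite big1 ?mulr0; last by move=> i _; rewrite pO mul0r.
  by rewrite big1// => i _; rewrite big1// => j _; rewrite [pd i phi x]pO mulr0.
have := el_ellip Hel Ox (fun i => pd i phi x).
under eq_bigr do rewrite expr2; move=> /le_trans; apply.
by apply: ler_sum => i _; apply: ler_sum => j _; rewrite mulrAC.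
Qed.

End LocalForm.
End EnergySpace.

(** * The inf-sup bound *)

Lemma tcut_shift {R : realType} (k m theta s : R) : 0 < k -> 0 <= m -> theta <= 1 ->
  tcut k (s - theta * m) <= tcut k (s - m) + ((1 - theta) * m + k^-1).
Proof.
move=> k0 m0 t1; have ki : 0 <= k^-1 by rewrite invr_ge0 ltW.
have [->|] := eqVneq (tcut k (s - theta * m)) 0.
  by rewrite addr_ge0 ?tcut_ge0// addr_ge0// mulr_ge0 ?subr_ge0.
move=> /(tcut_gt0 k0) p1; have := tcut_le k0 (ltW p1).
have [p2|p2] := leP 0 (s - m); first by have := tcut_near k0 p2; move: ki; lra.
by have := tcut_ge0 (s - m) k0; move: ki p1 p2; lra.
Qed.

Lemma tcut_lower {R : realType} (k m s : R) : 0 < k ->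
  s <= tcut k (s - m) + (m + k^-1).
Proof.
move=> k0; have ki : 0 <= k^-1 by rewrite invr_ge0 ltW.
have [p|p] := leP 0 (s - m); first by have := tcut_near k0 p; lra.
by have := tcut_ge0 (s - m) k0; move: p ki; lra.
Qed.

Lemma residual_arith {R : realType} (G C k : R) : 0 <= k -> 0 <= C * G ->
  G + C * k <= (1 + C) * (G + k).
Proof. by lra. Qed.

Lemma base_arith {R : realType} (a g K iy t F p : R) : K * iy <= a / 2 * g -> 0 <= t ->
  a * g - K * iy + t <= F * p -> a * g <= 2 * F * p.
Proof. by lra. Qed.

Lemma step_arith {R : realType} (a g K iy iz t u F C D X W p : R) :
  a * g - K * iy + t <= F * p -> K * iy <= K * iz + t + u -> K * iz <= K * (p * (D * X)) ->
  u <= K * W * X * p -> F * p <= (1 + C) * X * p ->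
  a * g <= (1 + C + K * (D + W)) * X * p.
Proof. by lra. Qed.

(** Otherwise [G <= p], the right side of the hypothesis is at most [(D + b) G p], and this is below
    [p^2]. *)
Lemma quadratic_bound {R : realType} (D b G p : R) : 0 <= D -> 0 <= b -> 0 <= G ->
  0 <= p -> p ^+ 2 <= D * G ^+ 2 + b * G * p -> p <= (D + b + 1) * G.
Proof.
move=> D0 b0 G0 p0 h; rewrite leNgt; apply/negP => hp.
have Gp : G <= p.
  apply: le_trans (ltW hp); rewrite -[leLHS]mul1r; apply: ler_wpM2r => //.
  by rewrite lerDr addr_ge0.
have h1 : D * G ^+ 2 <= D * G * p by rewrite expr2 mulrA ler_wpM2l// mulr_ge0.
have pp : 0 < p by apply: le_lt_trans hp; rewrite mulr_ge0// !addr_ge0.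
have h2 : (D + b + 1) * G * p < p * p by rewrite ltr_pM2r.
have h3 := mulr_ge0 G0 p0.
move: h h1 h2 h3; rewrite expr2; lra.
Qed.

Lemma level_arith {R : realType} (N C G x k W : R) :
  N <= C * (G + k) + C * (G + k) + (x * N + k) * W -> x * W <= 4^-1 -> 0 <= N ->
  0 <= k -> 0 <= C * k -> 0 <= W * k -> 0 <= C * G ->
  N <= 4 * C * G + (4 * C + 2 * W) * k.
Proof.
move=> h h1 N0 k0 Ck Wk CG; have := ler_wpM2r N0 h1.
by move: h Ck Wk CG; lra.
Qed.

Section InfSup.
Context {R : realType} {n : nat}.
Notation E := 'rV[R]_n.
Notation mu := (@lrow R n).
Notation PV := ((E -> R) * ('I_n -> E -> R))%type.
Implicit Types (U V Z W : PV) (phi : E -> R).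
Variables (Omega : set E) (P : E) (alpha lambda : R) (q : E -> R) (Q0 M pmin diam : R).
Variables (A : 'I_n -> 'I_n -> E -> R) (Amax a0 c rad : R).
Hypothesis Hnl : nonlocal_setting Omega P alpha lambda q Q0 M pmin diam.
Hypothesis Hel : elliptic_setting Omega A Amax a0.
Hypotheses (c0 : 0 <= c) (rad0 : 0 < rad) (Orad : Omega `<=` cube rad).
Local Notation fop := (frac_op P alpha setT).
Local Notation ptest := (ptest Omega).
Local Notation H0 := (H0 Omega).
Let a00 := el_a0 Hel.
Let bi := ip_bilinear mu.

(** The form of the problem for real functions, the test function in the first argument; [c] will be
    [alpha / Gamma (1 - alpha)]. *)
Definition wform U Z : R := lform A U Z + c * ip mu (fop (q * U.1)) Z.1.

Lemma H0_slope U : H0 U -> slope_on Omega P U.1 (pnrm U).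
Proof.
move=> [lU uO [Phi tP cP]].
have h k : pnrm (Phi k) <= pnrm U + pnrm (Phi k - U).
  rewrite -[X in pnrm X <= _](subrK U) addrC.
  by apply: pnrmD => //; apply: (subB pL2_submodule) => //; exact: ptest_L2.
apply: (slope_limit Hnl (phi := fun k => (Phi k).1) (N := fun k => pnrm U + pnrm (Phi k - U))).
- by case: lU.
- exact: uO.
- move=> k; have [p1 p2 p3 p4] := slope_rtest Hnl (tP k).1.
  rewrite -(ptest_pdot (tP k)) in p2 p4; split => //; first exact: le_trans p2 (h k).
  move=> t t0; apply: le_trans (p4 t t0) _; by apply: ler_wpM2l; [exact: ltW|exact: h].
- apply: (@squeeze_cvgr _ _ _ _ (cst 0) (fun k => pnrm (Phi k - U))) => //; last exact: cvg_cst.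
  by apply: nearW => k; rewrite nrm_ge0 /=; exact: (nrm_le_pnrm (Phi k - U)).
- rewrite -[X in _ --> X]addr0; apply: cvgD => //; exact: cvg_cst.
Qed.

Lemma L2_fop U : H0 U -> L2 mu (fop (q * U.1)) /\
  nrm mu (fop (q * U.1)) <= nlC Q0 M * pnrm U * bndI alpha lambda.
Proof. by move=> hU; apply: (L2_Wop Hnl measurableT); exact: H0_slope. Qed.

Lemma wform_bilinear : bilinear_on H0 wform.
Proof.
have lb := lform_bilinear Hel.
have fin U : H0 U -> Wfin P alpha setT (q * U.1).
  by move=> hU; exact: (Wop_fin Hnl measurableT (H0_slope hU)).
split.
- move=> U V W hU hV hW; have [[lU _ _] [lV _ _] [lW _ _]] := And3 hU hV hW.
  have [f1 _] := L2_fop hU; have [f2 _] := L2_fop hV.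
  have [f3 _] := L2_fop (subD (H0_submodule Omega) hU hV).
  rewrite /wform (bilDl lb lU lV lW) addrACA -mulrDr -(bilDl bi f1 f2 lW.1); congr (_ + _ * _).
  apply: ip_ae_eq; [exact: L2_meas f3|exact: L2_meas (L2D f1 f2)|exact: L2_meas lW.1|].
  by rewrite fstD mulrDr; apply: WopD; exact: fin.
- move=> k U W hU hW; have [[lU _ _] [lW _ _]] := conj hU hW.
  have [f1 _] := L2_fop hU; have [f3 _] := L2_fop (subZ (H0_submodule Omega) k hU).
  rewrite /wform (bilZl lb k lU lW) mulrDr [k * (c * _)]mulrCA -(bilZl bi k f1 lW.1).
  congr (_ + _ * _).
  apply: ip_ae_eq; [exact: L2_meas f3|exact: L2_meas (L2Z k f1)|exact: L2_meas lW.1|].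
  rewrite (_ : q * (k *: U).1 = k *: (q * U.1)); first by apply: WopZ; exact: fin.
  by apply/funext => x; exact: mulrCA.
- move=> U V W hU hV hW; have [[lU _ _] [lV _ _] [lW _ _]] := And3 hU hV hW.
  have [f1 _] := L2_fop hW.
  by rewrite /wform (bilDr lb lU lV lW) fstD (bilDr bi lU.1 lV.1 f1); ring.
- move=> k U W hU hW; have [[lU _ _] [lW _ _]] := conj hU hW.
  have [f1 _] := L2_fop hW.
  by rewrite /wform (bilZr lb k lU lW) fstZ (bilZr bi k lU.1 f1); ring.
Qed.

Definition wformC := `|Amax| * n%:R ^+ 2 + c * (nlC Q0 M * bndI alpha lambda).

Lemma Hel' : elliptic_setting Omega A `|Amax| a0.
Proof.
case: Hel => h1 h2 h3 h4; split => // i j x.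
by apply: le_trans (h2 i j x) _; exact: ler_norm.
Qed.

Lemma wform_le U Z : H0 U -> pL2 Z -> `|wform U Z| <= wformC * pnrm U * pnrm Z.
Proof.
move=> hU lZ; have [lU _ _] := hU; have [f1 n1] := L2_fop hU.
apply: le_trans (ler_normD _ _) _; rewrite /wformC; set K := nlC Q0 M * _.
rewrite !mulrDl; apply: lerD.
  exact: (lform_le Hel').
rewrite normrM ger0_norm// -!mulrA; apply: ler_wpM2l => //.
apply: le_trans (ip_CS f1 lZ.1) _; rewrite !mulrA.
apply: ler_pM; rewrite ?nrm_ge0//; last exact: nrm_le_pnrm.
by rewrite /K mulrAC.
Qed.

Let W1 := nrm mu (\1_Omega : E -> R).
Let K1 := M * bndI alpha lambda / 2.
Let d1 := pmin * (diam `^ (- alpha) / alpha).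
Let CW := nlC Q0 M * bndI alpha lambda * W1.
Let grad phi : PV := (phi, fun i => pd i phi).
Let Y k m phi : PV := grad (cut k m phi).

Let K10 : 0 <= K1.
Proof.
by rewrite /K1 divr_ge0// mulr_ge0 ?(nl_M0 Hnl)// (ltW (bndI_gt0 Hnl)).
Qed.
Let d10 : 0 < d1.
Proof. by rewrite mulr_gt0 ?(nl_pmin Hnl)// divr_gt0 ?powR_gt0 ?(nl_diam0 Hnl) ?(nl_alpha0 Hnl). Qed.
Let W10 : 0 <= W1. Proof. exact: nrm_ge0. Qed.
Let CW0 : 0 <= CW.
Proof.
by rewrite /CW !mulr_ge0// ?(nlC_ge0 Hnl)// (ltW (bndI_gt0 Hnl)).
Qed.
Let l1 : L2 mu (\1_Omega : E -> R).
Proof. by apply: L2_indic; [exact: (nl_mO Hnl)|exact: (nl_fin Hnl)]. Qed.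

Let grad_ptest phi : rtest Omega phi -> ptest (grad phi). Proof. by []. Qed.

Let out phi x : rtest Omega phi -> ~ Omega x -> phi x = 0.
Proof. by move=> tp; exact: (ptest_out (grad_ptest tp)). Qed.

Let Rint_cut phi : rtest Omega phi -> \int[mu]_x phi x = ip mu phi (\1_Omega).
Proof.
move=> tp; apply: eq_Rintegral => x _; rewrite indicE.
have [Ox|Ox] := pselect (Omega x); first by rewrite mem_set ?mulr1.
by rewrite (out tp Ox) mul0r.
Qed.

(** With [y] the truncation, [phi = y + min (phi, m) + r]. Against [y] the nonlocal term is bounded
    below by [Wop_ge], against [min (phi, m)] it yields the gain of [Wop_trunc_ge], and [r] is the
    smoothing error, of order [1/k]. *)
Lemma wform_cut_ge k m phi : 0 < k -> 0 <= m -> rtest Omega phi ->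
  a0 * gnrm2 (cut k m phi) - c * K1 * ip mu (cut k m phi) (cut k m phi)
    + c * (m * d1) * \int[mu]_x cut k m phi x - c * (CW / k) * pnrm (Y k m phi)
  <= wform (Y k m phi) (grad phi).
Proof.
move=> k0 m0 tp; have tc := rtest_cut k0 m0 tp.
set y := cut k m phi in tc *; have lp := rtest_L2 tp; have ly := rtest_L2 tc.
have hY := ptest_H0 (grad_ptest tc); have sY := H0_slope hY.
have [lw nw] := L2_fop hY; rewrite -/y in lw nw.
have y0 x : 0 <= y x by exact: tcut_ge0.
have h1 := lform_cut Hel k0 m0 tp.
pose u1 : E -> R := fun x => Num.min (phi x) m.
have mu1 : measurable_fun setT u1.
  by apply: measurable_minr; [exact: L2_meas lp|exact: measurable_cst].
have lu1 : L2 mu u1.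
  apply: L2_dom lp _ => // x; rewrite /u1; have [pm|pm] := leP (phi x) m => //.
  by rewrite ger0_norm// (le_trans (ltW pm))// ler_norm.
(* It vanishes where [phi <= m], in particular off the domain, and is at most [1/k] elsewhere. *)
pose r : E -> R := phi - y - u1.
have lr : L2 mu r by apply: L2B => //; exact: L2B.
have nr : nrm mu r <= k^-1 * W1.
  have lk := L2Z k^-1 l1.
  have -> : k^-1 * W1 = nrm mu (k^-1 *: (\1_Omega : E -> R)).
    by rewrite nrmZ// gtr0_norm ?invr_gt0.
  apply: le_nrm => //; first exact: L2_meas lr.
  move=> x; rewrite /r /u1 /y /cut !fctE /=.
  have [pm|pm] := leP (phi x) m.
    by rewrite tcut_eq0 ?subr_le0// subr0 subrr normr0.
  have Ox : Omega x.
    by apply: contrapT => Ox; move: pm; rewrite (out tp Ox) ltNge m0.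
  have pm' : 0 <= phi x - m by rewrite subr_ge0 ltW.
  have hn := tcut_near k0 pm'; have hl := tcut_le k0 pm'.
  rewrite [X in _ <= `|X|](_ : _ = k^-1); last first.
    by rewrite /GRing.scale /= indicE mem_set// mulr1.
  rewrite ger0_norm; last first.
    by move: hl; lra.
  rewrite gtr0_norm ?invr_gt0//; apply: le_trans hn; lra.
have Ephi : phi = y + u1 + r by apply/funext => x; rewrite /r !fctE; ring.
have E1 : ip mu (fop (q * y)) phi = ip mu (fop (q * y)) y + ip mu (fop (q * y)) u1 + ip mu (fop (q * y)) r.
  by rewrite {1}Ephi (bilDr bi (L2D ly lu1) lr lw) (bilDr bi ly lu1 lw).
have g1 := Wop_ge Hnl measurableT sY; rewrite -/y in g1.
have g2 : m * d1 * \int[mu]_x y x <= ip mu (fop (q * y)) u1.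
  apply: (Wop_trunc_ge Hnl sY) => //.
  - move=> x yx; have [pm|pm] := leP (phi x) m; first by rewrite /u1 min_l.
    by move/eqP: yx; rewrite (negPf (tcut_neq0 k0 _))// subr_gt0.
  - move=> x /(tcut_gt0 k0); rewrite subr_gt0 => pm; rewrite /u1 min_r//; exact: ltW.
have g3 : - (CW / k * pnrm (grad y)) <= ip mu (fop (q * y)) r.
  rewrite lerNl; apply: le_trans (ler_norm _) _; rewrite normrN.
  apply: le_trans (ip_CS lw lr) _.
  apply: (@le_trans _ _ (nlC Q0 M * pnrm (grad y) * bndI alpha lambda * (k^-1 * W1))).
    by apply: ler_pM; rewrite ?nrm_ge0.
  by rewrite /CW le_eqVlt; apply/orP; left; apply/eqP; ring.
rewrite /wform [(grad phi).1]/= [(Y k m phi).1]/= -/y E1.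
have := ler_wpM2l c0 g1; have := ler_wpM2l c0 g2; have := ler_wpM2l c0 g3.
rewrite -/K1 -/(grad y) [Y k m phi]/(grad y).
move: h1; rewrite -/y -/(grad y) -/(grad phi).
move: (lform A _ _) (gnrm2 y) (ip mu y y) (pnrm _) (\int[mu]_x y x).
move: (ip mu _ y) (ip mu _ u1) (ip mu _ r) => i1 i2 i3 L g iy p I.
rewrite !mulrDr; lra.
Qed.

(* [U] solves the problem shifted by [s] up to an error [G] in the dual norm. *)
Definition residual s U G := [/\ 0 <= s, ptest U, 0 <= G &
  forall V, ptest V -> `|wform V U + s * pdot V U| <= G * pnrm V].

(** The Poincaré constant of the bounding cube, plus 1 for the gradient itself. *)
Let kap := 1 + (2 * rad + 1) ^+ 2.
Let kap0 : 0 < kap. Proof. by rewrite ltr_pwDl// sqr_ge0. Qed.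

Lemma pnrm_le_gnrm2 phi : rtest Omega phi -> pnrm (grad phi) ^+ 2 <= kap * gnrm2 phi.
Proof.
move=> tp; rewrite pnrm_sqr (ptest_pdot (grad_ptest tp)) /kap mulrDl mul1r addrC lerD2l.
exact: (poincare (nl_n0 Hnl) rad0 Orad tp).
Qed.

Lemma level_bound s U G k m : 0 < k -> 0 <= m -> residual s U G ->
  a0 * gnrm2 (cut k m U.1) - c * K1 * ip mu (cut k m U.1) (cut k m U.1)
    + c * (m * d1) * \int[mu]_x cut k m U.1 x
  <= (G + c * (CW / k)) * pnrm (Y k m U.1).
Proof.
move=> k0 m0 [s0 [tU eU] G0 hU]; have tc := rtest_cut k0 m0 tU.
have Ugrad : U = grad U.1 by rewrite [LHS]surjective_pairing eU.
have h1 := wform_cut_ge k0 m0 tU.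
have := hU _ (grad_ptest tc); rewrite ler_norml => /andP[_ h2].
have h3 : 0 <= pdot (grad (cut k m U.1)) U.
  rewrite /pdot eU; apply: addr_ge0.
    apply: Rintegral_ge0 => x _; rewrite [(grad _).1 x]/=.
    have [->|/(tcut_gt0 k0)] := eqVneq (cut k m U.1 x) 0; first by rewrite mul0r.
    by rewrite subr_gt0 => pm; apply: mulr_ge0; [exact: tcut_ge0|exact: le_trans (ltW pm)].
  apply: sumr_ge0 => i _; apply: Rintegral_ge0 => x _.
  rewrite [(grad _).2 i x]/= pd_cut; last by case: tU.
  by rewrite -mulrA mulr_ge0// -?expr2 ?sqr_ge0//; case/andP: (dcut01 (U.1 x - m) k0).
rewrite -Ugrad in h1; have h4 := mulr_ge0 s0 h3.
move: h1 h2 h4; rewrite /Y; lra.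
Qed.

Let K2 := c * K1.
Let K20 : 0 <= K2. Proof. exact: mulr_ge0. Qed.
Let C2 := c * CW.
Let C20 : 0 <= C2. Proof. exact: mulr_ge0. Qed.

Let ik k : 1 <= k -> 0 < k :> R. Proof. exact: lt_le_trans. Qed.

Let energy_to_norm phi X : rtest Omega phi -> 0 <= X ->
  a0 * gnrm2 phi <= X * pnrm (grad phi) -> pnrm (grad phi) <= kap / a0 * X.
Proof.
move=> tp X0 h; have h2 := pnrm_le_gnrm2 tp; have p0 := pnrm_ge0 (grad phi).
have ka : 0 <= kap / a0 by rewrite divr_ge0 ?ltW.
have : pnrm (grad phi) ^+ 2 <= kap / a0 * X * pnrm (grad phi).
  apply: le_trans h2 _.
  have -> : kap * gnrm2 phi = kap / a0 * (a0 * gnrm2 phi) by field; rewrite gt_eqF.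
  by rewrite -[leRHS]mulrA; apply: ler_wpM2l.
rewrite le_eqVlt in p0; case/predU1P: p0 => [<- _|p0]; first exact: mulr_ge0.
by rewrite expr2 ler_pM2r.
Qed.

(** At such a level Chebyshev's inequality bounds the measure of the set [U.1 > m] as
    [small_support_estimate] requires, and the negative zero-order term takes at most half of the
    gradient term. *)
Lemma level_base : exists r C, [/\ 0 < r, 0 <= C & forall s U G k m, 1 <= k -> 0 < m ->
  residual s U G -> 4 * ip mu U.1 U.1 <= (2 * r) ^+ n * m ^+ 2 ->
  pnrm (Y k m U.1) <= C * (G + k^-1)].
Proof.
(* Chosen so that [K2 * 4 (n r)^2 <= a0 / 2] when [r^2 = a0 / Kr]; the summand 1 keeps [Kr] positive
   when [K2 = 0]. *)
pose Kr := 8 * (K2 * n%:R ^+ 2) + 1.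
have Kr0 : 0 < Kr by rewrite ltr_wpDl// mulr_ge0// mulr_ge0// exprn_ge0.
pose r := Num.sqrt (a0 / Kr); have r0 : 0 < r by rewrite sqrtr_gt0 divr_gt0.
exists r, (2 * (kap / a0) * (1 + C2)).
have C0 : 0 <= 2 * (kap / a0) * (1 + C2).
  by apply: mulr_ge0; [apply: mulr_ge0 => //; apply: divr_ge0; exact: ltW|exact: addr_ge0].
split => // s U G k m k1 m0 hU hm; have k0 := ik k1; have [_ [tU _] G0 _] := hU.
have tc := rtest_cut k0 (ltW m0) tU; have lU := rtest_L2 tU.
set y := cut k m U.1 in tc *.
pose S := [set x | m < U.1 x].
have mS : measurable S.
  have := @measurable_fun_ltr _ _ _ setT (cst m) U.1 (measurable_cst _) (L2_meas lU) measurableT [set true].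
  by rewrite setTI; exact.
have yS x : ~ S x -> y x = 0.
  by move=> /negP; rewrite -leNgt => h; rewrite /y /cut tcut_eq0 ?subr_le0.
(* Chebyshev's inequality for the square of [U.1]. *)
have mS2 : (mu S <= (ip mu U.1 U.1 / m ^+ 2)%:E)%E.
  rewrite -(setIT S) -integral_indic//.
  rewrite mulrC EFinM -nrm_sqr nrm_sqrE// -ge0_integralZl//; last 3 first.
  - by apply/measurable_EFinP; apply: measurable_funX; exact: L2_meas lU.
  - by move=> x _; rewrite lee_fin sqr_ge0.
  - by rewrite lee_fin invr_ge0 sqr_ge0.
  apply: ge0_le_integral => //.
  - by apply/measurable_EFinP; exact: measurable_indic.
  - apply: measurable_funeM; apply/measurable_EFinP; apply: measurable_funX; exact: L2_meas lU.
  move=> x _; rewrite -EFinM lee_fin indicE; case: (boolP (x \in S)) => [|_]; last first.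
    by rewrite mulr_ge0 ?invr_ge0 ?sqr_ge0.
  rewrite inE /S /= => mx; rewrite ler_pdivlMl ?exprn_gt0// mulr1.
  have um := ltW (lt_trans m0 mx).
  by apply: lerXn2r; rewrite ?nnegrE ?um ?(ltW m0) ?(ltW mx).
have Sb : 2 * (ip mu U.1 U.1 / m ^+ 2) <= (2 * r) ^+ n / 2.
  rewrite mulrA ler_pdivrMr ?exprn_gt0//; move: hm.
  by move: (_ ^+ n) (m ^+ 2) (ip mu _ _) => a b d; lra.
have h1 := small_support_estimate tc mS yS r0 mS2 Sb.
have h2 := level_bound k0 (ltW m0) hU; rewrite -/y in h2.
have y1 : 0 <= \int[mu]_x y x by apply: Rintegral_ge0 => x _; exact: tcut_ge0.
have cm : 0 <= c * (m * d1) * \int[mu]_x y x.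
  by apply: mulr_ge0 => //; apply: mulr_ge0 => //; apply: mulr_ge0; exact: ltW.
have g0 := gnrm2_ge0 y.
have hr : K2 * ip mu y y <= a0 / 2 * gnrm2 y.
  apply: le_trans (ler_wpM2l K20 h1) _; rewrite mulrA; apply: ler_wpM2r => //.
  have rr : r ^+ 2 = a0 / Kr by rewrite sqr_sqrtr// divr_ge0// ltW.
  rewrite exprMn rr [leLHS](_ : _ = (Kr - 1) / Kr * (a0 / 2)); last first.
    by rewrite /Kr; field; rewrite -/Kr gt_eqF.
  rewrite -[leRHS]mul1r; apply: ler_wpM2r; first by rewrite divr_ge0// ltW.
  by rewrite ler_pdivrMr// mul1r lerBlDr lerDl.
have X0 : 0 <= 2 * (G + C2 / k) by rewrite mulr_ge0// addr_ge0// divr_ge0// ltW.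
have h3 : a0 * gnrm2 y <= 2 * (G + C2 / k) * pnrm (grad y).
  apply: (base_arith hr cm); rewrite -[C2 / k]mulrA; exact: h2.
apply: le_trans (energy_to_norm tc X0 h3) _.
have ki : 0 <= k^-1 by rewrite invr_ge0 ltW.
rewrite mulrCA mulrA -[leRHS]mulrA; apply: ler_wpM2l.
  by apply: mulr_ge0 => //; rewrite divr_ge0// ltW.
exact: (residual_arith ki (mulr_ge0 C20 G0)).
Qed.

(** Any [theta < 1] with [K1 (1 - theta) <= theta * d1] would do; this value makes the left side
    [K1 d1 / (K1 + 2 d1)] and the right side [(K1 + d1) d1 / (K1 + 2 d1)], and it stays in []0, 1[]
    when [K1 = 0]. *)
Let theta := (K1 + d1) / (K1 + d1 + d1).
Let kd : 0 < K1 + d1. Proof. exact: ltr_wpDl. Qed.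
Let kdd : 0 < K1 + d1 + d1. Proof. exact: addr_gt0. Qed.
Let theta0 : 0 < theta. Proof. exact: divr_gt0. Qed.
Let theta1 : theta < 1. Proof. by rewrite ltr_pdivrMr ?mul1r ?ltrDl. Qed.
Let theta_le : K1 * (1 - theta) <= theta * d1.
Proof.
have -> : K1 * (1 - theta) = K1 / (K1 + d1 + d1) * d1 by rewrite /theta; field; rewrite gt_eqF.
by apply: ler_wpM2r; [exact: ltW|apply: ler_wpM2r; rewrite ?invr_ge0 ?lerDl ltW].
Qed.

Lemma level_step C s U G k m : 0 <= C -> 1 <= k -> 0 < m -> residual s U G ->
  pnrm (Y k m U.1) <= C * (G + k^-1) ->
  pnrm (Y k (theta * m) U.1) <=
    kap / a0 * (1 + C2 + K2 * (C + W1)) * (G + k^-1).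
Proof.
move=> C0 k1 m0 hU hm; have k0 := ik k1; have [_ [tU _] G0 _] := hU.
have tm0 : 0 <= theta * m by rewrite mulr_ge0 ?(ltW theta0)// ltW.
have tc := rtest_cut k0 (ltW m0) tU; have tc' := rtest_cut k0 tm0 tU.
set y := cut k m U.1 in tc hm *; set y' := cut k (theta * m) U.1 in tc' *.
have ly := rtest_L2 tc; have ly' := rtest_L2 tc'.
have ki : 0 <= k^-1 by rewrite invr_ge0 ltW.
have h2 := level_bound k0 tm0 hU; rewrite -/y' in h2.
have I0 : 0 <= \int[mu]_x y' x by apply: Rintegral_ge0 => x _; exact: tcut_ge0.
have Ile : \int[mu]_x y' x <= pnrm (grad y') * W1.
  rewrite (Rint_cut tc'); apply: le_trans (ler_norm _) _; apply: le_trans (ip_CS ly' l1) _.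
  by apply: ler_wpM2r => //; exact: (nrm_le_pnrm (grad y')).
pose b := (1 - theta) * m + k^-1.
have yy x : y' x <= y x + b by apply: tcut_shift => //; [exact: ltW|exact: ltW].
(* Only one of the two factors [y'] is replaced by [y + b], so that the error is linear in [y'] and
   comparable with the gain at the level [theta m]. *)
have hI : ip mu y' y' <= ip mu y' y + b * \int[mu]_x y' x.
  rewrite (Rint_cut tc').
  have <- : ip mu y' (b *: (\1_Omega : E -> R)) = b * ip mu y' \1_Omega by exact: (bilZr bi b l1 ly').
  have lb := L2Z b l1; rewrite -(bilDr bi ly lb ly').
  apply: le_Rintegral => //; first exact: (L2_integrableM ly' ly').
    exact: (L2_integrableM ly' (L2D ly lb)).
  move=> x _; rewrite [(y + _) x](_ : _ = y x + b * \1_Omega x)// indicE.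
  have [Ox|Ox] := pselect (Omega x); last by rewrite (out tc' Ox) !mul0r.
  by rewrite mem_set// mulr1; apply: ler_wpM2l; [exact: tcut_ge0|exact: yy].
have hyy : ip mu y' y <= pnrm (grad y') * (C * (G + k^-1)).
  apply: le_trans (ler_norm _) _; apply: le_trans (ip_CS ly' ly) _.
  apply: ler_pM; rewrite ?nrm_ge0//; first exact: (nrm_le_pnrm (grad y')).
  exact: le_trans (nrm_le_pnrm (grad y)) hm.
have Gk : 0 <= G + k^-1 by exact: addr_ge0.
have CC : 0 <= 1 + C2 + K2 * (C + W1) by rewrite addr_ge0 ?addr_ge0// mulr_ge0// addr_ge0.
rewrite -mulrA; apply: energy_to_norm => //; first exact: mulr_ge0.
(* The part [(1 - theta) m] of [b] is absorbed by the gain thanks to [theta_le]; the part [1/k]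
   joins the residual. *)
have e1 : K2 * (ip mu y' y + b * \int[mu]_x y' x) <=
   K2 * ip mu y' y + c * (theta * m * d1) * \int[mu]_x y' x + K2 * k^-1 * \int[mu]_x y' x.
  have -> : K2 * (ip mu y' y + b * \int[mu]_x y' x) = K2 * ip mu y' y +
     c * m * \int[mu]_x y' x * (K1 * (1 - theta)) + K2 * k^-1 * \int[mu]_x y' x.
    by rewrite /b /K2; ring.
  have -> : c * (theta * m * d1) * \int[mu]_x y' x = c * m * \int[mu]_x y' x * (theta * d1) by ring.
  rewrite lerD2r lerD2l; apply: ler_wpM2l => //; apply: mulr_ge0 => //.
  by apply: mulr_ge0 => //; exact: ltW.
have e2 := le_trans (ler_wpM2l K20 hI) e1.
have e3 := ler_wpM2l K20 hyy.
have e4 : K2 * k^-1 * \int[mu]_x y' x <= K2 * W1 * (G + k^-1) * pnrm (grad y').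
  apply: (@le_trans _ _ (K2 * k^-1 * (pnrm (grad y') * W1))).
    by apply: ler_wpM2l => //; exact: mulr_ge0.
  rewrite [leLHS](_ : _ = K2 * W1 * pnrm (grad y') * k^-1); last by ring.
  rewrite [leRHS](_ : _ = K2 * W1 * pnrm (grad y') * (G + k^-1)); last by ring.
  by apply: ler_wpM2l; [apply: mulr_ge0; [exact: mulr_ge0|exact: pnrm_ge0]|rewrite lerDr].
have e5 : (G + C2 / k) * pnrm (grad y') <= (1 + C2) * (G + k^-1) * pnrm (grad y').
  by apply: ler_wpM2r; [exact: pnrm_ge0|exact: (residual_arith ki (mulr_ge0 C20 G0))].
apply: (step_arith _ e2 e3 e4 e5); rewrite -[C2 / k]mulrA; exact: h2.
Qed.

(** The radius [r] is fixed before the number [j] of steps, and the constant depends on [j] alone;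
    this permits choosing the initial level from the norm of [U], and [j] independently of [U]. *)
Lemma levels : exists r, 0 < r /\ forall j, exists2 C, 0 <= C & forall s U G k m,
  1 <= k -> 0 < m -> residual s U G -> 4 * ip mu U.1 U.1 <= (2 * r) ^+ n * m ^+ 2 ->
  pnrm (Y k (theta ^+ j * m) U.1) <= C * (G + k^-1).
Proof.
have [r [C [r0 C0 base]]] := level_base; exists r; split => // j.
elim: j => [|j [Cj Cj0 IH]].
  exists C; first exact: C0.
  by move=> s U G k m; rewrite expr0 mul1r; exact: (base s U G k m).
have ka : 0 <= kap / a0 by rewrite divr_ge0 ?ltW.
exists (kap / a0 * (1 + C2 + K2 * (Cj + W1))).
  apply: (mulr_ge0 ka); apply: (addr_ge0 (addr_ge0 ler01 C20)).
  exact: (mulr_ge0 K20 (addr_ge0 Cj0 W10)).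
move=> s U G k m k1 m0 hU hm; rewrite exprS -mulrA.
have mj : 0 < theta ^+ j * m by rewrite mulr_gt0// exprn_gt0.
exact: (level_step Cj0 k1 mj hU (IH s U G k m k1 m0 hU hm)).
Qed.

Lemma residualN s U G : residual s U G -> residual s (- U) G.
Proof.
move=> [s0 tU G0 hU]; split => //; first exact: (subN (ptest_submodule Omega)).
move=> V tV; rewrite (bilNr wform_bilinear (ptest_H0 tV) (ptest_H0 tU)).
rewrite (bilNr (sip_bil pdot_sip) (ptest_L2 tV) (ptest_L2 tU)) mulrN -opprD normrN.
exact: hU.
Qed.

(** The level argument for [U] and [- U] bounds the L2 norm of [U] by a multiple of [G]; testing the
    residual with [U] itself then bounds the gradient. *)
Lemma infsup : exists2 C, 0 < C & forall s U G, residual s U G -> pnrm U <= C * G.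
Proof.
have [r [r0 lev]] := levels.
have b0 : 0 < (2 * r) ^+ n by rewrite exprn_gt0// mulr_gt0.
(* With [m = rho * |U|] the smallness condition of [levels] holds with equality. *)
pose rho := Num.sqrt (4 / (2 * r) ^+ n).
have rho0 : 0 < rho by rewrite sqrtr_gt0 divr_gt0.
have rhoE : (2 * r) ^+ n * rho ^+ 2 = 4.
  by rewrite sqr_sqrtr ?divr_ge0 ?(ltW b0)// mulrCA divff ?mulr1// gt_eqF.
(* After [j] steps the constant function equal to the level has, on the domain, norm at most a
   quarter of that of [U]. *)
have [j hj] : exists j, theta ^+ j * rho * W1 <= 4^-1.
  have /cvgrPdist_lt/(_ 1 ltr01) : theta ^+ j * (4 * rho * W1) @[j --> \oo] --> 0 * (4 * rho * W1).
    by apply: cvgM; [apply: cvg_expr; rewrite gtr0_norm|exact: cvg_cst].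
  case=> j _ /(_ j (leqnn j)); rewrite mul0r sub0r normrN => /ltW /(le_trans (ler_norm _)) h.
  exists j; rewrite -(ler_pM2l (ltr0n R 4)) mulfV ?pnatr_eq0//.
  by apply: le_trans h; rewrite le_eqVlt; apply/orP; left; apply/eqP; ring.
have [C C0 HC] := lev j.
have NG s U G : residual s U G -> nrm mu U.1 <= 4 * C * G.
  move=> hU; have [s0 tU G0 _] := hU; set N := nrm mu U.1.
  have CG : 0 <= C * G by exact: mulr_ge0.
  have [N0|N0] := leP N 0; first by apply: le_trans N0 _; rewrite -mulrA mulr_ge0.
  have m0 : 0 < rho * N by exact: mulr_gt0.
  have hm : 4 * ip mu U.1 U.1 <= (2 * r) ^+ n * (rho * N) ^+ 2.
    by rewrite [(rho * N) ^+ 2]exprMn mulrA rhoE /N nrm_sqr.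
  have key k : 1 <= k -> N <= 4 * C * G + (4 * C + 2 * W1) * k^-1.
    move=> k1; have k0 := ik k1; have ki : 0 <= k^-1 by rewrite invr_ge0 ltW.
    have hp := HC s U G k _ k1 m0 hU hm.
    have hn := HC s (- U) G k (rho * N) k1 m0 (residualN hU).
    rewrite mulrA in hp hn; set m := theta ^+ j * rho * N in hp hn.
    have m00 : 0 <= m by rewrite mulr_ge0 ?ltW// mulr_gt0 ?exprn_gt0.
    have tp := rtest_cut k0 m00 tU.1; have tU' : rtest Omega (- U).1.
      by case: (residualN hU) => _ [].
    have tn := rtest_cut k0 m00 tU'.
    have lp := rtest_L2 tp; have ln := rtest_L2 tn.
    have lb := L2Z (m + k^-1) l1.
    have hn' : pnrm (Y k m (- U).1) <= C * (G + k^-1).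
      by apply: hn; rewrite -nrm_sqr -[(- U).1]/(- U.1) nrmN nrm_sqr; exact: hm.
    apply: (@level_arith _ _ _ _ (theta ^+ j * rho)) => //; last first.
    - exact: mulr_ge0.
    - exact: mulr_ge0.
    - exact: ltW.
    (* On the domain [|U|] is at most the sum of the truncations of [U] and [- U] plus the level, up
       to [1/k]. *)
    rewrite -/m; apply: (@le_trans _ _ (nrm mu (cut k m U.1 + cut k m (- U).1 + (m + k^-1) *: \1_Omega))).
      apply: le_nrm; first exact: rtest_measurable tU.1.
        exact: L2D (L2D lp ln) lb.
      move=> x; rewrite [X in _ <= `|X|](_ : _ = cut k m U.1 x + cut k m (- U).1 x + (m + k^-1) * \1_Omega x)//.
      have [Ox|Ox] := pselect (Omega x); last by rewrite (out tU.1 Ox) normr0.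
      rewrite indicE mem_set// mulr1 [leRHS]ger0_norm; last first.
        by rewrite !addr_ge0// tcut_ge0.
      rewrite /cut -[(- U).1 x]/(- U.1 x).
      have h1 := tcut_lower m (U.1 x) k0; have h2 := tcut_lower m (- U.1 x) k0.
      have h3 := tcut_ge0 (U.1 x - m) k0; have h4 := tcut_ge0 (- U.1 x - m) k0.
      rewrite ler_norml; apply/andP; split.
        rewrite lerNl; apply: le_trans h2 _; rewrite lerD2r lerDr; exact: h3.
      by apply: le_trans h1 _; rewrite lerD2r lerDl; exact: h4.
    apply: le_trans (nrmD (L2D lp ln) lb) _; apply: lerD.
      apply: le_trans (nrmD lp ln) _; apply: lerD.
        exact: le_trans (nrm_le_pnrm (Y k m U.1)) hp.
      exact: le_trans (nrm_le_pnrm (Y k m (- U).1)) hn'.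
    by rewrite nrmZ// ger0_norm ?addr_ge0.
  (* The smoothing error is removed: [k = 1 + D / e] makes [D / k] at most [e]. *)
  apply/ler_addgt0Pr => e e0; pose D := 4 * C + 2 * W1.
  have D0 : 0 <= D by rewrite addr_ge0 ?mulr_ge0.
  have k1 : 1 <= 1 + D / e by rewrite lerDl divr_ge0// ltW.
  apply: le_trans (key _ k1) _; rewrite lerD2l -/D ler_pdivrMr ?(lt_le_trans ltr01 k1)//.
  by rewrite mulrDr mulr1 mulrCA divff ?mulr1 ?lerDr ?(ltW e0)// gt_eqF.
(* The coefficient of [G^2] that results from inserting the bound [4 C G] for the L2 norm into the
   energy inequality and dividing by [a0]. *)
pose D := (a0 + K2) * (4 * C) ^+ 2 / a0.
have D0 : 0 <= D.
  by rewrite divr_ge0 ?(ltW a00)// mulr_ge0 ?sqr_ge0// addr_ge0// ltW.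
have ai : 0 <= a0^-1 by rewrite invr_ge0 ltW.
exists (D + a0^-1 + 1); first by rewrite ltr_wpDl// addr_ge0.
move=> s U G hU; have [s0 tU G0 hV] := hU; have p0 := pnrm_ge0 U.
apply: quadratic_bound => //.
have h1 := lform_ge Hel tU.1.
have h2 := Wop_ge Hnl measurableT (H0_slope (ptest_H0 tU)).
have := hV U tU; rewrite ler_norml => /andP[_ h3].
have h4 := mulr_ge0 s0 (pdot_ge0 U).
have Ugrad : U = grad U.1 by rewrite [LHS]surjective_pairing tU.2.
have h5 : a0 * gnrm2 U.1 <= G * pnrm U + K2 * ip mu U.1 U.1.
  have h2' := ler_wpM2l c0 h2; rewrite -/K1 in h2'.
  have h1' : a0 * gnrm2 U.1 <= lform A U U by rewrite {2 3}Ugrad.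
  move: h1' h2' h3 h4; rewrite /wform /K2.
  move: (lform A U U) (ip mu _ _) (ip mu U.1 U.1) (pdot U U) (pnrm U) (gnrm2 U.1) => L i1 i2 pd0 p g.
  lra.
have h6 : ip mu U.1 U.1 <= (4 * C) ^+ 2 * G ^+ 2.
  rewrite -nrm_sqr -exprMn; apply: lerXn2r; rewrite ?nnegrE ?nrm_ge0 ?(NG _ _ _ hU)//.
  by rewrite !mulr_ge0.
rewrite pnrm_sqr (ptest_pdot tU) -(ler_pM2l a00).
have -> : a0 * (D * G ^+ 2 + a0^-1 * G * pnrm U) = (a0 + K2) * ((4 * C) ^+ 2 * G ^+ 2) + G * pnrm U.
  by rewrite /D; field; rewrite gt_eqF.
have := ler_wpM2l (addr_ge0 (ltW a00) K20) h6.
move: h5; move: (ip mu _ _) (gnrm2 _) (pnrm U) (_ ^+ 2 * _) => i2 g p X; lra.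
Qed.

End InfSup.

(** * The real problem *)

Lemma le0_of_cvg {R : realType} (a : R) (u : nat -> R) : (forall k, a <= u k) ->
  u k @[k --> \oo] --> 0 -> a <= 0.
Proof.
move=> h c; rewrite -(cvg_lim _ c)//.
by apply: limr_ge; [exact: cvgP c|exact: nearW].
Qed.

Lemma sum_sqr_le {R : realType} (n : nat) (b : 'I_n -> R) : (forall i, 0 <= b i) ->
  \sum_i b i ^+ 2 <= (\sum_i b i) ^+ 2.
Proof.
move=> b0; rewrite expr2 mulr_suml; apply: ler_sum => i _; rewrite expr2.
by apply: ler_wpM2l => //; rewrite (bigD1 i)//= lerDl sumr_ge0.
Qed.

Section WellPosed.
Context {R : realType} {n : nat}.
Notation E := 'rV[R]_n.
Notation mu := (@lrow R n).
Notation PV := ((E -> R) * ('I_n -> E -> R))%type.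
Implicit Types (U V Z W : PV) (phi f : E -> R).

Lemma pnrm_le_sum U : pnrm U <= nrm mu U.1 + \sum_i nrm mu (U.2 i).
Proof.
have s0 : 0 <= \sum_i nrm mu (U.2 i) by rewrite sumr_ge0// => i _; exact: nrm_ge0.
have n0 := nrm_ge0 mu U.1.
rewrite -[leRHS]ger0_norm ?addr_ge0// -sqrtr_sqr ler_wsqrtr//.
rewrite /pdot -nrm_sqr; under eq_bigr do rewrite -nrm_sqr.
have := @sum_sqr_le _ _ (fun i => nrm mu (U.2 i)) (fun i => nrm_ge0 _ _).
have := mulr_ge0 n0 s0; rewrite sqrrD -mulr_natl.
by move: (nrm mu U.1) (\sum_i nrm _ _) (\sum_i _ ^+ 2) => a b d; lra.
Qed.

Lemma cvg_pnrm (Phi : nat -> PV) U :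
  nrm mu ((Phi k).1 - U.1) @[k --> \oo] --> 0 ->
  (forall i, nrm mu ((Phi k).2 i - U.2 i) @[k --> \oo] --> 0) ->
  pnrm (Phi k - U) @[k --> \oo] --> 0.
Proof.
move=> c1 c2; have cs : (\sum_i nrm mu ((Phi k).2 i - U.2 i)) @[k --> \oo] --> 0.
  elim: (index_enum _) => [|i s IH].
    by under eq_fun do rewrite big_nil; exact: cvg_cst.
  rewrite -[X in _ --> X](addr0 0); under eq_fun do rewrite big_cons.
  exact: cvgD (c2 i) IH.
apply: (@squeeze_cvgr _ _ _ _ (cst 0)
  (fun k => nrm mu ((Phi k).1 - U.1) + \sum_i nrm mu ((Phi k).2 i - U.2 i))).
- by apply: nearW => k; rewrite pnrm_ge0 /=; exact: (pnrm_le_sum (Phi k - U)).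
- exact: cvg_cst.
- by rewrite -[X in _ --> X](addr0 0); exact: cvgD.
Qed.

Lemma pL2_complete (Phi : nat -> PV) : (forall k, pL2 (Phi k)) ->
  (forall k, pnrm (Phi k.+1 - Phi k) <= (2^-1) ^+ k) ->
  exists2 U, pL2 U & pnrm (Phi k - U) @[k --> \oo] --> 0.
Proof.
move=> lP cP.
have [|z lz cz] := @L2_complete _ _ _ mu (fun k => (Phi k).1) (fun k => (lP k).1).
  by move=> k; exact: le_trans (nrm_le_pnrm (Phi k.+1 - Phi k)) (cP k).
have ex i : exists g : E -> R, L2 mu g /\ nrm mu ((Phi k).2 i - g) @[k --> \oo] --> 0.
  have [|g lg cg] := @L2_complete _ _ _ mu (fun k => (Phi k).2 i) (fun k => (lP k).2 i).
    by move=> k; exact: le_trans (nrm_grad_le_pnrm (Phi k.+1 - Phi k) i) (cP k).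
  by exists g.
exists (z, fun i => sval (cid (ex i))).
  by split => // i /=; case: cid => g [].
apply: cvg_pnrm => //= i; by case: cid => g [].
Qed.

Variables (Omega : set E) (P : E) (alpha lambda : R) (q : E -> R) (Q0 M pmin diam : R).
Variables (A : 'I_n -> 'I_n -> E -> R) (Amax a0 c rad : R).
Hypothesis Hnl : nonlocal_setting Omega P alpha lambda q Q0 M pmin diam.
Hypothesis Hel : elliptic_setting Omega A Amax a0.
Hypotheses (c0 : 0 <= c) (rad0 : 0 < rad) (Orad : Omega `<=` cube rad).
Local Notation ptest := (ptest Omega).
Local Notation H0 := (H0 Omega).
Local Notation wform := (wform P alpha q A c).
Local Notation CB := (wformC alpha lambda Q0 M Amax c (n:=n)).
Let bi := ip_bilinear mu.
Let wb : bilinear_on H0 wform := wform_bilinear c Hnl Hel.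
Let wle U Z : H0 U -> pL2 Z -> `|wform U Z| <= CB * pnrm U * pnrm Z.
Proof. exact: (wform_le Hnl Hel c0). Qed.

Lemma H0_L2 U : H0 U -> pL2 U. Proof. by case. Qed.

(** The function component of [H0] must vanish off the domain at every point, whereas an L2 limit is
    determined almost everywhere; cutting it off does not increase the distance to test
    functions. *)
Lemma H0_closed (Phi : nat -> PV) U : (forall k, ptest (Phi k)) -> pL2 U ->
  pnrm (Phi k - U) @[k --> \oo] --> 0 ->
  exists2 Z, H0 Z & pnrm (Phi k - Z) @[k --> \oo] --> 0.
Proof.
move=> tP lU cU; pose z : E -> R := fun x => \1_Omega x * U.1 x.
have lz : L2 mu z.
  apply: (@L2M_bounded _ _ _ mu 1) lU.1; last by move=> x; rewrite indicE; case: (_ \in _); rewrite ?normr1 ?normr0.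
  by apply: measurable_indic; exact: (nl_mO Hnl).
have cz : pnrm (Phi k - (z, U.2)) @[k --> \oo] --> 0.
  apply: cvg_pnrm => [|i].
    apply: (@squeeze_cvgr _ _ _ _ (cst 0) (fun k => pnrm (Phi k - U))) => //; last exact: cvg_cst.
    apply: nearW => k; rewrite nrm_ge0 /=; have [p1 _] := ptest_L2 (tP k).
    apply: le_trans (nrm_le_pnrm (Phi k - U)).
    apply: le_nrm; [exact: L2_meas (L2B p1 lz)|exact: L2B p1 lU.1|].
    move=> x; rewrite [X in `|X| <= _](_ : _ = (Phi k).1 x - z x)//.
    rewrite [X in _ <= `|X|](_ : _ = (Phi k).1 x - U.1 x)// /z indicE.
    have [Ox|Ox] := pselect (Omega x); first by rewrite mem_set ?mul1r.
    by rewrite memNset// mul0r (ptest_out (tP k) Ox) subr0 normr0.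
  apply: (@squeeze_cvgr _ _ _ _ (cst 0) (fun k => pnrm (Phi k - U))) => //; last exact: cvg_cst.
  by apply: nearW => k; rewrite nrm_ge0 /=; exact: (nrm_grad_le_pnrm (Phi k - U) i).
exists (z, U.2) => //; split; first by split => //; exact: lU.2.
  by move=> x Ox; rewrite /z /= indicE memNset// mul0r.
by exists Phi.
Qed.

Lemma wform_solvable : solvable ptest (@pdot R n) wform.
Proof.
have [C C0 HC] := infsup Hnl Hel c0 rad0 Orad.
have sd : semi_inner_product ptest (@pdot R n).
  have [[b1 b2 b3 b4] h2 h3] := @pdot_sip R n; have L := @ptest_L2 R n Omega.
  split; first split.
  - by move=> U V W /L lU /L lV /L lW; exact: b1.
  - by move=> k U W /L lU /L lW; exact: b2.
  - by move=> U V W /L lU /L lV /L lW; exact: b3.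
  - by move=> k U W /L lU /L lW; exact: b4.
  - by move=> U V /L lU /L lV; exact: h2.
  - by move=> U /L lU; exact: h3.
have wbt : bilinear_on ptest wform.
  have [b1 b2 b3 b4] := wb; have L := @ptest_H0 R n Omega.
  split; [move=> U V W /L hU /L hV /L hW; exact: b1|move=> k U W /L hU /L hW; exact: b2|
    move=> U V W /L hU /L hV /L hW; exact: b3|move=> k U W /L hU /L hW; exact: b4].
apply: (solvable_of_infsup (ptest_submodule Omega) sd wbt C0 (CB := CB)).
  by move=> V U tV tU; apply: wle; [exact: ptest_H0|exact: ptest_L2 tU].
by move=> s U s0 tU G G0 hG; apply: (HC s U G).
Qed.

(** The inf-sup bound makes approximate solutions with summable errors a Cauchy sequence of test
    pairs, whose limit lies in [H0]. *)
Lemma real_exists f : L2 mu f ->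
  exists2 Z, H0 Z & forall V, H0 V -> wform V Z = ip mu f V.1.
Proof.
move=> lf; have [C C0 HC] := infsup Hnl Hel c0 rad0 Orad.
have fF : functional_on ptest (fun V => ip mu f V.1).
  split; first by move=> U V /ptest_L2[u1 _] /ptest_L2[v1 _]; rewrite fstD (bilDr bi).
  by move=> k U /ptest_L2[u1 _]; rewrite fstZ (bilZr bi).
have Fle V : pL2 V -> `|ip mu f V.1| <= nrm mu f * pnrm V.
  move=> lV; apply: le_trans (ip_CS lf lV.1) _; apply: ler_wpM2l; first exact: nrm_ge0.
  exact: nrm_le_pnrm.
(* The residual of a difference of two consecutive approximations is at most [e k + e k], and [C]
   times this is [2^-k]. *)
pose e k : R := (2^-1) ^+ k / (2 * C).
have e0 k : 0 < e k by rewrite divr_gt0 ?mulr_gt0// exprn_gt0// invr_gt0.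
have ex k : exists Z, ptest Z /\ forall V, ptest V -> `|wform V Z - ip mu f V.1| <= e k * pnrm V.
  have [Z tZ hZ] := wform_solvable fF (fun V tV => Fle V (ptest_L2 tV)) (e0 k).
  by exists Z.
pose Phi k := sval (cid (ex k)).
have tP k : ptest (Phi k) by rewrite /Phi; case: cid => Z [].
have hP k V : ptest V -> `|wform V (Phi k) - ip mu f V.1| <= e k * pnrm V.
  by rewrite /Phi; case: cid => Z [_ h] /=; exact: h.
have lP k := ptest_L2 (tP k).
have cP k : pnrm (Phi k.+1 - Phi k) <= (2^-1) ^+ k.
  have -> : (2^-1) ^+ k = C * (e k + e k) :> R by rewrite /e; field; rewrite gt_eqF.
  apply: (HC 0); split => //; first exact: (subB (ptest_submodule Omega)).
    by rewrite addr_ge0// ltW.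
  move=> V tV; have hV := ptest_H0 tV; rewrite mul0r addr0.
  rewrite (bilBr (H0_submodule Omega) wb hV (ptest_H0 (tP _)) (ptest_H0 (tP _))).
  rewrite -[X in `|X|](subrKA (ip mu f V.1)); apply: le_trans (ler_normD _ _) _.
  rewrite mulrDl; apply: lerD; last by rewrite distrC; exact: hP.
  apply: le_trans (hP _ _ tV) _; apply: ler_wpM2r; first exact: pnrm_ge0.
  rewrite /e; apply: ler_wpM2r; first by rewrite invr_ge0 mulr_ge0// ltW.
  rewrite exprS -[leRHS]mul1r; apply: ler_wpM2r; first by rewrite exprn_ge0// invr_ge0.
  by rewrite invf_le1// ler1n.
have [U lU cU] := pL2_complete lP cP.
have [Z hZ cZ] := H0_closed tP lU cU; exists Z => //; have lZ := H0_L2 hZ.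
have eC : e k @[k --> \oo] --> 0.
  have -> : 0 = 0 * (2 * C)^-1 :> R by rewrite mul0r.
  apply: cvgM; last exact: cvg_cst.
  by apply: cvg_expr; rewrite ger0_norm ?invr_ge0// invf_lt1// ltr1n.
have Ht V : ptest V -> wform V Z = ip mu f V.1.
  move=> tV; have hV := ptest_H0 tV; apply/eqP; rewrite -subr_eq0 -normr_le0.
  apply: (@le0_of_cvg _ _ (fun k => CB * pnrm V * pnrm (Phi k - Z) + e k * pnrm V)).
    move=> k; rewrite -[X in `|X|](subrKA (wform V (Phi k))).
    apply: le_trans (ler_normD _ _) _; apply: lerD; last exact: hP.
    rewrite distrC -(bilBr (H0_submodule Omega) wb hV (ptest_H0 (tP k)) hZ).
    by apply: wle => //; exact: (subB pL2_submodule).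
  have -> : 0 = CB * pnrm V * 0 + 0 * pnrm V :> R by rewrite mulr0 mul0r addr0.
  by apply: cvgD; apply: cvgM => //; exact: cvg_cst.
(* From test pairs to all of [H0] by density, both sides being continuous in the test function. *)
move=> V hV; have [lV _ [Psi tQ cQ]] := hV; apply/eqP; rewrite -subr_eq0 -normr_le0.
apply: (@le0_of_cvg _ _ (fun k => CB * pnrm (Psi k - V) * pnrm Z + nrm mu f * pnrm (Psi k - V))).
  move=> k; have lQ := ptest_L2 (tQ k); have hQ := ptest_H0 (tQ k).
  have hd := subB (H0_submodule Omega) hQ hV; have ld := H0_L2 hd.
  have -> : wform V Z - ip mu f V.1 = - wform (Psi k - V) Z + ip mu f (Psi k - V).1.
    rewrite (bilBl (H0_submodule Omega) wb hQ hV hZ) (Ht _ (tQ k)).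
    rewrite -[(Psi k - V).1]/((Psi k).1 - V.1).
    by rewrite (bilBr (L2_submodule mu) bi lf lQ.1 lV.1); ring.
  apply: le_trans (ler_normD _ _) _; rewrite normrN; apply: lerD; first exact: wle.
  exact: Fle.
have -> : 0 = CB * 0 * pnrm Z + nrm mu f * 0 :> R by rewrite !mulr0 mul0r addr0.
apply: cvgD; apply: cvgM => //; try exact: cvg_cst.
by apply: cvgM => //; exact: cvg_cst.
Qed.

(** The inf-sup bound is available for test pairs only. It is applied to approximations of [Z],
    whose residual is at most [CB] times their distance to [Z]. *)
Lemma real_unique Z : H0 Z -> (forall V, ptest V -> wform V Z = 0) -> pnrm Z = 0.
Proof.
move=> hZ Z0; have [C C0 HC] := infsup Hnl Hel c0 rad0 Orad.
have [lZ _ [Phi tP cP]] := hZ.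
have CB0 : 0 <= CB.
  rewrite /wformC addr_ge0// mulr_ge0 ?exprn_ge0//.
  by rewrite mulr_ge0 ?(nlC_ge0 Hnl)// (ltW (bndI_gt0 Hnl)).
apply/eqP; rewrite eq_le pnrm_ge0 andbT.
apply: (@le0_of_cvg _ _ (fun k => C * (CB * pnrm (Phi k - Z)) + pnrm (Phi k - Z))).
  move=> k; have lP := ptest_L2 (tP k).
  have ld : pL2 (Phi k - Z) by exact: (subB pL2_submodule).
  rewrite -{1}(subrK (Phi k) Z) addrC.
  apply: le_trans (pnrmD lP _) _; first exact: (subB pL2_submodule).
  rewrite (pnrm_distC lZ lP); apply: lerD => //.
  apply: (HC 0); split => //; first by rewrite mulr_ge0 ?pnrm_ge0.
  move=> V tV; have hV := ptest_H0 tV; rewrite mul0r addr0.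
  have -> : wform V (Phi k) = wform V (Phi k - Z).
    by rewrite (bilBr (H0_submodule Omega) wb hV (ptest_H0 (tP k)) hZ) Z0// subr0.
  by rewrite mulrAC; exact: wle.
have -> : 0 = C * (CB * 0) + 0 :> R by rewrite !mulr0 addr0.
apply: cvgD => //; apply: cvgM; first exact: cvg_cst.
by apply: cvgM => //; exact: cvg_cst.
Qed.

End WellPosed.

(** * Geometry of the rays of a convex domain *)

Section ConvexRays.
Context {R : realType} {n : nat}.
Notation E := 'rV[R]_n.
Notation mu := (@lrow R n).
Implicit Types (x y Q e : E) (f p : E -> R).
Variables (Omega : set E) (P : E).
Hypotheses (oO : open Omega) (cO : convex_set Omega) (bO : bounded_set Omega)
  (PO : (closure Omega `\` interior Omega) P).

Let convexE x y (t : R) : 0 <= t -> t <= 1 -> Omega x -> Omega y ->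
  Omega (t *: x + (1 - t) *: y).
Proof.
move=> t0 t1 Ox Oy; have := cO (x := x) (y := y) (Itv01 t0 t1).
by rewrite !inE => /(_ Ox Oy).
Qed.

Lemma P_notin : ~ Omega P.
Proof. by case: PO => _ nP OP; apply: nP; move: oO; rewrite openE; exact. Qed.

Lemma segment_in Q (s : R) : Omega Q -> 0 < s -> s <= 1 -> Omega (P + s *: (Q - P)).
Proof.
move=> OQ s0; rewrite le_eqVlt => /predU1P[->|s1]; first by rewrite scale1r addrC subrK.
have : nbhs Q Omega by move: oO; rewrite openE => /(_ _ OQ).
move=> /nbhs_ballP[d /= d0 dO].
pose k := (1 - s) / s; have k0 : 0 < k by rewrite divr_gt0 ?subr_gt0.
have := PO.1 _ (nbhsx_ballx P (d / k) (divr_gt0 d0 k0)).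
case=> P' [OP']; rewrite -ball_normE /= => PP'.
have OQ' : Omega (Q + k *: (P - P')).
  apply: dO; rewrite -ball_normE /= opprD addNKr normrN normrZ gtr0_norm//.
  by rewrite mulrC -ltr_pdivlMr.
have := convexE (ltW s0) (ltW s1) OQ' OP'.
congr Omega; apply/rowP => i; rewrite !mxE /k; field.
by rewrite gt_eqF.
Qed.

Lemma ray_in x (t : R) : 0 <= t -> Omega (x + t *: direction P x) -> Omega x.
Proof.
move=> t0; have [->|xP] := eqVneq x P.
  by rewrite /direction subrr !scaler0 addr0.
have r0 : 0 < enorm (x - P) by rewrite enorm_gt0 subr_eq0.
set r := enorm (x - P) in r0 *; move=> Oy.
have rt : 0 < r + t by rewrite ltr_wpDr.
(* [x] lies on the segment from [P] to the shifted point, at this parameter. *)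
have := segment_in (s := r / (r + t)) Oy (divr_gt0 r0 rt).
rewrite ler_pdivrMr// mul1r lerDl => /(_ t0); congr Omega.
rewrite /direction -/r; have -> : x + t *: (r^-1 *: (x - P)) - P = ((r + t) / r) *: (x - P).
  rewrite scalerA addrAC -[X in X + _]scale1r -scalerDl; congr (_ *: _).
  by field; rewrite gt_eqF.
rewrite scalerA; have -> : r / (r + t) * ((r + t) / r) = 1 by field; rewrite !gt_eqF.
by rewrite scale1r addrC subrK.
Qed.

Lemma ray_bounds : exists2 rad, 0 < rad & Omega `<=` cube rad.
Proof.
have [M [Mr HM]] := bO; exists (`|M| + 1); first by rewrite ltr_wpDl.
move=> x Ox i; rewrite in_itv /= -ler_norml.
have := HM (`|M| + 1); rewrite (le_lt_trans (ler_norm M)) ?ltrDl// => /(_ isT x Ox).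
by move=> /= h; apply: le_trans h; exact: coord_le_norm.
Qed.

Lemma enorm_le_norm x : enorm x <= n%:R * `|x|.
Proof.
apply: le_trans (enorm_le_sum x) _; apply: (@le_trans _ _ (\sum_(i < n) `|x|)).
  by apply: ler_sum => i _; exact: coord_le_norm.
by rewrite sumr_const card_ord -[leLHS]mulr_natl.
Qed.

Lemma diam_bound : exists2 diam, 0 < diam & forall x, Omega x -> enorm (x - P) <= diam.
Proof.
have [M [Mr HM]] := bO; pose B := `|M| + 1 + `|P|.
have B0 : 0 < B by apply: ltr_pwDl => //; apply: ltr_wpDl.
exists (n%:R * B + 1); first by rewrite ltr_wpDl// mulr_ge0// ltW.
move=> x Ox; apply: le_trans (enorm_le_norm _) _; rewrite -[leLHS]addr0; apply: lerD => //.
apply: ler_wpM2l => //; apply: le_trans (ler_normB _ _) _; rewrite lerD2r.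
by have := HM (`|M| + 1); rewrite (le_lt_trans (ler_norm M)) ?ltrDl// => /(_ isT x Ox).
Qed.

Lemma closure_compact : compact (closure Omega).
Proof.
apply: bounded_closed_compact; last exact: closed_closure.
have [M [Mr HM]] := bO; exists M; split => // N MN x cx.
apply/ler_addgt0Pr => e e0.
have [y [Oy]] := cx _ (nbhsx_ballx x e e0); rewrite -ball_normE /= => xy.
rewrite -(subrK y x) addrC; apply: le_trans (ler_normD _ _) _.
by apply: lerD; [exact: HM MN _ Oy|exact: ltW].
Qed.

Let OsubC : Omega `<=` closure Omega. Proof. exact: subset_closure. Qed.

Lemma within_bounded f : {within closure Omega, continuous f} ->
  exists2 M, 0 <= M & forall x, closure Omega x -> `|f x| <= M.
Proof.
move=> cf; have ne : closure Omega !=set0 by exists P; exact: PO.1.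
have [a _ ha] := EVT_max_rV ne closure_compact cf.
have [b _ hb] := EVT_min_rV ne closure_compact cf.
exists (`|f a| + `|f b|); first exact: addr_ge0.
move=> x cx; have h1 := ha x (mem_set cx); have h2 := hb x (mem_set cx).
rewrite ler_norml; apply/andP; split.
  rewrite lerNl; apply: (@le_trans _ _ (- f b)); first by rewrite lerN2.
  by rewrite ler_wpDl// -normrN ler_norm.
by apply: le_trans h1 _; rewrite ler_wpDr// ler_norm.
Qed.

Lemma measurable_zero_ext f : {within closure Omega, continuous f} ->
  measurable_fun setT (fun x => \1_Omega x * f x).
Proof.
move=> cf; have mO := open_row_measurable oO.
have cf' : {in Omega, continuous f}.
  by rewrite -continuous_open_subspace//; exact: continuous_subspaceW cf.
have mf : measurable_fun Omega f.
  move=> mD; apply: (measurability _ (RGenOpens.measurableE R)) => //.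
  move=> _ [_ [a [b ->] <-]]; apply: open_row_measurable.
  rewrite openE => x [Ox fx]; apply: filterI; first by move: oO; rewrite openE; exact.
  by apply: (cf' x (mem_set Ox)); exact: (interval_open (a := BRight a) (b := BLeft b)).
have -> : (fun x : E => \1_Omega x * f x) = f \_ Omega.
  apply/funext => x; rewrite patchE indicE; case: (x \in Omega); first exact: mul1r.
  exact: mul0r.
exact: (@measurable_restrictT _ _ _ _ Omega f mO).1 mf.
Qed.

Lemma Lip_continuous lambda p : 0 < lambda -> Lip Omega lambda p ->
  {within closure Omega, continuous p}.
Proof.
move=> l0 [M HM]; apply/subspace_continuousP => x cx.
apply/cvgrPdist_lt => e e0.
pose K := `|M| + 1; have K0 : 0 < K by rewrite ltr_wpDl.
pose d := (e / K) `^ lambda^-1; have d0 : 0 < d by apply: powR_gt0; exact: divr_gt0.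
have n1 : 0 < n%:R + 1 :> R by rewrite ltr_wpDl.
(* The balls are those of the sup norm; the factor [n + 1] dominates the Euclidean norm. *)
apply/nbhs_ballP; exists (d / (n%:R + 1)); first exact: divr_gt0.
move=> y; rewrite -ball_normE /= => xy cy.
apply: le_lt_trans (HM x y cx cy) _.
have ed : enorm (x - y) < d.
  apply: le_lt_trans (enorm_le_norm _) _.
  apply: (@le_lt_trans _ _ ((n%:R + 1) * `|x - y|)); first by apply: ler_wpM2r => //; rewrite lerDl.
  by rewrite mulrC -ltr_pdivlMr.
have eE : e / K = d `^ lambda.
  by rewrite /d -powRrM mulVf ?gt_eqF// powRr1// divr_ge0 ?ltW.
have : enorm (x - y) `^ lambda < e / K.
  by rewrite eE; apply: gt0_ltr_powR => //; rewrite nnegrE ?enorm_ge0// ltW.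
rewrite ltr_pdivlMr// mulrC; apply: le_lt_trans.
by apply: ler_wpM2r; [exact: powR_ge0|rewrite (le_trans (ler_norm M))// lerDl].
Qed.

Lemma nonlocal_settingP (alpha lambda : R) p : (0 < n)%N ->
  0 < alpha -> alpha < lambda -> lambda <= 1 ->
  (forall x, closure Omega x -> 0 < p x) -> Lip Omega lambda p ->
  exists Q0 M pmin diam : R,
    nonlocal_setting Omega P alpha lambda (fun x => \1_Omega x * p x) Q0 M pmin diam.
Proof.
move=> n0 a0 al l1 p0 Lp; have l0 := lt_trans a0 al.
have cp := Lip_continuous l0 Lp; have [M HM] := Lp.
have [Q0 Q00 HQ] := within_bounded cp.
have ne : closure Omega !=set0 by exists P; exact: PO.1.
have [a ca ha] := EVT_min_rV ne closure_compact cp; rewrite inE in ca.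
have [diam d0 hd] := diam_bound; have [rad r0 Or] := ray_bounds.
have mO := open_row_measurable oO.
(* The Hölder constant covers [t^lambda <= 1], and [2 * Q0] bounds any difference of [p] when the
   minimum in [lip_bnd] is 1. *)
exists Q0, (`|M| + 2 * Q0), (p a), diam; split => //.
- apply: le_lt_trans (lrow_cube_lty rad); apply: le_measure; rewrite ?inE//.
  exact: measurable_cube.
- exact: measurable_zero_ext.
- by move=> x Ox; rewrite indicE memNset// mul0r.
- move=> x; rewrite indicE; case: (boolP (x \in Omega)); last by rewrite mul0r.
  by rewrite inE => /OsubC/p0/ltW; rewrite mul1r.
- move=> x; rewrite indicE; case: (boolP (x \in Omega)); last by rewrite mul0r.
  by rewrite inE mul1r => /OsubC/HQ; apply: le_trans; exact: ler_norm.
- exact: p0.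
- by move=> x Ox; rewrite indicE mem_set// mul1r; apply: ha; rewrite inE; exact: OsubC.
- by rewrite addr_ge0// mulr_ge0.
- by move=> x t; exact: ray_in.
move=> x t t0 Oy; have Ox := ray_in (ltW t0) Oy.
rewrite !indicE !mem_set// !mul1r.
have [cx cy] := (OsubC Ox, OsubC Oy).
have h2 : `|p x - p (x + t *: direction P x)| <= 2 * Q0.
  apply: le_trans (ler_normB _ _) _; have := HQ _ cx; have := HQ _ cy; lra.
have xP : x != P by apply/eqP => xP; apply: P_notin; rewrite -xP.
have h1 : `|p x - p (x + t *: direction P x)| <= `|M| * t `^ lambda.
  apply: le_trans (HM _ _ cx cy) _.
  rewrite opprD addNKr enormN enormZ enorm_direction// mulr1 gtr0_norm//.
  by apply: ler_wpM2r; [exact: powR_ge0|exact: ler_norm].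
have M0 := normr_ge0 M; have tl := powR_ge0 t lambda.
rewrite /lip_bnd; case: (leP (t `^ lambda) 1) => _.
  by apply: le_trans h1 _; apply: ler_wpM2r => //; rewrite lerDl mulr_ge0.
by rewrite mulr1; apply: le_trans h2 _; rewrite lerDr.
Qed.

Lemma elliptic_settingP (a : 'I_n -> 'I_n -> E -> R) (a0 : R) :
  (forall i j, C1_closure Omega (a i j)) -> 0 < a0 ->
  (forall Q, closure Omega Q -> forall xi : E,
    a0 * enorm xi ^+ 2 <= \sum_i \sum_j a i j Q * xi ord0 i * xi ord0 j) ->
  exists Amax, elliptic_setting Omega (fun i j x => \1_Omega x * a i j x) Amax a0.
Proof.
move=> ca a00 el.
have B i j : exists M, 0 <= M /\ forall x, closure Omega x -> `|a i j x| <= M.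
  by have [M M0 HM] := within_bounded (ca i j).1; exists M.
pose b i j := sval (cid (B i j)).
have b0 i j : 0 <= b i j by rewrite /b; case: cid => M [].
have bP i j x : Omega x -> `|a i j x| <= b i j.
  by move=> /OsubC cx; rewrite /b; case: cid => M [M0 /= HM]; exact: HM.
exists (\sum_i \sum_j b i j); split => //.
- by move=> i j; apply: measurable_zero_ext; case: (ca i j).
- move=> i j x; have bb : b i j <= \sum_i \sum_j b i j.
    rewrite (bigD1 i)//= ler_wpDr//.
      by apply: sumr_ge0 => k _; apply: sumr_ge0.
    by rewrite (bigD1 j)//= lerDl sumr_ge0.
  rewrite indicE; case: (boolP (x \in Omega)); rewrite ?inE => h.
    by rewrite mul1r; apply: le_trans (bP i j x h) bb.
  by rewrite mul0r normr0; apply: le_trans bb; exact: b0.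
move=> x Ox xi; have := el x (OsubC Ox) (\row_i xi i).
rewrite enorm_sqr; under eq_bigr do rewrite mxE.
move=> /le_trans; apply; apply: ler_sum => i _; apply: ler_sum => j _.
by rewrite !mxE indicE mem_set// mul1r.
Qed.

(** The parameters in the domain are bounded, stable under decrease by [segment_in], and without
    maximum as the domain is open; so they form []0, d[]. *)
Lemma ray_lengthP Q : Omega Q -> forall t, 0 < t ->
  (Omega (P + t *: direction P Q) <-> t < ray_length Omega P (direction P Q)).
Proof.
move=> OQ; set e := direction P Q; have [diam d0 hd] := diam_bound.
have QP : Q != P by apply/eqP => QP; apply: P_notin; rewrite -QP.
have e1 : enorm e = 1 by exact: enorm_direction.
pose T := [set t : R | 0 < t /\ Omega (P + t *: e)].
have T0 : T (enorm (Q - P)).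
  split; first by rewrite enorm_gt0 subr_eq0.
  rewrite /e /direction scalerA divff ?scale1r ?[P + _]addrC ?subrK//.
  by rewrite gt_eqF// enorm_gt0 subr_eq0.
have Tub : ubound T diam.
  move=> t [t0 Ot]; have := hd _ Ot.
  by rewrite addrC addKr enormZ e1 mulr1 gtr0_norm.
have hT : has_sup T by split; [exists (enorm (Q - P))|exists diam].
move=> t t0; split => [Ot|ts].
  have : nbhs (P + t *: e) Omega by move: oO; rewrite openE => /(_ _ Ot).
  move=> /nbhs_ballP[d /= dd dO]; pose k := d / (`|e| + 1).
  have k0 : 0 < k by rewrite divr_gt0// ltr_wpDl.
  have Tk : T (t + k / 2).
    split; first by rewrite addr_gt0// divr_gt0.
    apply: dO; rewrite -ball_normE /= scalerDl addrA opprD addNKr normrN normrZ.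
    rewrite gtr0_norm ?divr_gt0//.
    apply: (@le_lt_trans _ _ (k / 2 * (`|e| + 1))).
      by apply: ler_wpM2l; [rewrite divr_ge0// ltW|rewrite lerDl].
    rewrite mulrAC divfK; last by rewrite gt_eqF// ltr_wpDl.
    by rewrite ltr_pdivrMr// ltr_pMr// ltr1n.
  by apply: lt_le_trans (ub_le_sup hT.2 Tk); rewrite ltrDl divr_gt0.
have [t' [t'0 Ot'] tt'] : exists2 t', T t' & t < t'.
  have st : 0 < sup T - t by rewrite subr_gt0.
  have [t' Tt' h] := sup_adherent st hT; exists t' => //.
  by move: h; rewrite opprB addrC subrK.
have tt : t / t' <= 1 by rewrite ler_pdivrMr// mul1r ltW.
have := segment_in Ot' (divr_gt0 t0 t'0) tt; congr Omega; congr (_ + _).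
by rewrite addrC addKr scalerA divfK// gt_eqF.
Qed.

End ConvexRays.

(** * Truncated right-side derivatives *)

Section RealComplex.
Context {R : realType}.
Local Open Scope complex_scope.
Implicit Types (k : R) (z w : R[i]).

Lemma ReD z w : complex.Re (z + w) = complex.Re z + complex.Re w.
Proof. by case: z w => [a b] []. Qed.
Lemma ImD z w : complex.Im (z + w) = complex.Im z + complex.Im w.
Proof. by case: z w => [a b] []. Qed.
Lemma ReB z w : complex.Re (z - w) = complex.Re z - complex.Re w.
Proof. by case: z w => [a b] []. Qed.
Lemma ImB z w : complex.Im (z - w) = complex.Im z - complex.Im w.
Proof. by case: z w => [a b] []. Qed.
Lemma Re_rM k z : complex.Re (k%:C * z) = k * complex.Re z.
Proof. by case: z => a b /=; rewrite mul0r subr0. Qed.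
Lemma Im_rM k z : complex.Im (k%:C * z) = k * complex.Im z.
Proof. by case: z => a b /=; rewrite mul0r addr0. Qed.
Lemma Re_rdiv z k : complex.Re (z / k%:C) = complex.Re z / k.
Proof. by rewrite mulrC -fmorphV Re_rM mulrC. Qed.
Lemma Im_rdiv z k : complex.Im (z / k%:C) = complex.Im z / k.
Proof. by rewrite mulrC -fmorphV Im_rM mulrC. Qed.
Lemma Re_Mr z k : complex.Re (z * k%:C) = complex.Re z * k.
Proof. by rewrite mulrC Re_rM mulrC. Qed.
Lemma Im_Mr z k : complex.Im (z * k%:C) = complex.Im z * k.
Proof. by rewrite mulrC Im_rM mulrC. Qed.

End RealComplex.

Lemma Rintegral_shift {R : realType} (F : R -> R) (r : R) :
  measurable_fun setT (F : measurableTypeR R -> R) ->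
  \int[@lebesgue_measure R]_t F t = \int[@lebesgue_measure R]_t F (t + r).
Proof.
move=> mF; have mF' : measurable_fun setT (fun x : measurableTypeR R => (F x)%:E).
  exact/measurable_EFinP.
have sh (f : measurableTypeR R -> \bar R) : measurable_fun setT f ->
    (forall x, 0 <= f x)%E ->
    (\int[@lebesgue_measure R]_t f t = \int[@lebesgue_measure R]_t f (t + r)%R)%E.
  move=> mf f0; have := ge0_integral_affine r ltr01 mf f0.
  by rewrite invr1 mul1e => <-; apply: eq_integral => t _; rewrite mul1r.
rewrite /Rintegral integralE [in RHS]integralE; congr (fine (_ - _)%E).
- rewrite (sh _ (measurable_funepos mF') (funepos_ge0 _)).
  by apply: eq_integral => t _; rewrite !funeposE.
- rewrite (sh _ (measurable_funeneg mF') (funeneg_ge0 _)).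
  by apply: eq_integral => t _; rewrite !funenegE.
Qed.

Lemma mem_itvoo {R : realType} (a b : R) (t : measurableTypeR R) :
  (t \in (`]a, b[%classic : set (measurableTypeR R))) = (a < (t : R) < b).
Proof. by apply/idP/idP; rewrite inE /= in_itv. Qed.

Lemma mem_itvoy {R : realType} (a : R) (t : measurableTypeR R) :
  (t \in (`]a, +oo[%classic : set (measurableTypeR R))) = (a < (t : R)).
Proof. by apply/idP/idP; rewrite inE /= in_itv /= andbT. Qed.

Lemma mem_itvcy {R : realType} (a : R) (t : measurableTypeR R) :
  (t \in (`[a, +oo[%classic : set (measurableTypeR R))) = (a <= (t : R)).
Proof. by apply/idP/idP; rewrite inE /= in_itv /= andbT. Qed.

(** * The truncated derivative of a real function along rays *)

Section Truncated.
Context {R : realType} {n : nat}.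
Notation E := 'rV[R]_n.
Notation leb := (@lebesgue_measure R).
Notation TR := (measurableTypeR R).
Notation mu := (@lrow R n).
Implicit Types (g u v : E -> R) (Q : E) (eps : R).
Variables (Omega : set E) (P : E) (alpha lambda : R) (q : E -> R) (Q0 M pmin diam : R).
Hypothesis Hnl : nonlocal_setting Omega P alpha lambda q Q0 M pmin diam.
Hypothesis PO : ~ Omega P.
Hypothesis hray : forall Q, Omega Q -> forall t, 0 < t ->
  (Omega (P + t *: direction P Q) <-> t < ray_length Omega P (direction P Q)).
Variable G : R.
Let mO := nl_mO Hnl.
Let alpha0 := nl_alpha0 Hnl.
Local Notation Wop := (frac_op P alpha).
Local Notation kerA := (cut_ker alpha).
Local Notation dif := (ray_dif P).

(** The formula of [right_deriv_trunc] for real functions, with [G] for the value of the Gamma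
    function. *)
Definition rtrunc eps g Q : R :=
  let r := enorm (Q - P) in let e := direction P Q in
  let d := ray_length Omega P e in
  G^-1 * g Q * (d - r) `^ (- alpha) + alpha / G *
  (if r <= d - eps then
    \int[leb]_(t in `[r + eps, d[) ((g (P + r *: e) - g (P + t *: e)) / (t - r) `^ (alpha + 1))
  else g Q / alpha * ((eps `^ alpha)^-1 - ((d - r) `^ alpha)^-1)).

Let inside g (z : E * TR) : R :=
  \1_Omega (z.1 + (z.2 : R) *: direction P z.1) * dif g z.
(** [ray_length] is a supremum over uncountably many points, so measurability in [Q] is not visible.
    On the domain [d - r] is the length of the remaining part of the ray, an integral of an
    indicator, measurable by Fubini; [mtrunc] rewrites the truncated derivative with it. *)
Let len Q : R := \int[leb]_t (\1_(`]0, +oo[%classic : set TR) t * \1_Omega (Q + t *: direction P Q)).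
Let mtrunc eps g Q : R := G^-1 * g Q * len Q `^ (- alpha) + alpha / G *
  (if eps <= len Q then param_int (inside g) (kerA `[eps, +oo[) Q
   else g Q / alpha * ((eps `^ alpha)^-1 - (len Q `^ alpha)^-1)).

Let mOray : measurable_fun setT (fun z : E * TR => \1_Omega (z.1 + (z.2 : R) *: direction P z.1) : R).
Proof.
apply: (measurableT_comp (measurable_indic mO)); apply: measurable_ray.
  exact: measurable_fst.
exact: measurable_snd.
Qed.

Let minside g : measurable_fun setT g -> measurable_fun setT (inside g).
Proof. by move=> mg; apply: measurable_funM => //; exact: measurable_dif. Qed.

Let measurable_mtrunc eps g : measurable_fun setT g -> measurable_fun setT (mtrunc eps g).
Proof.
move=> mg; have ml : measurable_fun setT len.
  apply: (@measurable_Rintegral_snd _ _ _ _ _ leb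
    (fun z : E * TR => \1_(`]0, +oo[%classic : set TR) z.2 * \1_Omega (z.1 + (z.2 : R) *: direction P z.1))).
  apply: measurable_funM; last exact: mOray.
  apply: (measurableT_comp (f := (\1_(`]0, +oo[%classic : set TR) : TR -> R))) measurable_snd.
  exact: measurable_indic.
have mpow b : measurable_fun setT (fun Q => len Q `^ b).
  exact: (measurableT_comp (measurable_powR b)).
apply: measurable_funD; first by apply: measurable_funM => //; exact: measurable_funM.
apply: measurable_funM => //; apply: measurable_fun_ifT.
- by apply: measurable_fun_ler.
- apply: measurable_param_int; first exact: minside.
  by apply: measurable_kerA; exact: measurable_itv.
apply: measurable_funM; first exact: measurable_funM.
apply: measurable_funB => //.
under eq_fun do rewrite -powRN.
exact: mpow.
Qed.

Let rayE Q t : Q + t *: direction P Q = P + (enorm (Q - P) + t) *: direction P Q.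
Proof.
rewrite scalerDl addrA; congr (_ + _).
have [->|QP] := eqVneq Q P; first by rewrite subrr enorm0 scale0r addr0.
rewrite /direction scalerA divff ?scale1r ?[P + _]addrC ?subrK//.
by rewrite gt_eqF// enorm_gt0 subr_eq0.
Qed.

Let r_gt0 Q : Omega Q -> 0 < enorm (Q - P).
Proof.
by move=> OQ; rewrite enorm_gt0 subr_eq0; apply/eqP => QP; apply: PO; rewrite -QP.
Qed.

Let QE Q : P + enorm (Q - P) *: direction P Q = Q.
Proof. by have := rayE Q 0; rewrite scale0r !addr0 => <-. Qed.

Let inO Q t : Omega Q -> 0 < t ->
  \1_Omega (Q + t *: direction P Q) =
  (t < ray_length Omega P (direction P Q) - enorm (Q - P))%R%:R :> R.
Proof.
move=> OQ t0; rewrite indicE rayE; congr ((nat_of_bool _)%:R); apply/idP/idP.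
  rewrite inE => h; have := (hray OQ (addr_gt0 (r_gt0 OQ) t0)).1 h.
  by rewrite ltrBrDl.
by rewrite inE ltrBrDl => h; apply/(hray OQ (addr_gt0 (r_gt0 OQ) t0)).
Qed.

Let len_gt0 Q : Omega Q -> 0 < ray_length Omega P (direction P Q) - enorm (Q - P).
Proof. by move=> OQ; rewrite subr_gt0; apply/(hray OQ (r_gt0 OQ)); rewrite QE. Qed.

Let lenE Q : Omega Q -> len Q = ray_length Omega P (direction P Q) - enorm (Q - P).
Proof.
move=> OQ; set D := _ - _; have D0 : 0 < D := len_gt0 OQ.
rewrite /len (_ : (fun t : TR => _) = \1_(`]0, D[%classic : set TR)).
  rewrite /Rintegral integral_indic//= ?setIT.
  by rewrite lebesgue_measure_itv /= lte_fin D0 oppr0 adde0.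
apply/funext => t; rewrite [\1_`]0, +oo[ t]indicE [RHS]indicE mem_itvoo mem_itvoy.
by have [t0|t0] := ltP 0 (t : R); rewrite ?mul0r// mul1r (inO OQ t0).
Qed.

Let integralE eps g Q : 0 < eps -> measurable_fun setT g -> Omega Q ->
  \int[leb]_(t in `[enorm (Q - P) + eps, ray_length Omega P (direction P Q)[)
    ((g (P + enorm (Q - P) *: direction P Q) - g (P + t *: direction P Q)) /
     (t - enorm (Q - P)) `^ (alpha + 1)) =
  param_int (inside g) (kerA `[eps, +oo[) Q.
Proof.
move=> e0 mg OQ; set r := enorm _; set e := direction P Q; set d := ray_length _ _ _.
pose F (t : R) := \1_(`[r + eps, d[%classic : set TR) t *
  ((g (P + r *: e) - g (P + t *: e)) / (t - r) `^ (alpha + 1)).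
have mF : measurable_fun setT (F : TR -> R).
  apply: measurable_funM; first by apply: measurable_indic; exact: measurable_itv.
  apply: measurable_funM.
    apply: measurable_funB => //; apply: (measurableT_comp mg).
    apply: (measurable_rowD (f := fun=> P)) => //.
    by apply: (measurable_rowZ (f := fun=> e)).
  under eq_fun do rewrite -powRN.
  apply: (measurableT_comp (measurable_powR _)).
  exact: (measurable_funB (f := @id TR) (g := cst r)).
transitivity (\int[leb]_t F t).
  rewrite Rintegral_mkcond; apply: eq_Rintegral => t _; rewrite patchE /F indicE.
  by case: ifP => _; rewrite ?mul1r ?mul0r.
have Qe : P + r *: e = Q := QE Q.
have rE (t : R) : P + (t + r) *: e = Q + t *: e by rewrite [t + r]addrC rayE.
have mE (t : R) : ((t + r : TR) \in (`[r + eps, d[%classic : set TR)) = (eps <= t) && (r + t < d).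
  by apply/idP/idP; rewrite inE /= in_itv /= [t + r]addrC lerD2l.
rewrite (Rintegral_shift r mF); apply: eq_Rintegral => t _.
rewrite /F /inside /cut_ker /ray_ker /ray_dif /= addrK Qe rE [in LHS]indicE mE.
rewrite [\1_`[eps, +oo[ t]indicE mem_itvcy; have [et|et] := leP eps (t : R); last first.
  by rewrite /= !mul0r mulr0.
have t0 : 0 < (t : R) by exact: lt_le_trans et.
rewrite (inO OQ t0) t0 -/e -/d -/r ltrBrDl mul1r /=.
by case: (r + t < d); rewrite ?mul0r// !mul1r; congr (_ * _); rewrite -powRN opprD.
Qed.

Lemma rtruncE eps g Q : 0 < eps -> measurable_fun setT g -> Omega Q ->
  rtrunc eps g Q = mtrunc eps g Q.
Proof.
move=> e0 mg OQ; rewrite /rtrunc /mtrunc (integralE e0 mg OQ) (lenE OQ).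
set r := enorm _; set d := ray_length _ _ _.
by have -> : (r <= d - eps) = (eps <= d - r) by rewrite lerBrDr lerBrDr addrC.
Qed.

(** All points involved lie in the domain, so [g] may be replaced by its extension by 0. *)
Lemma rtrunc_ext eps g u Q : 0 < eps -> Omega Q -> (forall x, Omega x -> g x = u x) ->
  rtrunc eps g Q = rtrunc eps u Q.
Proof.
move=> e0 OQ gu; rewrite /rtrunc gu//; congr (_ + _ * _); case: ifP => // _.
apply: eq_Rintegral => t; rewrite inE /= in_itv /= => /andP[t1 t2].
rewrite QE gu// (gu (P + t *: _))//; apply/(hray OQ) => //.
by apply: lt_le_trans t1; rewrite addr_gt0 ?r_gt0.
Qed.

Lemma measurable_rtrunc eps g : 0 < eps -> measurable_fun setT g ->
  measurable_fun Omega (rtrunc eps g).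
Proof.
move=> e0 mg; apply: (eq_measurable_fun (mtrunc eps g)).
  by move=> Q; rewrite inE => OQ; rewrite rtruncE.
by apply: measurable_funTS; exact: measurable_mtrunc.
Qed.

(** If [eps <= d - r], the part [t >= d - r] contributes [g(Q) (d - r)^(- alpha) / alpha], the
    boundary term. Otherwise only the tail from [eps] is left, with [eps^(- alpha)], and the powers
    of [d - r] in the second case of the definition cancel. *)
Lemma rtrunc_Wop eps g Q : 0 < eps -> measurable_fun setT g -> Omega Q ->
  (forall x, ~ Omega x -> g x = 0) ->
  leb.-integrable setT (fun t => (dif g (Q, t) * kerA setT t)%:E) ->
  rtrunc eps g Q = alpha / G * Wop `[eps, +oo[ g Q.
Proof.
move=> e0 mg OQ gO ig; rewrite rtruncE// /mtrunc.
have D0 : 0 < len Q by rewrite lenE// len_gt0.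
have out t : 0 < t -> len Q <= t -> g (Q + t *: direction P Q) = 0.
  move=> t0 Dt; apply: gO => Oy; have := inO OQ t0.
  rewrite indicE mem_set// -lenE// ltNge Dt /= => /eqP.
  by rewrite oner_eq0.
have ins t : 0 < t -> t < len Q -> \1_Omega (Q + t *: direction P Q) = 1 :> R.
  by move=> t0 Dt; rewrite inO// -lenE// Dt.
have outs t : 0 < t -> len Q <= t -> \1_Omega (Q + t *: direction P Q) = 0 :> R.
  by move=> t0 Dt; rewrite inO// -lenE// ltNge Dt.
have an0 : alpha != 0 by rewrite gt_eqF.
rewrite -!powRN; have [eD|De] := leP eps (len Q).
  have [iT ET] := tail_ker Hnl D0.
  have iI : leb.-integrable setT (fun t => (inside g (Q, t) * kerA `[eps, +oo[ t)%:E).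
    apply: (le_integrable measurableT _ _ ig).
      apply/measurable_EFinP; apply: measurable_funM.
        exact: (measurable_fun_pair2 Q (minside mg)).
      by apply: measurable_kerA; exact: measurable_itv.
    move=> t _ /=; rewrite lee_fin !normrM; apply: ler_pM => //.
      rewrite -[leRHS]mul1r; apply: ler_wpM2r => //.
      by rewrite indicE; case: (_ \in _); rewrite ?normr1 ?normr0.
    apply: ler_wpM2r => //; rewrite !indicE in_setT normr1.
    by case: (_ \in _); rewrite ?normr1 ?normr0.
  have igT : leb.-integrable setT (fun t => (g Q * kerA `[len Q, +oo[ t)%:E).
    exact: (integrableZl measurableT _ iT).
  have -> : Wop `[eps, +oo[ g Q = param_int (inside g) (kerA `[eps, +oo[) Q +
      g Q * (len Q `^ (- alpha) / alpha).
    rewrite -ET -RintegralZl// -[param_int _ _ _]/(Rintegral _ _ _) -RintegralD//.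
    apply: eq_Rintegral => t _; rewrite /inside /ray_dif /cut_ker /ray_ker /= !indicE.
    rewrite !mem_itvcy -[(_ \in Omega)%:R]indicE.
    have [t0|t0] := ltP 0 (t : R); last by rewrite !mulr0 addr0.
    have [tD|tD] := ltP (t : R) (len Q).
      by rewrite ins// mul1r mul0r mulr0 addr0.
    by rewrite outs// !mul0r add0r out// subr0 (le_trans eD tD).
  move: (param_int _ _ _) (_ `^ _) => I X.
  by move: (G^-1) => Gi; field.
have [iT ET] := tail_ker Hnl e0.
have -> : Wop `[eps, +oo[ g Q = g Q * (eps `^ (- alpha) / alpha).
  rewrite -ET -RintegralZl//; apply: eq_Rintegral => t _.
  rewrite /ray_dif /cut_ker /= indicE mem_itvcy; have [et|et] := leP eps (t : R); last first.
    by rewrite mul0r !mulr0.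
  by rewrite out ?subr0//; [exact: lt_le_trans et|apply: ltW; exact: lt_le_trans et].
by move: (_ `^ _) (_ `^ _) (G^-1) => X Y Gi; field.
Qed.

End Truncated.

(** * Real and imaginary parts *)

Section Complexification.
Context {R : realType} {n : nat}.
Notation E := 'rV[R]_n.
Notation mu := (@lrow R n).
Notation PV := ((E -> R) * ('I_n -> E -> R))%type.
Local Open Scope complex_scope.
Implicit Types (u v g phi : E -> R[i]) (psi : E -> R).
Variable Omega : set E.
Hypothesis oO : open Omega.
Let mO := open_row_measurable oO.

(** Extension by 0 turns all integrals into integrals over the whole space, and radial shifts across
    the boundary see 0. *)
Definition re_on u : E -> R := fun x => \1_Omega x * complex.Re (u x).
Definition im_on u : E -> R := fun x => \1_Omega x * complex.Im (u x).

Let indO x : Omega x -> \1_Omega x = 1 :> R.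
Proof. by move=> Ox; rewrite indicE mem_set. Qed.
Let indN x : ~ Omega x -> \1_Omega x = 0 :> R.
Proof. by move=> Ox; rewrite indicE memNset. Qed.

Lemma re_onE u x : Omega x -> re_on u x = complex.Re (u x).
Proof. by move=> Ox; rewrite /re_on indO// mul1r. Qed.
Lemma im_onE u x : Omega x -> im_on u x = complex.Im (u x).
Proof. by move=> Ox; rewrite /im_on indO// mul1r. Qed.
Lemma re_on_out u x : ~ Omega x -> re_on u x = 0.
Proof. by move=> Ox; rewrite /re_on indN// mul0r. Qed.
Lemma im_on_out u x : ~ Omega x -> im_on u x = 0.
Proof. by move=> Ox; rewrite /im_on indN// mul0r. Qed.

Lemma re_onB u v : re_on (fun x => u x - v x) = re_on u - re_on v.
Proof. by apply/funext => x; rewrite /re_on ReB mulrBr. Qed.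
Lemma im_onB u v : im_on (fun x => u x - v x) = im_on u - im_on v.
Proof. by apply/funext => x; rewrite /im_on ImB mulrBr. Qed.

Let patch1 (f : E -> R) : f \_ Omega = (fun x => \1_Omega x * f x).
Proof.
apply/funext => x; rewrite patchE indicE; case: (x \in Omega); first exact/esym/mul1r.
exact/esym/mul0r.
Qed.

Lemma Rintegral_on (f : E -> R) :
  \int[lebesgue_row n]_(x in Omega) f x = \int[mu]_x (\1_Omega x * f x).
Proof. by rewrite Rintegral_mkcond patch1. Qed.

Lemma cintegralE u : cintegral (lebesgue_row n) Omega u =
  (\int[mu]_x re_on u x) +i* (\int[mu]_x im_on u x).
Proof. by rewrite /cintegral !Rintegral_on. Qed.

Let measurable_on (f : E -> R) :
  measurable_fun Omega f <-> measurable_fun setT (fun x => \1_Omega x * f x).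
Proof. by rewrite -patch1; exact: (@measurable_restrictT _ _ _ _ Omega f mO). Qed.

Lemma L2sq_on u : L2sq Omega u =
  (\int[mu]_x (re_on u x ^+ 2 + im_on u x ^+ 2)%:E)%E.
Proof.
rewrite /L2sq integral_mkcond; apply: eq_integral => x _.
rewrite patchE /re_on /im_on indicE; case: (x \in Omega); first by rewrite !mul1r.
by rewrite !mul0r expr0n /= addr0.
Qed.

Lemma in_L2P u : in_L2 Omega u <-> L2 mu (re_on u) /\ L2 mu (im_on u).
Proof.
have sq0 (x : R) : (0 <= (x ^+ 2)%:E)%E by rewrite lee_fin sqr_ge0.
split=> [[m1 m2 h]|[l1 l2]].
  have {}m1 := (measurable_on _).1 m1; have {}m2 := (measurable_on _).1 m2.
  have le (f : E -> R) : (forall x, f x ^+ 2 <= re_on u x ^+ 2 + im_on u x ^+ 2) ->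
      measurable_fun setT f -> (\int[mu]_x (f x ^+ 2)%:E < +oo)%E.
    move=> fle mf; apply: le_lt_trans h; rewrite L2sq_on; apply: ge0_le_integral => //.
    - by apply/measurable_EFinP; exact: measurable_funX.
    - by apply/measurable_EFinP; apply: measurable_funD; exact: measurable_funX.
    - by move=> x _; rewrite lee_fin.
  by split; apply: L2P => //; apply: le => // x; rewrite ?lerDl ?lerDr sqr_ge0.
have m1 := L2_meas l1; have m2 := L2_meas l2.
split; [exact/measurable_on|exact/measurable_on|].
rewrite L2sq_on; under eq_integral do rewrite EFinD.
rewrite ge0_integralD//; last 2 first.
- by apply/measurable_EFinP; exact: measurable_funX.
- by apply/measurable_EFinP; exact: measurable_funX.
by apply: lte_add_pinfty; exact: L2_lty.
Qed.

Lemma L2sq_nrm u : in_L2 Omega u ->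
  L2sq Omega u = (nrm mu (re_on u) ^+ 2 + nrm mu (im_on u) ^+ 2)%:E.
Proof.
move=> /in_L2P[l1 l2]; rewrite EFinD !nrm_sqrE// L2sq_on.
under [LHS]eq_integral do rewrite EFinD.
rewrite ge0_integralD//.
- by move=> x _; rewrite lee_fin sqr_ge0.
- by apply/measurable_EFinP; apply: measurable_funX; exact: L2_meas l1.
- by move=> x _; rewrite lee_fin sqr_ge0.
- by apply/measurable_EFinP; apply: measurable_funX; exact: L2_meas l2.
Qed.

Lemma in_L2B u v : in_L2 Omega u -> in_L2 Omega v -> in_L2 Omega (fun x => u x - v x).
Proof.
move=> /in_L2P[u1 u2] /in_L2P[v1 v2]; apply/in_L2P.
by rewrite re_onB im_onB; split; exact: L2B.
Qed.

Lemma test_functionP phi : test_function Omega phi <->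
  rtest Omega (fun x => complex.Re (phi x)) /\ rtest Omega (fun x => complex.Im (phi x)).
Proof.
split=> [[s1 s2 [K [cK KO K0]]]|[[s1 [K [cK KO K0]]] [s2 [K' [cK' KO' K0']]]]].
  by split; split => //; exists K; split => // x /K0 ->.
split => //; exists (K `|` K'); split; first exact: compactU.
  by move=> x [/KO|/KO'].
move=> x /not_orP[/K0 h /K0' h'].
by move: h h'; case: (phi x) => a b /= -> ->.
Qed.

Let test_out psi x : rtest Omega psi -> ~ Omega x -> psi x = 0.
Proof. by move=> [_ [K [_ KO K0]]] Ox; apply: K0 => /KO. Qed.

Lemma re_on_test phi : test_function Omega phi -> re_on phi = (fun x => complex.Re (phi x)).
Proof.
move=> /test_functionP[t1 _]; apply/funext => x; have [Ox|Ox] := pselect (Omega x).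
  by rewrite re_onE.
by rewrite re_on_out// (test_out t1 Ox).
Qed.

Lemma im_on_test phi : test_function Omega phi -> im_on phi = (fun x => complex.Im (phi x)).
Proof.
move=> /test_functionP[_ t2]; apply/funext => x; have [Ox|Ox] := pselect (Omega x).
  by rewrite im_onE.
by rewrite im_on_out// (test_out t2 Ox).
Qed.

Lemma test_in_L2 phi : test_function Omega phi -> in_L2 Omega phi.
Proof.
move=> tp; have /test_functionP[t1 t2] := tp; apply/in_L2P.
by rewrite re_on_test// im_on_test//; split; [exact: rtest_L2 t1|exact: rtest_L2 t2].
Qed.

Lemma test_cpartial i phi : test_function Omega phi -> test_function Omega (cpartial i phi).
Proof.
move=> /test_functionP[t1 t2]; apply/test_functionP.
by split; [exact: (rtest_pd i t1)|exact: (rtest_pd i t2)].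
Qed.

(** Real test functions suffice: a complex one is split into its parts, and the four real identities
    recombine. *)
Lemma is_gen_derivP i u g : in_L2 Omega u ->
  is_gen_deriv Omega i u g <-> in_L2 Omega g /\ forall psi, rtest Omega psi ->
    ip mu (re_on u) (pd i psi) = - ip mu (re_on g) psi /\
    ip mu (im_on u) (pd i psi) = - ip mu (im_on g) psi.
Proof.
move=> lu; have /in_L2P[u1 u2] := lu.
split=> [[lg h]|[lg h]]; split => //.
  move=> psi tpsi; pose phi x := (psi x)%:C.
  have tphi : test_function Omega phi.
    by apply/test_functionP; split => //; exact: rtest0.
  have cE x : cpartial i phi x = (pd i psi x)%:C.
    rewrite /cpartial /=; congr (_ +i* _); exact: derive_cst.
  have := h phi tphi; rewrite !cintegralE /re_on /im_on => -[h1 h2]; split.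
  - move: h1; rewrite /ip => h1.
    transitivity (\int[mu]_x (\1_Omega x * complex.Re (u x * cpartial i phi x))).
      by apply: eq_Rintegral => x _; rewrite cE Re_Mr mulrA.
    rewrite h1; congr (- _); apply: eq_Rintegral => x _.
    by rewrite Re_Mr mulrA.
  - move: h2; rewrite /ip => h2.
    transitivity (\int[mu]_x (\1_Omega x * complex.Im (u x * cpartial i phi x))).
      by apply: eq_Rintegral => x _; rewrite cE Im_Mr mulrA.
    rewrite h2; congr (- _); apply: eq_Rintegral => x _.
    by rewrite Im_Mr mulrA.
have /in_L2P[g1 g2] := lg.
move=> phi /test_functionP[t1 t2].
have [a1 a2] := h _ t1; have [b1 b2] := h _ t2.
pose p1 x := complex.Re (phi x); pose p2 x := complex.Im (phi x).
have l1 : L2 mu p1 := rtest_L2 t1; have l2 : L2 mu p2 := rtest_L2 t2.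
have d1 : L2 mu (pd i p1) := rtest_L2 (rtest_pd i t1).
have d2 : L2 mu (pd i p2) := rtest_L2 (rtest_pd i t2).
have Ere (f v : E -> R[i]) : re_on (fun x => f x * v x) =
    (fun x => re_on f x * complex.Re (v x) - im_on f x * complex.Im (v x)).
  apply/funext => x; rewrite /re_on /im_on; case: (f x) (v x) => [a b] [a' b'] /=; ring.
have Eim (f v : E -> R[i]) : im_on (fun x => f x * v x) =
    (fun x => re_on f x * complex.Im (v x) + im_on f x * complex.Re (v x)).
  apply/funext => x; rewrite /re_on /im_on; case: (f x) (v x) => [a b] [a' b'] /=; ring.
have IB (f1 f2 h1 h2 : E -> R) : L2 mu f1 -> L2 mu f2 -> L2 mu h1 -> L2 mu h2 ->
    \int[mu]_x (f1 x * h1 x - f2 x * h2 x) = ip mu f1 h1 - ip mu f2 h2.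
  by move=> *; apply: RintegralB => //; exact: L2_integrableM.
have ID (f1 f2 h1 h2 : E -> R) : L2 mu f1 -> L2 mu f2 -> L2 mu h1 -> L2 mu h2 ->
    \int[mu]_x (f1 x * h1 x + f2 x * h2 x) = ip mu f1 h1 + ip mu f2 h2.
  by move=> *; apply: RintegralD => //; exact: L2_integrableM.
rewrite !cintegralE !Ere !Eim.
rewrite (IB _ _ _ _ u1 u2 d1 d2) (ID _ _ _ _ u1 u2 d2 d1).
rewrite (IB _ _ _ _ g1 g2 l1 l2) (ID _ _ _ _ g1 g2 l2 l1).
rewrite a1 a2 b1 b2; congr (_ +i* _); ring.
Qed.

Lemma gen_deriv_unique (f g : E -> R) : L2 mu f -> L2 mu g ->
  (forall psi, rtest Omega psi -> ip mu f psi = ip mu g psi) ->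
  {ae mu, forall x, Omega x -> f x = g x}.
Proof.
move=> lf lg h; have lfg := L2B lf lg.
apply: filterS (flcv oO lfg _).
  by move=> x + Ox => /(_ Ox) /eqP; rewrite subr_eq0 => /eqP.
move=> psi tpsi; rewrite (bilBl (L2_submodule mu) (ip_bilinear mu) lf lg (rtest_L2 tpsi)).
by rewrite h// subrr.
Qed.

Lemma pdot_nrm (U : PV) : pdot U U = nrm mu U.1 ^+ 2 + \sum_i nrm mu (U.2 i) ^+ 2.
Proof. by rewrite /pdot nrm_sqr; congr (_ + _); apply: eq_bigr => i _; rewrite nrm_sqr. Qed.

Definition pair_re u : PV := (re_on u, fun i => re_on (gen_deriv Omega i u)).
Definition pair_im u : PV := (im_on u, fun i => im_on (gen_deriv Omega i u)).

Lemma in_H1_gen_deriv i u : in_H1 Omega u -> is_gen_deriv Omega i u (gen_deriv Omega i u).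
Proof. by move=> [_ /(_ i)[g hg]]; exact: (xgetPex (fun=> 0) (ex_intro _ g hg)). Qed.

Lemma pair_L2 u : in_H1 Omega u -> pL2 (pair_re u) /\ pL2 (pair_im u).
Proof.
move=> hu; have /in_L2P[u1 u2] := hu.1.
by split; split => // i; have [/in_L2P[]] := in_H1_gen_deriv i hu.
Qed.

Lemma H10_H0 u : in_H10 Omega u -> H0 Omega (pair_re u) /\ H0 Omega (pair_im u).
Proof.
move=> [hu ha]; have [l1 l2] := pair_L2 hu; have lu := hu.1.
have ex k : exists phi, test_function Omega phi /\
    (L2sq Omega (fun x => u x - phi x)%R + \sum_(i < n)
       L2sq Omega (fun x => gen_deriv Omega i u x - cpartial i phi x)%R
     < (((2^-1) ^+ k) ^+ 2)%:E)%E.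
  have [|phi t h] := ha (((2^-1) ^+ k) ^+ 2); last by exists phi.
  by rewrite !exprn_gt0// invr_gt0.
pose phi k := sval (cid (ex k)).
have tphi k : test_function Omega (phi k) by rewrite /phi; case: cid => x [].
pose P1 k : PV := ((fun x => complex.Re (phi k x)), (fun i => pd i (fun x => complex.Re (phi k x)))).
pose P2 k : PV := ((fun x => complex.Im (phi k x)), (fun i => pd i (fun x => complex.Im (phi k x)))).
have tP1 k : ptest Omega (P1 k) by split => //; have /test_functionP[] := tphi k.
have tP2 k : ptest Omega (P2 k) by split => //; have /test_functionP[] := tphi k.
have E1 k i : re_on (cpartial i (phi k)) = (P1 k).2 i by rewrite re_on_test//; exact: test_cpartial.
have E2 k i : im_on (cpartial i (phi k)) = (P2 k).2 i by rewrite im_on_test//; exact: test_cpartial.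
have bound k : pdot (pair_re u - P1 k) (pair_re u - P1 k) +
    pdot (pair_im u - P2 k) (pair_im u - P2 k) < ((2^-1) ^+ k) ^+ 2.
  have : (L2sq Omega (fun x => u x - phi k x)%R + \sum_(i < n)
       L2sq Omega (fun x => gen_deriv Omega i u x - cpartial i (phi k) x)%R
     < (((2^-1) ^+ k) ^+ 2)%:E)%E by rewrite /phi; case: cid => x [].
  rewrite (L2sq_nrm (in_L2B lu (test_in_L2 (tphi k)))) re_onB im_onB.
  rewrite (re_on_test (tphi k)) (im_on_test (tphi k)).
  under eq_bigr => i _.
    have ld : in_L2 Omega (fun x => gen_deriv Omega i u x - cpartial i (phi k) x).
      by apply: in_L2B; [case: (in_H1_gen_deriv i hu)|exact/test_in_L2/test_cpartial].
    rewrite (L2sq_nrm ld) re_onB im_onB E1 E2; over.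
  rewrite sumEFin -EFinD lte_fin; apply: le_lt_trans.
  by rewrite !pdot_nrm [leLHS]addrACA -big_split; exact: lexx.
have cv (U : PV) (Phi : nat -> PV) : pL2 U -> (forall k, ptest Omega (Phi k)) ->
    (forall k, pdot (U - Phi k) (U - Phi k) <= ((2^-1) ^+ k) ^+ 2) ->
    pnrm (Phi k - U) @[k --> \oo] --> 0.
  move=> lU tP h; apply: (@squeeze_cvgr _ _ _ _ (cst 0) (fun k => (2^-1) ^+ k)).
  - apply: nearW => k; rewrite pnrm_ge0 /= (pnrm_distC (ptest_L2 (tP k)) lU).
    have i0 : 0 <= (2^-1 : R) ^+ k by rewrite exprn_ge0// invr_ge0.
    by rewrite -[leRHS](ger0_norm i0) -sqrtr_sqr ler_wsqrtr.
  - exact: cvg_cst.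
  - by apply: cvg_expr; rewrite ger0_norm ?invr_ge0// invf_lt1// ltr1n.
split; split => //.
- by move=> x Ox; exact: re_on_out.
- exists P1 => //; apply: cv => // k; apply: ltW; apply: le_lt_trans (bound k).
  by rewrite lerDl pdot_ge0.
- by move=> x Ox; exact: im_on_out.
- exists P2 => //; apply: cv => // k; apply: ltW; apply: le_lt_trans (bound k).
  by rewrite lerDr pdot_ge0.
Qed.

(** Integration by parts holds for the approximating test pairs and passes to the limit. *)
Lemma H0_pd U i psi : H0 Omega U -> rtest Omega psi ->
  ip mu U.1 (pd i psi) = - ip mu (U.2 i) psi.
Proof.
move=> [lU _ [Phi tP cP]] tpsi; have lp := rtest_L2 tpsi.
have ldp := rtest_L2 (rtest_pd i tpsi); have bi := ip_bilinear mu.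
apply/eqP; rewrite -subr_eq0 -normr_le0.
apply: (@le0_of_cvg _ _ (fun k => pnrm (Phi k - U) * nrm mu (pd i psi) + pnrm (Phi k - U) * nrm mu psi)).
  move=> k; have [p1 p2] := ptest_L2 (tP k).
  have e0 : ip mu (Phi k).1 (pd i psi) = - ip mu ((Phi k).2 i) psi.
    have [t1 ->] := tP k; have := ip_pd i tpsi t1.
    by rewrite ipC => ->; rewrite [in RHS]ipC.
  have -> : ip mu U.1 (pd i psi) - - ip mu (U.2 i) psi =
      - ip mu ((Phi k).1 - U.1) (pd i psi) - ip mu ((Phi k).2 i - U.2 i) psi.
    rewrite (bilBl (L2_submodule mu) bi p1 lU.1 ldp).
    by rewrite (bilBl (L2_submodule mu) bi (p2 i) (lU.2 i) lp) e0; ring.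
  apply: le_trans (ler_normB _ _) _; rewrite normrN; apply: lerD.
    apply: le_trans (ip_CS (L2B p1 lU.1) ldp) _; apply: ler_wpM2r; first exact: nrm_ge0.
    exact: (nrm_le_pnrm (Phi k - U)).
  apply: le_trans (ip_CS (L2B (p2 i) (lU.2 i)) lp) _; apply: ler_wpM2r; first exact: nrm_ge0.
  exact: (nrm_grad_le_pnrm (Phi k - U) i).
have -> : 0 = 0 * nrm mu (pd i psi) + 0 * nrm mu psi :> R by rewrite !mul0r addr0.
by apply: cvgD; apply: cvgM => //; exact: cvg_cst.
Qed.

(** [H0] imposes vanishing off the domain on the function only. For the gradient component it
    follows from the test pairs that converge to it, whose gradients vanish there. *)
Lemma H0_grad_out U i : H0 Omega U -> {ae mu, forall x, ~ Omega x -> U.2 i x = 0}.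
Proof.
move=> [lU _ [Phi tP cP]]; have lUi := lU.2 i.
pose f x := (1 - \1_Omega x) * U.2 i x.
have lf : L2 mu f.
  apply: (@L2M_bounded _ _ _ mu 1) lUi.
    by apply: measurable_funB => //; exact: measurable_indic.
  by move=> x; rewrite indicE; case: (_ \in _); rewrite ?subrr ?subr0 ?normr0 ?normr1.
have f0 : nrm mu f = 0.
  apply/eqP; rewrite eq_le nrm_ge0 andbT.
  apply: (@le0_of_cvg _ _ (fun k => pnrm (Phi k - U))) => // k.
  apply: le_trans (nrm_grad_le_pnrm (Phi k - U) i).
  have [p1 p2] := ptest_L2 (tP k).
  apply: le_nrm; [exact: L2_meas lf|exact: L2B (p2 i) lUi|] => x.
  rewrite [X in _ <= `|X|](_ : _ = (Phi k).2 i x - U.2 i x)// /f.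
  have [Ox|Ox] := pselect (Omega x); first by rewrite indO// subrr mul0r normr0.
  have [t1 ->] := tP k.
  by rewrite indN// subr0 mul1r (test_out (rtest_pd i t1) Ox) sub0r normrN.
apply: filterS (nrm_eq0_ae lf f0) => x + Ox.
by rewrite /f indN// subr0 mul1r.
Qed.

Definition complexify (U1 U2 : PV) : E -> R[i] := fun x => U1.1 x +i* U2.1 x.

Lemma re_on_complexify U1 U2 : H0 Omega U1 -> re_on (complexify U1 U2) = U1.1.
Proof.
move=> [_ U0 _]; apply/funext => x; have [Ox|Ox] := pselect (Omega x).
  by rewrite re_onE.
by rewrite re_on_out// U0.
Qed.

Lemma im_on_complexify U1 U2 : H0 Omega U2 -> im_on (complexify U1 U2) = U2.1.
Proof.
move=> [_ U0 _]; apply/funext => x; have [Ox|Ox] := pselect (Omega x).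
  by rewrite im_onE.
by rewrite im_on_out// U0.
Qed.

(** [gen_deriv] is a chosen representative, so the original pairs are recovered at distance 0 rather
    than with equality; inside the domain by [gen_deriv_unique], outside by [H0_grad_out]. *)
Lemma complexify_H10 U1 U2 : H0 Omega U1 -> H0 Omega U2 ->
  [/\ in_H10 Omega (complexify U1 U2),
      pnrm (pair_re (complexify U1 U2) - U1) = 0 &
      pnrm (pair_im (complexify U1 U2) - U2) = 0].
Proof.
move=> h1 h2; set u := complexify U1 U2.
have [lU1 U10 [Phi1 tP1 cP1]] := h1; have [lU2 U20 [Phi2 tP2 cP2]] := h2.
have Ere : re_on u = U1.1 := re_on_complexify U2 h1.
have Eim : im_on u = U2.1 := im_on_complexify U1 h2.
have lu : in_L2 Omega u by apply/in_L2P; rewrite Ere Eim; split; [case: lU1|case: lU2].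
have cutL2 f : L2 mu f -> L2 mu (fun x => \1_Omega x * f x).
  apply: (@L2M_bounded _ _ _ mu 1); first exact: measurable_indic.
  by move=> x; rewrite indicE; case: (_ \in _); rewrite ?normr0 ?normr1.
have cut_ip f psi : rtest Omega psi -> ip mu (fun x => \1_Omega x * f x) psi = ip mu f psi.
  move=> tpsi; apply: eq_Rintegral => x _; have [Ox|Ox] := pselect (Omega x).
    by rewrite indO// mul1r.
  by rewrite (test_out tpsi Ox) !mulr0.
have gd i : is_gen_deriv Omega i u (fun x => U1.2 i x +i* U2.2 i x).
  apply/(is_gen_derivP i _ lu); split.
    by apply/in_L2P; split; apply: cutL2; [exact: lU1.2|exact: lU2.2].
  move=> psi tpsi; rewrite Ere Eim /re_on /im_on /= !cut_ip//.
  by split; exact: H0_pd.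
have hu : in_H1 Omega u by split => // i; eexists; exact: gd.
have g1 i : nrm mu (re_on (gen_deriv Omega i u) - U1.2 i) = 0.
  have [lg hg] := (is_gen_derivP i _ lu).1 (in_H1_gen_deriv i hu).
  have [l1 l2] := (in_L2P _).1 lg.
  have -> : 0 = nrm mu (0 : E -> R).
    by rewrite -(scale0r (0 : E -> R)) nrmZ ?normr0 ?mul0r//; exact: L2_0.
  apply: nrm_ae_eq; [exact: L2_meas (L2B l1 (lU1.2 i))|exact: L2_meas (L2_0 mu)|].
  have hin : {ae mu, forall x, Omega x -> re_on (gen_deriv Omega i u) x = U1.2 i x}.
    apply: (gen_deriv_unique l1 (lU1.2 i)) => psi tpsi.
    by apply/oppr_inj; rewrite -(H0_pd i h1 tpsi) -(hg psi tpsi).1 Ere.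
  apply: filterS2 hin (H0_grad_out i h1) => x hin hout.
  rewrite [LHS](_ : _ = re_on (gen_deriv Omega i u) x - U1.2 i x)//.
  have [Ox|Ox] := pselect (Omega x); first by rewrite hin// subrr.
  by rewrite hout// re_on_out// subrr.
have g2 i : nrm mu (im_on (gen_deriv Omega i u) - U2.2 i) = 0.
  have [lg hg] := (is_gen_derivP i _ lu).1 (in_H1_gen_deriv i hu).
  have [l1 l2] := (in_L2P _).1 lg.
  have -> : 0 = nrm mu (0 : E -> R).
    by rewrite -(scale0r (0 : E -> R)) nrmZ ?normr0 ?mul0r//; exact: L2_0.
  apply: nrm_ae_eq; [exact: L2_meas (L2B l2 (lU2.2 i))|exact: L2_meas (L2_0 mu)|].
  have hin : {ae mu, forall x, Omega x -> im_on (gen_deriv Omega i u) x = U2.2 i x}.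
    apply: (gen_deriv_unique l2 (lU2.2 i)) => psi tpsi.
    by apply/oppr_inj; rewrite -(H0_pd i h2 tpsi) -(hg psi tpsi).2 Eim.
  apply: filterS2 hin (H0_grad_out i h2) => x hin hout.
  rewrite [LHS](_ : _ = im_on (gen_deriv Omega i u) x - U2.2 i x)//.
  have [Ox|Ox] := pselect (Omega x); first by rewrite hin// subrr.
  by rewrite hout// im_on_out// subrr.
have nrm00 : nrm mu (0 : E -> R) = 0.
  by rewrite -(scale0r (0 : E -> R)) nrmZ ?normr0 ?mul0r//; exact: L2_0.
have n1 : pnrm (pair_re u - U1) = 0.
  apply/eqP; rewrite eq_le pnrm_ge0 andbT; apply: le_trans (pnrm_le_sum _) _.
  rewrite big1; last by move=> i _; exact: g1.
  by rewrite addr0 -[(_ - _).1]/(re_on u - U1.1) Ere subrr nrm00.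
have n2 : pnrm (pair_im u - U2) = 0.
  apply/eqP; rewrite eq_le pnrm_ge0 andbT; apply: le_trans (pnrm_le_sum _) _.
  rewrite big1; last by move=> i _; exact: g2.
  by rewrite addr0 -[(_ - _).1]/(im_on u - U2.1) Eim subrr nrm00.
split => //; split => // e e0.
have [lp1 lp2] := pair_L2 hu.
have cc : pnrm (Phi1 k - U1) ^+ 2 + pnrm (Phi2 k - U2) ^+ 2 @[k --> \oo] --> (0 * 0 + 0 * 0 : R).
  by apply: cvgD; apply: cvgM.
have [k hk] : exists k, pnrm (Phi1 k - U1) ^+ 2 + pnrm (Phi2 k - U2) ^+ 2 < e.
  move/cvgrPdist_lt: cc => /(_ e e0)[k _ /(_ k (leqnn k))] h; exists k.
  by move: h; rewrite mul0r addr0 sub0r normrN; apply: le_lt_trans; exact: ler_norm.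
pose phi x := (Phi1 k).1 x +i* (Phi2 k).1 x.
have tphi : test_function Omega phi.
  by apply/test_functionP; split; [case: (tP1 k)|case: (tP2 k)].
exists phi => //.
have P1E : (re_on phi, fun i => re_on (cpartial i phi)) = Phi1 k.
  rewrite (re_on_test tphi) [RHS]surjective_pairing; congr pair.
  apply/funext => i; rewrite (re_on_test (test_cpartial i tphi)) /=.
  by case: (tP1 k) => _ ->.
have P2E : (im_on phi, fun i => im_on (cpartial i phi)) = Phi2 k.
  rewrite (im_on_test tphi) [RHS]surjective_pairing; congr pair.
  apply/funext => i; rewrite (im_on_test (test_cpartial i tphi)) /=.
  by case: (tP2 k) => _ ->.
have lc i : in_L2 Omega (fun x => gen_deriv Omega i u x - cpartial i phi x).
  by apply: in_L2B; [case: (in_H1_gen_deriv i hu)|exact/test_in_L2/test_cpartial].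
rewrite (L2sq_nrm (in_L2B lu (test_in_L2 tphi))) re_onB im_onB.
under eq_bigr => i _ do rewrite (L2sq_nrm (lc i)) re_onB im_onB.
rewrite sumEFin -EFinD lte_fin; apply: le_lt_trans hk.
(* Since the distances just computed are 0, the approximants of [U1] and [U2] also approximate the
   pairs built from [gen_deriv]. *)
have close (X U Y : PV) : pL2 X -> pL2 U -> pL2 Y -> pnrm (X - U) = 0 ->
    pdot (X - Y) (X - Y) <= pnrm (Y - U) ^+ 2.
  move=> lX lU lY XU; rewrite -pnrm_sqr; apply: lerXn2r; rewrite ?nnegrE ?pnrm_ge0//.
  rewrite -[X - Y](subrKA U); apply: le_trans (pnrmD _ _) _; try exact: (subB pL2_submodule).
  by rewrite XU add0r (pnrm_distC lU lY).
have c1 := close _ _ _ lp1 lU1 (ptest_L2 (tP1 k)) n1.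
have c2 := close _ _ _ lp2 lU2 (ptest_L2 (tP2 k)) n2.
apply: le_trans (lerD c1 c2).
by rewrite !pdot_nrm [leRHS]addrACA -big_split -P1E -P2E; exact: lexx.
Qed.

End Complexification.

(** * The right-side derivative *)

Lemma cvg_sum_sqr0 {R : realType} (S : R -> \bar R) (x y k : R -> R) (K1 K2 : R) :
  (forall e : R, 0 < e -> S e = (x e ^+ 2 + y e ^+ 2)%:E) ->
  (forall e : R, 0 < e -> 0 <= x e <= K1 * k e) ->
  (forall e : R, 0 < e -> 0 <= y e <= K2 * k e) ->
  k e @[e --> 0^'+] --> (0 : R) -> S e @[e --> 0^'+] --> 0%E.
Proof.
move=> SE hx hy k0; apply: cvg_EFin.
  by near=> e; rewrite SE//; near: e; exact: nbhs_right_gt.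
apply: (@squeeze_cvgr _ _ _ _ (cst 0)
  (fun e => (K1 * k e) * (K1 * k e) + (K2 * k e) * (K2 * k e))).
- near=> e; have e0 : 0 < e by near: e; exact: nbhs_right_gt.
  have /andP[x0 x1] := hx _ e0; have /andP[y0 y1] := hy _ e0.
  rewrite /= SE//= addr_ge0 ?sqr_ge0//= !expr2.
  by apply: lerD; apply: ler_pM.
- exact: cvg_cst.
- rewrite (_ : nbhs 0 = nbhs (K1 * 0 * (K1 * 0) + K2 * 0 * (K2 * 0))); last first.
    by rewrite !mulr0 addr0.
  by apply: cvgD; apply: cvgM; apply: cvgM => //; exact: cvg_cst.
Unshelve. all: by end_near. Qed.

Section RightDerivative.
Context {R : realType} {n : nat}.
Notation E := 'rV[R]_n.
Notation mu := (@lrow R n).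
Notation leb := (@lebesgue_measure R).
Notation TR := (measurableTypeR R).
Notation PV := ((E -> R) * ('I_n -> E -> R))%type.
Local Open Scope complex_scope.
Implicit Types (u v g w : E -> R[i]) (Q : E) (eps : R).
Variables (Omega : set E) (P : E) (alpha lambda : R) (p : E -> R) (Q0 M pmin diam : R).
Let q : E -> R := fun x => \1_Omega x * p x.
Hypothesis oO : open Omega.
Hypothesis Hnl : nonlocal_setting Omega P alpha lambda q Q0 M pmin diam.
Hypothesis PO : ~ Omega P.
Hypothesis hray : forall Q, Omega Q -> forall t, 0 < t ->
  (Omega (P + t *: direction P Q) <-> t < ray_length Omega P (direction P Q)).
Let mO := nl_mO Hnl.
Let alpha0 := nl_alpha0 Hnl.
Let alpha1 := nl_alpha1 Hnl.
Let G : R := Gamma (1 - alpha).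
Let c : R := alpha / G.
Local Notation Wop := (frac_op P alpha).
Local Notation rtrunc := (rtrunc Omega P alpha G).
Local Notation re_on := (re_on Omega).
Local Notation im_on := (im_on Omega).

Lemma Re_trunc eps g Q : complex.Re (right_deriv_trunc Omega P alpha eps g Q) =
  rtrunc eps (fun x => complex.Re (g x)) Q.
Proof.
rewrite /right_deriv_trunc /psi_right /rtrunc /= ReD Re_Mr !Re_rM; congr (_ + _ * _).
case: ifP => _; last by rewrite Re_Mr Re_rdiv.
rewrite /cintegral /=; apply: eq_Rintegral => t _.
by rewrite Re_rdiv ReB.
Qed.

Lemma Im_trunc eps g Q : complex.Im (right_deriv_trunc Omega P alpha eps g Q) =
  rtrunc eps (fun x => complex.Im (g x)) Q.
Proof.
rewrite /right_deriv_trunc /psi_right /rtrunc /= ImD Im_Mr !Im_rM; congr (_ + _ * _).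
case: ifP => _; last by rewrite Im_Mr Im_rdiv.
rewrite /cintegral /=; apply: eq_Rintegral => t _.
by rewrite Im_rdiv ImB.
Qed.

Let cut f x : R := \1_Omega x * f x.

Let cutL2 f : L2 mu f -> L2 mu (cut f).
Proof.
apply: (@L2M_bounded _ _ _ mu 1); first exact: measurable_indic.
by move=> x; rewrite indicE; case: (_ \in _); rewrite ?normr0 ?normr1.
Qed.

Let patch1 (f : E -> R) : f \_ Omega = cut f.
Proof.
apply/funext => x; rewrite patchE /cut indicE; case: (x \in Omega); first exact/esym/mul1r.
exact/esym/mul0r.
Qed.

Let qn x : `|q x| <= Q0. Proof. by rewrite ger0_norm ?(nl_q_ge0 Hnl)// (nl_q_le Hnl). Qed.

(** The integral of [t^(lambda - alpha - 1)] over []0, eps]], from [integral_bnd_near]. *)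
Let rate eps := eps `^ (lambda - alpha) / (lambda - alpha).

(** On the domain the truncated derivative is almost everywhere [c] times the operator with kernel
    restricted to [t >= eps]. The error is therefore the operator with [t < eps], whose norm is
    bounded by the small mass of the kernel there. *)
Lemma rtrunc_L2 (u : E -> R) N eps : slope_on Omega P u N -> 0 < eps ->
  L2 mu (cut (rtrunc eps (q * u))) /\
  nrm mu (cut (rtrunc eps (q * u)) - cut (c *: Wop setT (q * u))) <=
    `|c| * (nlC Q0 M * N * rate eps).
Proof.
move=> su e0; have [lu _ uO _] := su.
have mA : measurable (`[eps, +oo[%classic : set TR) by exact: measurable_itv.
have mB : measurable (`]-oo, eps[%classic : set TR) by exact: measurable_itv.
have lqu : L2 mu (q * u) by exact: (L2M_bounded (nl_mq Hnl) qn).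
have mqu := L2_meas lqu.
have quO x : ~ Omega x -> (q * u) x = 0 by move=> Ox; rewrite fctE /= uO// mulr0.
have m1 : measurable_fun setT (cut (rtrunc eps (q * u))).
  rewrite -patch1; exact: (@measurable_restrictT _ _ _ _ Omega _ mO).1
    (measurable_rtrunc Hnl PO hray G e0 mqu).
have [lA _] := L2_Wop Hnl mA su; have [lT _] := L2_Wop Hnl measurableT su.
have rate0 : 0 < rate eps by rewrite divr_gt0 ?powR_gt0// subr_gt0.
have [|lB nB] := L2_WopI Hnl mB rate0 _ su.
  apply: le_trans (integral_bnd_near Hnl e0); apply: ge0_le_integral => //.
  - by move=> t _; rewrite lee_fin mulr_ge0 ?bnd_ge0 ?kerA_ge0.
  - apply/measurable_EFinP; apply: measurable_funM; first exact: measurable_bnd.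
    exact: measurable_kerA.
  - apply/measurable_EFinP; apply: measurable_funM; first exact: measurable_bnd.
    by apply: measurable_kerA; exact: measurable_itv.
  move=> t _; rewrite lee_fin; apply: ler_wpM2l; first exact: bnd_ge0.
  apply: ler_wpM2r; first exact: ker_ge0.
  rewrite !indicE ler_nat; case: (boolP (t \in _)) => // ht.
  by rewrite mem_set//; move: ht; rewrite inE /= !in_itv /= => /ltW.
have ae1 : {ae mu, forall x, cut (rtrunc eps (q * u)) x = cut (c *: Wop `[eps, +oo[ (q * u)) x}.
  apply: filterS (Wop_fin Hnl measurableT su) => x hx; rewrite /cut indicE.
  have [Ox|Ox] := pselect (Omega x); last by rewrite memNset// !mul0r.
  by rewrite mem_set// (rtrunc_Wop Hnl PO hray G e0 mqu Ox quO hx).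
have lcA := cutL2 (L2Z c lA); have lcT := cutL2 (L2Z c lT).
have l1 : L2 mu (cut (rtrunc eps (q * u))).
  apply: (L2_ae_eq m1 lcA); apply: filterS ae1 => x; exact: esym.
split => //.
have ae2 : {ae mu, forall x, (cut (rtrunc eps (q * u)) - cut (c *: Wop setT (q * u))) x =
    cut (- c *: Wop `]-oo, eps[ (q * u)) x}.
  apply: filterS3 ae1 (Wop_fin Hnl mA su) (Wop_fin Hnl mB su) => x h1 hA hB.
  have ET : Wop setT (q * u) x = Wop `[eps, +oo[ (q * u) x + Wop `]-oo, eps[ (q * u) x.
    rewrite -[RHS](RintegralD measurableT hA hB).
    apply: eq_Rintegral => t _; rewrite /cut_ker !indicE in_setT mem_itvcy.
    have -> : (t \in (`]-oo, eps[%classic : set TR)) = ((t : R) < eps).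
      by apply/idP/idP; rewrite inE /= in_itv.
    by case: (leP eps (t : R)) => _ /=; ring.
  rewrite [LHS](_ : _ = cut (rtrunc eps (q * u)) x - cut (c *: Wop setT (q * u)) x)// h1 /cut.
  by rewrite !scalrfctE ET /GRing.scale /=; ring.
have lcB := L2Z (- c) lB.
rewrite (nrm_ae_eq _ _ ae2); [|exact: L2_meas (L2B l1 lcT)|exact: L2_meas (cutL2 lcB)].
apply: (@le_trans _ _ (1 * nrm mu (- c *: Wop `]-oo, eps[ (q * u)))).
  apply: nrmM_bounded => //.
  by move=> x; rewrite indicE; case: (_ \in _); rewrite ?normr0 ?normr1.
by rewrite mul1r nrmZ// normrN; apply: ler_wpM2l.
Qed.

Lemma right_deriv_exists v : in_H10 Omega v ->
  is_right_deriv Omega P alpha (fun Q => (p Q)%:C * v Q)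
    (fun Q => (c * Wop setT (q * re_on v) Q) +i* (c * Wop setT (q * im_on v) Q)).
Proof.
move=> hv; have [h1 h2] := H10_H0 oO hv.
have s1 : slope_on Omega P (re_on v) _ := H0_slope Hnl h1.
have s2 : slope_on Omega P (im_on v) _ := H0_slope Hnl h2.
set N1 := pnrm _ in s1; set N2 := pnrm _ in s2.
set g := fun Q => (p Q)%:C * v Q; set w := fun Q => _ +i* _.
have [lT1 _] := L2_Wop Hnl measurableT s1; have [lT2 _] := L2_Wop Hnl measurableT s2.
have rw : re_on w = cut (c *: Wop setT (q * re_on v)) by [].
have iw : im_on w = cut (c *: Wop setT (q * im_on v)) by [].
have lw : in_L2 Omega w.
  by apply/(in_L2P oO); rewrite rw iw; split; apply: cutL2; exact: L2Z.
have rT eps : 0 < eps -> re_on (right_deriv_trunc Omega P alpha eps g) =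
    cut (rtrunc eps (q * re_on v)).
  move=> e0; apply/funext => x; rewrite /cut.
  have [Ox|Ox] := pselect (Omega x); last by rewrite re_on_out// indicE memNset// mul0r.
  rewrite re_onE// Re_trunc indicE mem_set// mul1r.
  apply: (rtrunc_ext alpha PO hray G e0 Ox) => y Oy.
  by rewrite /g Re_rM fctE /= /q indicE mem_set// mul1r re_onE.
have iT eps : 0 < eps -> im_on (right_deriv_trunc Omega P alpha eps g) =
    cut (rtrunc eps (q * im_on v)).
  move=> e0; apply/funext => x; rewrite /cut.
  have [Ox|Ox] := pselect (Omega x); last by rewrite im_on_out// indicE memNset// mul0r.
  rewrite im_onE// Im_trunc indicE mem_set// mul1r.
  apply: (rtrunc_ext alpha PO hray G e0 Ox) => y Oy.
  by rewrite /g Im_rM fctE /= /q indicE mem_set// mul1r im_onE.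
have lT eps : 0 < eps -> in_L2 Omega (right_deriv_trunc Omega P alpha eps g).
  move=> e0; apply/(in_L2P oO); rewrite rT// iT//.
  by split; [case: (rtrunc_L2 s1 e0)|case: (rtrunc_L2 s2 e0)].
split => //; first by near=> eps; apply: lT; near: eps; exact: nbhs_right_gt.
have LE eps : 0 < eps -> L2sq Omega (fun Q => right_deriv_trunc Omega P alpha eps g Q - w Q) =
    (nrm mu (cut (rtrunc eps (q * re_on v)) - cut (c *: Wop setT (q * re_on v))) ^+ 2 +
     nrm mu (cut (rtrunc eps (q * im_on v)) - cut (c *: Wop setT (q * im_on v))) ^+ 2)%:E.
  move=> e0; rewrite (L2sq_nrm oO (in_L2B oO (lT _ e0) lw)) re_onB im_onB.
  by rewrite rT// iT// rw iw.
apply: (cvg_sum_sqr0 (k := fun eps => eps `^ (lambda - alpha))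
  (K1 := `|c| * (nlC Q0 M * N1 / (lambda - alpha)))
  (K2 := `|c| * (nlC Q0 M * N2 / (lambda - alpha))) LE) => [eps e0|eps e0|].
- have [_ n1] := rtrunc_L2 s1 e0; rewrite nrm_ge0 /=; apply: le_trans n1 _.
  rewrite /rate le_eqVlt; apply/orP; left; apply/eqP.
  by move: (_ `^ _) => y; ring.
- have [_ n2] := rtrunc_L2 s2 e0; rewrite nrm_ge0 /=; apply: le_trans n2 _.
  rewrite /rate le_eqVlt; apply/orP; left; apply/eqP.
  by move: (_ `^ _) => y; ring.
- by apply: powR_cvg0; rewrite subr_gt0.
Unshelve. all: by end_near. Qed.

Lemma right_deriv_unique g w w' : is_right_deriv Omega P alpha g w ->
  is_right_deriv Omega P alpha g w' ->
  nrm mu (re_on w - re_on w') = 0 /\ nrm mu (im_on w - im_on w') = 0.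
Proof.
move=> [lw hT cw] [lw' _ cw'].
have [w1 w2] := (in_L2P oO _).1 lw; have [w1' w2'] := (in_L2P oO _).1 lw'.
have small (e : R) : 0 < e -> exists T : E -> R[i], [/\ in_L2 Omega T,
    (L2sq Omega (fun Q => T Q - w Q)%R < (e ^+ 2)%:E)%E &
    (L2sq Omega (fun Q => T Q - w' Q)%R < (e ^+ 2)%:E)%E].
  move=> e0; have ee : 0 < e ^+ 2 by rewrite exprn_gt0.
  have nb := @nbhs_open_ereal_lt R 0 (fun=> e ^+ 2) ee.
  have n1 := cw _ nb; have n2 := cw' _ nb.
  have N : (0 : R)^'+ (fun eps => [/\ in_L2 Omega (right_deriv_trunc Omega P alpha eps g),
      (L2sq Omega (fun Q => right_deriv_trunc Omega P alpha eps g Q - w Q)%R < (e ^+ 2)%:E)%E &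
      (L2sq Omega (fun Q => right_deriv_trunc Omega P alpha eps g Q - w' Q)%R < (e ^+ 2)%:E)%E]).
    by apply: filterS3 hT n1 n2 => eps k1 k2 k3.
  have [eps k] := filter_ex N.
  by exists (right_deriv_trunc Omega P alpha eps g).
have le (f f' T : E -> R) e : 0 < e -> L2 mu f -> L2 mu f' -> L2 mu T ->
    nrm mu (T - f) ^+ 2 < e ^+ 2 -> nrm mu (T - f') ^+ 2 < e ^+ 2 ->
    nrm mu (f - f') <= e + e.
  move=> e0 lf lf' lT h1 h2.
  have g1 : nrm mu (T - f) < e.
    by rewrite -(ltr_pXn2r (n := 2))// ?nnegrE ?nrm_ge0// ltW.
  have g2 : nrm mu (T - f') < e.
    by rewrite -(ltr_pXn2r (n := 2))// ?nnegrE ?nrm_ge0// ltW.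
  have -> : f - f' = (f - T) + (T - f') by apply/funext => x; rewrite !fctE; ring.
  apply: le_trans (nrmD (L2B lf lT) (L2B lT lf')) _.
  by rewrite nrm_distC; apply: lerD; exact: ltW.
have fin e : 0 < e -> nrm mu (re_on w - re_on w') <= e + e /\ nrm mu (im_on w - im_on w') <= e + e.
  move=> e0; have [T [lT h1 h2]] := small e e0.
  have [t1 t2] := (in_L2P oO _).1 lT.
  move: h1 h2; rewrite (L2sq_nrm oO (in_L2B oO lT lw)) (L2sq_nrm oO (in_L2B oO lT lw')).
  rewrite !lte_fin !re_onB !im_onB => h1 h2.
  split; [apply: (le _ _ (re_on T))|apply: (le _ _ (im_on T))] => //.
  - by apply: le_lt_trans h1; rewrite lerDl sqr_ge0.
  - by apply: le_lt_trans h2; rewrite lerDl sqr_ge0.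
  - by apply: le_lt_trans h1; rewrite lerDr sqr_ge0.
  - by apply: le_lt_trans h2; rewrite lerDr sqr_ge0.
split; apply/eqP; rewrite eq_le nrm_ge0 andbT; apply/ler_addgt0Pr => e e0.
  by rewrite add0r (splitr e); have [] := fin _ (divr_gt0 e0 (ltr0n R 2)).
by rewrite add0r (splitr e); have [] := fin _ (divr_gt0 e0 (ltr0n R 2)).
Qed.

End RightDerivative.

(** * The weak problem *)

Lemma Gamma_ge0 {R : realType} (x : R) : 0 <= Gamma x.
Proof. by apply: Rintegral_ge0 => t _; rewrite mulr_ge0 ?powR_ge0 ?expR_ge0. Qed.

Section ComplexParts.
Context {R : realType}.
Local Open Scope complex_scope.
Implicit Types x y : R[i].

Lemma Re_sum (I : Type) (s : seq I) (F : I -> R[i]) :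
  complex.Re (\sum_(i <- s) F i) = \sum_(i <- s) complex.Re (F i).
Proof. exact: (big_morph _ (@ReD R) erefl). Qed.

Lemma Im_sum (I : Type) (s : seq I) (F : I -> R[i]) :
  complex.Im (\sum_(i <- s) F i) = \sum_(i <- s) complex.Im (F i).
Proof. exact: (big_morph _ (@ImD R) erefl). Qed.

Lemma Re_conjM x y : complex.Re (x * y^*) =
  complex.Re x * complex.Re y + complex.Im x * complex.Im y.
Proof. by case: x y => a b [c d] /=; ring. Qed.

(** The sign is attached to the imaginary part of [y], so that the expression is a sum of two
    products and [Rintegral_form] applies with the pair [- pair_im z]. *)
Lemma Im_conjM x y : complex.Im (x * y^*) =
  complex.Im x * complex.Re y + complex.Re x * - complex.Im y.
Proof. by case: x y => a b [c d] /=; ring. Qed.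

Lemma Re_scale_conjM (k : R) x y : complex.Re (k%:C * x * y^*) =
  k * complex.Re x * complex.Re y + k * complex.Im x * complex.Im y.
Proof. by rewrite Re_conjM Re_rM Im_rM. Qed.

Lemma Im_scale_conjM (k : R) x y : complex.Im (k%:C * x * y^*) =
  k * complex.Im x * complex.Re y + k * complex.Re x * - complex.Im y.
Proof. by rewrite Im_conjM Re_rM Im_rM. Qed.

End ComplexParts.

Section WeakForm.
Context {R : realType} {n : nat}.
Notation E := 'rV[R]_n.
Notation mu := (@lrow R n).
Notation PV := ((E -> R) * ('I_n -> E -> R))%type.
Local Open Scope complex_scope.
Implicit Types (U V Z : PV) (u v w z f g : E -> R[i]).
Variables (Omega : set E) (P : E) (alpha lambda : R) (a : 'I_n -> 'I_n -> E -> R) (p : E -> R).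
Variables (Q0 M pmin diam Amax a0 rad : R).
Let q : E -> R := fun x => \1_Omega x * p x.
Let A : 'I_n -> 'I_n -> E -> R := fun i j x => \1_Omega x * a i j x.
Hypothesis oO : open Omega.
Hypothesis Hnl : nonlocal_setting Omega P alpha lambda q Q0 M pmin diam.
Hypothesis Hel : elliptic_setting Omega A Amax a0.
Hypothesis PO : ~ Omega P.
Hypothesis hray : forall Q, Omega Q -> forall t, 0 < t ->
  (Omega (P + t *: direction P Q) <-> t < ray_length Omega P (direction P Q)).
Hypotheses (rad0 : 0 < rad) (Orad : Omega `<=` cube rad).
Let c : R := alpha / Gamma (1 - alpha).
Local Notation Wop := (frac_op P alpha setT).
Local Notation re_on := (re_on Omega).
Local Notation im_on := (im_on Omega).
Local Notation pair_re := (pair_re Omega).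
Local Notation pair_im := (pair_im Omega).
Local Notation H0 := (H0 Omega).
Local Notation wform := (wform P alpha q A c).
Let bi := ip_bilinear mu.
Let wb : bilinear_on H0 wform := wform_bilinear c Hnl Hel.
Let sb := H0_submodule Omega.

Let c0 : 0 <= c.
Proof. by rewrite divr_ge0 ?Gamma_ge0// ltW// (nl_alpha0 Hnl). Qed.

(** Needed because pairs are known only up to distance 0; continuity of the form makes it
    insensitive to this. *)
Lemma wform_congr U Y Z : H0 U -> H0 Y -> H0 Z -> pnrm (Y - Z) = 0 ->
  wform U Y = wform U Z.
Proof.
move=> hU hY hZ e; apply/eqP; rewrite -subr_eq0 -(bilBr sb wb)// -normr_le0.
have [l _ _] := subB sb hY hZ.
by have := wform_le Hnl Hel c0 hU l; rewrite e mulr0.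
Qed.

Lemma wform_congl U V Z : H0 U -> H0 V -> H0 Z -> pnrm (U - V) = 0 ->
  wform U Z = wform V Z.
Proof.
move=> hU hV hZ e; apply/eqP; rewrite -subr_eq0 -(bilBl sb wb)// -normr_le0.
have [l _ _] := hZ.
by have := wform_le Hnl Hel c0 (subB sb hU hV) l; rewrite e mulr0 mul0r.
Qed.

Let ip_null (x y k : E -> R) : L2 mu x -> L2 mu y -> L2 mu k -> nrm mu (x - y) = 0 ->
  ip mu x k = ip mu y k.
Proof.
move=> lx ly lk e; apply/eqP; rewrite -subr_eq0 -(bilBl (L2_submodule mu) bi)// -normr_le0.
by have := ip_CS (L2B lx ly) lk; rewrite e mul0r.
Qed.

(** The given [w] is any L2 limit of the truncations, hence agrees with the explicit one up to norm
    0; its values off the domain are irrelevant against a [k] vanishing there. *)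
Lemma right_deriv_ip v w (k : E -> R) : in_H10 Omega v ->
  is_right_deriv Omega P alpha (fun Q => (p Q)%:C * v Q) w ->
  L2 mu k -> (forall x, ~ Omega x -> k x = 0) ->
  ip mu (re_on w) k = c * ip mu (Wop (q * re_on v)) k /\
  ip mu (im_on w) k = c * ip mu (Wop (q * im_on v)) k.
Proof.
move=> hv hw lk kO; have [h1 h2] := H10_H0 oO hv.
have hw0 := right_deriv_exists oO Hnl PO hray hv.
have [e1 e2] := right_deriv_unique oO hw hw0.
have [w1 w2] : L2 mu (re_on w) /\ L2 mu (im_on w) by apply/(in_L2P oO); case: hw.
have [v1 v2] := (in_L2P oO _).1 (let: And3 l _ _ := hw0 in l).
rewrite (ip_null w1 v1 lk e1) (ip_null w2 v2 lk e2).
rewrite -!(bilZl bi)//; last 2 first.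
- by have [] := L2_fop Hnl h2.
- by have [] := L2_fop Hnl h1.
split; apply: eq_Rintegral => x _; have [Ox|Ox] := pselect (Omega x).
- by rewrite re_onE.
- by rewrite kO// !mulr0.
- by rewrite im_onE.
- by rewrite kO// !mulr0.
Qed.

Let intA i j (k l : E -> R) : L2 mu k -> L2 mu l ->
  mu.-integrable setT (EFin \o (fun x => A i j x * k x * l x)).
Proof. by move=> lk ll; exact: (L2_integrableM (L2_coef Hel i j lk) ll). Qed.

Lemma Rintegral_form V1 V2 Z1 Z2 (w1 w2 : E -> R) :
  pL2 V1 -> pL2 V2 -> pL2 Z1 -> pL2 Z2 -> L2 mu w1 -> L2 mu w2 ->
  ip mu w1 Z1.1 = c * ip mu (Wop (q * V1.1)) Z1.1 ->
  ip mu w2 Z2.1 = c * ip mu (Wop (q * V2.1)) Z2.1 ->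
  \int[mu]_x (\sum_i \sum_j (A i j x * V1.2 j x * Z1.2 i x + A i j x * V2.2 j x * Z2.2 i x) +
    (w1 x * Z1.1 x + w2 x * Z2.1 x)) = wform V1 Z1 + wform V2 Z2.
Proof.
move=> [_ v1] [_ v2] [z1 z1'] [z2 z2'] lw1 lw2 e1 e2.
have I i j : mu.-integrable setT (EFin \o (fun x =>
    A i j x * V1.2 j x * Z1.2 i x + A i j x * V2.2 j x * Z2.2 i x)).
  have := integrableD measurableT (intA i j (v1 j) (z1' i)) (intA i j (v2 j) (z2' i)).
  by apply: eq_integrable.
have S i := Rintegral_sum (index_enum 'I_n) (I i).
have [T1 T2] := Rintegral_sum (index_enum 'I_n) (fun i => (S i).1).
have J1 := L2_integrableM lw1 z1; have J2 := L2_integrableM lw2 z2.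
have J : mu.-integrable setT (EFin \o (fun x => w1 x * Z1.1 x + w2 x * Z2.1 x)).
  by have := integrableD measurableT J1 J2; apply: eq_integrable.
rewrite (RintegralD measurableT T1 J) T2 (RintegralD measurableT J1 J2).
rewrite -[X in _ + (X + _) = _]/(ip mu w1 Z1.1) -[X in _ + (_ + X) = _]/(ip mu w2 Z2.1) e1 e2.
rewrite /wform addrACA; congr (_ + _); rewrite /lform -big_split /=; apply: eq_bigr => i _.
rewrite (S i).2 -big_split /=; apply: eq_bigr => j _.
by rewrite (RintegralD measurableT (intA i j (v1 j) (z1' i)) (intA i j (v2 j) (z2' i))).
Qed.

(** The coefficients and the nonlocal operator are real, so the form, linear in [v] and
    conjugate-linear in [z], expands into four real forms. *)
Lemma cintegral_form v z w : in_H10 Omega v -> in_H10 Omega z ->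
  is_right_deriv Omega P alpha (fun Q => (p Q)%:C * v Q) w ->
  cintegral (lebesgue_row n) Omega (fun Q =>
    \sum_i \sum_j (a i j Q)%:C * gen_deriv Omega j v Q * (gen_deriv Omega i z Q)^* +
    w Q * (z Q)^*) =
  (wform (pair_re v) (pair_re z) + wform (pair_im v) (pair_im z)) +i*
  (wform (pair_im v) (pair_re z) - wform (pair_re v) (pair_im z)).
Proof.
move=> hv hz hw; have [v1 v2] := H10_H0 oO hv; have [z1 z2] := H10_H0 oO hz.
have [lv1 lv2] := pair_L2 oO hv.1; have [lz1 lz2] := pair_L2 oO hz.1.
have z2N := subN sb z2; have [lz2N z2out _] := z2N.
have [w1 w2] : L2 mu (re_on w) /\ L2 mu (im_on w) by apply/(in_L2P oO); case: hw.
have [k1 k2] := right_deriv_ip hv hw lz1.1 (re_on_out z).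
have [k3 k4] := right_deriv_ip hv hw lz2.1 (im_on_out z).
have [k5 _] := right_deriv_ip hv hw lz2N.1 z2out.
rewrite cintegralE -(bilNr wb)//.
rewrite -(Rintegral_form lv1 lv2 lz1 lz2 w1 w2 k1 k4).
rewrite -(Rintegral_form lv2 lv1 lz1 lz2N w2 w1 k2 k5).
have null (k1' k2' l1 l2 : R) : 0 * k1' * l1 + 0 * k2' * l2 = 0 by rewrite !mul0r addr0.
have AE i j x : Omega x -> A i j x = a i j x by move=> Ox; rewrite /A indicE mem_set// mul1r.
have AO i j x : ~ Omega x -> A i j x = 0 by move=> Ox; rewrite /A indicE memNset// mul0r.
congr (_ +i* _); apply: eq_Rintegral => x _; have [Ox|Ox] := pselect (Omega x).
- have r u : re_on u x = complex.Re (u x) := re_onE u Ox.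
  have m u : im_on u x = complex.Im (u x) := im_onE u Ox.
  rewrite r ReD Re_conjM -[(pair_re z).1 x]/(re_on z x) -[(pair_im z).1 x]/(im_on z x) !r !m.
  congr (_ + _); rewrite Re_sum; apply: eq_bigr => i _; rewrite Re_sum; apply: eq_bigr => j _.
  rewrite Re_scale_conjM (AE _ _ _ Ox).
  have E (X X' Y Y' x1 x2 y1 y2 : R) : x1 = X -> x2 = X' -> y1 = Y -> y2 = Y' ->
      a i j x * X * Y + a i j x * X' * Y' = a i j x * x1 * y1 + a i j x * x2 * y2.
    by move=> -> -> -> ->.
  exact: (E _ _ _ _ _ _ _ _ (r _) (m _) (r _) (m _)).
- rewrite re_on_out// (re_on_out w Ox) (im_on_out w Ox) !mul0r !addr0.
  rewrite big1// => i _; rewrite big1// => j _.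
  by rewrite (AO _ _ _ Ox); exact: null.
- have r u : re_on u x = complex.Re (u x) := re_onE u Ox.
  have m u : im_on u x = complex.Im (u x) := im_onE u Ox.
  rewrite m ImD Im_conjM -[(pair_re z).1 x]/(re_on z x) -[(- pair_im z).1 x]/(- im_on z x) !r !m.
  congr (_ + _); rewrite Im_sum; apply: eq_bigr => i _; rewrite Im_sum; apply: eq_bigr => j _.
  rewrite Im_scale_conjM (AE _ _ _ Ox).
  have E (X X' Y Y' x1 x2 y1 y2 : R) : x1 = X -> x2 = X' -> y1 = Y -> y2 = Y' ->
      a i j x * X * Y + a i j x * X' * Y' = a i j x * x1 * y1 + a i j x * x2 * y2.
    by move=> -> -> -> ->.
  exact: (E _ _ _ _ _ _ _ _ (m _) (r _) (r _) (f_equal -%R (m _))).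
- rewrite im_on_out// (re_on_out w Ox) (im_on_out w Ox) !mul0r !addr0.
  rewrite big1// => i _; rewrite big1// => j _.
  by rewrite (AO _ _ _ Ox); exact: null.
Qed.

Lemma cintegral_rhs v f : in_L2 Omega v -> in_L2 Omega f ->
  cintegral (lebesgue_row n) Omega (fun Q => v Q * (f Q)^*) =
  (ip mu (re_on f) (re_on v) + ip mu (im_on f) (im_on v)) +i*
  (ip mu (re_on f) (im_on v) - ip mu (im_on f) (re_on v)).
Proof.
move=> /(in_L2P oO)[v1 v2] /(in_L2P oO)[f1 f2]; rewrite cintegralE -(bilNl bi)//.
have f2N := subN (L2_submodule mu) f2.
rewrite /ip -!(RintegralD measurableT); try exact: L2_integrableM.
congr (_ +i* _); apply: eq_Rintegral => x _; have [Ox|Ox] := pselect (Omega x).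
- by rewrite !re_onE// !im_onE// Re_conjM; ring.
- by rewrite !re_on_out// !im_on_out// !mul0r addr0.
- rewrite -[(- im_on f) x]/(- im_on f x) !im_onE// !re_onE// Im_conjM; ring.
- by rewrite -[(- im_on f) x]/(- im_on f x) !im_on_out// !re_on_out// oppr0 !mul0r addr0.
Qed.

(** The real and imaginary parts of the solution solve the real problem with the corresponding parts
    of [f]. *)
Lemma weak_solution_exists f : in_L2 Omega f ->
  exists2 z, generalized_solution Omega P alpha a p f z &
    (forall V, H0 V -> wform V (pair_re z) = ip mu (re_on f) V.1) /\
    (forall V, H0 V -> wform V (pair_im z) = ip mu (im_on f) V.1).
Proof.
move=> lf; have [f1 f2] := (in_L2P oO _).1 lf.
have [Z1 hZ1 e1] := real_exists Hnl Hel c0 rad0 Orad f1.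
have [Z2 hZ2 e2] := real_exists Hnl Hel c0 rad0 Orad f2.
have [hz n1 n2] := complexify_H10 oO hZ1 hZ2.
set z := complexify Z1 Z2 in hz n1 n2; have [p1 p2] := H10_H0 oO hz.
have E1 V : H0 V -> wform V (pair_re z) = ip mu (re_on f) V.1.
  by move=> hV; rewrite (wform_congr hV p1 hZ1 n1) e1.
have E2 V : H0 V -> wform V (pair_im z) = ip mu (im_on f) V.1.
  by move=> hV; rewrite (wform_congr hV p2 hZ2 n2) e2.
exists z => //; split => // v hv; have [q1 q2] := H10_H0 oO hv.
have hw := right_deriv_exists oO Hnl PO hray hv; eexists; first exact: hw.
by rewrite (cintegral_form hv hz hw) (cintegral_rhs hv.1.1 lf) !E1// !E2.
Qed.

(** Conversely, a real test function, taken as a complex one with imaginary part 0, separates the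
    two real problems. *)
Lemma weak_solution_form f z U : in_L2 Omega f ->
  generalized_solution Omega P alpha a p f z -> H0 U ->
  wform U (pair_re z) = ip mu (re_on f) U.1 /\
  wform U (pair_im z) = ip mu (im_on f) U.1.
Proof.
move=> lf [hz eq] hU; have h0 := sub0 sb.
have [hv n1 n2] := complexify_H10 oO hU h0; set v := complexify U 0 in hv n1 n2.
have [v1 v2] := H10_H0 oO hv; have [z1 z2] := H10_H0 oO hz.
have [w hw] := eq v hv; rewrite (cintegral_form hv hz hw) (cintegral_rhs hv.1.1 lf).
have zl Z : H0 Z -> wform (pair_im v) Z = 0.
  by move=> hZ; rewrite (wform_congl v2 h0 hZ n2); have := bilZl wb 0 h0 hZ; rewrite scale0r mul0r.
rewrite !(wform_congl v1 hU _ n1)// !zl// addr0 sub0r.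
rewrite (re_on_complexify 0 hU) (im_on_complexify U h0).
have ip0 (h : E -> R) : ip mu h (0 : PV).1 = 0.
  by rewrite /ip (_ : (fun x => _) = cst 0) ?Rintegral_cst ?mul0r//; apply/funext => x; rewrite /= mulr0.
rewrite !ip0.
by rewrite addr0 sub0r => -[-> /oppr_inj ->].
Qed.

(** Both parts of the difference solve the homogeneous real problem, so [real_unique] applies to
    each. *)
Lemma weak_solution_unique f z z' : in_L2 Omega f ->
  generalized_solution Omega P alpha a p f z ->
  generalized_solution Omega P alpha a p f z' ->
  {ae mu, forall Q, Omega Q -> z' Q = z Q}.
Proof.
move=> lf sz sz'; have [hz hz'] := (sz.1, sz'.1).
have [z1 z2] := H10_H0 oO hz; have [z1' z2'] := H10_H0 oO hz'.
have N Z Z' : H0 Z -> H0 Z' -> (forall U, H0 U -> wform U Z' = wform U Z) ->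
    {ae mu, forall x, (Z'.1 - Z.1) x = 0}.
  move=> hZ hZ' e; have hB := subB sb hZ' hZ; have [lB _ _] := hB.
  have n0 : pnrm (Z' - Z) = 0.
    apply: (real_unique Hnl Hel c0 rad0 Orad hB) => U /ptest_H0 hU.
    by rewrite (bilBr sb wb)// e// subrr.
  apply: nrm_eq0_ae; first exact: lB.1.
  have le0 := nrm_le_pnrm (Z' - Z); rewrite n0 in le0.
  by apply/eqP; rewrite eq_le nrm_ge0 andbT; exact: le0.
have a1 := N _ _ z1 z1' _; have a2 := N _ _ z2 z2' _.
have {}a1 := a1 (fun U hU => etrans (weak_solution_form lf sz' hU).1
  (esym (weak_solution_form lf sz hU).1)).
have {}a2 := a2 (fun U hU => etrans (weak_solution_form lf sz' hU).2
  (esym (weak_solution_form lf sz hU).2)).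
apply: filterS2 a1 a2 => Q; rewrite /= => h1 h2 OQ.
move: h1 h2; rewrite -[(_ - _) Q]/(re_on z' Q - re_on z Q) => /eqP; rewrite subr_eq0 => /eqP h1.
rewrite -[(_ - _) Q]/(im_on z' Q - im_on z Q) => /eqP; rewrite subr_eq0 => /eqP h2.
move: h1 h2; rewrite !re_onE// !im_onE//; case: (z' Q) (z Q) => x y [x' y'] /= -> ->.
by [].
Qed.

End WeakForm.

Theorem theorem1 (R : realType) (n : nat) (Omega : set 'rV[R]_n)
    (P : 'rV[R]_n) (alpha : R) (a : 'I_n -> 'I_n -> 'rV[R]_n -> R) (a0 : R)
    (p : 'rV[R]_n -> R) (lambda : R) :
  (0 < n)%N ->
  open Omega -> Omega !=set0 -> convex_set Omega -> bounded_set Omega ->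
  (closure Omega `\` interior Omega) P ->
  0 < alpha < 1 ->
  (forall i j, C1_closure Omega (a i j)) ->
  0 < a0 ->
  (forall Q, closure Omega Q -> forall xi : 'rV[R]_n,
    a0 * enorm xi ^+ 2 <=
    \sum_i \sum_j a i j Q * xi ord0 i * xi ord0 j) ->
  (forall Q, closure Omega Q -> 0 < p Q) ->
  alpha < lambda <= 1 ->
  Lip Omega lambda p ->
  forall f : 'rV[R]_n -> R[i], in_L2 Omega f ->
  exists2 z, generalized_solution Omega P alpha a p f z &
    forall z', generalized_solution Omega P alpha a p f z' ->
      {ae lebesgue_row n, forall Q, Omega Q -> z' Q = z Q}.
Proof.
move=> n0 oO _ cO bO PO /andP[alpha0 _] ca a00 el p0 /andP[al l1] Lp f lf.
have [Q0 [M [pmin [diam Hnl]]]] := nonlocal_settingP oO cO bO PO n0 alpha0 al l1 p0 Lp.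
have [Amax Hel] := elliptic_settingP oO bO PO ca a00 el.
have [rad rad0 Orad] := ray_bounds bO.
have nP := P_notin oO PO; have hray := ray_lengthP oO cO bO PO.
have [z sz _] := weak_solution_exists oO Hnl Hel nP hray rad0 Orad lf.
exists z => // z' sz'.
exact: (weak_solution_unique oO Hnl Hel nP hray rad0 Orad lf sz sz').
Qed.
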